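(* Let $K=\tfrac43\pi$, $\omega=e^{2\pi i/3}$, $\Lambda=\mathbb Z\oplus\omega\mathbb Z$, and let $U\in C^\infty(\mathbb C;\mathbb C)$ satisfy $$U(z+\gamma)=e^{i\langle\gamma,K\rangle}U(z)\ (\gamma\in\Lambda),\qquad U(\omega z)=\omega U(z),\qquad \overline{U(\bar z)}=-U(-z),$$ where $\langle z,w\rangle:=\operatorname{Re}(z\bar w)$. For $\alpha,k\in\mathbb C$ let $E_1(\alpha,k)\ge 0$ be the first band of the chiral Hamiltonian of twisted bilayer graphene with potential $U$, and let $\mathcal A\subset\mathbb C$ be the set of magic parameters $\alpha$ (both defined in the context). Then for every $\alpha\in\mathbb C$ there is a constant $c(\alpha)\ge 0$ such that $$E_1(\alpha,k)=c(\alpha)\,|k-K|+\mathcal O(|k-K|^2)\quad\text{as }k\to K,$$ $$E_1(\alpha,k)=c(\alpha)\,|k+K|+\mathcal O(|k+K|^2)\quad\text{as }k\to -K,$$ and $c(\alpha)=0$ if and only if $\alpha\in\mathcal A$.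
   Context: Identify $\mathbb C\simeq\mathbb R^2$, $z=x_1+ix_2$, and put $D_{\bar z}:=\frac1{2i}(\partial_{x_1}+i\partial_{x_2})$. For $\alpha\in\mathbb C$ define the first order matrix operator, acting on $\mathbb C^2$-valued functions on $\mathbb C$, $$D(\alpha):=\begin{pmatrix}2D_{\bar z}&\alpha U(z)\\ \alpha U(-z)&2D_{\bar z}\end{pmatrix}.$$ For $\gamma\in\Lambda$ and $u\in L^2_{\rm loc}(\mathbb C;\mathbb C^2)$ let $$L_\gamma u(z):=\begin{pmatrix}e^{i\langle\gamma,K\rangle}&0\\0&e^{-i\langle\gamma,K\rangle}\end{pmatrix}u(z+\gamma);$$ one has $L_\gamma D(\alpha)=D(\alpha)L_\gamma$. Let $L^2_0(\mathbb C;\mathbb C^2):=\{u\in L^2_{\rm loc}(\mathbb C;\mathbb C^2): L_\gamma u=u\ \text{for all }\gamma\in\Lambda\}$, a Hilbert space with norm given by $\|u\|^2=\int_{\mathbb C/\Lambda}|u(z)|^2\,dm(z)$ ($m$ is Lebesgue measure), and let $H^1_0:=L^2_0\cap H^1_{\rm loc}$ (the subscript $0$ refers to this twisted periodicity condition, not to boundary vanishing). The spaces $L^2_0(\mathbb C;\mathbb C^4)$ and $H^1_0(\mathbb C;\mathbb C^4)$ are defined in the same way, with $L_\gamma$ acting on each of the two $\mathbb C^2$ blocks of $\mathbb C^4=\mathbb C^2\oplus\mathbb C^2$. For $k\in\mathbb C$ the (Bloch-transformed) chiral Hamiltonian is the self-adjoint operator $$H_k(\alpha):=\begin{pmatrix}0&D(\alpha)^*+\bar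 k\\ D(\alpha)+k&0\end{pmatrix}$$ on $L^2_0(\mathbb C;\mathbb C^4)$ with domain $H^1_0(\mathbb C;\mathbb C^4)$. Its spectrum is discrete and symmetric about $0$, and, counted with multiplicity, is labelled $\{E_\ell(\alpha,k)\}_{\ell\in\mathbb Z\setminus\{0\}}$ in nondecreasing order with $E_{-\ell}(\alpha,k)=-E_\ell(\alpha,k)$. Equivalently, $E_\ell(\alpha,k)$, $\ell\ge1$, is the nondecreasing sequence of singular values of $D(\alpha)+k:H^1_0(\mathbb C;\mathbb C^2)\to L^2_0(\mathbb C;\mathbb C^2)$; in particular $E_1(\alpha,k)$ is the smallest singular value. The set of magic parameters is $\mathcal A:=\{\alpha\in\mathbb C: E_1(\alpha,k)=0\ \text{for all }k\in\mathbb C\}$. The constants implied in $\mathcal O(\cdot)$ may depend on $\alpha$ and $U$. *)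

(* Defs.v *)
From HB Require Import structures.
From mathcomp Require Import all_boot all_order all_algebra.
From mathcomp Require Import complex.
From mathcomp Require Import all_classical all_reals all_analysis.

Set Implicit Arguments.
Unset Strict Implicit.
Unset Printing Implicit Defensive.

Import Order.TTheory GRing.Theory Num.Theory.
Import numFieldNormedType.Exports.

#[global] Open Scope classical_set_scope.
#[global] Open Scope ring_scope.

Section Conventions.
Variable R : realType.
Local Notation C := R[i].

Definition to_C (p : R * R) : C := (p.1 +i* p.2)%C.

Definition iunit : C := (0 +i* 1)%C.

Definition expi (t : R) : C := (cos t +i* sin t)%C.

Definition modulus (z : C) : R := Normc.normc z.

Definition cdot (z w : C) : R := complex.Re (z * conjc w).

Definition omega : C := expi (2 * pi / 3).

Definition Kpt : C := real_complex R (4 / 3 * pi).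

Definition Lambda : set C :=
  [set g | exists m n : int, g = m%:~R + n%:~R * omega].

Definition plane : {measure set (measurableTypeR R * measurableTypeR R) -> \bar R} :=
  ((@lebesgue_measure R) \x (@lebesgue_measure R))%E.

Definition ae_eqC (T : Type) (f g : C -> T) : Prop :=
  {ae plane, forall p, f (to_C p) = g (to_C p)}.

Definition cintegral (A : set (R * R)) (f : C -> C) : C :=
  (Rintegral plane A (fun p => complex.Re (f (to_C p)))
   +i* Rintegral plane A (fun p => complex.Im (f (to_C p))))%C.

End Conventions.

Section FunctionSpaces.
Variable R : realType.
Local Notation C := R[i].

(* Directions are indexed by bool: false is x_1, true is x_2. *)
Definition basis_vec (j : bool) : R * R := if j then (0, 1) else (1, 0).

Definition partial (j : bool) (f : R * R -> R) : R * R -> R :=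
  fun p => 'D_(basis_vec j) f p.

Definition smooth2 (f : R * R -> R) : Prop :=
  forall s : seq bool,
    continuous (foldr partial f s) /\
    forall (j : bool) (p : R * R), derivable (foldr partial f s) p (basis_vec j).

Definition smoothC (f : C -> C) : Prop :=
  smooth2 (fun p => complex.Re (f (to_C p))) /\
  smooth2 (fun p => complex.Im (f (to_C p))).

Definition test_function (phi : R * R -> R) : Prop :=
  smooth2 phi /\
  exists2 B : set (R * R), compact B & forall p, ~ B p -> phi p = 0.

Definition L2loc (f : C -> C) : Prop :=
  [/\ measurable_fun setT
        (fun p : measurableTypeR R * measurableTypeR R =>
           complex.Re (f (to_C p))),
      measurable_fun setT
        (fun p : measurableTypeR R * measurableTypeR R =>
           complex.Im (f (to_C p))) &
      forall B : set (R * R), compact B ->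
        (\int[@plane R]_(p in B) ((modulus (f (to_C p)) ^+ 2)%:E) < +oo)%E].

Definition is_weak_partial (j : bool) (f g : C -> C) : Prop :=
  forall phi : R * R -> R, test_function phi ->
    cintegral setT (fun z =>
      f z * real_complex R (partial j phi (complex.Re z, complex.Im z))) =
    - cintegral setT (fun z =>
      g z * real_complex R (phi (complex.Re z, complex.Im z))).

(* The distributional derivative as a function: it is unique almost everywhere,
   and arbitrary when no such function exists in L^2_loc. *)
Definition weak_partial (j : bool) (f : C -> C) : C -> C :=
  xget (fun=> 0) [set g | L2loc g /\ is_weak_partial j f g].

Definition H1loc (f : C -> C) : Prop :=
  L2loc f /\ forall j, exists g, L2loc g /\ is_weak_partial j f g.

(* D_zbar = (1/2i) (d_1 + i d_2) *)
Definition Dzbar (f : C -> C) : C -> C := fun z =>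
  (2 * iunit R)^-1 *
  (weak_partial false f z + iunit R * weak_partial true f z).

Definition twist (g : C) : 'M[C]_2 :=
  \matrix_(i, j) (if i == j then
                    if i == 0 then expi (cdot g (Kpt R))
                    else expi (- cdot g (Kpt R))
                  else 0).

Definition Ltrans (g : C) (u : C -> 'cV[C]_2) : C -> 'cV[C]_2 :=
  fun z => twist g *m u (z + g).

(* Elements of these spaces are functions; equality is almost everywhere. *)
Definition L20 (u : C -> 'cV[C]_2) : Prop :=
  (forall i, L2loc (fun z => u z i 0)) /\
  forall g, Lambda g -> ae_eqC (Ltrans g u) u.

Definition H10 (u : C -> 'cV[C]_2) : Prop :=
  L20 u /\ forall i, H1loc (fun z => u z i 0).

(* Fundamental domain of Lambda, representing the torus C/Lambda. *)
Definition cell : set (R * R) :=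
  [set p | exists a b : R, [/\ 0 <= a < 1, 0 <= b < 1 &
     to_C p = real_complex R a + real_complex R b * omega R]].

Definition inner (u v : C -> 'cV[C]_2) : C :=
  cintegral cell (fun z => \sum_(i < 2) u z i 0 * conjc (v z i 0)).

(* The adjoint in L^2_0 of an operator with domain H^1_0: again unique almost
   everywhere, and arbitrary outside the domain of the adjoint. *)
Definition adjoint (A : (C -> 'cV[C]_2) -> (C -> 'cV[C]_2))
    (v : C -> 'cV[C]_2) : C -> 'cV[C]_2 :=
  xget (fun=> 0) [set w | L20 w /\ forall u, H10 u -> inner (A u) v = inner u w].

(* C^4 = C^2 (+) C^2, with L_gamma acting on each block. *)
Definition H10_4 (w : C -> 'cV[C]_(2 + 2)) : Prop :=
  H10 (fun z => usubmx (w z)) /\ H10 (fun z => dsubmx (w z)).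

End FunctionSpaces.

Section Chiral.
Variable R : realType.
Local Notation C := R[i].
Variable U : C -> C.

Definition potential (z : C) : 'M[C]_2 :=
  \matrix_(i, j) (if i == j then 0 else if i == 0 then U z else U (- z)).

Definition Dop (alpha : C) (u : C -> 'cV[C]_2) : C -> 'cV[C]_2 := fun z =>
  (\col_i (2 * Dzbar (fun y => u y i 0) z)) + (alpha *: potential z) *m u z.

Definition Hop (alpha k : C) (w : C -> 'cV[C]_(2 + 2)) :
    C -> 'cV[C]_(2 + 2) :=
  let u z := usubmx (w z) in
  let v z := dsubmx (w z) in
  fun z => col_mx (adjoint (Dop alpha) v z + conjc k *: v z)
                  (Dop alpha u z + k *: u z).

Definition eigenspaceH (alpha k : C) (l : R) : set (C -> 'cV[C]_(2 + 2)) :=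
  [set w | H10_4 w /\
           ae_eqC (Hop alpha k w) (fun z => real_complex R l *: w z)].

(* e is a basis, modulo almost everywhere equality, of the eigenspace of l *)
Definition eigenbasis (alpha k : C) (l : R) (n : nat)
    (e : 'I_n -> C -> 'cV[C]_(2 + 2)) : Prop :=
  [/\ forall i, eigenspaceH alpha k l (e i),
      forall c : 'I_n -> C,
        ae_eqC (fun z => \sum_i c i *: e i z) (fun=> 0) -> forall i, c i = 0 &
      forall w, eigenspaceH alpha k l w ->
        exists c : 'I_n -> C, ae_eqC w (fun z => \sum_i c i *: e i z)].

Definition multiplicity (alpha k : C) (l : R) (n : nat) : Prop :=
  exists e : 'I_n -> C -> 'cV[C]_(2 + 2), eigenbasis alpha k l e.

(* H_k(alpha) is self-adjoint with discrete spectrum, so its spectrum counted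
   with multiplicity is the family of its real eigenvalues, each repeated as
   many times as the dimension of its eigenspace.  The index 0 is not part of
   the labelling; the symmetry forces the dummy value E(0) = 0, so a labelling
   is unique. *)
Definition band_labelling (alpha k : C) (E : int -> R) : Prop :=
  [/\ forall i j : int, i != 0 -> j != 0 -> i <= j -> E i <= E j,
      forall j : int, E (- j) = - E j &
      forall l : R, exists2 n : nat, multiplicity alpha k l n &
        ([set j : int | j != 0 /\ E j = l] #= `I_n)%card].

Definition bands (alpha k : C) : int -> R :=
  xget (fun=> 0) [set E | band_labelling alpha k E].

Definition E1 (alpha k : C) : R := bands alpha k 1.

Definition magic : set C := [set alpha | forall k : C, E1 alpha k = 0].

End Chiral.

Definition conical_at (R : realType) (f : R[i] -> R) (k0 : R[i]) (c : R) : Prop :=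
  exists M d : R, 0 < d /\ forall k : R[i], modulus (k - k0) < d ->
    `|f k - c * modulus (k - k0)| <= M * modulus (k - k0) ^+ 2.

(* Main.v *)
From HB Require Import structures.
Require Import Defs.
From mathcomp Require Import all_boot all_order all_algebra perm.
From mathcomp Require Import complex finmap.
From mathcomp Require Import all_classical all_reals all_analysis measurable_realfun.
From mathcomp Require Import zify lra ring.

(* Expand spinors in the characters exp(i <z, xi>) allowed by the twisted periodicity: [D(alpha) + k] becomes the operator
   [opA] on sequences over Z^2, diagonal plus convolution with the even sequence of Fourier coefficients of U, hence a complex
   symmetric operator A_k with A_k^* = conj A_k conj. Minimising |A_k u| successively gives Takagi vectors [A_k u_n = s_n conj u_n],
   and the bands are the [s_n] and their opposites.

   At k = K the rotation multiplies A_K by the conjugate of omega and fixes exactly one frequency. A truncation of A_K to a rotation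
   invariant finite set is therefore singular, because the trace of the rotation is 1, and a compactness argument yields a kernel
   vector u of A_K. Put W = sum_g u_g^2. If the kernel is spanned by the unit vector u and W <> 0, pairing
   [(A_K + e) f = s conj f] with u gives s = |W| |e| + O(|e|^2), while the symmetry g -> -g exchanges k and -k.

   Otherwise the kernel contains a vector u with W = 0. Its reflection v lies in the kernel of A_(-K), the Wronskian
   u_1 v_2 - u_2 v_1 is a constant multiple of W, so u and v are everywhere parallel: for a fixed frequency the shifts n of u and
   m of v satisfy m u = n v. Dividing m by the symbol of 2 D_zbar + ka and n by that of 2 D_zbar + ka + 2K gives F and F' such
   that F u - F' v is a nonzero kernel vector of A_(K + ka) for all small ka <> 0. Since an invertible A_k has
   discrete eigenvalues, no A_k is invertible, that is, alpha is magic. *)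

Set Implicit Arguments.
Unset Strict Implicit.
Unset Printing Implicit Defensive.
Import Order.TTheory GRing.Theory Num.Theory.
Import numFieldNormedType.Exports.
Local Notation rc := (real_complex _).
Local Open Scope classical_set_scope.
Local Open Scope ring_scope.

(** * Unconditional sums and square-summable families *)

(** [weak_partial], [adjoint] and [bands] are choices with default values, so the objects must be
    shown to exist before anything follows from them. For [adjoint] this is shown only for spinors
    with rapidly decreasing coefficients. Were the default 0 taken, the eigenvalue equation would
    read conj k * v = l * u, and for k <> 0 this forces the decay. Hence labellings are constructed
    for k <> 0, which is enough near K and - K, while the value 0 of [E1] in the isotropic case is
    obtained for every k, with or without a labelling. The two spinor components have frequencies in
    different classes mod 3, so that one scalar sequence carries a spinor and one even sequence
    carries both potentials. Evenness makes the operator symmetric for the bilinear pairing. Takagi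
    vectors then replace the spectral theorem: A_k u = s conj u yields eigenvectors (u, conj u) and
    (u, - conj u) of H_k for s and - s. Solutions of such equations have rapidly decreasing
    coefficients, which is what allows the return from sequences to functions, where [Dop] acts term
    by term. *)

Section Modulus.
Variable R : realType.
Local Notation C := R[i].
Implicit Types (z w : C) (x : R).

Lemma modM z w : modulus (z * w) = modulus z * modulus w.
Proof. exact: Normc.normcM. Qed.

Lemma modD z w : modulus (z + w) <= modulus z + modulus w.
Proof. exact: le_normcD. Qed.

Lemma modN z : modulus (- z) = modulus z.
Proof. exact: normcN. Qed.

Lemma modB z w : modulus (z - w) <= modulus z + modulus w.
Proof. by rewrite -(modN w); exact: modD. Qed.

Lemma modC z w : modulus (z - w) = modulus (w - z).
Proof. by rewrite -modN opprB. Qed.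

Lemma mod0 : modulus (0 : C) = 0.
Proof. exact: Normc.normc0. Qed.

Lemma mod_ge0 z : 0 <= modulus z.
Proof. by case: z => a b; exact: sqrtr_ge0. Qed.

Lemma mod_eq0 z : modulus z = 0 -> z = 0.
Proof. exact: Normc.eq0_normc. Qed.

Lemma mod_gt0 z : z != 0 -> 0 < modulus z.
Proof.
move=> z0; rewrite lt_def mod_ge0 andbT; apply/negP => /eqP /mod_eq0 /eqP.
by rewrite (negPf z0).
Qed.

Lemma modV z : modulus (GRing.inv z) = GRing.inv (modulus z).
Proof. exact: Normc.normcV. Qed.

Lemma mod_rc x : modulus (rc x) = `|x|.
Proof. by rewrite /modulus /= expr0n addr0 sqrtr_sqr. Qed.

Lemma mod_sq z : modulus z ^+ 2 = complex.Re z ^+ 2 + complex.Im z ^+ 2.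
Proof. by case: z => a b; rewrite /modulus /= sqr_sqrtr // addr_ge0 ?sqr_ge0. Qed.

Lemma mod_conj z : modulus (conjc z) = modulus z.
Proof. by case: z => a b; rewrite /modulus /= sqrrN. Qed.

Lemma mul_conj z : z * conjc z = rc (modulus z ^+ 2).
Proof. by rewrite mod_sq; case: z => a b; congr (_ +i* _)%C => /=; ring. Qed.

Lemma ReE_le z : `|complex.Re z| <= modulus z.
Proof.
rewrite -(@ler_pXn2r _ 2) ?nnegrE ?mod_ge0 // mod_sq real_normK ?num_real //.
by rewrite lerDl sqr_ge0.
Qed.

Lemma ImE_le z : `|complex.Im z| <= modulus z.
Proof.
rewrite -(@ler_pXn2r _ 2) ?nnegrE ?mod_ge0 // mod_sq real_normK ?num_real //.
by rewrite lerDr sqr_ge0.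
Qed.

Lemma mod_le z : modulus z <= `|complex.Re z| + `|complex.Im z|.
Proof.
rewrite -(@ler_pXn2r _ 2) ?nnegrE ?mod_ge0 ?addr_ge0 // mod_sq sqrrD.
by rewrite !real_normK ?num_real // lerD2r lerDl mulrn_wge0 ?mulr_ge0.
Qed.

Lemma mod_sum (I : Type) (r : seq I) (f : I -> C) :
  modulus (\sum_(i <- r) f i) <= \sum_(i <- r) modulus (f i).
Proof.
elim: r => [|a r IH]; first by rewrite !big_nil mod0.
by rewrite !big_cons (le_trans (modD _ _)) // lerD2l.
Qed.

Lemma mod_sqD z w : modulus (z + w) ^+ 2 <= 2 * modulus z ^+ 2 + 2 * modulus w ^+ 2.
Proof.
apply: (@le_trans _ _ ((modulus z + modulus w) ^+ 2)).
  by rewrite ler_pXn2r ?nnegrE ?addr_ge0 ?mod_ge0 ?modD.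
have := sqr_ge0 (modulus z - modulus w).
by rewrite sqrrB sqrrD; lra.
Qed.

Lemma rcB x y : rc (x - y) = rc x - rc y :> C. Proof. exact: rmorphB. Qed.

Lemma rcD x y : rc (x + y) = rc x + rc y :> C. Proof. exact: rmorphD. Qed.

Lemma rcM x y : rc (x * y) = rc x * rc y :> C. Proof. exact: rmorphM. Qed.

Lemma rc_sum (I : Type) (r : seq I) (f : I -> R) :
  rc (\sum_(i <- r) f i) = \sum_(i <- r) rc (f i) :> C.
Proof. exact: rmorph_sum. Qed.

Lemma conjcD z w : conjc (z + w) = conjc z + conjc w. Proof. exact: rmorphD. Qed.

Lemma conjcB z w : conjc (z - w) = conjc z - conjc w. Proof. exact: rmorphB. Qed.

Lemma conjcM z w : conjc (z * w) = conjc z * conjc w. Proof. exact: rmorphM. Qed.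

Lemma conjc_sum (I : Type) (r : seq I) (f : I -> C) :
  conjc (\sum_(i <- r) f i) = \sum_(i <- r) conjc (f i).
Proof. exact: rmorph_sum. Qed.

Lemma eps_eq0 z : (forall e : R, 0 < e -> modulus z <= e) -> z = 0.
Proof.
move=> h; apply: mod_eq0; apply/eqP; rewrite eq_le mod_ge0 andbT.
by apply/ler_addgt0Pl => e e0; rewrite addr0 h.
Qed.

Lemma eps_le (x y : R) : (forall e : R, 0 < e -> x <= y + e) -> x <= y.
Proof. by move=> h; apply/ler_addgt0Pr. Qed.
End Modulus.

(* Unconditional summation over an arbitrary index type: [asum f] says that the finite sums of the moduli are bounded,
   and [hsum f l] that the net of finite sums converges to [l]. *)
Section Sums.
Variables (R : realType) (T : choiceType).
Local Notation C := R[i].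
Implicit Types (f g : T -> C) (S : {fset T}).

Definition psum f S : C := \sum_(i <- S) f i.
Definition rpsum (h : T -> R) S : R := \sum_(i <- S) h i.
Definition bsum (h : T -> R) := exists B : R, forall S, rpsum h S <= B.
Definition asum f := bsum (fun i => modulus (f i)).
Definition hsum f (l : C) := forall e : R, 0 < e ->
  exists S, forall S', (S `<=` S')%fset -> modulus (psum f S' - l) <= e.
Definition csum f : C := xget 0 [set l | hsum f l].

Lemma sub_psum f S S' : (S `<=` S')%fset ->
  psum f S' = psum f S + psum f (S' `\` S)%fset.
Proof.
move=> /fsubsetP sub; rewrite /psum (bigID (mem S)) /= -[X in X + _ = _]big_filter -[X in _ + X = _]big_filter; congr (_ + _).
  apply/perm_big/uniq_perm; rewrite ?filter_uniq ?fset_uniq // => x.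
  by rewrite mem_filter; case xS: (x \in S) => //=; rewrite sub.
apply/perm_big/uniq_perm; rewrite ?filter_uniq ?fset_uniq // => x.
by rewrite mem_filter !inE.
Qed.

Lemma sub_rpsum (h : T -> R) S S' : (S `<=` S')%fset ->
  rpsum h S' = rpsum h S + rpsum h (S' `\` S)%fset.
Proof.
move=> /fsubsetP sub; rewrite /rpsum (bigID (mem S)) /= -[X in X + _ = _]big_filter -[X in _ + X = _]big_filter; congr (_ + _).
  apply/perm_big/uniq_perm; rewrite ?filter_uniq ?fset_uniq // => x.
  by rewrite mem_filter; case xS: (x \in S) => //=; rewrite sub.
apply/perm_big/uniq_perm; rewrite ?filter_uniq ?fset_uniq // => x.
by rewrite mem_filter !inE.
Qed.

Lemma rpsum_ge0 (h : T -> R) S : (forall t, 0 <= h t) -> 0 <= rpsum h S.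
Proof. by move=> h0; apply: sumr_ge0. Qed.

Lemma rpsum_mono (h : T -> R) S S' : (forall t, 0 <= h t) -> (S `<=` S')%fset ->
  rpsum h S <= rpsum h S'.
Proof. by move=> h0 /sub_rpsum ->; rewrite lerDl rpsum_ge0. Qed.

Lemma rpsum_le (h k : T -> R) S : (forall t, h t <= k t) -> rpsum h S <= rpsum k S.
Proof. by move=> hk; apply: ler_sum. Qed.

Lemma hsum_uniq f l l' : hsum f l -> hsum f l' -> l = l'.
Proof.
move=> h h'; apply/eqP; rewrite -subr_eq0; apply/eqP/eps_eq0 => e e0.
have e2 : 0 < e / 2 by rewrite divr_gt0.
have [S hS] := h _ e2; have [S' hS'] := h' _ e2.
have /hS a := fsubsetUl S S'; have /hS' b := fsubsetUr S S'.
have -> : l - l' = (psum f (S `|` S')%fset - l') - (psum f (S `|` S')%fset - l) by ring.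
by rewrite (le_trans (modB _ _)) // [e]splitr lerD.
Qed.

Lemma hsum_csum f l : hsum f l -> csum f = l.
Proof. by move=> h; rewrite /csum; case: xgetP => [y _ /hsum_uniq|/(_ l)]; [exact | ]. Qed.

Lemma hsumD f g l l' : hsum f l -> hsum g l' -> hsum (fun t => f t + g t) (l + l').
Proof.
move=> h h' e e0; have e2 : 0 < e / 2 by rewrite divr_gt0.
have [S hS] := h _ e2; have [S' hS'] := h' _ e2.
exists (S `|` S')%fset => A sA.
have /hS a := fsubset_trans (fsubsetUl S S') sA.
have /hS' b := fsubset_trans (fsubsetUr S S') sA.
rewrite /psum big_split /=.
have -> : \sum_(i <- A) f i + \sum_(i <- A) g i - (l + l') =
  (psum f A - l) + (psum g A - l') by rewrite /psum; ring.
by rewrite (le_trans (modD _ _)) // [e]splitr lerD.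
Qed.

Lemma hsumZ c f l : hsum f l -> hsum (fun t => c * f t) (c * l).
Proof.
move=> h e e0.
have c1 : 0 < modulus c + 1 by rewrite ltr_pwDr // mod_ge0.
have [S hS] := h (e / (modulus c + 1)) (divr_gt0 e0 c1).
exists S => A /hS; rewrite /psum -mulr_sumr -mulrBr modM => hA.
apply: (@le_trans _ _ ((modulus c + 1) * modulus (psum f A - l))).
  by rewrite ler_wpM2r ?mod_ge0 // lerDl.
by rewrite mulrC -ler_pdivlMr.
Qed.

Lemma hsum_conj f l : hsum f l -> hsum (fun t => conjc (f t)) (conjc l).
Proof.
move=> h e e0; have [S hS] := h _ e0; exists S => A /hS.
by rewrite /psum -conjc_sum -conjcB mod_conj.
Qed.

Lemma hsum_le f l (B : R) : hsum f l -> (forall S, rpsum (fun t => modulus (f t)) S <= B) ->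
  modulus l <= B.
Proof.
move=> h hB; apply: eps_le => e e0; have [S hS] := h _ e0.
have -> : l = psum f S - (psum f S - l) by ring.
rewrite (le_trans (modB _ _)) // lerD ?hS //.
by rewrite (le_trans _ (hB S)) // mod_sum.
Qed.

Lemma hsum_fin f S : (forall t, t \notin S -> f t = 0) -> hsum f (psum f S).
Proof.
move=> h e e0; exists S => A /(sub_psum f) ->.
have -> : psum f (A `\` S)%fset = 0.
  by rewrite /psum big_seq big1 // => t; rewrite !inE => /andP[/h].
by rewrite addr0 subrr mod0 ltW.
Qed.

Lemma bsum_tail (h : T -> R) : (forall t, 0 <= h t) -> bsum h -> forall e : R, 0 < e ->
  exists S, forall S', [disjoint S & S']%fset -> rpsum h S' <= e.
Proof.
move=> h0 [B hB] e e0; pose E : set R := range (rpsum h).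
have sE : has_sup E.
  split; first by exists (rpsum h fset0), fset0.
  by exists B => _ [S _ <-]; exact: hB.
have [_ [S _ <-] hS] := sup_adherent e0 sE.
exists S => S' dS.
have : rpsum h (S `|` S')%fset <= sup E by apply: sup_upper_bound => //; exists (S `|` S')%fset.
rewrite (sub_rpsum h (fsubsetUl S S')).
have -> : ((S `|` S') `\` S)%fset = S'.
  rewrite fsetDUl fsetDv fset0U; apply/fsetDidPl.
  by rewrite -fsetI_eq0 fsetIC fsetI_eq0.
by move: hS; lra.
Qed.

Lemma rsum_exists (h : T -> R) : (forall t, 0 <= h t) -> bsum h ->
  exists2 l : R, hsum (fun t => rc (h t)) (rc l) & forall S, rpsum h S <= l.
Proof.
move=> h0 [B hB]; pose E : set R := range (rpsum h).
have sE : has_sup E.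
  split; first by exists (rpsum h fset0), fset0.
  by exists B => _ [S _ <-]; exact: hB.
have ub S : rpsum h S <= sup E by apply: sup_upper_bound => //; exists S.
exists (sup E) => // e e0; have [_ [S _ <-] hS] := sup_adherent e0 sE.
exists S => A /(rpsum_mono h0) hA.
rewrite /psum -rc_sum -rcB mod_rc distrC ger0_norm ?subr_ge0 ?ub //.
by move: hS hA (ub A); rewrite /rpsum; lra.
Qed.

Lemma bsum_le (h k : T -> R) : (forall t, h t <= k t) -> bsum k -> bsum h.
Proof. by move=> hk [B hB]; exists B => S; apply: le_trans (hB S); exact: rpsum_le. Qed.

Lemma bsumD (h k : T -> R) : bsum h -> bsum k -> bsum (fun t => h t + k t).
Proof.
by move=> [B hB] [D hD]; exists (B + D) => S; rewrite /rpsum big_split /= lerD ?hB ?hD.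
Qed.

Lemma bsumZ c (h : T -> R) : 0 <= c -> bsum h -> bsum (fun t => c * h t).
Proof.
by move=> c0 [B hB]; exists (c * B) => S; rewrite /rpsum -mulr_sumr ler_wpM2l ?hB.
Qed.

Lemma asum_le f (k : T -> R) : (forall t, modulus (f t) <= k t) -> bsum k -> asum f.
Proof. exact: bsum_le. Qed.

Lemma asumD f g : asum f -> asum g -> asum (fun t => f t + g t).
Proof. by move=> h h'; apply: asum_le (bsumD h h') => t; exact: modD. Qed.

Lemma asumZ c f : asum f -> asum (fun t => c * f t).
Proof.
by move=> h; apply: asum_le (bsumZ (mod_ge0 c) h) => t; rewrite modM.
Qed.

Lemma asum_conj f : asum f -> asum (fun t => conjc (f t)).
Proof. by move=> h; apply: asum_le h => t; rewrite mod_conj. Qed.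

Lemma asum_bdd f g (B : R) : (forall t, modulus (g t) <= B) -> asum f -> asum (fun t => g t * f t).
Proof.
move=> gB h; apply: asum_le (bsumZ (c := `|B|) _ h) => // t.
by rewrite modM ler_wpM2r ?mod_ge0 // (le_trans (gB t)) // ler_norm.
Qed.

Lemma asum_fin f S : (forall t, t \notin S -> f t = 0) -> asum f.
Proof.
move=> h; exists (rpsum (fun t => modulus (f t)) S) => A.
apply: (@le_trans _ _ (rpsum (fun t => modulus (f t)) (S `|` A)%fset)).
  by apply: rpsum_mono (fsubsetUr S A) => t; exact: mod_ge0.
rewrite (sub_rpsum _ (fsubsetUl S A)) gerDl /rpsum big_seq big1 // => t.
by rewrite !inE => /andP[/h ->]; rewrite mod0.
Qed.

Lemma asum_hsum f : asum f -> hsum f (csum f).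
Proof.
move=> hf; suff [l hl] : exists l, hsum f l by rewrite (hsum_csum hl).
(* Positive and negative parts of the real and imaginary parts reduce the claim to nonnegative
   families, whose sum is a supremum. *)
pose p (x : R) := (`|x| + x) / 2; pose q (x : R) := (`|x| - x) / 2.
have p0 x : 0 <= p x by rewrite /p; have := ler_norm (- x); rewrite normrN; lra.
have q0 x : 0 <= q x by rewrite /q; have := ler_norm x; lra.
have pl x : p x <= `|x| by rewrite /p; have := ler_norm x; lra.
have ql x : q x <= `|x| by rewrite /q; have := ler_norm (- x); rewrite normrN; lra.
have ex (h : T -> R) : (forall t, 0 <= h t) -> (forall t, h t <= modulus (f t)) ->
    exists l, hsum (fun t => rc (h t)) l.
  by move=> h0 hm; have [l hl _] := rsum_exists h0 (bsum_le hm hf); exists (rc l).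
have [l1 h1] := ex (fun t => p (complex.Re (f t))) (fun t => p0 _) (fun t => le_trans (pl _) (ReE_le _)).
have [l2 h2] := ex (fun t => q (complex.Re (f t))) (fun t => q0 _) (fun t => le_trans (ql _) (ReE_le _)).
have [l3 h3] := ex (fun t => p (complex.Im (f t))) (fun t => p0 _) (fun t => le_trans (pl _) (ImE_le _)).
have [l4 h4] := ex (fun t => q (complex.Im (f t))) (fun t => q0 _) (fun t => le_trans (ql _) (ImE_le _)).
have h12 := hsumD h1 (hsumZ (-1) h2).
have h34 := hsumZ (iunit R) (hsumD h3 (hsumZ (-1) h4)).
have := hsumD h12 h34; set k := (X in hsum X _) => hk.
suff -> : f = k by eexists; exact: hk.
apply/funext => t; rewrite /k.
case: (f t) => a b; rewrite /p /q /=; apply/eqP; rewrite eq_complex /=.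
by apply/andP; split; apply/eqP; field.
Qed.

Lemma csumD f g : asum f -> asum g -> csum (fun t => f t + g t) = csum f + csum g.
Proof. by move=> hf hg; apply/hsum_csum/hsumD; exact: asum_hsum. Qed.

Lemma csumZ c f : asum f -> csum (fun t => c * f t) = c * csum f.
Proof. by move=> hf; apply/hsum_csum/hsumZ; exact: asum_hsum. Qed.

Lemma csum_conj f : asum f -> csum (fun t => conjc (f t)) = conjc (csum f).
Proof. by move=> hf; apply/hsum_csum/hsum_conj; exact: asum_hsum. Qed.

Lemma csum_fin f S : (forall t, t \notin S -> f t = 0) -> csum f = psum f S.
Proof. by move=> h; apply/hsum_csum/hsum_fin. Qed.

Lemma csum1 f t0 : (forall t, t != t0 -> f t = 0) -> csum f = f t0.
Proof.
move=> h; rewrite (@csum_fin _ [fset t0]%fset).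
  by rewrite /psum big_seq_fset1.
by move=> t; rewrite !inE => /h.
Qed.

Lemma csum0 f : (forall t, f t = 0) -> csum f = 0.
Proof. by move=> h; rewrite (@csum_fin _ fset0) // /psum big_seq_fset0. Qed.

Lemma csum_ler f (B : R) : (forall S, rpsum (fun t => modulus (f t)) S <= B) -> modulus (csum f) <= B.
Proof. by move=> h; apply: (hsum_le _ h); apply: asum_hsum; exists B. Qed.

Lemma csum_sum (I : Type) (r : seq I) (F : I -> T -> C) : (forall i, asum (F i)) ->
  csum (fun t => \sum_(i <- r) F i t) = \sum_(i <- r) csum (F i) /\
  asum (fun t => \sum_(i <- r) F i t).
Proof.
move=> h; elim: r => [|a r [IH1 IH2]].
  split; first by rewrite big_nil csum0 // => t; rewrite big_nil.
  by apply: (@asum_fin _ fset0) => t _; rewrite big_nil.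
have -> : (fun t => \sum_(i <- a :: r) F i t) = (fun t => F a t + \sum_(i <- r) F i t).
  by apply/funext => t; rewrite big_cons.
by split; [rewrite csumD // IH1 big_cons | exact: asumD].
Qed.

Definition rsum (h : T -> R) : R := complex.Re (csum (fun t => rc (h t))).
Lemma bsum_asum (h : T -> R) : (forall t, 0 <= h t) -> bsum h -> asum (fun t => rc (h t)).
Proof. by move=> h0 hb; apply: asum_le hb => t; rewrite mod_rc ger0_norm. Qed.

Lemma rsumE (h : T -> R) : (forall t, 0 <= h t) -> bsum h ->
  csum (fun t => rc (h t)) = rc (rsum h).
Proof.
by move=> h0 hb; have [l hl _] := rsum_exists h0 hb; rewrite /rsum (hsum_csum hl).
Qed.

Lemma rpsum_rsum (h : T -> R) S : (forall t, 0 <= h t) -> bsum h -> rpsum h S <= rsum h.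
Proof.
by move=> h0 hb; have [l hl H] := rsum_exists h0 hb; rewrite /rsum (hsum_csum hl).
Qed.

Lemma rsum_le (h : T -> R) (B : R) : (forall t, 0 <= h t) -> (forall S, rpsum h S <= B) -> rsum h <= B.
Proof.
move=> h0 hB; apply: le_trans (ler_norm _) _; apply: le_trans (ReE_le _) _.
apply: csum_ler => S; rewrite (_ : rpsum _ S = rpsum h S) //.
by apply: eq_bigr => t _; rewrite mod_rc ger0_norm.
Qed.

Lemma rsum_ge0 (h : T -> R) : (forall t, 0 <= h t) -> bsum h -> 0 <= rsum h.
Proof. by move=> h0 hb; apply: le_trans (rpsum_rsum fset0 h0 hb); rewrite rpsum_ge0. Qed.

Lemma term_le_rsum (h : T -> R) t : (forall t, 0 <= h t) -> bsum h -> h t <= rsum h.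
Proof.
by move=> h0 hb; have := rpsum_rsum [fset t]%fset h0 hb; rewrite /rpsum big_seq_fset1.
Qed.

Lemma mod_csum f : asum f -> modulus (csum f) <= rsum (fun t => modulus (f t)).
Proof. by move=> hf; apply: csum_ler => S; apply: rpsum_rsum => // t; exact: mod_ge0. Qed.

(** Dominated convergence: a finite set [S] carries all but e / 4 of the sum of [h], and on [S] the
    filter gives uniform closeness. The filter is arbitrary because this is used both along
    ultrafilters on nat and along finite sets ordered by inclusion. *)
Lemma dct (I : Type) (F : set_system I) (FF : ProperFilter F) (f : I -> T -> C) g (h : T -> R) :
  (forall n t, modulus (f n t) <= h t) -> bsum h ->
  (forall t e, 0 < e -> F (fun n : I => modulus (f n t - g t) <= e)) ->
  asum g /\ forall e, 0 < e -> F (fun n : I => modulus (csum (f n) - csum g) <= e).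
Proof.
move=> fh bh fg.
have h0 t : 0 <= h t by have [n _] := filter_ex (fg t _ (@ltr01 R)); exact: le_trans (mod_ge0 _) (fh n t).
have gh t : modulus (g t) <= h t.
  apply: eps_le => e e0; have [n /= hn] := filter_ex (fg t _ e0).
  have -> : g t = f n t - (f n t - g t) by ring.
  by rewrite (le_trans (modB _ _)) // lerD.
have ag : asum g by exact: asum_le gh bh.
have af n : asum (f n) by exact: asum_le (fh n) bh.
split=> // e e0.
have e4 : 0 < e / 4 by rewrite divr_gt0.
have [S hS] := bsum_tail h0 bh e4.
have tail k : asum k -> (forall t, modulus (k t) <= h t) -> modulus (csum k - psum k S) <= e / 4.
  move=> ak kh; apply: eps_le => d d0.
  have [A hA] := asum_hsum ak d0.
  have /hA {}hA := fsubsetUr S A.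
  have -> : csum k - psum k S = (psum k (S `|` A)%fset - psum k S) - (psum k (S `|` A)%fset - csum k) by ring.
  rewrite (le_trans (modB _ _)) // lerD // (sub_psum k (fsubsetUl S A)) addrC addKr.
  apply: le_trans (mod_sum _ _) _; apply: le_trans (rpsum_le _ kh) _; apply: hS.
  by rewrite -fsetI_eq0 fsetIDA fsetD_eq0 fsubsetIl.
have d0 : 0 < e / 4 / (size S).+1%:R by rewrite divr_gt0.
have : F (fun n : I => forall t, t \in S -> modulus (f n t - g t) <= e / 4 / (size S).+1%:R).
  have: forall r : seq T, F (fun n : I => forall t, t \in r -> modulus (f n t - g t) <= e / 4 / (size S).+1%:R).
    elim=> [|a r IH]; first by apply: filterS filterT.
    apply: filterS (filterI (fg a _ d0) IH) => n [/= h1 h2] t.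
    by rewrite inE => /orP[/eqP ->|/h2].
  by apply.
apply: filterS => n /= hn.
have -> : csum (f n) - csum g = (csum (f n) - psum (f n) S) - (csum g - psum g S) + (psum (f n) S - psum g S) by ring.
have p : modulus (psum (f n) S - psum g S) <= e / 4.
  rewrite /psum -sumrB; apply: le_trans (mod_sum _ _) _.
  apply: (@le_trans _ _ (\sum_(i <- S) e / 4 / (size S).+1%:R)).
    by rewrite big_seq [leRHS]big_seq; apply: ler_sum => t; exact: hn.
  rewrite big_const_seq count_predT iter_addr_0 -[_ *+ _]mulr_natr -mulrA; apply: ler_piMr; first exact: ltW.
  by rewrite ler_pdivrMl ?ltr0n // mulr1 ler_nat.
have h1 := tail _ (af n) (fh n); have h2 := tail _ ag gh.
have := modD (csum (f n) - psum (f n) S - (csum g - psum g S)) (psum (f n) S - psum g S).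
have := modB (csum (f n) - psum (f n) S) (csum g - psum g S).
by move: h1 h2 p; lra.
Qed.
End Sums.
Arguments hsum_csum {R T f l}.

Section Reindex.
Variable R : realType.
Local Notation C := R[i].

Lemma psum_imfset (T T' : choiceType) (h : T -> T') (f : T' -> C) (S : {fset T}) :
  injective h -> psum (fun t => f (h t)) S = psum f [fset h t | t in S]%fset.
Proof.
move=> inj; rewrite /psum.
rewrite -(big_map h xpredT f); apply/perm_big/uniq_perm; rewrite ?fset_uniq //.
  by rewrite map_inj_uniq ?fset_uniq.
move=> x; apply/mapP/imfsetP => -[y yS ->]; exists y => //.
Qed.

(** The condition on [hinv] only says that the support of [f] lies in the range of [h]; this covers
    non-surjective injections such as the inclusion of one row of a double family. *)
Lemma hsum_inj (T T' : choiceType) (h : T -> T') (hinv : T' -> T) (f : T' -> C) l :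
  cancel h hinv -> (forall t, f t != 0 -> h (hinv t) = t) ->
  hsum f l -> hsum (fun t => f (h t)) l.
Proof.
move=> hK fK hf e e0; have [S hS] := hf e e0.
exists [fset hinv t | t in S]%fset => A sA.
rewrite psum_imfset; last exact: can_inj hK.
set B := [fset h t | t in A]%fset; have /hS := fsubsetUr B S.
rewrite (sub_psum f (fsubsetUl B S)).
suff -> : psum f ((B `|` S) `\` B)%fset = 0 by rewrite addr0.
rewrite /psum big_seq big1 // => t; rewrite !inE => /andP[tB]; rewrite (negPf tB) /= => tS.
apply/eqP; apply: contraNT tB => ft; apply/imfsetP; exists (hinv t); last by rewrite fK.
by move/fsubsetP: sA; apply; apply/imfsetP; exists t.
Qed.

Lemma asum_inj (T T' : choiceType) (h : T -> T') (f : T' -> C) :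
  injective h -> asum f -> asum (fun t => f (h t)).
Proof.
move=> inj [B hB]; exists B => S; apply: le_trans (hB [fset h t | t in S]%fset).
rewrite le_eqVlt; apply/orP; left; apply/eqP; apply: complexI.
have := psum_imfset (fun t => rc (modulus (f t))) S inj.
by rewrite /psum -!rc_sum.
Qed.

Lemma csum_inj (T T' : choiceType) (h : T -> T') (hinv : T' -> T) (f : T' -> C) :
  cancel h hinv -> (forall t, f t != 0 -> h (hinv t) = t) ->
  asum f -> csum (fun t => f (h t)) = csum f.
Proof. by move=> hK fK af; apply/hsum_csum/(hsum_inj hK fK)/asum_hsum. Qed.

Lemma csum_bij (T T' : choiceType) (h : T -> T') (hinv : T' -> T) (f : T' -> C) :
  cancel h hinv -> cancel hinv h -> asum f -> csum (fun t => f (h t)) = csum f.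
Proof. by move=> hK hK' af; apply: csum_inj hK _ af => t _; exact: hK'. Qed.

Lemma rsum_bij (T T' : choiceType) (h : T -> T') (hinv : T' -> T) (f : T' -> R) :
  (forall t, 0 <= f t) -> bsum f ->
  cancel h hinv -> cancel hinv h -> rsum (fun t => f (h t)) = rsum f.
Proof.
by move=> f0 bf hK hK'; rewrite /rsum (csum_bij hK hK' (bsum_asum f0 bf)).
Qed.

Lemma bsum_inj (T T' : choiceType) (h : T -> T') (f : T' -> R) :
  (forall t, 0 <= f t) -> injective h -> bsum f -> bsum (fun t => f (h t)).
Proof.
move=> f0 inj /(bsum_asum f0)/(asum_inj inj) h1; apply: bsum_le h1 => t.
by rewrite mod_rc ger0_norm.
Qed.

(** The filter of finite sets directed by inclusion. [hsum] is convergence along it, which makes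
    [dct] applicable to partial sums. *)
Definition totally (T : choiceType) : set_system {fset T} :=
  filter_from setT (fun S S' : {fset T} => (S `<=` S')%fset : Prop).
Global Instance totally_proper (T : choiceType) : ProperFilter (@totally T).
Proof.
eapply filter_from_proper; last by move=> A _; exists A => /=; rewrite fsubset_refl.
apply: filter_fromT_filter; first by exists fset0.
by move=> A B; exists (A `|` B)%fset => P /=; rewrite fsubUset => /andP[].
Qed.

Section Fubini.
Variables T1 T2 : choiceType.
Implicit Types F : T1 * T2 -> C.

(** The rows indexed by a finite set A add up to the sum of [F] cut off outside A, and [dct] along
    [totally] removes the cutoff. The same computation for the moduli bounds the row sums. *)
Lemma fubini F : asum F ->
  [/\ forall i, asum (fun j => F (i, j)), asum (fun i => csum (fun j => F (i, j))) &
      csum (fun i => csum (fun j => F (i, j))) = csum F].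
Proof.
move=> aF.
have arow i : asum (fun j => F (i, j)) by apply: (asum_inj _ aF) => j j' [].
pose Fi i t := if t.1 == i then F t else 0.
have aFi i : asum (Fi i).
  by apply: asum_le aF => t; rewrite /Fi; case: eqP; rewrite ?mod0 ?mod_ge0.
have cFi i : csum (Fi i) = csum (fun j => F (i, j)).
  rewrite -(@csum_inj _ _ (fun j => (i, j)) snd _ _ _ (aFi i)) //.
    by congr csum; apply/funext => j; rewrite /Fi eqxx.
  by case=> i' j; rewrite /Fi /=; case: (i' =P i) => [->|]; rewrite ?eqxx.
have key (A : {fset T1}) : psum (fun i => csum (fun j => F (i, j))) A =
    csum (fun t => if t.1 \in A then F t else 0).
  rewrite /psum -(eq_bigr _ (fun i _ => cFi i)) -(csum_sum A aFi).1.
  congr csum; apply/funext => t; rewrite /Fi.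
  case: ifPn => tA.
    rewrite (bigD1_seq t.1) ?fset_uniq //= eqxx big1_seq ?addr0 // => i /andP[/negPf it _].
    by rewrite eq_sym it.
  rewrite big1_seq // => i /andP[_ iA]; case: eqP => // ti; by rewrite ti iA in tA.
have [||_ D] := @dct R _ _ (@totally T1) _ (fun A t => if t.1 \in A then F t else 0) F
  (fun t => modulus (F t)) _ aF.
- by move=> A t; case: ifP; rewrite ?mod0 ?mod_ge0.
- move=> t e e0; exists [fset t.1]%fset => // A /=; rewrite fsub1set => ->.
  by rewrite subrr mod0 ltW.
have H : hsum (fun i => csum (fun j => F (i, j))) (csum F).
  move=> e /D[S _ hS]; exists S => A /hS /=; by rewrite key.
split=> //; last exact: hsum_csum.
case: aF => B hB; exists B => A; rewrite /rpsum.
have abF : asum (fun t => rc (modulus (F t))).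
  by exists B => S; apply: le_trans (hB S); apply: rpsum_le => t; rewrite mod_rc ger0_norm ?mod_ge0.
pose m i := rsum (fun j => modulus (F (i, j))).
apply: (@le_trans _ _ (\sum_(i <- A) m i)); first by apply: ler_sum => i _; exact: mod_csum.
have -> : \sum_(i <- A) m i = rsum (fun t => if t.1 \in A then modulus (F t) else 0).
  apply: complexI; rewrite rc_sum -rsumE; last 2 first.
  - by move=> t; case: ifP; rewrite ?mod_ge0.
  - by exists B => S; apply: le_trans (hB S); apply: rpsum_le => t; case: ifP; rewrite ?mod_ge0.
  pose Gi i t := if t.1 == i then rc (modulus (F t)) else 0.
  have aGi i : asum (Gi i).
    by apply: asum_le abF => t; rewrite /Gi; case: eqP; rewrite ?mod0 ?mod_ge0.
  have cGi i : csum (Gi i) = rc (m i).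
    rewrite -(@csum_inj _ _ (fun j => (i, j)) snd _ _ _ (aGi i)) //.
      rewrite -rsumE; last 2 first.
      - by move=> j; exact: mod_ge0.
      - exact: arow.
      by congr csum; apply/funext => j; rewrite /Gi eqxx.
    by case=> i' j; rewrite /Gi /=; case: (i' =P i) => [->|]; rewrite ?eqxx.
  rewrite -(eq_bigr _ (fun i _ => cGi i)) -(csum_sum A aGi).1.
  congr csum; apply/funext => t; rewrite /Gi.
  case: ifPn => tA.
    rewrite (bigD1_seq t.1) ?fset_uniq //= eqxx big1_seq ?addr0 // => i /andP[/negPf it _].
    by rewrite eq_sym it.
  rewrite big1_seq // => i /andP[_ iA]; case: eqP => // ti; by rewrite ti iA in tA.
apply: rsum_le => [t|S]; first by case: ifP; rewrite ?mod_ge0.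
by apply: le_trans (hB S); apply: rpsum_le => t; case: ifP; rewrite ?mod_ge0.
Qed.

(** A finite set of pairs lies in the product of its two projections, where the sum is a finite sum
    of finite row sums. *)
Lemma tonelli (h : T1 * T2 -> R) : (forall t, 0 <= h t) ->
  (forall i, bsum (fun j => h (i, j))) -> bsum (fun i => rsum (fun j => h (i, j))) -> bsum h.
Proof.
move=> h0 hi [B hB]; exists B => S.
set A1 := [fset t.1 | t in S]%fset; set A2 := [fset t.2 | t in S]%fset.
apply: (@le_trans _ _ (rpsum h (A1 `*` A2)%fset)).
  apply: rpsum_mono => //; apply/fsubsetP => t tS; rewrite in_fsetM.
  by apply/andP; split; apply/imfsetP; exists t.
apply: le_trans (hB A1).
have -> : rpsum h (A1 `*` A2)%fset = \sum_(i <- A1) \sum_(j <- A2) h (i, j).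
  rewrite -big_allpairs.
  apply/perm_big/uniq_perm; rewrite ?fset_uniq //.
    by rewrite allpairs_uniq ?fset_uniq // => -[a b] [c d].
  case=> a b; rewrite in_fsetM /=; apply/andP/allpairsP => [[aA bB]|[[c d] /= [cA dB [-> ->]]]] //.
  by exists (a, b).
by apply: ler_sum => i _; apply: rpsum_rsum.
Qed.
End Fubini.

Lemma csum_swap (T1 T2 : choiceType) (F : T1 -> T2 -> C) : asum (fun t => F t.1 t.2) ->
  csum (fun i => csum (F i)) = csum (fun j => csum (fun i => F i j)).
Proof.
move=> aF; have [_ _ E] := fubini aF; rewrite /= in E.
have aF' : asum (fun t : T2 * T1 => F t.2 t.1).
  by apply: (@asum_inj _ _ (fun t : T2 * T1 => (t.2, t.1)) (fun t => F t.1 t.2)) => // -[a b] [c d] [-> ->].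
have [_ _ E'] := fubini aF'; rewrite /= in E'.
rewrite (_ : (fun i => csum (F i)) = (fun i => csum (fun j => F i j))) // E E'.
by rewrite -(@csum_bij _ _ (fun t : T2 * T1 => (t.2, t.1)) (fun t => (t.2, t.1)) _ _ _ aF) // => -[].
Qed.
End Reindex.

Section L2.
Variables (R : realType) (T : choiceType).
Local Notation C := R[i].
Implicit Types f g : T -> C.

Definition sq f := fun t => modulus (f t) ^+ 2.
Definition l2 f := bsum (sq f).
Definition n2 f := rsum (sq f).
Definition ip f g := csum (fun t => f t * conjc (g t)).
Lemma sq_ge0 f t : 0 <= sq f t. Proof. exact: sqr_ge0. Qed.
Hint Resolve sq_ge0 : core.
Lemma n2_ge0 f : l2 f -> 0 <= n2 f. Proof. by move=> h; exact: rsum_ge0. Qed.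

Lemma l2_mul f g : l2 f -> l2 g -> asum (fun t => f t * g t).
Proof.
move=> hf hg; apply: asum_le (bsumD hf hg) => t; rewrite modM /sq.
have := sqr_ge0 (modulus (f t) - modulus (g t)).
have := mod_ge0 (f t); have := mod_ge0 (g t); rewrite sqrrB; nra.
Qed.

Lemma l2_conj f : l2 f -> l2 (fun t => conjc (f t)).
Proof. by move=> h; apply: bsum_le h => t; rewrite /sq mod_conj. Qed.

Lemma n2_conj f : n2 (fun t => conjc (f t)) = n2 f.
Proof. by congr rsum; apply/funext => t; rewrite /sq mod_conj. Qed.

Lemma l2_ip f g : l2 f -> l2 g -> asum (fun t => f t * conjc (g t)).
Proof. by move=> hf /l2_conj; exact: l2_mul. Qed.

Lemma l2D f g : l2 f -> l2 g -> l2 (fun t => f t + g t).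
Proof.
move=> hf hg; apply: bsum_le (bsumD (bsumZ (ler0n _ 2) hf) (bsumZ (ler0n _ 2) hg)) => t.
exact: mod_sqD.
Qed.

Lemma l2Z c f : l2 f -> l2 (fun t => c * f t).
Proof.
by move=> hf; apply: bsum_le (bsumZ (sqr_ge0 (modulus c)) hf) => t; rewrite /sq modM exprMn.
Qed.

Lemma ip_nn f : l2 f -> ip f f = rc (n2 f).
Proof.
by move=> h; rewrite /ip /n2 -rsumE //; congr csum; apply/funext => t; rewrite mul_conj.
Qed.

Lemma ipDl f g k : l2 f -> l2 g -> l2 k -> ip (fun t => f t + g t) k = ip f k + ip g k.
Proof.
move=> hf hg hk; rewrite /ip -csumD; try exact: l2_ip.
by congr csum; apply/funext => t; rewrite mulrDl.
Qed.

Lemma ipZl c f k : l2 f -> l2 k -> ip (fun t => c * f t) k = c * ip f k.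
Proof.
move=> hf hk; rewrite /ip -csumZ; last exact: l2_ip.
by congr csum; apply/funext => t; rewrite mulrA.
Qed.

Lemma ipC f g : l2 f -> l2 g -> ip g f = conjc (ip f g).
Proof.
move=> hf hg; rewrite /ip -csum_conj; last exact: l2_ip.
by congr csum; apply/funext => t; rewrite conjcM conjcK mulrC.
Qed.

Lemma n2D f g : l2 f -> l2 g ->
  n2 (fun t => f t + g t) = n2 f + 2 * complex.Re (ip f g) + n2 g.
Proof.
move=> hf hg; apply: complexI; rewrite -ip_nn; last exact: l2D.
rewrite ipDl //; last exact: l2D.
rewrite (ipC (l2D hf hg) hf) (ipC (l2D hf hg) hg) !ipDl // !conjcD -!ipC // !ip_nn //.
rewrite (ipC hf hg); case: (ip f g) => a b.
by apply/eqP; rewrite eq_complex /=; apply/andP; split; apply/eqP; ring.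
Qed.

Lemma n2Z c f : l2 f -> n2 (fun t => c * f t) = modulus c ^+ 2 * n2 f.
Proof.
move=> hf; apply: complexI; rewrite -ip_nn; last exact: l2Z.
rewrite ipZl //; last exact: l2Z.
rewrite (ipC (l2Z c hf) hf) ipZl // conjcM -ipC // ip_nn // mulrA mul_conj.
by rewrite -rcM.
Qed.

Lemma n2_eq0 f : l2 f -> n2 f = 0 -> forall t, f t = 0.
Proof.
move=> hf h0 t; apply: mod_eq0; apply/eqP; rewrite -sqrf_eq0.
have := term_le_rsum t (sq_ge0 f) hf; rewrite -/(n2 f) h0 => h.
by rewrite eq_le h sq_ge0.
Qed.

(** The optimal t is s / X, or Y / s when X = 0. The hypothesis can be checked term by term with the
    weighted arithmetic-geometric inequality, so Cauchy-Schwarz and the Schur bound need no square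
    roots of sums. *)
Lemma am_gm_sq (s X Y : R) : 0 <= s -> 0 <= X -> 0 <= Y ->
  (forall t : R, 0 < t -> 2 * s <= t * X + Y / t) -> s ^+ 2 <= X * Y.
Proof.
move=> s0 X0 Y0 h; case: (ltP 0 s) => [s1|s1]; last first.
  have -> : s = 0 by lra.
  by rewrite expr0n mulr_ge0.
case: (ltP 0 X) => [X1|X1].
  have := h (s / X) (divr_gt0 s1 X1).
  have -> : s / X * X + Y / (s / X) = (s ^+ 2 + X * Y) / s.
    by field; rewrite !gt_eqF.
  by rewrite ler_pdivlMr //; nra.
have X2 : X = 0 by lra.
have Y1 : 0 < Y.
  by have := h 1 ltr01; rewrite X2 mulr0 add0r divr1; lra.
have := h (Y / s) (divr_gt0 Y1 s1); rewrite X2 mulr0 add0r.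
have -> : Y / (Y / s) = s by field; rewrite !gt_eqF.
by lra.
Qed.

Lemma cauchy_schwarz f g : l2 f -> l2 g -> modulus (csum (fun t => f t * g t)) ^+ 2 <= n2 f * n2 g.
Proof.
move=> hf hg; apply: am_gm_sq; rewrite ?mod_ge0 ?n2_ge0 // => t t0.
have -> : 2 * modulus (csum (fun t => f t * g t)) = modulus (csum (fun t => rc 2 * (f t * g t))).
  by rewrite csumZ; [rewrite modM mod_rc ger0_norm | exact: l2_mul].
apply: csum_ler => S.
apply: (@le_trans _ _ (t * rpsum (sq f) S + rpsum (sq g) S / t)); last first.
  by rewrite lerD // ?ler_pM2l ?ler_pM2r ?invr_gt0 //; apply: rpsum_rsum.
rewrite /rpsum mulr_sumr mulr_suml -big_split /=; apply: ler_sum => i _.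
rewrite !modM mod_rc ger0_norm // /sq -(ler_pM2l t0) mulrDr.
have -> : t * (modulus (g i) ^+ 2 / t) = modulus (g i) ^+ 2 by field; rewrite gt_eqF.
have := sqr_ge0 (t * modulus (f i) - modulus (g i)); rewrite sqrrB; nra.
Qed.
End L2.
#[global] Hint Resolve sq_ge0 : core.

Section UltraLimit.
Variable R : realType.
Local Notation C := R[i].

(** The limit is the supremum of the t that lie below F-many values. Limits along an ultrafilter
    exist simultaneously for all coordinates, which replaces a diagonal extraction of
    subsequences. *)
Lemma ultra_real (F : set_system nat) (UF : UltraFilter F) (f : nat -> R) (B : R) :
  (forall n, `|f n| <= B) -> exists l : R, forall e, 0 < e -> F (fun n : nat => `|f n - l| <= e).
Proof.
move=> fB; have FF : ProperFilter F by case: UF.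
pose E : set R := fun t => F (fun n => t <= f n).
have bd n := fB n; have bd1 n : - B <= f n by move: (bd n); rewrite ler_norml => /andP[].
have bd2 n : f n <= B by move: (bd n); rewrite ler_norml => /andP[].
have sE : has_sup E.
  split; first by exists (- B); apply: filterS filterT => n _; exact: bd1.
  by exists B => t /filter_ex[n] /le_trans; apply.
exists (sup E) => e e0.
have [t Et tl] := sup_adherent e0 sE.
have : F (~` (fun n => sup E + e <= f n)).
  have [h|//] := in_ultra_setVsetC (fun n => sup E + e <= f n) UF.
  have : sup E + e <= sup E by apply: sup_upper_bound => //; exact: sE.
  by rewrite gerDl leNgt e0.
move=> h; apply: filterS (filterI Et h) => n [/= h1 /negP]; rewrite -ltNge => h2.
by rewrite ler_norml; apply/andP; split; move: tl h1 h2; lra.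
Qed.

Lemma ultra_complex (F : set_system nat) (UF : UltraFilter F) (f : nat -> C) (B : R) :
  (forall n, modulus (f n) <= B) ->
  exists l : C, forall e, 0 < e -> F (fun n : nat => modulus (f n - l) <= e).
Proof.
move=> fB; have FF : ProperFilter F by case: UF.
have [a ha] := ultra_real UF (fun n => le_trans (ReE_le (f n)) (fB n)).
have [b hb] := ultra_real UF (fun n => le_trans (ImE_le (f n)) (fB n)).
exists (a +i* b)%C => e e0; have e2 : 0 < e / 2 by rewrite divr_gt0.
apply: filterS (filterI (ha _ e2) (hb _ e2)) => n [/= h1 h2].
apply: le_trans (mod_le _) _; case: (f n) h1 h2 => x y /= h1 h2.
by rewrite [e]splitr lerD.
Qed.
End UltraLimit.

Section Fatou.
Variables (R : realType) (T : choiceType).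
Local Notation C := R[i].

Lemma sq_near (x y : C) (d B : R) : modulus (x - y) <= d -> modulus x <= B -> 
  modulus y ^+ 2 <= modulus x ^+ 2 + 2 * B * d + d ^+ 2.
Proof.
move=> h hB; have d0 := le_trans (mod_ge0 _) h; have x0 := mod_ge0 x.
have hy : modulus y <= modulus x + d.
  have -> : y = x - (x - y) by ring.
  by rewrite (le_trans (modB _ _)) // lerD2l.
apply: (@le_trans _ _ ((modulus x + d) ^+ 2)).
  by rewrite ler_pXn2r ?nnegrE ?addr_ge0 ?mod_ge0.
rewrite sqrrD -mulr_natl; have := ler_wpM2r d0 hB; nra.
Qed.

(** Lower semicontinuity of the norm under coordinatewise limits, checked on finite partial sums.
    The bounds [b n] only have to fall below B + e eventually, as they do for a minimising
    sequence. *)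
Lemma fatou_sq (I : Type) (F : set_system I) (FF : ProperFilter F) (f : I -> T -> C) (g : T -> C)
  (b : I -> R) (B : R) :
  (forall t e, 0 < e -> F (fun n : I => modulus (f n t - g t) <= e)) ->
  (forall n S, rpsum (sq (f n)) S <= b n) ->
  (forall e, 0 < e -> F (fun n : I => b n <= B + e)) ->
  forall S, rpsum (sq g) S <= B.
Proof.
move=> fg fb hb S; apply: eps_le => e e0.
have e2 : 0 < e / 2 by rewrite divr_gt0.
pose L := modulus (\sum_(i <- S) rc (modulus (g i))) + 1.
have gL t : t \in S -> modulus (g t) <= L.
  move=> tS; rewrite /L -rc_sum mod_rc ger0_norm; last by apply: sumr_ge0 => i _; exact: mod_ge0.
  rewrite (bigD1_seq t) ?fset_uniq //= -addrA lerDl addr_ge0 // sumr_ge0 // => i _; exact: mod_ge0.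
have L0 : 0 < L by rewrite /L ltr_pwDr // mod_ge0.
pose d := Num.min 1 (e / 2 / (size S).+1%:R / (2 * (L + 1) + 1)).
have d0 : 0 < d by rewrite lt_min ltr01 !divr_gt0 // ?ltr0n // addr_gt0 // mulr_gt0 // addr_gt0.
have hS : forall r : seq T, F (fun n : I => forall t, t \in r -> modulus (f n t - g t) <= d).
  elim=> [|a r IH]; first by apply: filterS filterT.
  apply: filterS (filterI (fg a _ d0) IH) => n [/= h1 h2] t.
  by rewrite inE => /orP[/eqP ->|/h2].
have [n [/= hn1 hn2]] := filter_ex (filterI (hS S) (hb _ e2)).
have d1 : d <= 1 by rewrite ge_min lexx.
have dd : d * (2 * (L + 1) + 1) <= e / 2 / (size S).+1%:R.
  rewrite -ler_pdivlMr; first by rewrite ge_min lexx orbT.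
  by rewrite addr_gt0 // mulr_gt0 // addr_gt0.
apply: (@le_trans _ _ (rpsum (sq (f n)) S + e / 2)); last first.
  by have := fb n S; lra.
apply: (@le_trans _ _ (\sum_(i <- S) (sq (f n) i + e / 2 / (size S).+1%:R))).
  rewrite /rpsum big_seq [leRHS]big_seq; apply: ler_sum => t tS.
  have fL : modulus (f n t) <= L + 1.
    have -> : f n t = g t + (f n t - g t) by ring.
    by rewrite (le_trans (modD _ _)) // lerD ?gL // (le_trans (hn1 _ tS)).
  apply: (le_trans (sq_near (hn1 _ tS) fL)); rewrite /sq -addrA lerD2l.
  by apply: le_trans dd; nra.
rewrite big_split /= lerD2l big_const_seq count_predT iter_addr_0 -[_ *+ _]mulr_natr -mulrA.
apply: ler_piMr; first exact: ltW.
by rewrite ler_pdivrMl ?ltr0n // mulr1 ler_nat.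
Qed.
End Fatou.

Section Convolution.
Variables (R : realType) (G : zmodType).
Local Notation C := R[i].
Implicit Types (b u v : G -> C).

Definition conv b u : G -> C := fun g => csum (fun g' => b (g - g') * u g').

Lemma sub_inj (g : G) : injective (fun g' => g - g').
Proof. by move=> x y /addrI /oppr_inj. Qed.

Lemma asum_shift b g : asum b -> asum (fun g' => b (g - g')).
Proof. exact: asum_inj (@sub_inj g). Qed.

Lemma rsum_shift (h : G -> R) g : (forall t, 0 <= h t) -> bsum h ->
  rsum (fun g' => h (g - g')) = rsum h.
Proof.
by move=> h0 hb; apply: (@rsum_bij _ _ _ (fun g' => g - g') (fun g' => g - g')) => // x; rewrite subKr.
Qed.

Lemma rsum_shiftl (h : G -> R) g : (forall t, 0 <= h t) -> bsum h ->
  rsum (fun g' => h (g' - g)) = rsum h.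
Proof.
move=> h0 hb; apply: (@rsum_bij _ _ _ (fun g' => g' - g) (fun g' => g' + g)) => // x.
  by rewrite subrK.
by rewrite addrK.
Qed.

Lemma bsum_shiftl (h : G -> R) g : (forall t, 0 <= h t) -> bsum h -> bsum (fun g' => h (g' - g)).
Proof. by move=> h0; apply: bsum_inj => // x y /addIr. Qed.

(** The double family is summed first in the order where the inner sums are explicit: for fixed g'
    the sum over g is [rsum p] times [q g']. *)
Lemma bsum_conv (p q : G -> R) : (forall t, 0 <= p t) -> (forall t, 0 <= q t) ->
  bsum p -> bsum q ->
  bsum (fun t : G * G => p (t.1 - t.2) * q t.2) /\
  [/\ forall g, bsum (fun g' => p (g - g') * q g'),
      bsum (fun g => rsum (fun g' => p (g - g') * q g')) &
      rsum (fun g => rsum (fun g' => p (g - g') * q g')) = rsum p * rsum q].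
Proof.
move=> p0 q0 bp bq.
pose h (t : G * G) := p (t.2 - t.1) * q t.1.
have h0 t : 0 <= h t by rewrite mulr_ge0.
have rowE g' : (fun g => rc (h (g', g))) = (fun g => rc (q g') * rc (p (g - g'))).
  by apply/funext => g; rewrite /h /= mulrC rcM.
have bps g' : bsum (fun g => p (g - g')) by exact: bsum_shiftl.
have rowb g' : bsum (fun g => h (g', g)).
  by apply: bsum_le (bsumZ (q0 g') (bps g')) => g; rewrite /h /= mulrC.
have rowS g' : rsum (fun g => h (g', g)) = rsum p * q g'.
  apply: complexI; rewrite -rsumE // rowE csumZ; last exact: bsum_asum.
  by rewrite rsumE // rsum_shiftl // -rcM mulrC.
have bh : bsum h.
  apply: tonelli => //; apply: bsum_le (bsumZ (rsum_ge0 p0 bp) bq) => g'.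
  by rewrite rowS.
have ah := bsum_asum h0 bh.
have bk : bsum (fun t : G * G => p (t.1 - t.2) * q t.2).
  apply: bsum_le (bsum_inj h0 (h := fun t : G * G => (t.2, t.1)) _ bh) => [t//|[a b] [c d] [-> ->]//].
split=> //.
have k0 (t : G * G) : 0 <= p (t.1 - t.2) * q t.2 by rewrite mulr_ge0.
have [f1 f2 f3] := fubini (bsum_asum k0 bk); rewrite /= in f1 f2 f3.
have b1 g : bsum (fun g' => p (g - g') * q g').
  by apply: bsum_le (f1 g) => g'; rewrite mod_rc ger0_norm ?mulr_ge0.
have s0 g : 0 <= rsum (fun g' => p (g - g') * q g') by apply: rsum_ge0 => // g'; rewrite mulr_ge0.
have E : (fun g => csum (fun g' => rc (p (g - g') * q g'))) = (fun g => rc (rsum (fun g' => p (g - g') * q g'))).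
  by apply/funext => g; rewrite rsumE // => g'; rewrite mulr_ge0.
rewrite E in f2 f3.
have b2 : bsum (fun g => rsum (fun g' => p (g - g') * q g')).
  by apply: bsum_le f2 => g; rewrite mod_rc ger0_norm.
split=> //; apply: complexI; rewrite -rsumE // f3.
have := csum_swap (F := fun g' g => rc (h (g', g))).
have [e1 e2 e3] := fubini ah; rewrite /= in e1 e2 e3.
have -> : csum (fun t : G * G => rc (p (t.1 - t.2) * q t.2)) = csum (fun t => rc (h t)).
  by rewrite -(@csum_bij _ _ _ (fun t : G * G => (t.2, t.1)) (fun t => (t.2, t.1)) _ _ _ ah) // => -[].
move=> _; rewrite -e3.
have -> : (fun i => csum (fun j => rc (h (i, j)))) = (fun g' => rc (rsum p) * rc (q g')).
  by apply/funext => g'; rewrite rsumE ?rowS ?rcM.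
by rewrite csumZ ?rsumE ?rcM //; exact: bsum_asum.
Qed.

Lemma l2_bdd u : l2 u -> forall t, modulus (u t) <= n2 u + 1.
Proof.
move=> hu t; have := term_le_rsum t (sq_ge0 u) hu; rewrite -/(n2 u) /sq.
by have := mod_ge0 (u t); have := sqr_ge0 (modulus (u t) - 1); rewrite sqrrB1; nra.
Qed.

Lemma asum_convr b u g : asum b -> (exists B : R, forall t, modulus (u t) <= B) -> asum (fun g' => b (g - g') * u g').
Proof.
move=> ab [B hB]; have := asum_bdd hB (asum_shift g ab).
by apply: asum_le => t; rewrite mulrC.
Qed.

Lemma asum_convl2 b u g : asum b -> l2 u -> asum (fun g' => b (g - g') * u g').
Proof. by move=> ab lu; apply: asum_convr => //; exists (n2 u + 1); exact: l2_bdd. Qed.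

(** Schur's test: |conv b u|^2 is at most the l^1 norm of b times the convolution of |b| with |u|^2,
    and the latter has sum [rsum] |b| * [n2 u]. *)
Lemma conv_l2 b u : asum b -> l2 u ->
  l2 (conv b u) /\ n2 (conv b u) <= rsum (fun t => modulus (b t)) ^+ 2 * n2 u.
Proof.
move=> ab lu; set X := rsum _.
have X0 : 0 <= X by apply: rsum_ge0 => // t; exact: mod_ge0.
have [_ [Y1 Y2 Y3]] := bsum_conv (fun t => mod_ge0 (b t)) (sq_ge0 u) ab lu.
pose Y g := rsum (fun g' => modulus (b (g - g')) * sq u g').
have Y0 g : 0 <= Y g.
  apply: rsum_ge0; last exact: Y1.
  by move=> g'; apply: mulr_ge0; [exact: mod_ge0 | exact: sq_ge0].
have key g : sq (conv b u) g <= X * Y g.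
  apply: am_gm_sq => //; first exact: mod_ge0.
  move=> t t0; rewrite /conv.
  have -> : 2 * modulus (csum (fun g' => b (g - g') * u g')) = modulus (csum (fun g' => rc 2 * (b (g - g') * u g'))).
    by rewrite csumZ; [rewrite modM mod_rc ger0_norm | exact: asum_convl2].
  apply: csum_ler => S.
  have bb : bsum (fun g' => modulus (b (g - g'))) by exact: (asum_shift g ab).
  apply: (@le_trans _ _ (t * rpsum (fun g' => modulus (b (g - g'))) S + rpsum (fun g' => modulus (b (g - g')) * sq u g') S / t)); last first.
    rewrite lerD // ?ler_pM2l ?ler_pM2r ?invr_gt0 //.
      rewrite /X -(rsum_shift g (fun t => mod_ge0 (b t)) ab); apply: rpsum_rsum => // g'; exact: mod_ge0.
    by apply: rpsum_rsum; [move=> g'; apply: mulr_ge0; [exact: mod_ge0 | exact: sq_ge0] | exact: Y1].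
  rewrite /rpsum mulr_sumr mulr_suml -big_split /=; apply: ler_sum => i _.
  rewrite !modM mod_rc ger0_norm // /sq -(ler_pM2l t0) mulrDr.
  have -> : t * (modulus (b (g - i)) * modulus (u i) ^+ 2 / t) = modulus (b (g - i)) * modulus (u i) ^+ 2.
    by field; rewrite gt_eqF.
  have := mulr_ge0 (mod_ge0 (b (g - i))) (sqr_ge0 (t - modulus (u i))); rewrite sqrrB; nra.
have lc : l2 (conv b u) by apply: bsum_le (bsumZ X0 Y2) => g; exact: key.
split=> //; apply: rsum_le => // S.
apply: le_trans (rpsum_le _ key) _; rewrite /rpsum -mulr_sumr.
rewrite expr2 -mulrA ler_wpM2l //.
by have := rpsum_rsum S Y0 Y2; rewrite /rpsum Y3.
Qed.

(** The kernel b (g - g') is symmetric because b is even. The sums may be exchanged because |b| |u|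
    |v| <= |b| (|u|^2 + |v|^2) is summable over pairs. *)
Lemma conv_sym b u v : asum b -> (forall g, b (- g) = b g) -> l2 u -> l2 v ->
  csum (fun g => conv b u g * v g) = csum (fun g => u g * conv b v g).
Proof.
move=> ab ev lu lv.
pose F (g g' : G) := b (g - g') * u g' * v g.
have aF : asum (fun t => F t.1 t.2).
  have [h1 _] := bsum_conv (fun t => mod_ge0 (b t)) (sq_ge0 u) ab lu.
  have [h2 _] := bsum_conv (fun t => mod_ge0 (b t)) (sq_ge0 v) ab lv.
  have h20 (t : G * G) : 0 <= modulus (b (t.1 - t.2)) * sq v t.2 by apply: mulr_ge0; [exact: mod_ge0 | exact: sq_ge0].
  have {}h2 : bsum (fun t : G * G => modulus (b (t.1 - t.2)) * sq v t.1).
    apply: bsum_le (bsum_inj h20 (h := fun t : G * G => (t.2, t.1)) _ h2) => /=.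
      by case=> x y /=; rewrite -ev opprB.
    by move=> [p q] [r s] [-> ->].
  apply: asum_le (bsumD h1 h2) => -[g g']; rewrite /F /= !modM -mulrA -mulrDr ler_wpM2l ?mod_ge0 // /sq.
  have := sqr_ge0 (modulus (u g') - modulus (v g)); have := mod_ge0 (u g'); have := mod_ge0 (v g).
  by rewrite sqrrB; nra.
transitivity (csum (fun g => csum (F g))).
  congr csum; apply/funext => g; rewrite mulrC /conv -csumZ; last exact: asum_convl2.
  by congr csum; apply/funext => g'; rewrite /F; ring.
rewrite csum_swap //; congr csum; apply/funext => g'; rewrite /conv -csumZ; last exact: asum_convl2.
by congr csum; apply/funext => g; rewrite /F -(ev (g - g')) opprB; ring.
Qed.

Lemma convD b u v g : asum b -> l2 u -> l2 v -> conv b (fun t => u t + v t) g = conv b u g + conv b v g.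
Proof.
move=> ab lu lv; rewrite /conv -csumD; try exact: asum_convl2.
by congr csum; apply/funext => t; ring.
Qed.

Lemma convZ b u c g : asum b -> l2 u -> conv b (fun t => c * u t) g = c * conv b u g.
Proof.
move=> ab lu; rewrite /conv -csumZ; last exact: asum_convl2.
by congr csum; apply/funext => t; ring.
Qed.
End Convolution.

Section L2Sums.
Variables (R : realType) (T : choiceType).
Local Notation C := R[i].
Implicit Types f g : T -> C.
Lemma n2_mono f g : l2 g -> (forall t, modulus (f t) <= modulus (g t)) -> l2 f /\ n2 f <= n2 g.
Proof.
move=> lg fg; have h t : sq f t <= sq g t by rewrite /sq ler_pXn2r ?nnegrE ?mod_ge0.
split; first exact: bsum_le lg.
by apply: rsum_le => // S; apply: le_trans (rpsum_le _ h) _; exact: rpsum_rsum.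
Qed.

Lemma n2D_le f g : l2 f -> l2 g -> n2 (fun t => f t + g t) <= 2 * n2 f + 2 * n2 g.
Proof.
move=> lf lg; apply: rsum_le => // S.
apply: (@le_trans _ _ (2 * rpsum (sq f) S + 2 * rpsum (sq g) S)); last first.
  by rewrite lerD // ler_pM2l //; apply: rpsum_rsum.
by rewrite /rpsum !mulr_sumr -big_split /=; apply: ler_sum => t _; exact: mod_sqD.
Qed.

Lemma l2N f : l2 f -> l2 (fun t => - f t).
Proof. by move=> h; apply: bsum_le h => t; rewrite /sq modN. Qed.

Lemma n2N f : n2 (fun t => - f t) = n2 f.
Proof. by congr rsum; apply/funext => t; rewrite /sq modN. Qed.

Lemma l2B f g : l2 f -> l2 g -> l2 (fun t => f t - g t).
Proof. by move=> lf /l2N; exact: l2D. Qed.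

Lemma n2B_le f g : l2 f -> l2 g -> n2 (fun t => f t - g t) <= 2 * n2 f + 2 * n2 g.
Proof. by move=> lf lg; rewrite -(n2N g); apply: n2D_le => //; exact: l2N. Qed.

Lemma near_all_seq (I : Type) (F : set_system I) (FF : Filter F) (P : I -> T -> Prop) (r : seq T) :
  (forall t, F (fun n : I => P n t)) -> F (fun n : I => forall t, t \in r -> P n t).
Proof.
move=> h; elim: r => [|a r IH]; first by apply: filterS filterT.
apply: filterS (filterI (h a) IH) => n [/= h1 h2] t.
by rewrite inE => /orP[/eqP ->|/h2].
Qed.

Lemma sum_small (S : {fset T}) (h : T -> R) (e : R) : 0 <= e ->
  (forall t, t \in S -> h t <= e / (size S).+1%:R) -> rpsum h S <= e.
Proof.
move=> e0 hS; rewrite /rpsum.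
apply: (@le_trans _ _ (\sum_(i <- S) e / (size S).+1%:R)).
  by rewrite big_seq [leRHS]big_seq; apply: ler_sum.
rewrite big_const_seq count_predT iter_addr_0 -[_ *+ _]mulr_natr -mulrA.
by apply: ler_piMr => //; rewrite ler_pdivrMl ?ltr0n // mulr1 ler_nat.
Qed.

Lemma rpsum_split (h : T -> R) (S A : {fset T}) : (forall t, 0 <= h t) ->
  rpsum h A <= rpsum h S + rpsum h (A `\` S)%fset.
Proof.
move=> h0; apply: (@le_trans _ _ (rpsum h (S `|` A)%fset)); first exact: rpsum_mono (fsubsetUr _ _).
by rewrite (sub_rpsum h (fsubsetUl S A)) fsetDUl fsetDv fset0U.
Qed.
End L2Sums.

(** * The operator on Fourier coefficients and its Takagi vectors *)

Section Operator.
Variables (R : realType) (G : zmodType).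
Local Notation C := R[i].
Variables (J : G -> bool) (fr a : G -> C) (al : C).
Hypothesis fr_coer : forall M : R, exists S : {fset G}, forall g, g \notin S -> M <= modulus (fr g).
Hypothesis a_even : forall g, a (- g) = a g.
Hypothesis a_sum : asum a.
Implicit Types (u v : G -> C) (k : C).

Definition supp u := forall g, ~~ J g -> u g = 0.
(* [D(al) + k] on Fourier coefficients supported in [J]. *)
Definition opA k u : G -> C := fun g =>
  if J g then (fr g + k) * u g + al * conv a u g else 0.
(** The Fourier side of H^1_0: [fr] stands for the symbol of 2 D_zbar, whose modulus is the length
    of the frequency. *)
Definition h1 u := [/\ supp u, l2 u & l2 (fun g => fr g * u g)].

Lemma opA_supp k u : supp (opA k u).
Proof. by move=> g /negPf Jg; rewrite /opA Jg. Qed.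

Lemma opAD k u v g : l2 u -> l2 v -> opA k (fun t => u t + v t) g = opA k u g + opA k v g.
Proof. by move=> lu lv; rewrite /opA convD //; case: ifP => _; ring. Qed.

Lemma opAZ k c u g : l2 u -> opA k (fun t => c * u t) g = c * opA k u g.
Proof. by move=> lu; rewrite /opA convZ //; case: ifP => _; ring. Qed.

Lemma opA_shift k e u g : supp u -> opA (k + e) u g = opA k u g + e * u g.
Proof.
by move=> su; rewrite /opA; case: ifPn => [_|/su ->]; ring.
Qed.

Let X : R := rsum (fun t => modulus (a t)).
(** The factor 4 comes from applying |x + y|^2 <= 2 |x|^2 + 2 |y|^2 twice: once to split k u from al
    * conv a u, once to split A u into the symbol part and this lower order part. *)
Definition bndA k : R := 4 * (modulus k ^+ 2 + modulus al ^+ 2 * X ^+ 2).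
Lemma bndA_ge0 k : 0 <= bndA k.
Proof. by rewrite /bndA mulr_ge0 // addr_ge0 ?sqr_ge0 // mulr_ge0 ?sqr_ge0. Qed.

Lemma opA_low k u : l2 u -> 
  let p := fun g => if J g then k * u g + al * conv a u g else 0 in
  l2 p /\ 2 * n2 p <= bndA k * n2 u.
Proof.
move=> lu p; have [lc nc] := conv_l2 a_sum lu.
have lq : l2 (fun g => k * u g + al * conv a u g) by apply: l2D; exact: l2Z.
have [|lp np] := @n2_mono _ _ p _ lq.
  by move=> g; rewrite /p; case: ifP; rewrite ?mod0 ?mod_ge0.
split=> //; apply: (@le_trans _ _ (2 * (2 * n2 (fun g => k * u g) + 2 * n2 (fun g => al * conv a u g)))).
  by rewrite ler_pM2l // (le_trans np) // n2D_le //; exact: l2Z.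
rewrite !n2Z // /bndA -/X in nc *.
have := ler_wpM2l (sqr_ge0 (modulus al)) nc; nra.
Qed.

Lemma opA_split k u g : supp u -> opA k u g = fr g * u g + (if J g then k * u g + al * conv a u g else 0).
Proof. by move=> su; rewrite /opA; case: ifPn => [_|/su ->]; ring. Qed.

Lemma opA_l2 k u : h1 u -> l2 (opA k u).
Proof.
case=> su lu lfu; have [lp _] := opA_low k lu.
by apply: bsum_le (l2D lfu lp) => g; rewrite /sq opA_split.
Qed.

(** The elliptic estimate: everything in [opA] except multiplication by [fr] is bounded on l^2, so
    [fr * u] is controlled by the graph norm. *)
Lemma h1_of k u : supp u -> l2 u -> l2 (opA k u) ->
  h1 u /\ n2 (fun g => fr g * u g) <= 2 * n2 (opA k u) + bndA k * n2 u.
Proof.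
move=> su lu lA; have [lp np] := opA_low k lu.
have E : (fun g => fr g * u g) = (fun g => opA k u g - (if J g then k * u g + al * conv a u g else 0)).
  by apply/funext => g; rewrite opA_split //; ring.
have lf : l2 (fun g => fr g * u g) by rewrite E; exact: l2B.
split=> //; rewrite {1}E; apply: le_trans (n2B_le lA lp) _; by rewrite lerD2l.
Qed.

Lemma h1D u v : h1 u -> h1 v -> h1 (fun g => u g + v g).
Proof.
move=> [su lu fu] [sv lv fv]; split; last 1 first.
- by apply: bsum_le (l2D fu fv) => g; rewrite /sq mulrDr.
- by move=> g Jg; rewrite su // sv // addr0.
- exact: l2D.
Qed.

Lemma h1Z c u : h1 u -> h1 (fun g => c * u g).
Proof.
move=> [su lu fu]; split; last 1 first.
- by apply: bsum_le (l2Z c fu) => g; rewrite /sq mulrCA.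
- by move=> g Jg; rewrite su // mulr0.
- exact: l2Z.
Qed.

Lemma h1_conj u : h1 u -> h1 (fun g => conjc (u g)).
Proof.
move=> [su lu fu]; split; last 1 first.
- by apply: bsum_le fu => g; rewrite /sq !modM mod_conj.
- by move=> g Jg; rewrite su // conjc0.
- exact: l2_conj.
Qed.

(** Symmetry for the bilinear pairing without conjugation: a diagonal operator plus convolution with
    an even sequence. The adjoint of A is therefore conj A conj. *)
Lemma opA_sym k u v : h1 u -> h1 v ->
  csum (fun g => opA k u g * v g) = csum (fun g => u g * opA k v g).
Proof.
move=> [su lu fu] [sv lv fv].
have E u' v' : supp v' -> (fun g => opA k u' g * v' g) =
    (fun g => (fr g * u' g) * v' g + (k * (u' g * v' g) + al * (conv a u' g * v' g))).
  by move=> sv'; apply/funext => g; rewrite /opA; case: ifPn => [_|/sv' ->]; ring.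
have E' : (fun g => u g * opA k v g) = (fun g => opA k v g * u g).
  by apply/funext => g; rewrite mulrC.
have [lcu _] := conv_l2 a_sum lu; have [lcv _] := conv_l2 a_sum lv.
rewrite E' !E //.
rewrite !csumD ?csumZ; try by [exact: l2_mul | apply: asumZ; exact: l2_mul |
  apply: asumD; apply: asumZ; exact: l2_mul].
rewrite conv_sym //; congr (_ + (_ + _)).
- by congr csum; apply/funext => g; ring.
- by congr (_ * _); congr csum; apply/funext => g; ring.
- by congr (_ * _); congr csum; apply/funext => g; ring.
Qed.

(** Rellich's theorem. Since |fr| tends to infinity, the bound on [fr * x n] makes the part outside
    a finite set uniformly small, and inside it the coordinates converge along one ultrafilter. *)
Lemma compactness (x : nat -> G -> C) (B : R) :
  (forall n, supp (x n)) -> (forall n, l2 (x n)) -> (forall n, n2 (x n) <= 1) ->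
  (forall n S, rpsum (sq (fun g => fr g * x n g)) S <= B) ->
  exists (F : set_system nat) (y : G -> C),
  [/\ UltraFilter F, forall N, F (fun n : nat => (N <= n)%N), h1 y,
    forall g e, 0 < e -> F (fun n : nat => modulus (x n g - y g) <= e) &
    forall e, 0 < e -> F (fun n : nat => n2 (fun g => x n g - y g) <= e)].
Proof.
move=> sx lx nx bx.
have [F [UF sF]] := ultraFilterLemma eventually_filter.
have FF : ProperFilter F by case: UF.
have x1 n g : modulus (x n g) <= 1.
  rewrite -(@ler_pXn2r _ 2) ?nnegrE ?mod_ge0 // expr1n.
  by rewrite (le_trans _ (nx n)) // (term_le_rsum g (sq_ge0 _) (lx n)).
have /choice[y hy] : forall g, exists l, forall e, 0 < e -> F (fun n : nat => modulus (x n g - l) <= e).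
  by move=> g; apply: ultra_complex (fun n => x1 n g).
have B0 : 0 <= B by rewrite (le_trans _ (bx 0%N fset0)) // rpsum_ge0.
have sy : supp y.
  move=> g Jg; apply: eps_eq0 => e /(hy g)/filter_ex[n /=].
  by rewrite sx // sub0r modN.
have yb S : rpsum (sq y) S <= 1.
  apply: (@fatou_sq _ _ _ F _ x y (fun=> 1)) => //.
    by move=> n A; apply: le_trans (nx n); apply: rpsum_rsum => //; exact: lx.
  by move=> e e0; apply: filterS filterT => n _; rewrite lerDl ltW.
have ly : l2 y by exists 1.
have fyb S : rpsum (sq (fun g => fr g * y g)) S <= B.
  apply: (@fatou_sq _ _ _ F _ (fun n g => fr g * x n g) _ (fun=> B)) => //.
    move=> t e e0; have m1 : 0 < modulus (fr t) + 1 by rewrite ltr_pwDr // mod_ge0.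
    apply: filterS (hy t _ (divr_gt0 e0 m1)) => n /= h.
    rewrite -mulrBr modM; apply: (@le_trans _ _ ((modulus (fr t) + 1) * modulus (x n t - y t))).
      by rewrite ler_wpM2r ?mod_ge0 // lerDl.
    by rewrite mulrC -ler_pdivlMr.
  by move=> e e0; apply: filterS filterT => n _; rewrite lerDl ltW.
exists F, y; split=> //.
  by move=> N; apply: sF; exists N.
  by split=> //; exists B.
move=> e e0.
have e2 : 0 < e / 2 by rewrite divr_gt0.
(* Outside [S] one has |fr|^2 >= M because M >= 1, so the squared difference sums to at most 4 B / M
   there, which is below e / 2. *)
pose M := 8 * B / e + 1.
have M1 : 1 <= M by rewrite lerDr divr_ge0 ?mulr_ge0 // ltW.
have [S hS] := fr_coer M.
pose eta := e / 2 / (size S).+1%:R.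
have eta0 : 0 < eta by rewrite divr_gt0.
have d0 : 0 < Num.min 1 eta by rewrite lt_min ltr01.
apply: filterS (near_all_seq _ S (fun t => hy t _ d0)) => n /= hn.
apply: rsum_le => // A; apply: le_trans (rpsum_split S A (sq_ge0 _)) _.
rewrite [leRHS]splitr lerD //.
  apply: sum_small; first exact: ltW.
  move=> t /hn; rewrite le_min => /andP[h1 h2]; apply: le_trans h2.
  by rewrite /sq expr2 ler_piMr ?mod_ge0.
have M0 : 0 < M by rewrite (lt_le_trans ltr01).
have h t : t \in (A `\` S)%fset -> sq (fun g => x n g - y g) t <= (2 * sq (fun g => fr g * x n g) t + 2 * sq (fun g => fr g * y g) t) / M.
  rewrite !inE => /andP[/hS tM _]; rewrite ler_pdivlMr //.
  apply: (@le_trans _ _ (sq (fun g => fr g * x n g - fr g * y g) t)); last first.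
    by have := mod_sqD (fr t * x n t) (- (fr t * y t)); rewrite modN.
  rewrite /sq -mulrBr modM exprMn mulrC ler_wpM2r ?sqr_ge0 //.
  by rewrite (le_trans tM) // expr2 ler_peMr ?mod_ge0 // (le_trans M1).
apply: (@le_trans _ _ ((2 * rpsum (sq (fun g => fr g * x n g)) (A `\` S)%fset + 2 * rpsum (sq (fun g => fr g * y g)) (A `\` S)%fset) / M)).
  rewrite /rpsum !mulr_sumr -big_split /= mulr_suml big_seq [leRHS]big_seq; exact: ler_sum.
rewrite ler_pdivrMr //.
apply: (@le_trans _ _ (4 * B)); first by have := bx n (A `\` S)%fset; have := fyb (A `\` S)%fset; lra.
have -> : e / 2 * M = 4 * B + e / 2 by rewrite /M; field; rewrite gt_eqF.
by rewrite lerDl ltW.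
Qed.

(** Used for contradictions: a sequence bounded in the graph norm cannot keep its members at a fixed
    distance from each other. *)
Lemma no_sep (x : nat -> G -> C) (B e : R) :
  (forall n, supp (x n)) -> (forall n, l2 (x n)) -> (forall n, n2 (x n) <= 1) ->
  (forall n S, rpsum (sq (fun g => fr g * x n g)) S <= B) -> 0 < e ->
  exists n m, (n < m)%N /\ n2 (fun g => x m g - x n g) <= e.
Proof.
move=> sx lx nx bx e0.
have [F [y [UF Finf [_ ly _] _ st]]] := compactness sx lx nx bx.
have FF : ProperFilter F by case: UF.
have e4 : 0 < e / 4 by rewrite divr_gt0.
have [n hn] := filter_ex (st _ e4).
have [m [/= hm nm]] := filter_ex (filterI (st _ e4) (Finf n.+1)).
exists n, m; split=> //; rewrite /= in hn.
rewrite (_ : (fun g => x m g - x n g) = (fun g => (x m g - y g) - (x n g - y g))); last first.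
  by apply/funext => g; ring.
have := n2B_le (l2B (lx m) ly) (l2B (lx n) ly); lra.
Qed.

(** The convolution converges by domination with |a (g - t)|, a valid majorant because the
    coordinates of vectors of norm at most 1 are at most 1. *)
Lemma opA_lim (F : set_system nat) (FF : ProperFilter F) k (x : nat -> G -> C) (y : G -> C) :
  (forall n, l2 (x n)) -> (forall n, n2 (x n) <= 1) ->
  (forall g e, 0 < e -> F (fun n : nat => modulus (x n g - y g) <= e)) ->
  forall g e, 0 < e -> F (fun n : nat => modulus (opA k (x n) g - opA k y g) <= e).
Proof.
move=> lx nx hx g e e0; rewrite /opA; case: (J g); last first.
  by apply: filterS filterT => n _; rewrite subrr mod0 ltW.
have x1 n t : modulus (x n t) <= 1.
  rewrite -(@ler_pXn2r _ 2) ?nnegrE ?mod_ge0 // expr1n.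
  by rewrite (le_trans _ (nx n)) // (term_le_rsum t (sq_ge0 _) (lx n)).
have [_ D] : asum (fun t => a (g - t) * y t) /\ forall e, 0 < e -> F (fun n : nat => modulus (conv a (x n) g - conv a y g) <= e).
  apply: (@dct _ _ _ F _ (fun n t => a (g - t) * x n t) _ (fun t => modulus (a (g - t)))).
  - by move=> n t; rewrite modM ler_piMr ?mod_ge0.
  - exact: (asum_shift g a_sum).
  - move=> t d d0; have m1 : 0 < modulus (a (g - t)) + 1 by rewrite ltr_pwDr // mod_ge0.
    apply: filterS (hx t _ (divr_gt0 d0 m1)) => n /= h.
    rewrite -mulrBr modM; apply: (@le_trans _ _ ((modulus (a (g - t)) + 1) * modulus (x n t - y t))).
      by rewrite ler_wpM2r ?mod_ge0 // lerDl.
    by rewrite mulrC -ler_pdivlMr.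
have e2 : 0 < e / 2 by rewrite divr_gt0.
have m1 : 0 < modulus (fr g + k) + 1 by rewrite ltr_pwDr // mod_ge0.
have m2 : 0 < modulus al + 1 by rewrite ltr_pwDr // mod_ge0.
apply: filterS (filterI (hx g _ (divr_gt0 e2 m1)) (D _ (divr_gt0 e2 m2))) => n /= [h1' h2'].
have -> : (fr g + k) * x n g + al * conv a (x n) g - ((fr g + k) * y g + al * conv a y g) =
  (fr g + k) * (x n g - y g) + al * (conv a (x n) g - conv a y g) by ring.
rewrite (le_trans (modD _ _)) // [e]splitr !modM lerD //.
  apply: (@le_trans _ _ ((modulus (fr g + k) + 1) * modulus (x n g - y g))).
    by rewrite ler_wpM2r ?mod_ge0 // lerDl.
  by rewrite mulrC -ler_pdivlMr.
apply: (@le_trans _ _ ((modulus al + 1) * modulus (conv a (x n) g - conv a y g))).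
  by rewrite ler_wpM2r ?mod_ge0 // lerDl.
by rewrite mulrC -ler_pdivlMr.
Qed.
End Operator.

(** * Takagi vectors by minimisation *)

Section Takagi.
Variables (R : realType) (G : zmodType).
Local Notation C := R[i].
Variables (J : G -> bool) (fr a : G -> C) (al : C).
Hypothesis fr_coer : forall M : R, exists S : {fset G}, forall g, g \notin S -> M <= modulus (fr g).
Hypothesis a_even : forall g, a (- g) = a g.
Hypothesis a_sum : asum a.
Variable jn : nat -> G.
Hypothesis jnI : injective jn.
Hypothesis jnJ : forall i, J (jn i).
Variable k : C.
Implicit Types (u v : G -> C).
Local Notation A := (opA J fr a al k).
Local Notation h1 := (h1 J fr).
Local Notation supp := (supp J).

(** A coneigenvector. As the adjoint of A is conj A conj, u is a right singular vector with singular
    value s, normalised so that the left one is conj u. *)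
Definition takagi_vec (s : R) u := [/\ h1 u, n2 u = 1, 0 <= s & forall g, A u g = rc s * conjc (u g)].

Lemma h1_l2 u : h1 u -> l2 u. Proof. by case. Qed.

Lemma n2_lip (f g : G -> C) (e : R) : l2 f -> l2 g -> n2 f <= 1 -> 0 <= e ->
  n2 (fun t => f t - g t) <= e ^+ 2 -> n2 g <= n2 f + 2 * e + e ^+ 2.
Proof.
move=> lf lg f1 e0 h; have ld := l2B lf lg.
have -> : n2 g = n2 (fun t => f t + - (f t - g t)).
  by congr n2; apply/funext => t; ring.
rewrite n2D //; last exact: l2N.
rewrite n2N -!addrA lerD2l lerD // ler_pM2l //.
apply: le_trans (ler_norm _) _; apply: le_trans (ReE_le _) _.
rewrite -(@ler_pXn2r _ 2) ?nnegrE ?mod_ge0 //.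
apply: le_trans (cauchy_schwarz lf (l2_conj (l2N ld))) _.
by rewrite n2_conj n2N; have := n2_ge0 ld; have := n2_ge0 lf; nra.
Qed.

Lemma n2_limit (F : set_system nat) (FF : ProperFilter F) (x : nat -> G -> C) y :
  (forall i, l2 (x i)) -> (forall i, n2 (x i) = 1) -> l2 y ->
  (forall e, 0 < e -> F (fun i : nat => n2 (fun g => x i g - y g) <= e)) -> n2 y = 1.
Proof.
move=> lx x2 ly st.
have x2' i : n2 (x i) <= 1 by rewrite x2.
have y1 : n2 y <= 1.
  apply: eps_le => e e0; pose d := Num.min 1 (e / 3).
  have d0 : 0 < d by rewrite lt_min ltr01 divr_gt0.
  have [i /= hi] := filter_ex (st _ (exprn_gt0 2 d0)).
  have := n2_lip (lx i) ly (x2' i) (ltW d0) hi; rewrite x2.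
  have : d <= 1 by rewrite ge_min lexx.
  have : d <= e / 3 by rewrite ge_min lexx orbT.
  by nra.
apply/eqP; rewrite eq_le y1 /=; apply: eps_le => e e0; pose d := Num.min 1 (e / 3).
have d0 : 0 < d by rewrite lt_min ltr01 divr_gt0.
have [i /= hi] := filter_ex (st _ (exprn_gt0 2 d0)).
have hi' : n2 (fun g => y g - x i g) <= d ^+ 2.
  by rewrite -n2N; rewrite (_ : (fun t => - (y t - x i t)) = (fun g => x i g - y g)) //; apply/funext => g; ring.
have := n2_lip ly (lx i) y1 (ltW d0) hi'; rewrite x2.
have : d <= 1 by rewrite ge_min lexx.
have : d <= e / 3 by rewrite ge_min lexx orbT.
by nra.
Qed.

Lemma ip_le (f g : G -> C) : l2 f -> l2 g -> modulus (ip f g) ^+ 2 <= n2 f * n2 g.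
Proof. by move=> lf lg; rewrite -(n2_conj g); apply: cauchy_schwarz => //; exact: l2_conj. Qed.

Lemma bsum_fin (h : G -> R) (S : {fset G}) : (forall t, 0 <= h t) -> (forall t, t \notin S -> h t = 0) -> bsum h.
Proof.
move=> h0 hS; have : asum (fun t => rc (h t)) by apply: (@asum_fin _ _ _ S) => t /hS ->.
by move=> [B hB]; exists B => A; apply: le_trans (hB A); apply: rpsum_le => t; rewrite mod_rc ger0_norm.
Qed.

Lemma fin_h1 u (S : {fset G}) : supp u -> (forall t, t \notin S -> u t = 0) -> h1 u.
Proof.
move=> su hS; split=> //; apply: (@bsum_fin _ S) => // t /hS.
  by rewrite /sq => ->; rewrite mod0 expr0n.
by rewrite /sq => ->; rewrite mulr0 mod0 expr0n.
Qed.

(** n conditions on a combination of n + 1 deltas at the points [jn]: a left kernel vector of an (n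
    + 1) by n matrix gives the coefficients. This keeps the minimisation problem from being
    empty. *)
Lemma exists_orth (us : nat -> G -> C) n : exists phi : G -> C,
  [/\ h1 phi, n2 phi = 1 & forall i, (i < n)%N -> ip phi (us i) = 0].
Proof.
pose M : 'M[C]_(n.+1, n) := \matrix_(i, j) conjc (us j (jn i)).
have kM : kermx M != 0.
  rewrite -mxrank_eq0 mxrank_ker -lt0n subn_gt0 ltnS; exact: rank_leq_col.
have [i0 [j0 cij]] : exists i j, kermx M i j != 0.
  apply: contrapT => h; move: kM => /eqP; apply; apply/matrixP => i j; rewrite [RHS]mxE.
  by apply: contrapT => /eqP hij; apply: h; exists i, j.
pose c j := kermx M i0 j.
have cM (l : 'I_n) : \sum_j c j * conjc (us l (jn j)) = 0 :> C.
  have /matrixP/(_ i0 l) := mulmx_ker M; rewrite mxE [X in _ = X]mxE => E; rewrite -[RHS]E.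
  by apply: eq_bigr => j _; rewrite /c [M _ _]mxE.
pose psi g := \sum_(j < n.+1) (if g == jn j then c j else 0).
pose S := [fset jn (j : 'I_n.+1) | j in enum 'I_n.+1]%fset.
have pS g : g \notin S -> psi g = 0.
  move=> gS; rewrite /psi big1 // => j _; case: eqP => // gj.
  by case/negP: gS; apply/imfsetP; exists j => //=; rewrite mem_enum.
have hpsi : h1 psi.
  apply: (@fin_h1 _ S) => // g Jg; rewrite /psi big1 // => j _; case: eqP => // gj.
  by move: Jg; rewrite gj jnJ.
have lpsi := h1_l2 hpsi.
have pj0 : psi (jn j0) = c j0.
  rewrite /psi (bigD1 j0) //= eqxx big1 ?addr0 // => j jj0.
  by case: eqP => // /jnI /val_inj jE; rewrite -jE eqxx in jj0.
have npsi : 0 < n2 psi.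
  rewrite lt_def n2_ge0 // andbT; apply/eqP => /(n2_eq0 lpsi)/(_ (jn j0)); rewrite pj0 => c0.
  by move: cij; rewrite -/(c j0) c0 eqxx.
pose r := (Num.sqrt (n2 psi))^-1.
exists (fun g => rc r * psi g); split; first exact: h1Z.
  rewrite n2Z // mod_rc ger0_norm ?invr_ge0 ?sqrtr_ge0 // /r exprVn sqr_sqrtr ?n2_ge0 //.
  by rewrite mulVf // gt_eqF.
move=> i li; rewrite /ip.
have -> : (fun t => rc r * psi t * conjc (us i t)) = (fun t => \sum_(j < n.+1) (if t == jn j then rc r * c j * conjc (us i (jn j)) else 0)).
  apply/funext => t; rewrite /psi mulr_sumr mulr_suml; apply: eq_bigr => j _.
  by case: eqP => [->|_]; rewrite ?mulr0 ?mul0r.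
have aj (j : 'I_n.+1) : asum (fun t => if t == jn j then rc r * c j * conjc (us i (jn j)) else 0).
  by apply: (@asum_fin _ _ _ [fset jn j]%fset) => t; rewrite !inE => /negPf ->.
rewrite (csum_sum _ aj).1.
rewrite (eq_bigr (fun j : 'I_n.+1 => rc r * (c j * conjc (us i (jn j))))); last first.
  move=> j _; rewrite (@csum1 _ _ _ (jn j)); first by rewrite eqxx mulrA.
  by move=> t /negPf ->.
by rewrite -mulr_sumr (cM (Ordinal li)) mulr0.
Qed.

Lemma ipZr c (f g : G -> C) : l2 f -> l2 g -> ip f (fun t => c * g t) = conjc c * ip f g.
Proof.
move=> lf lg; rewrite /ip -csumZ; last exact: l2_ip.
by congr csum; apply/funext => t; rewrite conjcM; ring.
Qed.

Lemma ipDr (f g h : G -> C) : l2 f -> l2 g -> l2 h -> ip f (fun t => g t + h t) = ip f g + ip f h.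
Proof.
move=> lf lg lh; rewrite /ip -csumD; try exact: l2_ip.
by congr csum; apply/funext => t; rewrite conjcD; ring.
Qed.

Lemma tk_sym s u v : takagi_vec s u -> h1 v -> csum (fun g => A v g * u g) = rc s * ip v u.
Proof.
move=> [hu _ _ Au] hv; rewrite opA_sym // /ip -csumZ; last by apply: l2_ip; exact: h1_l2.
by congr csum; apply/funext => g; rewrite Au; ring.
Qed.

(** The test value t = - r / (|q| + 1) makes the expression negative unless r = 0. *)
Lemma quad_zero (r q : R) : (forall t : R, 0 <= 2 * t * r + t ^+ 2 * q) -> r = 0.
Proof.
move=> h; apply/eqP; apply/negPn/negP => r0.
pose Q := `|q| + 1; have Q0 : 0 < Q by rewrite ltr_pwDr.
have := h (- r / Q).
have -> : 2 * (- r / Q) * r + (- r / Q) ^+ 2 * q = (r / Q) ^+ 2 * (q - 2 * Q).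
  by field; rewrite gt_eqF.
have r2 : 0 < (r / Q) ^+ 2 by rewrite exprn_even_gt0 //= mulf_neq0 // invr_eq0 gt_eqF.
rewrite pmulr_rge0 // /Q; have := ler_norm q; have := normr_ge0 q; lra.
Qed.

Variables (us : nat -> G -> C) (ss : nat -> R) (n : nat).
Hypothesis us_tk : forall i, (i < n)%N -> takagi_vec (ss i) (us i).
Hypothesis us_orth : forall i j, (i < j < n)%N -> ip (us j) (us i) = 0.
Definition orth u := forall i, (i < n)%N -> ip u (us i) = 0.

(** The direct method: a minimising sequence is bounded in the graph norm, [compactness] gives a
    strong limit of norm 1, and [fatou_sq] applied to the images shows that the infimum is
    attained. *)
Lemma minimiser : exists y m, [/\ h1 y, n2 y = 1, orth y, n2 (A y) = m &
  forall phi, h1 phi -> orth phi -> m * n2 phi <= n2 (A phi)].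
Proof.
pose E : set R := fun r => exists u, [/\ h1 u, n2 u = 1, orth u & r = n2 (A u)].
have A0 u : h1 u -> 0 <= n2 (A u) by move=> hu; apply: n2_ge0; exact: opA_l2.
have iE : has_inf E.
  split; last by exists 0 => _ [u [hu _ _ ->]]; exact: A0.
  by have [phi [h1p n2p op]] := exists_orth us n; exists (n2 (A phi)), phi.
pose m := inf E.
have mE u : h1 u -> n2 u = 1 -> orth u -> m <= n2 (A u).
  by move=> hu nu ou; apply: inf_lbound; [exact: iE.2 | exists u].
have /choice[x hx] : forall i : nat, exists u, [/\ h1 u, n2 u = 1, orth u & n2 (A u) <= m + i.+1%:R^-1].
  move=> i; have i0 : 0 < i.+1%:R^-1 :> R by rewrite invr_gt0 ltr0n.
  have [_ [u [hu nu ou ->]] h] := inf_adherent i0 iE.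
  by exists u; split=> //; rewrite ltW.
have x1 i : h1 (x i) by case: (hx i).
have x2 i : n2 (x i) = 1 by case: (hx i).
have x2' i : n2 (x i) <= 1 by rewrite x2.
have x3 i : orth (x i) by case: (hx i).
have x4 i : n2 (A (x i)) <= m + i.+1%:R^-1 by case: (hx i).
have x4' i : n2 (A (x i)) <= m + 1.
  by apply: le_trans (x4 i) _; rewrite lerD2l invf_le1 ?ltr0n // ler1n.
pose B := 2 * (m + 1) + bndA a al k.
have xB i S : rpsum (sq (fun g => fr g * x i g)) S <= B.
  have [s l f] := x1 i.
  have [[_ _ lf] nf] := h1_of a_sum s l (opA_l2 al a_sum k (x1 i)).
  apply: le_trans (rpsum_rsum S (sq_ge0 _) lf) _; apply: le_trans nf _.
  by rewrite /B x2 mulr1 lerD2r ler_pM2l.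
have sx i : supp (x i) by case: (x1 i).
have [F [y [UF Finf hy cy st]]] := compactness fr_coer sx
   (fun i => h1_l2 (x1 i)) x2' xB.
have FF : ProperFilter F by case: UF.
have ly := h1_l2 hy; have lx i := h1_l2 (x1 i).
have ny : n2 y = 1 by exact: (n2_limit _ lx x2 ly st).
have oy : orth y.
  move=> i li; have [hu nu _ _] := us_tk li; have lu := h1_l2 hu.
  apply: eps_eq0 => e e0; have [j /= hj] := filter_ex (st _ (exprn_gt0 2 e0)).
  have -> : ip y (us i) = - ip (fun g => x j g - y g) (us i).
    have := ipDl (l2B (lx j) ly) ly lu.
    rewrite (_ : (fun t => x j t - y t + y t) = x j); last by apply/funext => t; ring.
    by rewrite (x3 j i li) => /eqP; rewrite eq_sym addr_eq0 => /eqP ->; rewrite opprK.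
  rewrite modN -(@ler_pXn2r _ 2) ?nnegrE ?mod_ge0 ?(ltW e0) //.
  by apply: le_trans (ip_le (l2B (lx j) ly) lu) _; rewrite nu mulr1.
have Ay S : rpsum (sq (A y)) S <= m.
  apply: (@fatou_sq _ _ _ F _ (fun i => A (x i)) _ (fun i => m + i.+1%:R^-1)).
  - by apply: opA_lim => // i; rewrite x2.
  - move=> i S'; apply: le_trans (x4 i); apply: rpsum_rsum => //.
    exact: opA_l2.
  - move=> e e0; have [N hN] : exists N : nat, N.+1%:R^-1 <= e :> R.
      exists (Num.bound e^-1); rewrite -[leRHS]invrK lef_pV2 ?posrE ?invr_gt0 ?ltr0n //.
      have ei : 0 <= e^-1 by rewrite invr_ge0 ltW.
      by apply/ltW/(lt_le_trans (archi_boundP ei)); rewrite ler_nat leqnSn.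
    apply: filterS (Finf N) => i /= Ni; rewrite lerD2l (le_trans _ hN) //.
    by rewrite lef_pV2 ?posrE ?ltr0n // ler_nat.
have nAy : n2 (A y) = m.
  by apply/eqP; rewrite eq_le mE // andbT; apply: rsum_le.
exists y, m; split=> // phi hp op.
have lp := h1_l2 hp.
have [z|p0] := eqVneq (n2 phi) 0; first by rewrite z mulr0 A0.
have p1 : 0 < n2 phi by rewrite lt_def p0 n2_ge0.
pose r := (Num.sqrt (n2 phi))^-1.
have r2 : modulus (rc r) ^+ 2 = (n2 phi)^-1.
  by rewrite mod_rc ger0_norm ?invr_ge0 ?sqrtr_ge0 // /r exprVn sqr_sqrtr ?ltW.
have := mE (fun g => rc r * phi g) (h1Z _ hp).
rewrite n2Z // r2 mulVf //.
rewrite (_ : A _ = (fun g => rc r * A phi g)); last by apply/funext => g; rewrite opAZ.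
rewrite n2Z; last exact: opA_l2.
rewrite r2 => /(_ erefl) h.
rewrite -ler_pdivlMr // mulrC; apply: h => i li.
have [hu _ _ _] := us_tk li.
by rewrite ipZl ?op ?mulr0 //; exact: h1_l2.
Qed.

(** The stationarity condition is wanted for all [psi], although the minimisation only ranges over
    vectors orthogonal to the earlier ones; the earlier directions are supplied by the symmetry of
    A. *)
Lemma euler_lagrange y m : h1 y -> n2 y = 1 -> orth y -> n2 (A y) = m ->
  (forall phi, h1 phi -> orth phi -> m * n2 phi <= n2 (A phi)) ->
  forall psi, h1 psi -> ip (A y) (A psi) = rc m * ip y psi.
Proof.
move=> hy ny oy nAy mn.
have ly := h1_l2 hy; have lAy := opA_l2 al a_sum k hy.
pose L psi := ip (A y) (A psi) - rc m * ip y psi.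
have lA u : h1 u -> l2 (A u) by exact: opA_l2.
have LZ c u : h1 u -> L (fun g => c * u g) = conjc c * L u.
  move=> hu; have lu := h1_l2 hu; rewrite /L ipZr //.
  rewrite (_ : A (fun g => c * u g) = (fun g => c * A u g)); last by apply/funext => g; rewrite opAZ.
  by rewrite ipZr //; [ring | exact: lA].
have LD u v : h1 u -> h1 v -> L (fun g => u g + v g) = L u + L v.
  move=> hu hv; have lu := h1_l2 hu; have lv := h1_l2 hv; rewrite /L ipDr //.
  rewrite (_ : A (fun g => u g + v g) = (fun g => A u g + A v g)); last by apply/funext => g; rewrite opAD.
  by rewrite ipDr //; [ring | exact: lA | exact: lA].
(* First variation along y + t u with t real: the quadratic in t is nonnegative, so its linear
   coefficient vanishes. *)
have LRe u : h1 u -> orth u -> complex.Re (L u) = 0.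
  move=> hu ou; have lu := h1_l2 hu.
  apply: (@quad_zero _ (n2 (A u) - m * n2 u)) => t.
  have ht := h1D hy (h1Z (rc t) hu).
  have ot : orth (fun g => y g + rc t * u g).
    move=> i li; have [hi _ _ _] := us_tk li; have li2 := h1_l2 hi.
    by rewrite ipDl // ?ipZl ?oy ?ou ?mulr0 ?addr0 //; exact: l2Z.
  have := mn _ ht ot.
  rewrite (_ : A (fun g => y g + rc t * u g) = (fun g => A y g + rc t * A u g)); last first.
    by apply/funext => g; rewrite opAD ?opAZ //; exact: l2Z.
  rewrite !n2D //; try by [exact: l2Z | apply: l2Z; exact: lA].
  rewrite !n2Z ?ipZr //; try exact: lA.
  rewrite nAy ny mod_rc real_normK ?num_real // /L.
  move: (ip (A y) (A u)) (ip y u) => [p q] [r s] /=.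
  by rewrite !mul0r !subr0 !oppr0 !mul0r !subr0; lra.
(* [L] is antilinear, so the real part at i u is, up to sign, the imaginary part at u. *)
have L0 u : h1 u -> orth u -> L u = 0.
  move=> hu ou; have h := LRe _ hu ou.
  have : complex.Re (L (fun g => iunit R * u g)) = 0.
    apply: LRe; first exact: h1Z.
    move=> i li; have [hi _ _ _] := us_tk li.
    by rewrite ipZl ?ou ?mulr0 //; exact: h1_l2.
  rewrite LZ //; move: (L u) h => [p q] /= ->; rewrite mulr0 sub0r mulN1r opprK => ->.
  by [].
(* Here A (us i) = s_i conj (us i), so the pairing with A y reduces by symmetry to s_i^2 times the
   inner product of y and us i, which is 0. *)
have Lus i : (i < n)%N -> L (us i) = 0.
  move=> li; have [hi ni si Ai] := us_tk li; have lui := h1_l2 hi.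
  rewrite /L oy // mulr0 subr0.
  rewrite (_ : A (us i) = (fun g => rc (ss i) * conjc (us i g))); last exact/funext.
  rewrite ipZr //; last exact: l2_conj.
  have := tk_sym (us_tk li) hy; rewrite oy // mulr0 /ip => E.
  by rewrite (_ : csum _ = 0) ?mulr0 // -[RHS]E; congr csum; apply/funext => g; rewrite conjcK.
(* Induction on the number of earlier vectors to which u need not be orthogonal: the component along
   [us j] is subtracted and [Lus] disposes of it. *)
have P j : (j <= n)%N -> forall u, h1 u -> (forall i, (j <= i < n)%N -> ip u (us i) = 0) -> L u = 0.
  elim: j => [_ u hu ou|j IH jn' u hu ou]; first by apply: L0 => // i li; exact: ou.
  have [hj nj sj Aj] := us_tk jn'; have luj := h1_l2 hj; have lu := h1_l2 hu.
  pose c := ip u (us j).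
  have hv : h1 (fun g => u g + (- c) * us j g) by apply: h1D => //; exact: h1Z.
  have : L (fun g => u g + (- c) * us j g) = 0.
    apply: IH => //; first exact: ltnW.
    move=> i /andP[ji li]; have [hi _ _ _] := us_tk li; have li2 := h1_l2 hi.
    rewrite ipDl // ?ipZl //; last exact: l2Z.
    move: ji; rewrite leq_eqVlt => /orP[/eqP ji|ji].
      by rewrite -ji ip_nn // nj /c mulr1 subrr.
    rewrite ou ?ji //; have -> : ip (us j) (us i) = 0.
      by rewrite ipC // us_orth ?ji ?li // conjc0.
    by rewrite mulr0 addr0.
  rewrite LD // ?LZ // ?Lus ?mulr0 ?addr0 //; exact: h1Z.
move=> psi hp; apply/eqP; rewrite -subr_eq0; apply/eqP; apply: (P n) => // i /andP[/leq_ltn_trans h /h].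
by rewrite ltnn.
Qed.

Lemma h1_delta g : J g -> h1 (fun t => if t == g then 1 else 0).
Proof.
move=> Jg; apply: (@fin_h1 _ [fset g]%fset) => t.
  by case: eqP => // ->; rewrite Jg.
by rewrite !inE => /negPf ->.
Qed.

(** With z = conj (A y) stationarity says A z = m conj y, so that A exchanges y and z up to
    conjugation. On the span of y and z a coneigenvector for s = sqrt m is then written down
    explicitly. *)
Lemma takagi_step : exists u s, [/\ takagi_vec s u, orth u &
  forall phi, h1 phi -> orth phi -> s ^+ 2 * n2 phi <= n2 (A phi)].
Proof.
have [y [m [hy ny oy nAy mn]]] := minimiser.
have EL := euler_lagrange hy ny oy nAy mn.
have ly := h1_l2 hy; have lAy := opA_l2 al a_sum k hy.
have m0 : 0 <= m by rewrite -nAy n2_ge0.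
pose s := Num.sqrt m; have s0 : 0 <= s by exact: sqrtr_ge0.
have s2 : s ^+ 2 = m by rewrite sqr_sqrtr.
pose z g := conjc (A y g).
have sz : supp z by move=> g Jg; rewrite /z opA_supp ?conjc0.
have lz : l2 z by exact: l2_conj.
have Az g : A z g = rc m * conjc (y g).
  case Jg: (J g); last first.
    by have [sy _ _] := hy; rewrite opA_supp ?sy ?Jg ?conjc0 ?mulr0.
  (* Testing against the delta at g reads off the coordinate g of A z. *)
  have := EL _ (h1_delta Jg).
  have -> : ip y (fun t => if t == g then 1 else 0) = y g.
    rewrite /ip (@csum1 _ _ _ g) ?eqxx ?conjc1 ?mulr1 // => t /negPf ->.
    by rewrite conjc0 mulr0.
  move=> E; have -> : rc m * conjc (y g) = conjc (rc m * y g) by rewrite conjcM conjc_real.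
  rewrite -E /ip -csum_conj; last by apply: l2_ip => //; apply: opA_l2 => //; exact: h1_delta.
  have D h : opA J fr a al k (fun t => if t == g then 1 else 0) h =
      if J h then (if h == g then fr g + k else 0) + al * a (h - g) else 0.
    rewrite /opA; case: (J h) => //; congr (_ + al * _).
      by case: eqP => [->|]; rewrite ?mulr1 ?mulr0.
    rewrite /conv (@csum1 _ _ _ g) ?eqxx ?mulr1 // => t /negPf ->; exact: mulr0.
  transitivity (csum (fun h => (if h == g then (fr g + k) * z h else 0) + al * (a (g - h) * z h))).
    rewrite csumD; last 2 first.
    - by apply: (@asum_fin _ _ _ [fset g]%fset) => t; rewrite !inE => /negPf ->.
    - by apply: asumZ; exact: asum_convl2.
    rewrite csumZ; last exact: asum_convl2.
    rewrite (@csum1 _ _ _ g); last by move=> t /negPf ->.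
    by rewrite eqxx /opA Jg.
  congr csum; apply/funext => h; rewrite D conjcM conjcK -/(z h).
  have [Jh|/sz ->] := boolP (J h); last by rewrite !mulr0; case: eqP; rewrite ?mulr0 addr0.
  by rewrite -(a_even (g - h)) opprB; case: eqP => [->|_]; ring.
have hz : h1 z.
  apply: (h1_of (al := al) (k := k) a_sum sz lz _).1.
  by apply: bsum_le (l2Z (rc m) (l2_conj ly)) => g; rewrite /sq Az.
have oz : orth z.
  move=> i li; have [hi _ _ _] := us_tk li.
  have := tk_sym (us_tk li) hy; rewrite oy // mulr0 => E.
  have : conjc (csum (fun g => A y g * us i g)) = 0 by rewrite E conjc0.
  rewrite -csum_conj; last by apply: l2_mul => //; exact: h1_l2.
  by move=> <-; congr csum; apply/funext => g; rewrite conjcM.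
have fin u : h1 u -> n2 u = 1 -> orth u -> (forall g, A u g = rc s * conjc (u g)) ->
    exists u s, [/\ takagi_vec s u, orth u & forall phi, h1 phi -> orth phi -> s ^+ 2 * n2 phi <= n2 (A phi)].
  by move=> hu nu ou Au; exists u, s; rewrite s2.
(* A w = s^2 conj y + s conj z = s conj w, so w works after normalisation unless it vanishes. *)
pose w g := z g + rc s * y g.
have hw : h1 w by apply: h1D => //; exact: h1Z.
have lw := h1_l2 hw.
have ow : orth w.
  move=> i li; have [hi _ _ _] := us_tk li; have lui := h1_l2 hi.
  by rewrite ipDl // ?ipZl ?oz ?oy ?mulr0 ?addr0 //; exact: l2Z.
have Aw g : A w g = rc s * conjc (w g).
  rewrite opAD //; last exact: l2Z.
  rewrite opAZ // Az conjcD conjcM conjc_real -s2 /z conjcK expr2 rcM; ring.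
(* If w = 0 then A y = - s conj y, and multiplication by i turns the sign around because conj is
   antilinear. *)
have [w0|w0] := eqVneq (n2 w) 0.
  have zE g : A y g = - rc s * conjc (y g).
    have := n2_eq0 lw w0 g; rewrite /w => /eqP; rewrite addr_eq0 => /eqP zg.
    by rewrite -[A y g]conjcK -/(z g) zg (rmorphN (@conjc R)) /= conjcM conjc_real mulNr.
  apply: (fin (fun g => iunit R * y g)); first exact: h1Z.
  - rewrite n2Z // ny mulr1 mod_sq /= ; ring.
  - by move=> i li; have [hi _ _ _] := us_tk li; rewrite ipZl ?oy ?mulr0 //; exact: h1_l2.
  - move=> g; rewrite opAZ // zE conjcM (_ : conjc (iunit R) = - iunit R); first by ring.
    by apply/eqP; rewrite eq_complex /= oppr0 !eqxx.
have w1 : 0 < n2 w by rewrite lt_def w0 n2_ge0.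
pose r := (Num.sqrt (n2 w))^-1.
apply: (fin (fun g => rc r * w g)); first exact: h1Z.
- rewrite n2Z // mod_rc ger0_norm ?invr_ge0 ?sqrtr_ge0 // /r exprVn sqr_sqrtr ?n2_ge0 //.
  by rewrite mulVf.
- by move=> i li; have [hi _ _ _] := us_tk li; rewrite ipZl ?ow ?mulr0 //; exact: h1_l2.
- by move=> g; rewrite opAZ // Aw conjcM conjc_real; ring.
Qed.
End Takagi.

Lemma conjcN (R : realType) (z : R[i]) : conjc (- z) = - conjc z.
Proof. exact: rmorphN. Qed.

Section TakagiSeq.
Variables (R : realType) (G : zmodType).
Local Notation C := R[i].
Variables (J : G -> bool) (fr a : G -> C) (al : C).
Hypothesis fr_coer : forall M : R, exists S : {fset G}, forall g, g \notin S -> M <= modulus (fr g).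
Hypothesis a_even : forall g, a (- g) = a g.
Hypothesis a_sum : asum a.
Variable jn : nat -> G.
Hypothesis jnI : injective jn.
Hypothesis jnJ : forall i, J (jn i).
Variable k : C.
Local Notation A := (opA J fr a al k).
Local Notation h1 := (h1 J fr).
Local Notation takagi_vec := (takagi_vec J fr a al k).

Definition takagi_basis (U : nat -> G -> C) (s : nat -> R) := forall n,
  [/\ takagi_vec (s n) (U n), orth U n (U n) &
      forall phi, h1 phi -> orth U n phi -> s n ^+ 2 * n2 phi <= n2 (A phi)].

(** Each step depends on all earlier vectors. The recursion therefore runs over lists of pairs, a
    chosen extension preserves validity of the list, and the sequence is read off the diagonal. *)
Lemma takagi_basis_exists : exists U s, takagi_basis U s.
Proof.
pose d : (G -> C) * R := (fun=> 0, 0).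
pose u (l : seq ((G -> C) * R)) i := (nth d l i).1.
pose good l i := [/\ takagi_vec (nth d l i).2 (u l i), orth (u l) i (u l i) &
  forall phi, h1 phi -> orth (u l) i phi -> (nth d l i).2 ^+ 2 * n2 phi <= n2 (A phi)].
pose valid l := forall i, (i < size l)%N -> good l i.
have prefix l p i : (i < size l)%N -> nth d (rcons l p) i = nth d l i.
  by move=> il; rewrite nth_rcons il.
have ortho l m i v : (forall j, (j < i)%N -> nth d m j = nth d l j) -> orth (u m) i v <-> orth (u l) i v.
  by move=> h; split=> H j ji; have := H j ji; rewrite /u h.
have goodE l m i : (forall j, (j <= i)%N -> nth d m j = nth d l j) -> good l i -> good m i.
  move=> h; have h' j : (j < i)%N -> nth d m j = nth d l j by move=> /ltnW; exact: h.
  move=> [g1 g2 g3]; rewrite /good /u h //; split=> //.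
    by apply/(ortho _ _ _ _ h').
  by move=> phi hp /(ortho _ _ _ _ h'); exact: g3.
have ext l : exists p, valid l -> valid (rcons l p).
  case: (pselect (valid l)) => [vl|nv]; last by exists d.
  have [|i j /andP[ij jl]|v [s [tv ov mv]]] :=
    @takagi_step _ _ J fr a al fr_coer a_even a_sum jn jnI jnJ k (u l) (fun i => (nth d l i).2) (size l).
  - by move=> i /vl[].
  - by have [_ o _] := vl j jl; exact: o.
  exists (v, s) => _ i; rewrite size_rcons ltnS leq_eqVlt => /orP[/eqP ->|il].
    have h j : (j < size l)%N -> nth d (rcons l (v, s)) j = nth d l j by exact: prefix.
    rewrite /good /u nth_rcons ltnn eqxx /=; split=> //.
      by apply/(ortho _ _ _ _ h).
    by move=> phi hp /(ortho _ _ _ _ h); exact: mv.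
  apply: goodE (vl i il) => j ji; apply: prefix; exact: leq_ltn_trans il.
have /choice[f hf] := ext.
pose L n := iter n (fun l => rcons l (f l)) [::].
have sL n : size (L n) = n by elim: n => //= n IH; rewrite size_rcons IH.
have vL n : valid (L n) by elim: n => //= n IH; exact: hf.
have pL n i : (i < n)%N -> nth d (L n) i = nth d (L i.+1) i.
  elim: n => // n IH; rewrite ltnS leq_eqVlt => /orP[/eqP -> //|li].
  by rewrite /= -/(L n) prefix ?sL ?IH.
exists (fun n => (nth d (L n.+1) n).1), (fun n => (nth d (L n.+1) n).2) => n.
have [g1 g2 g3] := vL n.+1 n (eq_ind_r (fun m => n < m)%N (ltnSn n) (sL n.+1)).
split=> //.
  by move=> i li; have := g2 i li; rewrite /u (pL n.+1 i) // ltnW.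
move=> phi hp op; apply: g3 => // i li.
by have := op i li; rewrite /u (pL n.+1 i) // ltnW.
Qed.

Variables (U : nat -> G -> C) (s : nat -> R).
Hypothesis tb : takagi_basis U s.

Lemma tb_tk n : takagi_vec (s n) (U n). Proof. by case: (tb n). Qed.

Lemma tb_h1 n : h1 (U n). Proof. by case: (tb_tk n). Qed.

Lemma tb_l2 n : l2 (U n). Proof. exact: h1_l2 (tb_h1 n). Qed.

Lemma tb_s0 n : 0 <= s n. Proof. by case: (tb_tk n). Qed.

Lemma tb_eq n g : A (U n) g = rc (s n) * conjc (U n g). Proof. by case: (tb_tk n). Qed.

Lemma tb_ip n m : ip (U n) (U m) = if n == m then 1 else 0.
Proof.
case: (ltngtP n m) => [nm|mn|<-].
- by rewrite (ipC (tb_l2 m) (tb_l2 n)); have [_ o _] := tb m; rewrite o // conjc0.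
- by have [_ o _] := tb n; rewrite o.
- by have [_ nn _ _] := tb_tk n; rewrite ip_nn ?nn //; exact: tb_l2.
Qed.

Lemma tb_n2A n : n2 (A (U n)) = s n ^+ 2.
Proof.
have [_ nn s0 E] := tb_tk n.
rewrite (_ : A (U n) = (fun g => rc (s n) * conjc (U n g))); last exact/funext.
by rewrite n2Z ?n2_conj ?nn ?mulr1 ?mod_rc ?ger0_norm //; apply: l2_conj; exact: tb_l2.
Qed.

Lemma tb_mono n m : (n <= m)%N -> s n <= s m.
Proof.
move=> nm; rewrite -(@ler_pXn2r _ 2) ?nnegrE ?tb_s0 // -[leRHS]tb_n2A.
have [_ _ mn] := tb n; have [_ nn _ _] := tb_tk m.
have := mn _ (tb_h1 m); rewrite nn mulr1; apply => i li.
by have [_ o _] := tb m; apply: o; exact: leq_trans nm.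
Qed.

(** Otherwise the basis would be bounded in the graph norm, while distinct orthonormal vectors have
    squared distance 2 > 1, against [no_sep]. *)
Lemma tb_unbounded (M : R) : exists n, M < s n.
Proof.
apply: contrapT => /forallNP h.
have sM n : s n <= `|M|.
  by rewrite (le_trans _ (ler_norm M)) // leNgt; apply/negP/h.
have [n [m [nm]]] : exists n m, (n < m)%N /\ n2 (fun g => U m g - U n g) <= 1.
  apply: (@no_sep _ _ J fr fr_coer U (2 * `|M| ^+ 2 + bndA a al k)) => //.
  - by move=> n; case: (tb_h1 n).
  - exact: tb_l2.
  - by move=> n; have [_ -> _ _] := tb_tk n.
  - move=> n S; have [su lu lf] := tb_h1 n; have [_ nn _ _] := tb_tk n.
    have [_] := h1_of a_sum su lu (opA_l2 al a_sum k (tb_h1 n)).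
    rewrite tb_n2A nn mulr1 => h1'; apply: le_trans (rpsum_rsum S (sq_ge0 _) lf) _.
    apply: le_trans h1' _; rewrite lerD2r ler_pM2l // ler_pXn2r ?nnegrE ?tb_s0 //.
have [_ nn _ _] := tb_tk n; have [_ nm' _ _] := tb_tk m.
rewrite n2D ?n2N ?nn ?nm'; [|exact: tb_l2|by apply: l2N; exact: tb_l2].
rewrite (_ : ip (U m) (fun t => - U n t) = 0); first by rewrite mulr0 addr0; lra.
rewrite (_ : (fun t => - U n t) = (fun t => (-1) * U n t)); last by apply/funext => t; rewrite mulN1r.
by rewrite ipZr ?tb_ip ?gtn_eqF ?mulr0 //; exact: tb_l2.
Qed.

(** The labels n + 1 and - (n + 1) both belong to Takagi vector number n, hence the predecessor. *)
Definition bidx (j : int) : nat := (absz j).-1.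
Definition bsgn (j : int) : C := if (0 < j)%R then 1 else -1.
(* The bands are labelled by nonzero integers; label 0 is junk. *)
Definition band_label (j : int) : R :=
  if j == 0 then 0 else if (0 < j)%R then s (bidx j) else - s (bidx j).
(** [wx] and [wy] are the two halves of the eigenvector of H_k with label j: (u, conj u) for
    positive labels and (u, - conj u) for negative ones. *)
Definition wx (j : int) := U (bidx j).
Definition wy (j : int) g := bsgn j * conjc (U (bidx j) g).

(** The eigenvalue equation of H_k for (x, y); its upper row, which contains the adjoint of A, is
    conjugated so that only A occurs. *)
Definition eigenpair (l : R) (x y : G -> C) := [/\ h1 x, h1 y,
  forall g, A x g = rc l * y g & forall g, A (fun t => conjc (y t)) g = rc l * conjc (x g)].

Lemma bsgn_conj j : conjc (bsgn j) = bsgn j.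
Proof. by rewrite /bsgn; case: ifP => _; rewrite ?conjc1 // conjcN conjc1. Qed.

Lemma bsgn_sq j : bsgn j * bsgn j = 1.
Proof. by rewrite /bsgn; case: ifP => _; rewrite ?mulr1 // mulrNN mulr1. Qed.

Lemma blabE j : j != 0 -> rc (band_label j) = bsgn j * rc (s (bidx j)).
Proof.
rewrite /band_label /bsgn => /negPf ->; case: ifP => _; rewrite ?mul1r // mulN1r.
exact: (rmorphN (real_complex R)).
Qed.

Lemma h1_wy j : h1 (wy j).
Proof. by apply: h1Z; apply: h1_conj; exact: tb_h1. Qed.

Lemma eigp_w j : j != 0 -> eigenpair (band_label j) (wx j) (wy j).
Proof.
move=> j0; split; [exact: tb_h1 | exact: h1_wy | |] => g; rewrite blabE //.
  by rewrite tb_eq /wy mulrACA -expr2 expr2 mulrA bsgn_sq mul1r.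
rewrite (_ : (fun t => conjc (wy j t)) = (fun t => bsgn j * U (bidx j) t)).
  by rewrite opAZ ?tb_eq ?mulrA //; exact: tb_l2.
by apply/funext => t; rewrite /wy conjcM conjcK bsgn_conj.
Qed.

Definition wpair (x y : G -> C) (j : int) : C := ip x (wx j) + ip y (wy j).
Lemma wy_l2 j : l2 (wy j). Proof. exact: h1_l2 (h1_wy j). Qed.

(** The squared norm is 2, one from each half. Opposite labels share a Takagi vector, and the
    contributions of their halves cancel through the opposite signs. *)
Lemma wpair_w i j : i != 0 -> j != 0 -> wpair (wx i) (wy i) j = if i == j then 2 else 0.
Proof.
move=> i0 j0; rewrite /wpair /wx tb_ip /wy.
rewrite ipZr; [|by apply: wy_l2|by apply: l2_conj; exact: tb_l2].
rewrite ipZl; try by apply: l2_conj; exact: tb_l2.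
have -> : ip (fun t => conjc (U (bidx i) t)) (fun t => conjc (U (bidx j) t)) = conjc (ip (U (bidx i)) (U (bidx j))).
  rewrite /ip -csum_conj; last by apply: l2_ip; exact: tb_l2.
  by congr csum; apply/funext => t; rewrite conjcM.
rewrite tb_ip bsgn_conj.
have [<-|ij] := eqVneq i j; first by rewrite eqxx conjc1 mulr1 bsgn_sq.
case: eqP => [e|_]; last by rewrite conjc0 !mulr0 addr0.
rewrite conjc1 mulr1.
suff -> : bsgn j * bsgn i = -1 by rewrite subrr.
move: i0 j0 ij e; rewrite /bsgn /bidx; case: i => [[|i]|i]; case: j => [[|j]|j] //= _ _.
  by move=> /eqP ij e; case: ij; rewrite e.
- by rewrite mulN1r.
- by rewrite mul1r.
by move=> /eqP ij e; case: ij; rewrite e.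
Qed.

Lemma ip_suml (I : Type) (r : seq I) (c : I -> C) (f : I -> G -> C) (g : G -> C) :
  (forall i, l2 (f i)) -> l2 g ->
  l2 (fun t => \sum_(i <- r) c i * f i t) /\
  ip (fun t => \sum_(i <- r) c i * f i t) g = \sum_(i <- r) c i * ip (f i) g.
Proof.
move=> lf lg; elim: r => [|i r [IH1 IH2]].
  rewrite (_ : (fun t => _) = fun=> 0); last by apply/funext => t; rewrite big_nil.
  split; first by apply: (@bsum_fin _ _ _ fset0) => // t _; rewrite /sq mod0 expr0n.
  by rewrite big_nil /ip csum0 // => t; rewrite mul0r.
rewrite (_ : (fun t => _) = fun t => c i * f i t + \sum_(i <- r) c i * f i t).
  split; first by apply: l2D => //; exact: l2Z.
  by rewrite ipDl // ?ipZl ?IH2 ?big_cons //; exact: l2Z.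
by apply/funext => t; rewrite big_cons.
Qed.

(** With p and q the pairings of x and y with the Takagi vector, symmetry gives l q = s p and l p =
    s q. So p + q and p - q are multiplied by l and by s or - s at the same time. *)
Lemma eigp_orth l x y j : eigenpair l x y -> j != 0 -> band_label j != l -> wpair x y j = 0.
Proof.
move=> [hx hy Ax Ay] j0 jl; have lx := h1_l2 hx; have ly := h1_l2 hy.
pose p := ip x (U (bidx j)); pose q := csum (fun g => y g * U (bidx j) g).
have E1 : rc l * q = rc (s (bidx j)) * p.
  rewrite -(tk_sym a_even a_sum (tb_tk _) hx) -csumZ; last by apply: l2_mul => //; exact: tb_l2.
  by congr csum; apply/funext => g; rewrite Ax mulrA.
have E2 : rc l * p = rc (s (bidx j)) * q.
  have hcy := h1_conj hy.
  have := tk_sym a_even a_sum (tb_tk (bidx j)) hcy.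
  have -> : ip (fun g => conjc (y g)) (U (bidx j)) = conjc q.
    rewrite /q -csum_conj; last by apply: l2_mul => //; exact: tb_l2.
    by congr csum; apply/funext => t; rewrite conjcM.
  have -> : csum (fun g => A (fun t => conjc (y t)) g * U (bidx j) g) = rc l * conjc p.
    rewrite /p /ip -csum_conj; last by apply: l2_ip => //; exact: tb_l2.
    rewrite -csumZ; last by apply: asum_conj; apply: l2_ip => //; exact: tb_l2.
    by congr csum; apply/funext => g; rewrite Ay conjcM conjcK mulrA.
  by move=> /(congr1 conjc); rewrite !conjcM !conjcK !conjc_real.
have wE : wpair x y j = p + bsgn j * q.
  rewrite /wpair -/p; congr (_ + _).
  rewrite /wy ipZr; [|exact: ly|by apply: l2_conj; exact: tb_l2].
  by rewrite bsgn_conj /q /ip; congr (_ * csum _); apply/funext => t; rewrite conjcK.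
have : rc l * wpair x y j = rc (band_label j) * wpair x y j.
  have e := bsgn_sq j; rewrite blabE // wE mulrDr E2 [rc l * _]mulrCA E1.
  rewrite mulrDr [X in _ = _ + X](_ : _ = rc (s (bidx j)) * q * (bsgn j * bsgn j)); last by ring.
  by rewrite e; ring.
move/eqP; rewrite -subr_eq0 -mulrBl mulf_eq0 -rcB => /orP[/eqP h|/eqP //].
by move: jl; have := congr1 (@complex.Re R) h => /= /eqP; rewrite subr_eq0 eq_sym => ->.
Qed.

Lemma opA_sum (I : Type) (r : seq I) (c : I -> C) (f : I -> G -> C) g :
  (forall i, h1 (f i)) -> h1 (fun t => \sum_(i <- r) c i * f i t) /\
  A (fun t => \sum_(i <- r) c i * f i t) g = \sum_(i <- r) c i * A (f i) g.
Proof.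
move=> hf; elim: r => [|i r [IH1 IH2]].
  rewrite (_ : (fun t => _) = fun t => 0 * (fun=> 0) t); last by apply/funext => t; rewrite big_nil mul0r.
  have h0 : h1 (fun=> 0) by apply: (@fin_h1 _ _ _ _ _ fset0).
  split; first exact: h1Z.
  by rewrite opAZ ?big_nil ?mul0r //; exact: h1_l2 h0.
rewrite (_ : (fun t => _) = fun t => c i * f i t + \sum_(i <- r) c i * f i t).
  split; first by apply: h1D => //; exact: h1Z.
  have l1 := h1_l2 (hf i); have l3 := h1_l2 IH1.
  by rewrite opAD ?opAZ ?IH2 ?big_cons //; exact: l2Z.
by apply/funext => t; rewrite big_cons.
Qed.

(** Subtract the projection on the listed labels. The remainder is again an eigenpair for l and is
    orthogonal to all [wx], [wy]; the division by 2 in [c] undoes the norm of these vectors. *)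
Lemma eigp_span l x y (js : seq int) : eigenpair l x y -> uniq js ->
  (forall j, j \in js <-> (j != 0 /\ band_label j = l)) ->
  let c j := wpair x y j / 2 in
  (forall g, x g = \sum_(j <- js) c j * wx j g) /\ (forall g, y g = \sum_(j <- js) c j * wy j g).
Proof.
move=> [hx hy Ax Ay] ujs jsP c.
have lx := h1_l2 hx; have ly := h1_l2 hy.
pose X t := \sum_(j <- js) c j * wx j t; pose Y t := \sum_(j <- js) c j * wy j t.
have hX : h1 X by have [] := opA_sum js c 0 (fun j => tb_h1 (bidx j)).
have hY : h1 Y by have [] := opA_sum js c 0 h1_wy.
pose x' t := x t + (-1) * X t; pose y' t := y t + (-1) * Y t.
have hx' : h1 x' by apply: h1D => //; exact: h1Z.
have hy' : h1 y' by apply: h1D => //; exact: h1Z.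
have lX := h1_l2 hX; have lY := h1_l2 hY; have lx' := h1_l2 hx'; have ly' := h1_l2 hy'.
have wX j : j != 0 -> wpair X Y j = if j \in js then 2 * c j else 0.
  move=> j0; rewrite /wpair.
  have [_ ->] := ip_suml js c (fun j => tb_l2 (bidx j)) (tb_l2 (bidx j)).
  have [_ ->] := ip_suml js c wy_l2 (wy_l2 j).
  rewrite -big_split /= (eq_big_seq (fun i => c i * (if i == j then 2 else 0))); last first.
    move=> i /jsP[i0 _]; rewrite -wpair_w // /wpair mulrDr; by [].
  case: ifP => jj; last first.
    by rewrite big1_seq // => i /andP[_ ijs]; case: eqP => [e|]; rewrite ?mulr0 //; rewrite -e ijs in jj.
  rewrite (bigD1_seq j) //= eqxx big1 ?addr0 1?mulrC // => i /negPf ->; exact: mulr0.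
have w' j : j != 0 -> wpair x' y' j = 0.
  move=> j0; rewrite /wpair /x' /y' !ipDl ?ipZl //; try by [exact: l2Z | exact: tb_l2 | exact: wy_l2].
  have -> : ip x (wx j) + -1 * ip X (wx j) + (ip y (wy j) + -1 * ip Y (wy j)) = wpair x y j - wpair X Y j.
    by rewrite /wpair; ring.
  rewrite wX //; case: ifPn => jj.
    by rewrite /c mulrC divfK ?subrr // pnatr_eq0.
  rewrite subr0; apply: (@eigp_orth l) => //; apply: contra jj => /eqP e; exact/jsP.
have A' : (forall g, A x' g = rc l * y' g) /\ (forall g, A (fun t => conjc (y' t)) g = rc l * conjc (x' g)).
  have lwx j : l2 (wx j) by exact: tb_l2.
  have AX g : A X g = rc l * Y g.
    have [_ ->] := opA_sum js c g (fun j => tb_h1 (bidx j)).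
    rewrite /Y mulr_sumr; apply: eq_big_seq => j /jsP[j0 <-].
    by have [_ _ E _] := eigp_w j0; rewrite -[U _]/(wx j) E mulrCA.
  have AY g : A (fun t => conjc (Y t)) g = rc l * conjc (X g).
    have -> : (fun t => conjc (Y t)) = (fun t => \sum_(j <- js) conjc (c j) * conjc (wy j t)).
      by apply/funext => t; rewrite conjc_sum; apply: eq_bigr => j _; rewrite conjcM.
    have [_ ->] := opA_sum js (fun j => conjc (c j)) g (fun j => h1_conj (h1_wy j)).
    rewrite conjc_sum mulr_sumr; apply: eq_big_seq => j /jsP[j0 <-].
    by have [_ _ _ E] := eigp_w j0; rewrite E mulrCA [in RHS]conjcM.
  split=> g; rewrite /x' /y'.
    by rewrite opAD ?opAZ ?Ax ?AX //; [ring | exact: l2Z].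
  rewrite (_ : (fun t => conjc (y t + _)) = fun t => conjc (y t) + (-1) * conjc (Y t)); last first.
    by apply/funext => t; rewrite conjcD conjcM conjcN conjc1.
  rewrite opAD ?opAZ ?Ay ?AY; try by [exact: l2_conj | apply: l2Z; exact: l2_conj | exact: a_sum].
  by rewrite conjcD conjcM conjcN conjc1; ring.
(* The labels m + 1 and - (m + 1) give the sum and the difference of the two pairings, so both
   vanish. *)
have pq m : ip x' (U m) = 0 /\ csum (fun g => y' g * U m g) = 0.
  have e1 := w' m.+1%:Z isT; have e2 := w' (- m.+1%:Z) isT.
  have q j : bidx j = m -> wpair x' y' j = ip x' (U m) + bsgn j * csum (fun g => y' g * U m g).
    move=> jm; rewrite /wpair /wx jm /wy jm; congr (_ + _).
    rewrite ipZr; [|by []|by apply: l2_conj; exact: tb_l2].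
    by rewrite bsgn_conj /ip; congr (_ * csum _); apply/funext => t; rewrite conjcK.
  rewrite q // /bsgn /= mul1r in e1; rewrite q // /bsgn /= mulN1r in e2.
  have e3 : 2 * ip x' (U m) = 0 by rewrite -[RHS](addr0 0) -{1}e1 -e2; ring.
  have p0 : ip x' (U m) = 0 by apply/eqP; move/eqP: e3; rewrite mulf_eq0 pnatr_eq0.
  by split=> //; rewrite p0 add0r in e1.
have [A1 A2] := A'.
(* On vectors orthogonal to the first N Takagi vectors A expands by at least s_N > |l|, whereas the
   equations expand x' and y' in total by |l|; hence both are 0. *)
have [N hN] := tb_unbounded `|l|.
have [_ _ mn] := tb N.
have m1 := mn _ hx' (fun i _ => (pq i).1).
have oy' : orth U N (fun t => conjc (y' t)).
  move=> i _; rewrite /ip.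
  have -> : (fun t => conjc (y' t) * conjc (U i t)) = (fun t => conjc (y' t * U i t)).
    by apply/funext => t; rewrite conjcM.
  rewrite csum_conj ?(pq i).2 ?conjc0 //; apply: l2_mul => //; exact: tb_l2.
have m2 := mn _ (h1_conj hy') oy'.
rewrite (_ : A x' = fun g => rc l * y' g) in m1; last exact/funext.
rewrite (_ : A (fun t => conjc (y' t)) = fun g => rc l * conjc (x' g)) in m2; last exact/funext.
rewrite n2Z // mod_rc in m1; rewrite n2Z ?n2_conj ?mod_rc in m2; last exact: l2_conj.
have d0 : 0 < s N ^+ 2 - `|l| ^+ 2.
  by rewrite subr_gt0 ltr_pXn2r ?nnegrE ?tb_s0.
have nx := n2_ge0 lx'; have ny := n2_ge0 ly'.
have n0 : n2 x' = 0 /\ n2 y' = 0.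
  have : (s N ^+ 2 - `|l| ^+ 2) * (n2 x' + n2 y') <= 0 by nra.
  by rewrite pmulr_rle0 // => h; split; lra.
split=> g; apply/eqP; rewrite -subr_eq0; apply/eqP.
  by rewrite -[RHS](n2_eq0 lx' n0.1 g) /x' /X; ring.
by rewrite -[RHS](n2_eq0 ly' n0.2 g) /y' /Y; ring.
Qed.
End TakagiSeq.

(** * Regularity, protected states and the conical expansion *)

Section Regularity.
Variables (R : realType) (G : zmodType).
Local Notation C := R[i].
Variables (J : G -> bool) (fr a : G -> C) (al : C).
Hypothesis frD : forall g h, fr (g + h) = fr g + fr h.
Definition wt (g : G) : R := 1 + modulus (fr g).
Hypothesis a_w : forall n, asum (fun g => rc (wt g ^+ n) * a g).

Lemma wt_ge1 g : 1 <= wt g. Proof. by rewrite lerDl mod_ge0. Qed.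

Lemma wt_gt0 g : 0 < wt g. Proof. exact: lt_le_trans ltr01 (wt_ge1 g). Qed.

(** Submultiplicativity lets a power of the weight be distributed over the two factors of a
    convolution. *)
Lemma wt_sub g h : wt g <= wt (g - h) * wt h.
Proof.
rewrite /wt; have := modD (fr (g - h)) (fr h); rewrite -frD subrK.
have := mulr_ge0 (mod_ge0 (fr (g - h))) (mod_ge0 (fr h)); lra.
Qed.

(** The Sobolev space of order n on the Fourier side. *)
Definition wl2 n (u : G -> C) := l2 (fun g => rc (wt g ^+ n) * u g).

Lemma wl2_le n u v : (forall g, modulus (u g) <= modulus (v g)) -> wl2 n v -> wl2 n u.
Proof.
move=> h lv; apply: (n2_mono lv _).1 => g.
by rewrite !modM ler_wpM2l ?mod_ge0.
Qed.

Lemma wl2D n u v : wl2 n u -> wl2 n v -> wl2 n (fun g => u g + v g).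
Proof. by move=> lu lv; apply: bsum_le (l2D lu lv) => g; rewrite /sq mulrDr. Qed.

Lemma wl2Z n c u : wl2 n u -> wl2 n (fun g => c * u g).
Proof. by move=> lu; apply: bsum_le (l2Z c lu) => g; rewrite /sq mulrCA. Qed.

Lemma wl2_conv n u : wl2 n u -> wl2 n (conv a u).
Proof.
move=> lu; pose b g := rc (modulus (rc (wt g ^+ n) * a g)); pose v g := rc (modulus (rc (wt g ^+ n) * u g)).
have ab : asum b by apply: asum_le (a_w n) => g; rewrite mod_rc ger0_norm ?mod_ge0.
have lv : l2 v by apply: bsum_le lu => g; rewrite /sq mod_rc ger0_norm ?mod_ge0.
have [lc _] := conv_l2 ab lv.
apply: (n2_mono lc _).1 => g.
have cE : conv b v g = rc (rsum (fun g' => modulus (b (g - g') * v g'))).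
  rewrite -rsumE; last 2 first.
  - by move=> t; exact: mod_ge0.
  - exact: asum_convl2.
  congr csum; apply/funext => g'; rewrite modM rcM /b /v !mod_rc !ger0_norm ?mod_ge0 //.
rewrite cE mod_rc (le_trans _ (ler_norm _)) //.
have wn0 h : 0 <= wt h ^+ n by rewrite exprn_ge0 // ltW // wt_gt0.
have w1 : 1 <= wt g ^+ n by rewrite exprn_ege1 // wt_ge1.
have abv : asum (fun g' => b (g - g') * v g') by exact: asum_convl2.
have tb g' : modulus (rc (wt g ^+ n) * (a (g - g') * u g')) <= modulus (b (g - g') * v g').
  have mb h (q : G -> C) : modulus (rc (modulus (rc (wt h ^+ n) * q h))) = wt h ^+ n * modulus (q h).
    by rewrite mod_rc ger0_norm ?mod_ge0 // modM mod_rc ger0_norm.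
  rewrite modM mod_rc ger0_norm // !modM !mb mulrACA ler_wpM2r ?mulr_ge0 ?mod_ge0 //.
  by rewrite -exprMn; apply: lerXn2r; rewrite ?nnegrE ?mulr_ge0 ?(ltW (wt_gt0 _)) // wt_sub.
have aau : asum (fun g' => a (g - g') * u g').
  apply: asum_le abv => g'; apply: le_trans (tb g'); rewrite [leRHS]modM mod_rc ger0_norm //.
  by rewrite ler_peMl ?mod_ge0.
rewrite /conv -csumZ // (le_trans (mod_csum (asumZ _ aau))) //.
apply: rsum_le => [t|S]; first exact: mod_ge0.
apply: le_trans (rpsum_le _ tb) _; apply: rpsum_rsum => // t; exact: mod_ge0.
Qed.

(** Bootstrap: [fr * u] equals A u minus terms that are already in the space of order n, and A u is
    dominated by v. *)
Lemma regular_step n k M u v : supp J u -> wl2 n u -> wl2 n v -> 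
  (forall g, modulus (opA J fr a al k u g) <= M * modulus (v g)) -> wl2 n.+1 u.
Proof.
move=> su lu lv h.
have l3 : wl2 n (fun g => fr g * u g).
  have lA : wl2 n (opA J fr a al k u).
    apply: (@wl2_le _ _ (fun g => rc M * v g)); last exact: wl2Z.
    by move=> g; rewrite modM mod_rc (le_trans (h g)) // ler_wpM2r ?mod_ge0 // ler_norm.
  have lB : wl2 n (fun g => - k * u g + - al * conv a u g).
    by apply: wl2D; apply: wl2Z => //; exact: wl2_conv.
  apply: (@wl2_le _ _ (fun g => opA J fr a al k u g + if J g then (- k * u g + - al * conv a u g) else 0)).
    move=> g; rewrite /opA; case: ifPn => [_|/su ->]; last by rewrite mulr0 !mod0 addr0 mod0.
    by rewrite le_eqVlt; apply/orP; left; apply/eqP; congr modulus; ring.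
  apply: wl2D => //; apply: wl2_le lB => g; case: ifP => _ //; by rewrite mod0 mod_ge0.
have l4 := l2D lu lu.
apply: (@n2_mono _ _ _ (fun g => rc (modulus (rc (wt g ^+ n) * u g)) + rc (modulus (rc (wt g ^+ n) * (fr g * u g)))) _ _).1.
  by apply: l2D; [apply: bsum_le lu => g|apply: bsum_le l3 => g]; rewrite /sq mod_rc ger0_norm ?mod_ge0.
move=> g; rewrite -rcD mod_rc ger0_norm ?addr_ge0 ?mod_ge0 //.
have wn0 m h' : 0 <= wt h' ^+ m by rewrite exprn_ge0 // ltW // wt_gt0.
by rewrite !modM !mod_rc !(ger0_norm (wn0 _ _)) exprSr /wt; have := mod_ge0 (u g); lra.
Qed.

(** Two sequences that control each other's images gain derivatives together; this is the shape of
    the equations of an [eigenpair] for x and conj y. *)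
Lemma regular k k' M u v : supp J u -> supp J v -> l2 u -> l2 v ->
  (forall g, modulus (opA J fr a al k u g) <= M * modulus (v g)) ->
  (forall g, modulus (opA J fr a al k' v g) <= M * modulus (u g)) ->
  forall n, wl2 n u /\ wl2 n v.
Proof.
move=> su sv lu lv hu hv; elim=> [|n [IH1 IH2]].
  split; [apply: bsum_le lu => g|apply: bsum_le lv => g]; by rewrite /sq expr0 mul1r.
by split; [exact: regular_step hu | exact: regular_step hv].
Qed.

Lemma regular_eigp k l x y : eigenpair J fr a al k l x y -> forall n, wl2 n x /\ wl2 n y.
Proof.
move=> [hx hy Ax Ay] n.
have [sx lx _] := hx; have [sy ly _] := hy.
have [||||] := @regular k k `|l| x (fun g => conjc (y g)) sx _ lx _ _ _ n.
- by move=> g Jg; rewrite sy ?conjc0.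
- exact: l2_conj.
- by move=> g; rewrite Ax modM mod_rc mod_conj.
- by move=> g; rewrite Ay modM mod_rc mod_conj.
by move=> h1' h2; split=> //; apply: wl2_le h2 => g; rewrite mod_conj.
Qed.

Hypothesis w_sum : bsum (fun g => (wt g ^+ 4)^-1).
(** Cauchy-Schwarz against the square-summable family wt^-2, at the price of two orders. *)
Lemma wl2_asum n u : wl2 n.+2 u -> asum (fun g => rc (wt g ^+ n) * u g).
Proof.
move=> lu; have lw : l2 (fun g => rc ((wt g ^+ 2)^-1)).
  apply: bsum_le w_sum => g; rewrite /sq mod_rc real_normK ?num_real // exprVn -exprM.
  by [].
apply: asum_le (l2_mul lu lw) => g.
have w0 : wt g != 0 by rewrite gt_eqF // wt_gt0.
rewrite (_ : rc (wt g ^+ n.+2) * u g * rc ((wt g ^+ 2)^-1) = rc (wt g ^+ n) * u g) //.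
rewrite mulrAC -rcM; congr (rc _ * _).
by rewrite -addn2 exprD mulfK // expf_neq0.
Qed.
End Regularity.

(** * The kernel vector forced by the rotation symmetry *)

Section Protected.
Variables (R : realType) (G : zmodType).
Local Notation C := R[i].
Variables (J : G -> bool) (fr a : G -> C) (al k : C).
Hypothesis fr_coer : forall M : R, exists S : {fset G}, forall g, g \notin S -> M <= modulus (fr g).
Hypothesis a_even : forall g, a (- g) = a g.
Hypothesis a_sum : asum a.
Local Notation A := (opA J fr a al k).
Variables (rho : G -> G) (xi : C) (g0 : G).
Hypothesis xi1 : modulus xi = 1.
Hypothesis xi_neq1 : xi != 1.
Hypothesis rhoI : injective rho.
Hypothesis rhoJ : forall g, J (rho g) = J g.
Hypothesis rho_fr : forall g, fr (rho g) + k = xi * (fr g + k).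
Hypothesis rho_a : forall g h, a (rho g - rho h) = xi * a (g - h).
Hypothesis g0J : J g0.
Hypothesis rho_g0 : rho g0 = g0.
Hypothesis rho_fix : forall g, J g -> rho g = g -> g = g0.

(** The permutation matrix P of [rho] on S satisfies P M = xi M P for the truncated matrix M, and
    its trace counts fixed points, of which there is exactly one. *)
Lemma truncation_singular (S : {fset G}) : g0 \in S -> (forall g, g \in S -> J g) ->
  (forall g, g \in S -> rho g \in S) ->
  exists x, [/\ n2 x = 1, forall g, g \notin S -> x g = 0 & forall g, g \in S -> A x g = 0].
Proof.
move=> g0S SJ Srho.
pose n := #|{: S}|; pose v (i : 'I_n) : G := val (enum_val i).
have vS i : v i \in S by exact: valP.
have vI : injective v by move=> i j /val_inj /enum_val_inj.
pose r (i : 'I_n) : 'I_n := enum_rank [` Srho _ (vS i)]%fset.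
have vr i : v (r i) = rho (v i) by rewrite /v enum_rankK.
have rI : injective r by move=> i j ij; apply/vI/rhoI; rewrite -!vr ij.
pose s := perm rI.
pose M : 'M[C]_n := \matrix_(i, j) ((if i == j then fr (v i) + k else 0) + al * a (v i - v j)).
have Ms i j : M (s i) (s j) = xi * M i j.
  rewrite !mxE !permE (inj_eq rI) !vr rho_a; case: eqP => _; rewrite ?rho_fr; ring.
have PM : perm_mx s *m M = xi *: (M *m perm_mx s).
  apply/matrixP => i j; rewrite -row_permE mxE.
  rewrite -[s in perm_mx s]invgK -col_permE [RHS]mxE [(col_perm _ _) _ _]mxE -Ms permKV.
  by [].
(* For invertible M one gets P = xi M P M^-1, so tr P = xi tr P, that is 1 = xi. *)
have Munit : M \notin unitmx.
  apply/negP => uM.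
  have : \tr (perm_mx s) = xi * \tr (perm_mx s) :> C.
    rewrite -mxtraceZ -[in LHS](mulmxK uM (perm_mx s)) PM -scalemxAl !mxtraceZ; congr (_ * _).
    by rewrite mxtrace_mulC mulmxA mulVmx // mul1mx.
  have i0E : v (enum_rank [` g0S]%fset) = g0 by rewrite /v enum_rankK.
  have -> : \tr (perm_mx s) = 1 :> C.
    rewrite /mxtrace (bigD1 (enum_rank [` g0S]%fset)) //= big1 ?addr0.
      rewrite !mxE permE; have -> : r (enum_rank [` g0S]%fset) = enum_rank [` g0S]%fset.
        by apply: vI; rewrite vr i0E.
      by rewrite eqxx.
    move=> i ii0; rewrite !mxE permE; case: eqP => // ri; case/eqP: ii0.
    apply: vI; rewrite i0E; apply: rho_fix; first exact/SJ/vS.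
    by rewrite -vr ri.
  by move/eqP; rewrite mulr1 eq_sym (negPf xi_neq1).
have kM : kermx M != 0.
  by rewrite kermx_eq0 row_free_unit.
have [i0 [j0 cij]] : exists i j, kermx M i j != 0.
  apply: contrapT => h; move: kM => /eqP; apply; apply/matrixP => i j; rewrite [RHS]mxE.
  by apply: contrapT => /eqP hij; apply: h; exists i, j.
pose c j := kermx M i0 j.
have cM l : \sum_j c j * M j l = 0 :> C.
  by have /matrixP/(_ i0 l) := mulmx_ker M; rewrite mxE [X in _ = X]mxE => E; rewrite -[RHS]E.
pose x g := \sum_(j < n) (if g == v j then c j else 0).
have xS g : g \notin S -> x g = 0.
  move=> gS; rewrite /x big1 // => j _; case: eqP => // gj.
  by case/negP: gS; rewrite gj.
have xv j : x (v j) = c j.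
  rewrite /x (bigD1 j) //= eqxx big1 ?addr0 // => i ij.
  by case: eqP => // /vI jE; rewrite jE eqxx in ij.
have hx : h1 J fr x.
  by apply: (@fin_h1 _ _ _ _ _ S) => // g Jg; apply: xS; apply: contra Jg => /SJ.
have lx := h1_l2 hx.
have Ax g : g \in S -> A x g = 0.
  move=> gS; have [l lE] : exists l, g = v l.
    by exists (enum_rank [` gS]%fset); rewrite /v enum_rankK.
  rewrite /opA SJ // lE xv; rewrite -[RHS](cM l) /conv.
  have -> : (fun g' => a (v l - g') * x g') = (fun g' => \sum_(j < n) (if g' == v j then a (v l - v j) * c j else 0)).
    apply/funext => t; rewrite /x mulr_sumr; apply: eq_bigr => j _.
    by case: eqP => [->|_]; rewrite ?mulr0.
  have aj (j : 'I_n) : asum (fun t => if t == v j then a (v l - v j) * c j else 0).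
    by apply: (@asum_fin _ _ _ [fset v j]%fset) => t; rewrite !inE => /negPf ->.
  rewrite (csum_sum _ aj).1.
  rewrite (eq_bigr (fun j : 'I_n => a (v l - v j) * c j)); last first.
    move=> j _; rewrite (@csum1 _ _ _ (v j)) ?eqxx // => t /negPf ->; by [].
  rewrite [RHS](eq_bigr (fun j => (if j == l then (fr (v l) + k) * c l else 0) + al * (a (v l - v j) * c j))); last first.
    (* [kermx] gives a row vector with c M = 0; since a is even, M is symmetric and c is also a
       right kernel vector. *)
    move=> j _; rewrite mxE -(a_even (v l - v j)) opprB.
    by case: eqP => [->|_]; ring.
  rewrite big_split /= -mulr_sumr; congr (_ + _).
  by rewrite -big_mkcond big_pred1_eq.
have x0 : 0 < n2 x.
  rewrite lt_def n2_ge0 // andbT; apply/eqP => /(n2_eq0 lx)/(_ (v j0)); rewrite xv => c0.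
  by move: cij; rewrite -/(c j0) c0 eqxx.
pose q := (Num.sqrt (n2 x))^-1.
exists (fun g => rc q * x g); split.
- rewrite n2Z // mod_rc ger0_norm ?invr_ge0 ?sqrtr_ge0 // /q exprVn sqr_sqrtr ?n2_ge0 //.
  by rewrite mulVf // gt_eqF.
- by move=> g /xS ->; rewrite mulr0.
- by move=> g gS; rewrite opAZ // Ax ?mulr0.
Qed.

(** The truncations are sublevel sets of |fr + k|: finite by coercivity and invariant because |xi| =
    1. Their unit kernel vectors are bounded in the graph norm uniformly, and a limit along an
    ultrafilter satisfies the full equation at each frequency. *)
Lemma protected_state : exists u, [/\ h1 J fr u, n2 u = 1 & forall g, A u g = 0].
Proof.
have /choice[S hS] : forall N : nat, exists S : {fset G}, forall g,
    (g \in S) = J g && (modulus (fr g + k) <= N%:R + modulus (fr g0 + k)).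
  move=> N; have [S hS] := fr_coer (N%:R + modulus (fr g0 + k) + modulus k + 1).
  (* The summand |fr g0 + k| puts the fixed point into every sublevel set. *)
  pose P g := J g && (modulus (fr g + k) <= N%:R + modulus (fr g0 + k)).
  exists [fset g in S | P g]%fset => g.
  rewrite !inE /= -/(P g) /P; case gS: (g \in S) => //=.
  apply/esym/negP => /andP[_ h]; have /hS := negbT gS.
  have -> : fr g = (fr g + k) - k by ring.
  by move=> /le_trans/(_ (modB _ _)); lra.
have SJ N g : g \in S N -> J g by rewrite hS => /andP[].
have g0S N : g0 \in S N by rewrite hS g0J lerDr ler0n.
have Srho N g : g \in S N -> rho g \in S N by rewrite !hS rhoJ rho_fr modM xi1 mul1r.
have /choice[x hx] := fun N => truncation_singular (g0S N) (SJ N) (@Srho N).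
have nx N : n2 (x N) = 1 by case: (hx N).
have xS N g : g \notin S N -> x N g = 0 by case: (hx N) => _ + _; apply.
have Ax N g : g \in S N -> A (x N) g = 0 by case: (hx N) => _ _; apply.
have x1 N : h1 J fr (x N).
  by apply: (@fin_h1 _ _ _ _ _ (S N)) => [g Jg|g /xS //]; apply: xS; apply: contra Jg => /SJ.
have lx N := h1_l2 (x1 N).
have sx N : supp J (x N) by case: (x1 N).
have [||F [y [UF Finf hy cy st]]] := compactness fr_coer sx lx (B := bndA a al k).
- by move=> N; rewrite nx.
- move=> N T; have [lp np] := opA_low J al a_sum k (lx N).
  set p := (fun g => _) in lp np.
  have h g : sq (fun g => fr g * x N g) g <= sq p g.
    rewrite /sq ler_pXn2r ?nnegrE ?mod_ge0 //.
    have [gS|/xS ->] := boolP (g \in S N); last by rewrite mulr0 mod0 mod_ge0.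
    have := @opA_split _ _ J fr a al k (x N) g (sx N); rewrite Ax // => /eqP; rewrite eq_sym addr_eq0 => /eqP ->.
    by rewrite modN.
  apply: le_trans (rpsum_le _ h) _; apply: le_trans (rpsum_rsum _ (sq_ge0 _) lp) _.
  by rewrite nx mulr1 in np; have := n2_ge0 lp; rewrite /n2 in np *; lra.
have FF : ProperFilter F by case: UF.
exists y; split=> //; first exact: n2_limit _ lx nx (h1_l2 hy) st.
move=> g; have [Jg|nJ] := boolP (J g); last by rewrite opA_supp.
apply: eps_eq0 => e e0.
have x1' N : n2 (x N) <= 1 by rewrite nx.
have [N hN] : exists N : nat, modulus (fr g + k) <= N%:R.
  by exists (Num.bound (modulus (fr g + k))); rewrite ltW // archi_boundP ?mod_ge0.
have [m [/= h1 h2]] := filter_ex (filterI (@opA_lim _ _ J fr a al a_sum F FF k x y lx x1' cy g e e0) (Finf N)).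
move: h1; rewrite Ax ?sub0r ?modN // hS Jg /= (le_trans hN) //.
by rewrite (@le_trans _ _ m%:R) ?ler_nat // lerDl mod_ge0.
Qed.
End Protected.

(** * Perturbation of a one-dimensional kernel *)

Section Conical.
Variables (R : realType) (G : zmodType).
Local Notation C := R[i].
Variables (J : G -> bool) (fr a : G -> C) (al kk : C).
Hypothesis fr_coer : forall M : R, exists S : {fset G}, forall g, g \notin S -> M <= modulus (fr g).
Hypothesis a_even : forall g, a (- g) = a g.
Hypothesis a_sum : asum a.
Variable jn : nat -> G.
Hypothesis jnI : injective jn.
Hypothesis jnJ : forall i, J (jn i).
Local Notation A := (opA J fr a al).
Local Notation h1 := (h1 J fr).

(** Describes the smallest singular value of A_k without a chosen Takagi basis, so that it can be
    transported by the reflection and compared with [E1]. *)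
Definition is_min k (s : R) := 0 <= s /\ (exists u, takagi_vec J fr a al k s u) /\
  forall phi, h1 phi -> s ^+ 2 * n2 phi <= n2 (A k phi).

(** Pairing the perturbed Takagi equation bilinearly with u makes A_kk drop out by symmetry. What
    remains is s |tau| = |e| |sum f u|, with f close to tau u. *)
Lemma conical_seq u : h1 u -> n2 u = 1 -> (forall g, A kk u g = 0) ->
  (forall u', h1 u' -> (forall g, A kk u' g = 0) -> exists t, forall g, u' g = t * u g) ->
  let c := modulus (csum (fun g => u g * u g)) in
  exists M d : R, 0 < d /\ forall e s, modulus e < d -> is_min (kk + e) s ->
    `|s - c * modulus e| <= M * modulus e ^+ 2.
Proof.
move=> hu nu Au ker c.
have lu := h1_l2 hu; have su : supp J u by case: hu.
have [U [S tb]] := takagi_basis_exists al fr_coer a_even a_sum jnI jnJ kk.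
have nAu : n2 (A kk u) = 0.
  rewrite (_ : A kk u = fun g => 0 * u g); last by apply/funext => g; rewrite Au mul0r.
  by rewrite n2Z // mod0 expr0n mul0r.
have S0 : S 0%N = 0.
  have [_ _ mn] := tb 0%N; have := mn _ hu (fun i (h : (i < 0)%N) => False_ind _ (notF h)).
  rewrite nu mulr1 nAu => h; apply/eqP; rewrite -sqrf_eq0; apply/eqP.
  by apply/eqP; rewrite eq_le h sqr_ge0.
have [t0 U0] : exists t, forall g, U 0%N g = t * u g.
  apply: ker; first exact: tb_h1 tb 0%N.
  by move=> g; rewrite (tb_eq tb) S0 mul0r.
pose dl := S 1%N.
(* Two orthonormal vectors cannot both be multiples of u, so the second singular value at kk is
   positive; [dl] is the spectral gap. *)
have dl0 : 0 < dl.
  rewrite lt_def (tb_s0 tb) andbT; apply/eqP => S1.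
  have [t1 U1] : exists t, forall g, U 1%N g = t * u g.
    by apply: ker; [exact: tb_h1 tb 1%N | move=> g; rewrite (tb_eq tb) -/dl S1 mul0r].
  have e01 := tb_ip tb 1 0; have e00 := tb_ip tb 0 0; have e11 := tb_ip tb 1 1.
  have E1 : U 1%N = fun g => t1 * u g by exact/funext.
  have E0 : U 0%N = fun g => t0 * u g by exact/funext.
  have luu : ip u u = 1 by rewrite ip_nn // nu.
  have ipE t t' : ip (fun g => t * u g) (fun g => t' * u g) = t * conjc t'.
    by rewrite ipZl ?ipZr ?luu ?mulr1 //; exact: l2Z.
  rewrite E1 E0 ipE in e01; rewrite E0 ipE eqxx in e00; rewrite E1 ipE eqxx in e11.
  move/eqP: e01; rewrite mulf_eq0 conjc_eq0 => /orP[/eqP z|/eqP z].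
    by move/eqP: e11; rewrite z mul0r eq_sym oner_eq0.
  by move/eqP: e00; rewrite z mul0r eq_sym oner_eq0.
have t0n : modulus t0 ^+ 2 = 1.
  have [_ n0 _ _] := tb_tk tb 0; rewrite (_ : U 0%N = fun g => t0 * u g) in n0; last exact/funext.
  by rewrite n2Z // nu mulr1 in n0.
have gap phi : h1 phi -> ip phi u = 0 -> dl ^+ 2 * n2 phi <= n2 (A kk phi).
  move=> hp pu; have [_ _ mn] := tb 1%N; apply: mn => // i; rewrite ltnS leqn0 => /eqP ->.
  by rewrite (_ : U 0%N = fun g => t0 * u g); [rewrite ipZr ?pu ?mulr0 //; exact: (h1_l2 hp) | exact/funext].
(* The radius dl / 4 keeps n2 f' below 1 / 4, hence |tau| >= 1 / 2. The constant 4 / dl is the bound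
   2 |e| / dl on the pairing of f' with u, divided by 1 / 2. *)
exists (4 / dl), (dl / 4); split; first by rewrite divr_gt0.
move=> e s ed [s0 [[f [hf nf _ Af]] mn]].
have lf := h1_l2 hf; have sf : supp J f by case: hf.
have e0 := mod_ge0 e.
have Aeu g : A (kk + e) u g = e * u g by rewrite opA_shift // Au add0r.
have se : s <= modulus e.
  rewrite -(@ler_pXn2r _ 2) ?nnegrE //; have := mn _ hu; rewrite nu mulr1.
  by rewrite (_ : A (kk + e) u = fun g => e * u g); [rewrite n2Z // nu mulr1 | exact/funext].
pose tau := ip f u; pose f' g := f g + (- tau) * u g.
have hf' : h1 f' by apply: h1D => //; exact: h1Z.
have lf' := h1_l2 hf'.
have uu : ip u u = 1 by rewrite ip_nn // nu.
have f'u : ip f' u = 0.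
  by rewrite ipDl ?ipZl ?uu ?mulr1 /tau ?subrr //; exact: l2Z.
have Af' g : A kk f' g = rc s * conjc (f g) + (- e) * f g.
  have := Af g; rewrite opA_shift // => h.
  by rewrite opAD ?opAZ ?Au ?mulr0 ?addr0 // -?h; [ring | exact: l2Z].
(* A_kk f' = s conj f - e f has squared norm at most 2 s^2 + 2 |e|^2, and s <= |e| by testing with
   u. *)
have nf' : dl ^+ 2 * n2 f' <= 4 * modulus e ^+ 2.
  apply: le_trans (gap _ hf' f'u) _.
  rewrite (_ : A kk f' = fun g => rc s * conjc (f g) + (- e) * f g); last exact/funext.
  have lcf := l2_conj lf.
  apply: le_trans (n2D_le (l2Z _ lcf) (l2Z _ lf)) _.
  by rewrite !n2Z // n2_conj nf !mulr1 mod_rc modN ger0_norm //; nra.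
have fE : f = fun g => tau * u g + f' g by apply/funext => g; rewrite /f'; ring.
have tau2 : modulus tau ^+ 2 + n2 f' = 1.
  rewrite -nf [in RHS]fE [RHS]n2D //; last exact: l2Z.
  rewrite ipZl // (ipC lf' lu) f'u conjc0 mulr0 n2Z // nu mulr1.
  by rewrite (_ : complex.Re (0 : C) = 0) // mulr0 addr0.
have tauh : 1 / 2 <= modulus tau.
  have n0 := n2_ge0 lf'.
  have : n2 f' <= 1 / 4.
    rewrite -(ler_pM2l (exprn_gt0 2 dl0)); apply: le_trans nf' _.
    have : modulus e ^+ 2 <= (dl / 4) ^+ 2 by apply: lerXn2r; rewrite ?nnegrE ?divr_ge0 // ltW.
    by rewrite expr_div_n; lra.
  by have := mod_ge0 tau; move: tau2; nra.
have key : s * modulus tau = modulus e * modulus (csum (fun g => f g * u g)).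
  have h1' : csum (fun g => A (kk + e) f g * u g) = rc s * conjc tau.
    rewrite (_ : (fun g => _) = fun g => rc s * conjc (f g * conjc (u g))).
      by rewrite csumZ ?csum_conj //; [exact: l2_ip | apply: asum_conj; exact: l2_ip].
    by apply/funext => g; rewrite Af conjcM conjcK mulrA.
  have h2' : csum (fun g => A (kk + e) f g * u g) = e * csum (fun g => f g * u g).
    rewrite opA_sym // -csumZ; last exact: l2_mul.
    by congr csum; apply/funext => g; rewrite Aeu; ring.
  rewrite -modM -h2' h1' modM mod_rc mod_conj ger0_norm //.
have fu : csum (fun g => f g * u g) = tau * csum (fun g => u g * u g) + csum (fun g => f' g * u g).
  rewrite -csumZ; last exact: l2_mul.
  rewrite -csumD; [|by apply: asumZ; exact: l2_mul|exact: l2_mul].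
  by congr csum; apply/funext => g; rewrite {1}fE; ring.
have f'b : modulus (csum (fun g => f' g * u g)) <= 2 * modulus e / dl.
  rewrite -(@ler_pXn2r _ 2) ?nnegrE ?mod_ge0 ?divr_ge0 ?mulr_ge0 ?(ltW dl0) //.
  apply: le_trans (cauchy_schwarz lf' lu) _; rewrite nu mulr1 exprMn exprVn ler_pdivlMr ?exprn_gt0 //.
  by move: nf'; lra.
set q := csum (fun g => f' g * u g) in fu f'b.
have d1 : `|s - c * modulus e| * modulus tau <= modulus e * modulus q.
  have t0' := mod_ge0 tau.
  rewrite -{1}(ger0_norm t0') -normrM mulrBl key fu.
  have -> : modulus e * modulus (tau * csum (fun g => u g * u g) + q) - c * modulus e * modulus tau =
    modulus e * (modulus (tau * csum (fun g => u g * u g) + q) - modulus (tau * csum (fun g => u g * u g))).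
    by rewrite modM -/c; ring.
  rewrite normrM ger0_norm // ler_wpM2l // ler_norml; apply/andP; split.
    have := modB (tau * csum (fun g => u g * u g) + q) q; rewrite addrK; lra.
  have := modD (tau * csum (fun g => u g * u g)) q; lra.
have d2 : `|s - c * modulus e| * (1 / 2) <= modulus e * (2 * modulus e / dl).
  apply: le_trans (le_trans _ d1) _; first by rewrite ler_wpM2l.
  by rewrite ler_wpM2l.
have -> : 4 / dl * modulus e ^+ 2 = 2 * (modulus e * (2 * modulus e / dl)) by field; rewrite gt_eqF.
by lra.
Qed.
End Conical.

(** * Discreteness of the values k with nontrivial kernel *)

Section Discrete.
Variables (R : realType) (G : zmodType).
Local Notation C := R[i].
Variables (J : G -> bool) (fr a : G -> C) (al : C).
Hypothesis fr_coer : forall M : R, exists S : {fset G}, forall g, g \notin S -> M <= modulus (fr g).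
Hypothesis a_sum : asum a.
Local Notation A := (opA J fr a al).
Local Notation h1 := (h1 J fr).
Variables (x : nat -> G -> C) (kn : nat -> C) (D : R).
Hypothesis hx : forall n, h1 (x n).
Hypothesis nx : forall n, n2 (x n) <> 0.
Hypothesis Ax : forall n g, A (kn n) (x n) g = 0.
Hypothesis knI : injective kn.
Hypothesis knD : forall n, modulus (kn n) <= D.
Let lx n : l2 (x n) := h1_l2 (hx n).
Let cmb n (c : nat -> C) g := \sum_(i < n) c i * x i g.

Let h1_cmb n c : h1 (cmb n c).
Proof. by have [h _] := @opA_sum _ _ J fr a al a_sum 0 _ (index_enum 'I_n) (fun i => c i) (fun i => x i) 0 (fun i => hx i). Qed.

Let opA_cmb n c k g : A k (cmb n c) g = cmb n (fun i => c i * (k - kn i)) g.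
Proof.
have [_ ->] := @opA_sum _ _ J fr a al a_sum k _ (index_enum 'I_n) (fun i => c i) (fun i => x i) g (fun i => hx i).
apply: eq_bigr => i _; rewrite -mulrA; congr (_ * _).
have -> : k = kn i + (k - kn i) by ring.
rewrite opA_shift ?Ax ?add0r; last by case: (hx i).
by congr (_ * _); ring.
Qed.

Let cmbS n c g : cmb n.+1 c g = cmb n c g + c n * x n g.
Proof. by rewrite /cmb big_ord_recr. Qed.

(** The usual independence of eigenvectors: A at kn n multiplies the coefficient of x i by kn n - kn
    i and kills the last one. *)
Lemma eigvec_free n c : (forall g, cmb n c g = 0) -> forall i, (i < n)%N -> c i = 0.
Proof.
elim: n c => // n IH c h0.
have ci i : (i < n)%N -> c i = 0.
  move=> li; have : c i * (kn n - kn i) = 0.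
    apply: (IH (fun i => c i * (kn n - kn i))) li => g.
    have := opA_cmb n.+1 c (kn n) g; rewrite cmbS subrr mulr0 mul0r addr0 => <-.
    rewrite (_ : cmb n.+1 c = fun g => 0 * x 0%N g); last by apply/funext => t; rewrite h0 mul0r.
    by rewrite opAZ ?mul0r.
  move/eqP; rewrite mulf_eq0 subr_eq0 (inj_eq knI) gtn_eqF // orbF => /eqP //.
move=> i; rewrite ltnS leq_eqVlt => /orP[/eqP ->|]; last exact: ci.
apply/eqP/negPn/negP => cn; apply: (@nx n).
have xn g : x n g = 0.
  have := h0 g; rewrite cmbS /cmb big1 ?add0r.
    by move/eqP; rewrite mulf_eq0 (negPf cn) => /eqP.
  by move=> j _; rewrite ci ?mul0r.
rewrite (_ : x n = fun g => 0 * x n g); last by apply/funext => t; rewrite xn mulr0.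
by rewrite n2Z // mod0 expr0n mul0r.
Qed.

(** Gram-Schmidt in one step: n orthogonality conditions on n + 1 independent vectors, solved by a
    left kernel vector of the Gram matrix. *)
Lemma eigvec_gram n : exists c, n2 (cmb n.+1 c) = 1 /\ forall j, (j < n)%N -> ip (cmb n.+1 c) (x j) = 0.
Proof.
pose M : 'M[C]_(n.+1, n) := \matrix_(i, j) ip (x i) (x j).
have kM : kermx M != 0.
  rewrite -mxrank_eq0 mxrank_ker -lt0n subn_gt0 ltnS; exact: rank_leq_col.
have [i0 [j0 cij]] : exists i j, kermx M i j != 0.
  apply: contrapT => h; move: kM => /eqP; apply; apply/matrixP => i j; rewrite [RHS]mxE.
  by apply: contrapT => /eqP hij; apply: h; exists i, j.
pose c (j : nat) := kermx M i0 (inord j).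
have cM (l : 'I_n) : ip (cmb n.+1 c) (x l) = 0.
  have [_ ->] := ip_suml (index_enum 'I_n.+1) (fun i => c i) (fun i => lx i) (lx l).
  have /matrixP/(_ i0 l) := mulmx_ker M; rewrite mxE [X in _ = X]mxE => E; rewrite -[RHS]E.
  by apply: eq_bigr => j _; rewrite /c inord_val [M _ _]mxE.
have ly := h1_l2 (h1_cmb n.+1 c).
have y0 : 0 < n2 (cmb n.+1 c).
  rewrite lt_def n2_ge0 // andbT; apply/eqP => /(n2_eq0 ly) z.
  by move: cij; have := eigvec_free z (ltn_ord j0); rewrite /c inord_val => ->; rewrite eqxx.
pose r := (Num.sqrt (n2 (cmb n.+1 c)))^-1.
exists (fun i => rc r * c i).
have -> : cmb n.+1 (fun i => rc r * c i) = fun g => rc r * cmb n.+1 c g.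
  by apply/funext => g; rewrite /cmb mulr_sumr; apply: eq_bigr => i _; rewrite mulrA.
split; last by move=> j jn; rewrite ipZl // (cM (Ordinal jn)) mulr0.
rewrite n2Z // mod_rc ger0_norm ?invr_ge0 ?sqrtr_ge0 // /r exprVn sqr_sqrtr ?n2_ge0 //.
by rewrite mulVf // gt_eqF.
Qed.

(** The Riesz argument for compact inverses. Let y n be unit in the span of x 0, ..., x n and
    orthogonal to the earlier vectors, and let w n solve A w = y n at k1. The w n are bounded in the
    graph norm but stay apart. *)
Lemma eigvalues_discrete k1 (sg : R) : 0 < sg ->
  (forall phi, h1 phi -> sg ^+ 2 * n2 phi <= n2 (A k1 phi)) -> False.
Proof.
move=> sg0 inj.
have kd n : k1 - kn n != 0.
  apply/eqP => /eqP; rewrite subr_eq0 => /eqP k1E; apply: (@nx n).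
  have := inj _ (hx n); rewrite (_ : A k1 (x n) = fun g => 0 * x n g).
    rewrite n2Z // mod0 expr0n mul0r pmulr_rle0 ?exprn_gt0 // => h.
    by apply/eqP; rewrite eq_le h n2_ge0.
  by apply/funext => g; rewrite k1E Ax mul0r.
have /choice[c hc] := eigvec_gram.
pose y n := cmb n.+1 (c n).
pose w n := cmb n.+1 (fun i => c n i / (k1 - kn i)).
have hw n : h1 (w n) by exact: h1_cmb.
have ny n : n2 (y n) = 1 by case: (hc n).
have ly n : l2 (y n) by exact: h1_l2 (h1_cmb _ _).
have lw n : l2 (w n) by exact: h1_l2 (h1_cmb _ _).
have oy n j : (j < n)%N -> ip (y n) (x j) = 0 by case: (hc n) => _; apply.
have Aw n : A k1 (w n) = y n.
  apply/funext => g; rewrite opA_cmb; apply: eq_bigr => i _; congr (_ * _).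
  by rewrite divfK.
have nw n : sg ^+ 2 * n2 (w n) <= 1 by have := inj _ (h1_cmb n.+1 (fun i => c n i / (k1 - kn i))); rewrite Aw ny.
have ipx n j : (j < n)%N -> ip (x j) (y n) = 0 by move=> jn; rewrite ipC // oy // conjc0.
have ipc m (d : nat -> C) n : (m <= n)%N -> ip (cmb m d) (y n) = 0.
  move=> mn; have [_ ->] := ip_suml (index_enum 'I_m) (fun i => d i) (fun i => lx i) (ly n).
  by rewrite big1 // => i _; rewrite ipx ?mulr0 // (leq_trans (ltn_ord i)).
(* On x n the inverse is division by k1 - kn n, and modulo the earlier vectors w n is this multiple
   of y n. *)
have ipw n : ip (w n) (y n) = (k1 - kn n)^-1.
  have -> : w n = fun g => (k1 - kn n)^-1 * y n g + cmb n (fun i => c n i / (k1 - kn i) - (k1 - kn n)^-1 * c n i) g.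
    apply/funext => g; rewrite /w /y !cmbS mulrDr.
    have -> : cmb n (fun i => c n i / (k1 - kn i) - (k1 - kn n)^-1 * c n i) g =
        cmb n (fun i => c n i / (k1 - kn i)) g - (k1 - kn n)^-1 * cmb n (c n) g.
      by rewrite /cmb mulr_sumr -sumrB; apply: eq_bigr => i _; ring.
    by ring.
  have lc d m : l2 (cmb m d) by exact: h1_l2 (h1_cmb _ _).
  rewrite ipDl //; last exact: l2Z.
  by rewrite ipZl // ipc // addr0 ip_nn // ny; exact: mulr1.
pose Q := modulus k1 + D + 1.
have D0 : 0 <= D by rewrite (le_trans (mod_ge0 _) (knD 0)).
have Q0 : 0 < Q by rewrite /Q ltr_pwDr // addr_ge0 // mod_ge0.
(* The factor sg makes the norms at most 1. Pairing w m - w n with y m gives |k1 - kn m|^-1 >= 1 /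
   Q, so squared distances exceed sg^2 / (2 Q^2) after scaling. *)
have [|||||n [m [nm]]] := @no_sep _ _ J fr fr_coer (fun n g => rc sg * w n g) (2 * sg ^+ 2 + bndA a al k1) (sg ^+ 2 / (2 * Q ^+ 2)).
- by move=> n; case: (h1Z (rc sg) (hw n)).
- by move=> n; exact: l2Z.
- by move=> n; rewrite n2Z // mod_rc (ger0_norm (ltW sg0)).
- move=> n S; have hsw := h1Z (rc sg) (hw n); have [s1 l1 f1] := hsw.
  have [_ b1] := h1_of a_sum s1 l1 (opA_l2 al a_sum k1 hsw).
  apply: le_trans (rpsum_rsum S (sq_ge0 _) f1) _; apply: le_trans b1 _.
  have -> : A k1 (fun g => rc sg * w n g) = fun g => rc sg * y n g by apply/funext => g; rewrite -Aw opAZ.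
  by rewrite !n2Z // ny mulr1 mod_rc (ger0_norm (ltW sg0)) lerD2l ler_piMr ?bndA_ge0.
- by rewrite divr_gt0 ?mulr_gt0 ?exprn_gt0.
rewrite (_ : (fun g => _) = fun g => rc sg * (w m g - w n g)); last by apply/funext => g; ring.
have ld := l2B (lw m) (lw n).
rewrite n2Z // mod_rc (ger0_norm (ltW sg0)) ler_pM2l ?exprn_gt0 //.
have ipE : ip (fun g => w m g - w n g) (y m) = (k1 - kn m)^-1.
  rewrite (_ : (fun g => _) = fun g => w m g + (-1) * w n g); last by apply/funext => g; ring.
  by rewrite ipDl ?ipZl ?ipw ?ipc ?mulr0 ?addr0 //; exact: l2Z.
have := ip_le ld (ly m); rewrite ipE ny mulr1 modV => h1' h2'.
have kQ : modulus (k1 - kn m) <= Q.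
  by rewrite (le_trans (modB _ _)) // /Q -addrA lerD2l (le_trans (knD m)) // lerDl.
have k0 := mod_gt0 (kd m).
have : Q ^- 2 <= (2 * Q ^+ 2)^-1.
  apply: le_trans (le_trans h1' h2'); rewrite -exprVn; apply: lerXn2r; rewrite ?nnegrE ?invr_ge0 ?mod_ge0 ?(ltW Q0) //.
  by rewrite lef_pV2.
rewrite lef_pV2 ?posrE ?mulr_gt0 ?exprn_gt0 //; have := exprn_gt0 2 Q0; lra.
Qed.
End Discrete.

Lemma Z3P (z : 'Z_3) : [\/ z = 0, z = 1 | z = -1].
Proof.
case: z => [[|[|[|m]]] hm] //; [apply: Or31|apply: Or32|apply: Or33]; exact/val_inj.
Qed.

(** * Reflection symmetry and isotropic kernel vectors *)

Section Wronskian.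
Variables (R : realType) (G : zmodType).
Local Notation C := R[i].
Variables (fr a : G -> C) (al : C) (cls : G -> 'Z_3).
Hypothesis frD : forall g h, fr (g + h) = fr g + fr h.
Hypothesis clsD : forall g h, cls (g + h) = cls g + cls h.
Hypothesis a_even : forall g, a (- g) = a g.
Hypothesis a_sum : asum a.
Hypothesis a_cls : forall g, cls g = 0 -> a g = 0.
Let J g := cls g != 0.
Local Notation A := (opA J fr a al).
Local Notation h1 := (h1 J fr).
(** The sign that distinguishes the spinor components: frequencies of class 1 belong to the first,
    those of class - 1 to the second. *)
Definition eps (g : G) : C := if cls g == 1 then 1 else if cls g == -1 then -1 else 0.
Let cls0 : cls 0 = 0. Proof. by apply: (addrI (cls 0)); rewrite -clsD !addr0. Qed.

Let clsN g : cls (- g) = - cls g.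
Proof. by apply/eqP; rewrite -addr_eq0 -clsD addNr cls0. Qed.

Let clsB g h : cls (g - h) = cls g - cls h. Proof. by rewrite clsD clsN. Qed.

Let frB g h : fr (g - h) = fr g - fr h.
Proof. by apply/eqP; rewrite -subr_eq0 opprB addrA [fr (g - h) + _]addrC -frD [h + _]addrC subrK subrr. Qed.

Lemma epsN g : eps (- g) = - eps g.
Proof.
rewrite /eps clsN; case: (Z3P (cls g)) => -> /=; rewrite ?oppr0 ?opprK ?eqxx //=;
  by rewrite ?oppr0 ?opprK.
Qed.

Lemma eps_sq g : J g -> eps g * eps g = 1.
Proof. by rewrite /J /eps; case: (Z3P (cls g)) => -> //= _; rewrite ?mulrNN mulr1. Qed.

Lemma mod_eps g : modulus (eps g) <= 1.
Proof. by rewrite /eps; case: ifP => _; [|case: ifP => _]; rewrite ?modN ?mod0 // (mod_rc 1) normr1. Qed.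

(** As a vanishes on class 0, the potential only couples different classes, and between these [eps]
    changes sign. *)
Lemma eps_flip g h : J g -> J h -> (eps g + eps h) * a (g - h) = 0.
Proof.
rewrite /J /eps => Jg Jh; have := @a_cls (g - h); rewrite clsB.
case: (Z3P (cls g)) Jg => -> //= _; case: (Z3P (cls h)) Jh => -> //= _ H;
  by rewrite ?subrr ?addNr ?mul0r // H ?mulr0 // subrr.
Qed.

(** On functions this is (u_1, u_2)(z) -> (u_2(-z), - u_1(-z)); its square is - 1. *)
Definition refl (u : G -> C) g := eps g * u (- g).
Lemma refl_h1 u : h1 u -> h1 (refl u) /\ n2 (refl u) = n2 u.
Proof.
move=> [su lu fu].
have JN g : J (- g) = J g by rewrite /J clsN oppr_eq0.
have frN g : fr (- g) = - fr g.
  have f0 : fr 0 = 0 by apply: (addrI (fr 0)); rewrite -frD !addr0.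
  by apply/eqP; rewrite -addr_eq0 -frD addNr f0.
have sqE g : sq (refl u) g = sq u (- g).
  rewrite /sq /refl modM; have [Jg|nJ] := boolP (J g); last by rewrite su ?mod0 ?mulr0 // JN.
  have := eps_sq Jg => /(congr1 (@modulus R)); rewrite modM (mod_rc 1) normr1 => e.
  by rewrite exprMn expr2 e mul1r.
have bN (h : G -> R) : (forall t, 0 <= h t) -> bsum h -> bsum (fun g : G => h (- g)) by move=> h0; apply: bsum_inj => // p q /oppr_inj.
split; [split|].
- by move=> g Jg; rewrite /refl su ?mulr0 // JN.
- by apply: bsum_le (bN _ (sq_ge0 u) lu) => g; rewrite sqE.
- apply: bsum_le (bN _ (sq_ge0 _) fu) => g; rewrite /sq !modM frN modN !exprMn.
  by have := sqE g; rewrite /sq /refl modM exprMn => ->.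
rewrite /n2 -(@rsum_bij _ _ _ -%R -%R (sq u)) //; try exact: opprK.
by congr rsum; apply/funext => g; rewrite sqE.
Qed.

(** Under g -> - g the symbol is odd, and by [eps_flip] the potential term also changes sign; hence
    k has to change sign too. *)
Lemma refl_opA k u g : h1 u -> A (- k) (refl u) g = - refl (A k u) g.
Proof.
move=> [su lu fu]; have JN : J (- g) = J g by rewrite /J clsN oppr_eq0.
rewrite /refl /opA JN; have [Jg|nJ] := boolP (J g); last by rewrite mulr0 oppr0.
have frN : fr g = - fr (- g).
  have f0 : fr 0 = 0 by apply: (addrI (fr 0)); rewrite -frD !addr0.
  by apply/eqP; rewrite -addr_eq0 -frD addrN f0.
have -> : conv a (fun t => eps t * u (- t)) g = - (eps g * conv a u (- g)).
  rewrite /conv -(@csum_bij _ _ _ -%R -%R (fun g' => a (- g - g') * u g')); try exact: opprK; last exact: asum_convl2.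
  rewrite -mulNr -csumZ.
    congr csum; apply/funext => h; rewrite opprK -(a_even (- g + h)) opprD opprK.
    have [Jh|nJh] := boolP (J h); last by rewrite su ?mulr0 // /J clsN oppr_eq0.
    have := eps_flip Jg Jh; rewrite mulrDl => /eqP; rewrite addr_eq0 => /eqP e.
    rewrite mulrA [a _ * _]mulrC mulrA mulNr e opprK; ring.
  by apply: (@asum_inj _ _ _ -%R (fun g' => a (- g - g') * u g') oppr_inj); exact: asum_convl2.
by rewrite {1}frN; ring.
Qed.

Lemma refl_min k s : is_min J fr a al k s -> is_min J fr a al (- k) s.
Proof.
move=> [s0 [[u [hu nu _ Au]] mn]]; have [hr nr] := refl_h1 hu.
have reflK v : h1 v -> forall g, refl (refl v) g = - v g.
  move=> [sv _ _] g; rewrite /refl epsN opprK; have [Jg|nJ] := boolP (J g); last by rewrite sv ?mulr0 ?oppr0.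
  by rewrite mulrA mulrN eps_sq // mulN1r.
have nrA v : h1 v -> n2 (A (- k) (refl v)) = n2 (A k v).
  move=> hv; rewrite (_ : A (- k) (refl v) = fun g => - refl (A k v) g); last first.
    by apply/funext => g; exact: refl_opA.
  rewrite n2N; have lA := opA_l2 al a_sum k hv.
  rewrite /n2 -[in RHS](@rsum_bij _ _ _ -%R -%R) //; try exact: opprK.
  congr rsum; apply/funext => g; rewrite /sq /refl modM.
  have [Jg|nJ] := boolP (J g); last by rewrite opA_supp ?mod0 ?mulr0 // /J clsN oppr_eq0.
  have := eps_sq Jg => /(congr1 (@modulus R)); rewrite modM (mod_rc 1) normr1 => e.
  by rewrite exprMn expr2 e mul1r.
split=> //; split.
  (* The factor i absorbs the minus sign of [refl_opA], since conj (i v) = - i conj v. *)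
  exists (fun g => iunit R * refl u g); split=> //; first exact: h1Z.
    rewrite n2Z ?nr ?nu ?mulr1; last exact: h1_l2 hr.
    by rewrite mod_sq /=; ring.
  move=> g; rewrite opAZ //; last exact: h1_l2 hr.
  rewrite refl_opA // /refl Au !conjcM.
  have -> : conjc (eps g) = eps g.
    by rewrite /eps; case: ifP => _; [|case: ifP => _]; rewrite ?conjcN ?conjc1 ?conjc0.
  have -> : conjc (iunit R) = - iunit R by apply/eqP; rewrite eq_complex /= oppr0 !eqxx.
  ring.
move=> phi hp; have [hrp nrp] := refl_h1 hp.
have := mn _ hrp; rewrite nrp => h; apply: le_trans h _.
rewrite -(nrA _ hrp) (_ : refl (refl phi) = fun g => (-1) * phi g); last first.
  by apply/funext => g; rewrite reflK // mulN1r.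
rewrite (_ : A _ _ = fun g => (-1) * A (- k) phi g); last first.
  by apply/funext => g; rewrite opAZ //; exact: h1_l2 hp.
by rewrite n2Z ?modN ?(mod_rc 1) ?normr1 ?expr1n ?mul1r //; exact: opA_l2.
Qed.

(* Fourier coefficients of [u_1 v_2 - u_2 v_1]; only frequencies [r] with [cls r = 0] are meaningful. *)
Definition wronskian (u v : G -> C) (r : G) := csum (fun g => eps g * u g * v (r - g)).

(** In the derivative of u_1 v_2 - u_2 v_1 the potential terms cancel, so the Wronskian satisfies a
    scalar equation with symbol fr + k + k'. *)
Lemma wron_eq k k' u v r : h1 u -> h1 v -> asum u -> cls r = 0 ->
  (forall g, A k u g = 0) -> (forall g, A k' v g = 0) -> (fr r + k + k') * wronskian u v r = 0.
Proof.
move=> [su lu fu] [sv lv fv] au r0 Au Av.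
have Jr g : J (r - g) = J g by rewrite /J clsB r0 sub0r oppr_eq0.
have lvr : l2 (fun g => v (r - g)) by apply: (bsum_inj (sq_ge0 v) _ lv) => p q /addrI /oppr_inj.
have lfvr : l2 (fun g => fr (r - g) * v (r - g)) by apply: (bsum_inj (sq_ge0 _) _ fv) => p q /addrI /oppr_inj.
have le w : l2 w -> l2 (fun g => eps g * w g).
  by move=> lw; apply: (n2_mono lw _).1 => g; rewrite modM ler_piMl ?mod_ge0 ?mod_eps.
have a0 : asum (fun g => eps g * u g * v (r - g)) by apply: l2_mul => //; exact: le.
have a1 : asum (fun g => (eps g * (fr g * u g)) * v (r - g)) by apply: l2_mul => //; exact: le.
have a2 : asum (fun g => (eps g * u g) * (fr (r - g) * v (r - g))) by apply: l2_mul => //; exact: le.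
pose cu g := if J g then conv a u g else 0; pose cv g := if J g then conv a v g else 0.
have fuE g : fr g * u g = - k * u g - al * cu g.
  have := Au g; rewrite /opA /cu; have [Jg|nJ] := boolP (J g); last by rewrite su // => _; ring.
  by move=> E; apply/eqP; rewrite -subr_eq0 -[X in _ == X]E; apply/eqP; ring.
have fvE g : fr g * v g = - k' * v g - al * cv g.
  have := Av g; rewrite /opA /cv; have [Jg|nJ] := boolP (J g); last by rewrite sv // => _; ring.
  by move=> E; apply/eqP; rewrite -subr_eq0 -[X in _ == X]E; apply/eqP; ring.
have lcu : l2 cu.
  by have [lc _] := conv_l2 a_sum lu; apply: (n2_mono lc _).1 => g; rewrite /cu; case: ifP; rewrite ?mod0 ?mod_ge0.
have lcv : l2 cv.
  by have [lc _] := conv_l2 a_sum lv; apply: (n2_mono lc _).1 => g; rewrite /cv; case: ifP; rewrite ?mod0 ?mod_ge0.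
have lcvr : l2 (fun g => cv (r - g)) by apply: (bsum_inj (sq_ge0 _) _ lcv) => p q /addrI /oppr_inj.
have a3 : asum (fun g => (eps g * cu g) * v (r - g)) by apply: l2_mul => //; exact: le.
have a4 : asum (fun g => (eps g * u g) * cv (r - g)) by apply: l2_mul => //; exact: le.
(* Both sums run over the same double family with the roles of g and h exchanged; [eps_flip] gives
   them opposite signs. Absolute summability of u, with v bounded, justifies the exchange. *)
have cancel : csum (fun g => (eps g * cu g) * v (r - g)) + csum (fun g => (eps g * u g) * cv (r - g)) = 0.
  pose F (g h : G) := eps g * (if J g then 1 else 0) * (a (g - h) * u h * v (r - g)).
  have vB := l2_bdd lvr.
  have aF : asum (fun t => F t.1 t.2).
    have [b _] := bsum_conv (fun t => mod_ge0 (a t)) (fun t => mod_ge0 (u t)) a_sum au.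
    have V0 : 0 <= n2 (fun g => v (r - g)) + 1 by rewrite addr_ge0 // n2_ge0.
    apply: asum_le (bsumZ V0 b) => -[g h]; rewrite /F /= !modM mulrC.
    apply: (@le_trans _ _ (modulus (a (g - h)) * modulus (u h) * modulus (v (r - g)) * 1)).
      rewrite ler_wpM2l ?mulr_ge0 ?mod_ge0 // mulr_ile1 ?mod_ge0 ?mod_eps //.
      by case: ifP => _; rewrite ?mod0 // (mod_rc 1) normr1.
    by rewrite mulr1 mulrC ler_wpM2r ?mulr_ge0 ?mod_ge0.
  have -> : csum (fun g => (eps g * cu g) * v (r - g)) = csum (fun h => csum (fun g => F g h)).
    rewrite -csum_swap //; congr csum; apply/funext => g.
    rewrite /cu /F; case: ifP => _; last by rewrite csum0 => [|h]; ring.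
    rewrite /conv mulrAC -csumZ; last exact: asum_convl2.
    by congr csum; apply/funext => h; ring.
  have aF' : asum (fun t : G * G => F t.2 t.1).
    by apply: (@asum_inj _ _ _ (fun t : G * G => (t.2, t.1)) (fun t => F t.1 t.2)) => // -[p q] [p' q'] [-> ->].
  have [rowF colF _] := fubini aF'; rewrite /= in rowF colF.
  have -> : (fun g => (eps g * u g) * cv (r - g)) = (fun h => (-1) * csum (fun g => F g h)).
    apply/funext => h; have [Jh|nJ] := boolP (J h); last first.
      by rewrite su // mulr0 mul0r csum0 ?mulr0 // => g; rewrite /F su //; ring.
    rewrite /cv Jr Jh /conv -(@csum_bij _ _ _ (fun g => r - g) (fun g => r - g)); last first.
    - exact: asum_convl2.
    - by move=> g; rewrite subKr.
    - by move=> g; rewrite subKr.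
    rewrite -!csumZ //; last first.
      by apply: (@asum_inj _ _ _ (fun g => r - g) (fun g => a (r - h - g) * v g)); [move=> p q /addrI /oppr_inj | exact: asum_convl2].
    congr csum; apply/funext => g; rewrite /F.
    have -> : r - h - (r - g) = g - h by rewrite opprB addrC addrA subrK.
    have [Jg|nJ] := boolP (J g); last by rewrite sv ?Jr //; ring.
    have := eps_flip Jg Jh; rewrite mulrDl => /eqP; rewrite addr_eq0 => /eqP e.
    transitivity (- - (eps h * a (g - h)) * (u h * v (r - g))); first by ring.
    by rewrite -e; ring.
  by rewrite csumZ // mulN1r subrr.
have e1 : csum (fun g => (eps g * (fr g * u g)) * v (r - g)) = - k * wronskian u v r + - al * csum (fun g => (eps g * cu g) * v (r - g)).
  rewrite /wronskian -!csumZ // -csumD; try by apply: asumZ.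
  by congr csum; apply/funext => g; rewrite fuE; ring.
have e2 : csum (fun g => (eps g * u g) * (fr (r - g) * v (r - g))) = - k' * wronskian u v r + - al * csum (fun g => (eps g * u g) * cv (r - g)).
  rewrite /wronskian -!csumZ // -csumD; try by apply: asumZ.
  by congr csum; apply/funext => g; rewrite fvE; ring.
have e3 : fr r * wronskian u v r = csum (fun g => (eps g * (fr g * u g)) * v (r - g)) + csum (fun g => (eps g * u g) * (fr (r - g) * v (r - g))).
  rewrite /wronskian -csumZ // -csumD //; congr csum; apply/funext => g.
  have -> : fr r = fr g + fr (r - g) by rewrite -frD [g + _]addrC subrK.
  by ring.
rewrite !mulrDl e3 e1 e2.
have -> : - k * wronskian u v r + - al * csum (fun g => eps g * cu g * v (r - g)) + (- k' * wronskian u v r + - al * csum (fun g => eps g * u g * cv (r - g))) + k * wronskian u v r + k' * wronskian u v r =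
  - al * (csum (fun g => eps g * cu g * v (r - g)) + csum (fun g => eps g * u g * cv (r - g))) by ring.
by rewrite cancel mulr0.
Qed.

Lemma conv_conv (b F u : G -> C) g : asum b -> asum F -> asum u ->
  asum (conv F u) /\
  conv b (conv F u) g = csum (fun g' => u g' * csum (fun h => b (g - h) * F (h - g'))).
Proof.
move=> ab aF au.
have [bp [b1 b2 _]] := bsum_conv (fun t => mod_ge0 (F t)) (fun t => mod_ge0 (u t)) aF au.
have ac : asum (conv F u).
  apply: asum_le b2 => h; rewrite /conv; apply: csum_ler => S.
  apply: le_trans (rpsum_rsum S _ (b1 h)); last by move=> t; rewrite mulr_ge0 ?mod_ge0.
  by apply: rpsum_le => t; rewrite modM.
split=> //.
pose H (h g' : G) := b (g - h) * (F (h - g') * u g').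
have aH : asum (fun t => H t.1 t.2).
  apply: asum_le (bsumZ (c := rsum (fun t => modulus (b t))) _ bp).
    by move=> -[h g']; rewrite /H /= !modM ler_wpM2r ?mulr_ge0 ?mod_ge0 //; apply: (term_le_rsum (h := fun t => modulus (b t))) => // t; exact: mod_ge0.
  by apply: rsum_ge0 => // t; exact: mod_ge0.
have aFu h : asum (fun g' => F (h - g') * u g') by apply: asum_le (b1 h) => t; rewrite modM.
transitivity (csum (fun h => csum (H h))).
  by congr csum; apply/funext => h; rewrite /conv -csumZ.
rewrite csum_swap //; congr csum; apply/funext => g'.
rewrite -csumZ; last first.
  have [B hB] : exists B : R, forall t, modulus (F t) <= B.
    by exists (rsum (fun t => modulus (F t))) => t; apply: (term_le_rsum (h := fun t => modulus (F t))) => // s; exact: mod_ge0.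
  have h1' := @asum_convr _ _ b (fun h => F (h - g')) g ab (ex_intro _ B (fun t => hB _)).
  exact: h1'.
by congr csum; apply/funext => h; rewrite /H; ring.
Qed.

Lemma conv_comm (b F u : G -> C) g : asum b -> asum F -> asum u ->
  conv b (conv F u) g = conv F (conv b u) g.
Proof.
move=> ab aF au; rewrite (conv_conv g ab aF au).2 (conv_conv g aF ab au).2.
congr csum; apply/funext => g'; congr (_ * _).
have aX : asum (fun h => F (g - h) * b (h - g')).
  have [B hB] : exists B : R, forall t, modulus (b t) <= B.
    by exists (rsum (fun t => modulus (b t))) => t; apply: (term_le_rsum (h := fun t => modulus (b t))) => // s; exact: mod_ge0.
  exact: (@asum_convr _ _ F (fun h => b (h - g')) g aF (ex_intro _ B (fun t => hB _))).
have inv h : g + g' - (g + g' - h) = h by rewrite subKr.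
rewrite -[RHS](@csum_bij _ _ _ (fun h => g + g' - h) (fun h => g + g' - h)) //.
congr csum; apply/funext => h; rewrite mulrC; congr (_ * _); congr (_ _).
  by rewrite opprB opprD addrCA addNKr.
by rewrite [RHS]addrAC addrK.
Qed.

(** The Leibniz rule for multiplication by a Lambda-periodic function, that is, one with
    coefficients [F] supported on class 0: the potential commutes with it, and the derivative falls
    on u or on F. *)
Lemma opA_conv k ka F u g : asum F -> (forall p, cls p != 0 -> F p = 0) -> h1 u -> asum u -> J g ->
  asum (fun p => (fr p + ka) * F p) ->
  A (k + ka) (conv F u) g = conv F (A k u) g + conv (fun p => (fr p + ka) * F p) u g.
Proof.
move=> aF F0 [su lu fu] au Jg aF'; rewrite /opA Jg conv_comm //.
have [lcu _] := conv_l2 a_sum lu.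
have -> : conv F (opA J fr a al k u) g = csum (fun g' => F (g - g') * (fr g' * u g')) + (k * conv F u g + al * conv F (conv a u) g).
  rewrite /(conv F u) /(conv F (conv a u)) -!csumZ; try exact: asum_convl2.
  rewrite -!csumD; try by [exact: asum_convl2 | apply: asumZ; exact: asum_convl2 | apply: asumD; apply: asumZ; exact: asum_convl2].
  congr csum; apply/funext => h; rewrite /opA.
  have [gh|gh] := eqVneq (cls (g - h)) 0; last by rewrite F0 //; ring.
  have -> : J h by move: gh; rewrite clsB => /eqP; rewrite subr_eq0 /J => /eqP <-.
  rewrite /= /conv; ring.
have -> : conv (fun p => (fr p + ka) * F p) u g = fr g * conv F u g - csum (fun g' => F (g - g') * (fr g' * u g')) + ka * conv F u g.
  rewrite /(conv F u) -!csumZ; try exact: asum_convl2.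
  rewrite -[- csum _]mulN1r -csumZ; last exact: asum_convl2.
  rewrite -!csumD; try by [apply: asumZ; exact: asum_convl2 | apply: asumD; apply: asumZ; exact: asum_convl2].
  by congr csum; apply/funext => h; rewrite frB; ring.
by ring.
Qed.

Variables (K : C) (dl : R).
Hypothesis fr_gap : forall p, cls p = 0 -> p != 0 -> dl <= modulus (fr p).
Hypothesis fr_gap2 : forall p, cls p = 0 -> dl <= modulus (fr p + 2 * K).
Hypothesis dl0 : 0 < dl.

(** A periodic multiplier that solves (2 D_zbar + ka) F = m moves u to the parameter K + ka up to
    the error m u; the second multiplier, applied to v, produces the same error because u and v are
    parallel. *)
Lemma isotropic_kernel u : h1 u -> (exists g, u g != 0) -> asum u -> (forall g, A K u g = 0) ->
  csum (fun g => u g * u g) = 0 ->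
  exists2 r : R, 0 < r & forall ka, ka != 0 -> modulus ka < r ->
    exists f, [/\ h1 f, n2 f <> 0 & forall g, A (K + ka) f g = 0].
Proof.
move=> hu [q0 uq0] au Au iso.
have [su lu fu] := hu.
have Jq0 : J q0 by apply: contraNT uq0 => /su ->.
pose v := refl u; have [hv nv] := refl_h1 hu; have [sv lv fv] := hv.
have Av g : A (- K) v g = 0 by rewrite refl_opA // /refl Au mulr0 oppr0.
have fr0 : fr 0 = 0 by apply: (addrI (fr 0)); rewrite -frD !addr0.
(* For r <> 0 the symbol of the Wronskian equation is nonzero by the gap; at r = 0 the Wronskian is
   minus the sum of squares, 0 by assumption. *)
have w0 r : cls r = 0 -> wronskian u v r = 0.
  move=> r0; have [->|rn] := eqVneq r 0; last first.
    have := wron_eq hu hv au r0 Au Av; rewrite addrK => /eqP; rewrite mulf_eq0 => /orP[/eqP z|/eqP //].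
    by have := fr_gap r0 rn; rewrite z mod0 leNgt dl0.
  rewrite -[RHS]oppr0 -iso -mulN1r -csumZ; last exact: l2_mul.
  congr csum; apply/funext => g; rewrite /v /refl sub0r epsN opprK.
  have [Jg|nJ] := boolP (J g); last by rewrite su //; ring.
  by transitivity (- (eps g * eps g) * (u g * u g)); [ring | rewrite eps_sq].
have av : asum v.
  apply: asum_le (asum_inj oppr_inj au) => g; rewrite /v /refl modM ler_piMl ?mod_ge0 //; exact: mod_eps.
(* The coefficients of one component of v and of u, multiplied by the character of q0 so that they
   become periodic. Since u q0 <> 0, m does not vanish at p = 0. *)
pose m p := if cls p == 0 then v (p - q0) else 0.
pose n p := if cls p == 0 then u (p - q0) else 0.
have am : asum m.
  apply: asum_le (asum_inj (fun x y : G => @addIr _ (- q0) x y) av) => p; rewrite /m.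
  by case: ifP; rewrite ?mod0 ?mod_ge0.
have an : asum n.
  apply: asum_le (asum_inj (fun x y : G => @addIr _ (- q0) x y) au) => p; rewrite /n.
  by case: ifP; rewrite ?mod0 ?mod_ge0.
have mn g : J g -> conv m u g = conv n v g.
  move=> Jg; pose r := g - q0.
  have inv x : r - (r - x) = x by rewrite subKr.
  have anv : asum (fun g' => n (g - g') * v g') by apply: asum_convl2.
  rewrite {2}/conv -(@csum_bij _ _ _ (fun x => r - x) (fun x => r - x)) //.
  have E1 x : m (g - x) * u x = if cls x == cls g then u x * v (r - x) else 0.
    rewrite /m clsB subr_eq0 eq_sym; case: eqP => _; last by rewrite mul0r.
    by rewrite mulrC addrAC.
  have E2 x : n (g - (r - x)) * v (r - x) = if cls x == - cls q0 then u x * v (r - x) else 0.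
    rewrite /n; have -> : g - (r - x) = q0 + x by rewrite /r opprB opprB addrCA [g + _]addrCA subrr addr0 addrC.
    rewrite clsD [cls q0 + _]addrC addr_eq0; case: eqP => _; last by rewrite mul0r.
    by rewrite [q0 + x]addrC addrK.
  have av1 : asum (fun x => u x * v (r - x)).
    by apply: l2_mul => //; apply: (bsum_inj (sq_ge0 v) _ lv) => p q /addrI /oppr_inj.
  have aP (P : G -> bool) : asum (fun x => if P x then u x * v (r - x) else 0).
    by apply: asum_le av1 => x; case: ifP; rewrite ?mod0 ?mod_ge0.
  apply/eqP; rewrite -subr_eq0 -mulN1r -csumZ; last first.
    by rewrite (_ : (fun x => _) = fun x => if cls x == - cls q0 then u x * v (r - x) else 0) //; exact/funext.
  rewrite /conv -csumD; last 2 first.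
  - by rewrite (_ : (fun x => _) = fun x => if cls x == cls g then u x * v (r - x) else 0) //; exact/funext.
  - apply: asumZ; by rewrite (_ : (fun x => _) = fun x => if cls x == - cls q0 then u x * v (r - x) else 0) //; exact/funext.
  (* In the component that also defines m and n, m u = n v is trivial; in the other one it is the
     vanishing of the Wronskian at g - q0. *)
  have [e|ne] := eqVneq (cls g) (- cls q0).
    by rewrite csum0 // => x; rewrite E1 E2 e mulN1r subrr.
  have gq : cls g = cls q0.
    move: Jg Jq0 ne; rewrite /J; case: (Z3P (cls g)) => -> //= _; case: (Z3P (cls q0)) => -> //= _;
    by rewrite ?opprK eqxx.
  have r0 : cls r = 0 by rewrite /r clsB gq subrr.
  rewrite -[0](mulr0 (eps q0)) -(w0 r r0) /wronskian -csumZ; last first.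
    apply: asum_le av1 => x; rewrite !modM -mulrA ler_piMl ?mulr_ge0 ?mod_ge0 //; exact: mod_eps.
  apply/eqP; congr csum; apply/funext => x; rewrite E1 E2 gq.
  have [Jx|nJ] := boolP (J x); last by rewrite su //; case: ifP => _; case: ifP => _; ring.
  move: Jx Jq0; rewrite /J /eps; case: (Z3P (cls x)) => -> //= _; case: (Z3P (cls q0)) => -> //= _;
    rewrite ?opprK ?eqxx /=; ring.
have u1 : 0 < modulus (u q0) by exact: mod_gt0.
pose Nm := rsum (fun p => modulus (m p)); pose Nn := rsum (fun p => modulus (n p)).
have Nm0 : 0 <= Nm by apply: rsum_ge0 => // t; exact: mod_ge0.
have Nn0 : 0 <= Nn by apply: rsum_ge0 => // t; exact: mod_ge0.
pose Bu := n2 u + 1.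
have Bu0 : 0 < Bu by rewrite /Bu ltr_pwDr // n2_ge0.
have ub t : modulus (u t) <= Bu by exact: l2_bdd.
have vb t : modulus (v t) <= Bu by rewrite /Bu -nv; exact: l2_bdd.
(* Bounds, at frequency q0, all of F u - F' v except the term F(0) u(q0): away from the small
   denominator ka all denominators are at least dl / 2. *)
pose L := 2 / dl * (Nm + Nn) * Bu.
have d20 : 0 <= 2 / dl by rewrite divr_ge0 // ltW.
have L0 : 0 <= L by apply: mulr_ge0; [apply: mulr_ge0 => //; exact: addr_ge0 | exact: ltW].
exists (Num.min (dl / 2) (modulus (u q0) ^+ 2 / (L + 1))).
  by rewrite lt_min !divr_gt0 // ?exprn_gt0 // ltr_pwDr.
move=> ka ka0; rewrite lt_min => /andP[kd kL].
have k0 := mod_gt0 ka0.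
have gap1 p : cls p = 0 -> p != 0 -> dl / 2 <= modulus (fr p + ka).
  move=> p0 pn; have := modB (fr p + ka) ka; rewrite addrK; have := fr_gap p0 pn; lra.
have gap2 p : cls p = 0 -> dl / 2 <= modulus (fr p + (2 * K + ka)).
  move=> p0; have := modB (fr p + 2 * K + ka) ka; rewrite addrK -addrA; have := fr_gap2 p0; lra.
pose F p := m p / (fr p + ka); pose F' p := n p / (fr p + (2 * K + ka)).
(* The term p = 0 is split off: its denominator is ka, so F(0) u(q0) has modulus |u(q0)|^2 / |ka|
   and dominates [L] for small ka. This is why the combination does not vanish. *)
pose F0 (p : G) := if p == 0 then 0 else F p.
have iv z : dl / 2 <= modulus z -> modulus z^-1 <= 2 / dl.
  move=> h; have d2 : 0 < dl / 2 by rewrite divr_gt0.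
  rewrite modV -[2 / dl]invrK invfM invrK [_^-1 * _]mulrC lef_pV2 ?posrE //; exact: lt_le_trans h.
have F0b p : modulus (F0 p) <= 2 / dl * modulus (m p).
  rewrite /F0 /F; case: eqP => [|/eqP pn]; first by rewrite mod0 mulr_ge0 ?mod_ge0 ?divr_ge0 ?(ltW dl0).
  have [p0|p0] := eqVneq (cls p) 0; last by rewrite /m (negPf p0) mul0r mod0 mulr0.
  by rewrite modM mulrC ler_wpM2r ?mod_ge0 // iv // gap1.
have F'b p : modulus (F' p) <= 2 / dl * modulus (n p).
  have [p0|p0] := eqVneq (cls p) 0; last by rewrite /F' /n (negPf p0) mul0r mod0 mulr0.
  by rewrite /F' modM mulrC ler_wpM2r ?mod_ge0 // iv // gap2.
have aF0 : asum F0 by apply: asum_le (bsumZ d20 am) => p; exact: F0b.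
have aF' : asum F' by apply: asum_le (bsumZ d20 an) => p; exact: F'b.
pose Fd (p : G) := if p == 0 then F 0 else 0.
have aFd : asum Fd by apply: (@asum_fin _ _ _ [fset (0%R : G)]%fset) => p; rewrite !inE /Fd => /negPf ->.
have FE : F = fun p => Fd p + F0 p.
  by apply/funext => p; rewrite /Fd /F0; case: eqP => [->|_]; rewrite ?addr0 ?add0r.
have aF : asum F by rewrite FE; exact: asumD.
have Fc p : cls p != 0 -> F p = 0 by move=> /negPf pn; rewrite /F /m pn mul0r.
have F'c p : cls p != 0 -> F' p = 0 by move=> /negPf pn; rewrite /F' /n pn mul0r.
have Fm : (fun p => (fr p + ka) * F p) = m.
  apply/funext => p; rewrite /F /m; case: eqP => p0; last by rewrite mul0r mulr0.
  rewrite mulrC divfK //; apply/eqP => z; have [pz|pn] := eqVneq p 0.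
    by move: z ka0; rewrite pz fr0 add0r => ->; rewrite eqxx.
  by have := gap1 p p0 pn; rewrite z mod0 leNgt divr_gt0.
have Fn : (fun p => (fr p + (2 * K + ka)) * F' p) = n.
  apply/funext => p; rewrite /F' /n; case: eqP => p0; last by rewrite mul0r mulr0.
  rewrite mulrC divfK //; apply/eqP => z.
  by have := gap2 p p0; rewrite z mod0 leNgt divr_gt0.
have z0 (b : G -> C) g : conv b (fun=> 0) g = 0 by rewrite /conv csum0 // => t; rewrite mulr0.
have AF g : J g -> A (K + ka) (conv F u) g = conv m u g.
  move=> Jg; rewrite opA_conv // Fm // (_ : A K u = fun=> 0) ?z0 ?add0r //; exact/funext.
have AF' g : J g -> A (K + ka) (conv F' v) g = conv n v g.
  move=> Jg; have -> : K + ka = - K + (2 * K + ka) by ring.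
  rewrite opA_conv // Fn // (_ : A (- K) v = fun=> 0) ?z0 ?add0r //; exact/funext.
pose f g := conv F u g + (-1) * conv F' v g.
have [lFu _] := conv_l2 aF lu; have [lFv _] := conv_l2 aF' lv.
have lf : l2 f by apply: l2D => //; exact: l2Z.
have sconv (b w : G -> C) : (forall p, cls p != 0 -> b p = 0) -> supp J w -> supp J (conv b w).
  move=> bc sw g /negPn/eqP g0; rewrite /conv csum0 // => t.
  have [t0|t0] := eqVneq (cls t) 0; first by rewrite sw ?mulr0 // /J t0 eqxx.
  by rewrite bc ?mul0r // clsB g0 sub0r oppr_eq0.
have sf : supp J f.
  by move=> g Jg; rewrite /f (sconv F u Fc su) // (sconv F' v F'c sv) //; ring.
have Af g : A (K + ka) f g = 0.
  have [Jg|nJ] := boolP (J g); last by rewrite opA_supp.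
  rewrite opAD // ?opAZ ?AF ?AF' ?mn //; first by ring.
  exact: l2Z.
have hf : h1 f.
  apply: (h1_of (al := al) (k := K + ka) a_sum sf lf _).1.
  by apply: (@bsum_fin _ _ _ fset0) => // t _; rewrite /sq Af mod0 expr0n.
exists f; split=> //; move=> /(n2_eq0 lf)/(_ q0); rewrite /f FE.
have -> : conv (fun p => Fd p + F0 p) u q0 = F 0 * u q0 + conv F0 u q0.
  have -> : F 0 * u q0 = conv Fd u q0.
    rewrite /conv (@csum1 _ _ _ q0); first by rewrite subrr /Fd eqxx.
    by move=> t tq; rewrite /Fd subr_eq0 eq_sym (negPf tq) mul0r.
  rewrite /conv -csumD; try exact: asum_convl2.
  by congr csum; apply/funext => t; rewrite mulrDl.
have cb (b w q : G -> C) (B : R) : (forall t, modulus (w t) <= B) -> asum q -> (forall p, modulus (b p) <= 2 / dl * modulus (q p)) ->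
    modulus (conv b w q0) <= 2 / dl * rsum (fun p => modulus (q p)) * B.
  move=> wB aq bq; have B0 : 0 <= B by rewrite (le_trans _ (wB q0)) // mod_ge0.
  apply: csum_ler => S.
  rewrite -(rsum_shift q0 (fun t => mod_ge0 (q t)) aq) mulrAC.
  apply: (@le_trans _ _ (2 / dl * B * rpsum (fun t => modulus (q (q0 - t))) S)).
    rewrite /rpsum mulr_sumr; apply: ler_sum => t _; rewrite modM mulrAC.
    by apply: ler_pM; rewrite ?mod_ge0.
  apply: ler_wpM2l; first exact: mulr_ge0.
  apply: rpsum_rsum; last exact: (asum_shift q0 aq).
  by move=> t; exact: mod_ge0.
have b1 := cb _ _ _ _ ub am F0b; have b2 := cb _ _ _ _ vb an F'b.
have F00 : modulus (F 0 * u q0) = modulus (u q0) ^+ 2 / modulus ka.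
  rewrite /F /m cls0 eqxx fr0 !add0r /v /refl opprK epsN !modM modN modV.
  have := eps_sq Jq0 => /(congr1 (@modulus R)); rewrite modM (mod_rc 1) normr1 => e.
  have e1 : modulus (eps q0) = 1.
    by have := mod_ge0 (eps q0); move: e; set y := modulus _ => e y0; nra.
  by rewrite e1 mul1r; ring.
move=> z; have : modulus (F 0 * u q0) <= L.
  have -> : F 0 * u q0 = conv F' v q0 - conv F0 u q0.
    by apply/eqP; rewrite -subr_eq0 -[X in _ == X]z; apply/eqP; ring.
  have -> : L = 2 / dl * Nn * Bu + 2 / dl * Nm * Bu by rewrite /L; ring.
  by rewrite (le_trans (modB _ _)) // lerD.
rewrite F00 ler_pdivrMr // leNgt => /negP; apply.
by move: kL; rewrite ltr_pdivlMr; [have := k0; nra | rewrite ltr_pwDr].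
Qed.

Hypothesis fr_coer : forall M : R, exists S : {fset G}, forall g, g \notin S -> M <= modulus (fr g).
Variable jn : nat -> G.
Hypothesis jnI : injective jn.
Hypothesis jnJ : forall i, J (jn i).

Lemma is_min_exists k : exists s, is_min J fr a al k s.
Proof.
have [U [S tb]] := takagi_basis_exists al fr_coer a_even a_sum jnI jnJ k.
exists (S 0%N); have [t0 _ mn] := tb 0%N; split; first by case: t0.
by split; [exists (U 0%N) | move=> phi hp; exact: mn].
Qed.

(** If s > 0, A_k would be bounded below, while the points K + ka with nontrivial kernel form an
    infinite bounded set, against [eigvalues_discrete]. *)
Lemma isotropic_magic u : h1 u -> (exists g, u g != 0) -> asum u -> (forall g, A K u g = 0) ->
  csum (fun g => u g * u g) = 0 -> forall k s, is_min J fr a al k s -> s = 0.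
Proof.
move=> hu un au Au iso k s [s0 [_ mn]].
have [r r0 hr] := isotropic_kernel hu un au Au iso.
apply/eqP; apply/negPn/negP => sn; have s1 : 0 < s by rewrite lt_def sn.
(* Starting at r / 2 keeps all values strictly below r. *)
pose ka (n : nat) : R := r / n.+2%:R.
have ka0 n : 0 < ka n by rewrite divr_gt0.
have /choice[x hx] : forall n, exists f, [/\ h1 f, n2 f <> 0 & forall g, A (K + rc (ka n)) f g = 0].
  move=> n; apply: hr.
    by apply/eqP => /(congr1 (@complex.Re R)) /= e; have := ka0 n; rewrite e ltxx.
  rewrite mod_rc gtr0_norm // /ka ltr_pdivrMr // ltr_pMr // ltr1n //.
apply: (@eigvalues_discrete _ _ J fr a al fr_coer a_sum x (fun n => K + rc (ka n)) (modulus K + r) _ _ _ _ _ k s s1 mn).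
- by move=> n; case: (hx n).
- by move=> n; case: (hx n).
- by move=> n; case: (hx n).
- move=> n n' /addrI /(congr1 (@complex.Re R)) /= e.
  have : r^-1 * ka n = r^-1 * ka n' by rewrite e.
  rewrite /ka !mulrA mulVf ?gt_eqF // !mul1r => /invr_inj /eqP; rewrite eqr_nat => /eqP[] //.
- move=> n; rewrite (le_trans (modD _ _)) // lerD2l mod_rc gtr0_norm // /ka ler_pdivrMr // ler_peMr ?(ltW r0) //.
  by rewrite ler1n.
Qed.
End Wronskian.

(** * Integration over the plane and over a fundamental cell *)

Section PlaneIntegral.
Variable R : realType.
Local Notation C := R[i].
Local Notation mR := (measurableTypeR R).
Local Notation T := (measurableTypeR R * measurableTypeR R)%type.
Local Notation mu := (@plane R).
Local Notation Re := (@complex.Re R).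
Local Notation Im := (@complex.Im R).
Implicit Types (F H : R * R -> C).

Lemma ae_imp (P Q : R * R -> Prop) : (forall p, P p -> Q p) ->
  {ae mu, forall p, P p} -> {ae mu, forall p, Q p}.
Proof. by move=> h; apply: negligibleS => p /= nq /h. Qed.

Lemma ae_imp2 (P Q S : R * R -> Prop) : (forall p, P p -> Q p -> S p) ->
  {ae mu, forall p, P p} -> {ae mu, forall p, Q p} -> {ae mu, forall p, S p}.
Proof.
move=> h hp hq; apply: negligibleS (negligibleU hp hq) => p /= ns.
by apply: contrapT => /not_orP[/contrapT p1 /contrapT q1]; exact/ns/h.
Qed.

Definition shift (t p : R * R) : R * R := (p.1 + t.1, p.2 + t.2).

Lemma measurable_fun_addr (t : R) : measurable_fun setT (fun x : mR => x + t : mR).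
Proof. exact: measurable_funD. Qed.

Lemma lebesgue_shift (t : R) (A : set mR) : measurable A ->
  lebesgue_measure ((fun x : mR => x + t : mR) @^-1` A) = lebesgue_measure A.
Proof.
move=> mA.
pose phi := fun x : mR => x + t : mR.
have mphi : measurable_fun setT phi by exact: measurable_fun_addr.
pose m := mfun_Sub (mem_set mphi : phi \in mfun).
rewrite -[LHS]/(pushforward lebesgue_measure m A); apply/esym.
apply: lebesgue_measure_unique => // X [[a b] _ <-].
have E : phi @^-1` `]a, b]%classic = `]a - t, b - t]%classic.
  by apply/seteqP; split => x /=; rewrite !in_itv /= /phi => /andP[x1 x2]; apply/andP; split; lra.
rewrite -[RHS]/(lebesgue_measure (phi @^-1` `]a, b]%classic)) E.
rewrite !lebesgue_measure_itv /= !lte_fin ltrD2r; case: ifP => // _.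
by rewrite -!EFinB; congr (_%:E); ring.
Qed.

Lemma measurable_shift t : measurable_fun setT (shift t : T -> T).
Proof.
apply/measurable_fun_pairP; split.
  by apply: (measurable_funD (f := fun p : T => p.1 : mR)) => //; exact: measurable_fst.
by apply: (measurable_funD (f := fun p : T => p.2 : mR)) => //; exact: measurable_snd.
Qed.

Lemma planeX (A B : set mR) : measurable A -> measurable B ->
  mu (A `*` B) = (lebesgue_measure A * lebesgue_measure B)%E.
Proof. by move=> mA mB; exact: product_measure1E. Qed.

Lemma plane_shift t (A : set T) : measurable A -> mu (shift t @^-1` A) = mu A.
Proof.
move=> mA.
pose m := mfun_Sub (mem_set (measurable_shift t) : (shift t : T -> T) \in mfun).
rewrite -[LHS]/(pushforward mu m A); apply/esym; apply: product_measure_unique => // A1 A2 m1 m2.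
rewrite -[LHS]/(mu (((fun x : mR => x + t.1 : mR) @^-1` A1) `*` ((fun x : mR => x + t.2 : mR) @^-1` A2))).
have p1 : measurable ((fun x : mR => x + t.1 : mR) @^-1` A1).
  by have := measurable_fun_addr t.1 measurableT m1; rewrite setTI.
have p2 : measurable ((fun x : mR => x + t.2 : mR) @^-1` A2).
  by have := measurable_fun_addr t.2 measurableT m2; rewrite setTI.
by rewrite planeX // !lebesgue_shift.
Qed.

Definition mC F := measurable_fun [set: T] (fun p : T => Re (F p)) /\
  measurable_fun [set: T] (fun p : T => Im (F p)).
Definition ok F := mu.-integrable setT (fun p : T => (Re (F p))%:E) /\
  mu.-integrable setT (fun p : T => (Im (F p))%:E).
Definition plint F : C := ((\int[mu]_p (Re (F p)))%R +i* (\int[mu]_p (Im (F p)))%R)%C.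
Definition ind (D : set (R * R)) (p : R * R) : C := if p \in D then 1 else 0.

Lemma cintegralE (D : set (R * R)) (f : C -> C) :
  cintegral D f = plint (fun p => ind D p * f (to_C p)).
Proof.
rewrite /cintegral /plint; congr (_ +i* _)%C; rewrite Rintegral_mkcond; apply: eq_Rintegral => p _;
  rewrite /= patchE /ind; case: ifP => _; rewrite ?mul1r ?mul0r //.
Qed.

Lemma mC_ok F : ok F -> mC F.
Proof. by move=> [/measurable_int h1 /measurable_int h2]; split; exact/measurable_EFinP. Qed.

Lemma mC_rc (f : R * R -> R) : measurable_fun [set: T] (f : T -> R) -> mC (fun p => rc (f p)).
Proof. by move=> mf; split. Qed.

Lemma mC_cst c : mC (fun=> c). Proof. by split; exact: measurable_cst. Qed.

Lemma mCD F H : mC F -> mC H -> mC (fun p => F p + H p).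
Proof.
move=> [f1 f2] [h1 h2]; split.
  rewrite (_ : (fun p => _) = fun p : T => Re (F p) + Re (H p)); first exact: measurable_funD.
  by apply/funext => p; case: (F p) => a b; case: (H p).
rewrite (_ : (fun p => _) = fun p : T => Im (F p) + Im (H p)); first exact: measurable_funD.
by apply/funext => p; case: (F p) => a b; case: (H p).
Qed.

Lemma mCM F H : mC F -> mC H -> mC (fun p => F p * H p).
Proof.
move=> [f1 f2] [h1 h2]; split.
  rewrite (_ : (fun p => _) = fun p : T => Re (F p) * Re (H p) - Im (F p) * Im (H p)).
    by apply: measurable_funB; exact: measurable_funM.
  by apply/funext => p; case: (F p) => a b; case: (H p).
rewrite (_ : (fun p => _) = fun p : T => Re (F p) * Im (H p) + Im (F p) * Re (H p)).
  by apply: measurable_funD; exact: measurable_funM.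
by apply/funext => p; case: (F p) => a b; case: (H p).
Qed.

Lemma mC_conj F : mC F -> mC (fun p => conjc (F p)).
Proof.
move=> [f1 f2]; split.
  by rewrite (_ : (fun p => _) = fun p : T => Re (F p)) //; apply/funext => p; case: (F p).
rewrite (_ : (fun p => _) = fun p : T => - Im (F p)); first exact: measurableT_comp.
by apply/funext => p; case: (F p).
Qed.

Lemma mC_ind (D : set T) : measurable D -> mC (ind D).
Proof.
move=> mD; split.
  rewrite (_ : (fun p => _) = \1_D) //; apply/funext => p; rewrite indicE /ind.
  by case: (p \in D).
rewrite (_ : (fun p => _) = cst 0) //; apply/funext => p; rewrite /ind.
by case: (p \in D).
Qed.

Lemma mC_shift t F : mC F -> mC (fun p => F (shift t p)).
Proof.
move=> [f1 f2]; split.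
  exact: (measurableT_comp (f := fun p : T => Re (F p)) f1 (measurable_shift t)).
exact: (measurableT_comp (f := fun p : T => Im (F p)) f2 (measurable_shift t)).
Qed.

Lemma mC_sum (J : Type) (r : seq J) (F : J -> R * R -> C) : (forall j, mC (F j)) ->
  mC (fun p => \sum_(j <- r) F j p).
Proof.
move=> h; elim: r => [|j r IH].
  by rewrite (_ : (fun p => _) = fun=> 0); [exact: mC_cst | apply/funext => p; rewrite big_nil].
rewrite (_ : (fun p => _) = fun p => F j p + \sum_(j <- r) F j p); first exact: mCD.
by apply/funext => p; rewrite big_cons.
Qed.

Lemma mC_lim (Fn : nat -> R * R -> C) F : (forall n, mC (Fn n)) ->
  (forall p e, 0 < e -> exists N, forall n, (N <= n)%N -> modulus (Fn n p - F p) <= e) -> mC F.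
Proof.
move=> mFn h; split.
  apply: (@measurable_fun_cvg _ _ _ setT (fun n (p : T) => Re (Fn n p))) => //.
    by move=> n; case: (mFn n).
  move=> p _; apply/cvgrPdist_le => e e0; have [N hN] := h p e e0.
  exists N => // n /= Nn; rewrite distrC; apply: le_trans (hN n Nn).
  by have := ReE_le (Fn n p - F p); case: (Fn n p) => a b; case: (F p).
apply: (@measurable_fun_cvg _ _ _ setT (fun n (p : T) => Im (Fn n p))) => //.
  by move=> n; case: (mFn n).
move=> p _; apply/cvgrPdist_le => e e0; have [N hN] := h p e e0.
exists N => // n /= Nn; rewrite distrC; apply: le_trans (hN n Nn).
by have := ImE_le (Fn n p - F p); case: (Fn n p) => a b; case: (F p).
Qed.

Lemma mC_mod F : mC F -> measurable_fun [set: T] (fun p : T => modulus (F p)).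
Proof.
move=> [f1 f2]; rewrite (_ : (fun p => _) = fun p : T => Num.sqrt (Re (F p) ^+ 2 + Im (F p) ^+ 2)).
  apply: (measurableT_comp (f := @Num.sqrt R : mR -> mR)); last by apply: measurable_funD; exact: measurable_funX.
  by apply: continuous_measurable_fun; exact: sqrt_continuous.
by apply/funext => p; rewrite /modulus; case: (F p).
Qed.

Definition okr (h : R * R -> R) := mu.-integrable [set: T] (fun p : T => (h p)%:E).

Lemma ok_le F h : mC F -> okr h -> (forall p, modulus (F p) <= h p) -> ok F.
Proof.
move=> [f1 f2] ih Fh; split.
  apply: (le_integrable measurableT _ _ ih); first exact/measurable_EFinP.
  move=> p _; rewrite lee_fin /=; apply: le_trans (ReE_le _) _.
  by apply: le_trans (Fh p) _; exact: ler_norm.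
apply: (le_integrable measurableT _ _ ih); first exact/measurable_EFinP.
move=> p _; rewrite lee_fin /=; apply: le_trans (ImE_le _) _.
by apply: le_trans (Fh p) _; exact: ler_norm.
Qed.

Lemma okr_mod F : ok F -> okr (fun p => modulus (F p)).
Proof.
move=> oF; have mF := mC_mod (mC_ok oF); case: oF => f1 f2.
have h1 := integrable_norm f1; have h2 := integrable_norm f2.
apply: (le_integrable measurableT _ _ (integrableD measurableT h1 h2)); first exact/measurable_EFinP.
move=> p _; rewrite /= lee_fin ger0_norm ?mod_ge0 //.
by rewrite (le_trans (mod_le _)) // ler_norm.
Qed.

Lemma okD F H : ok F -> ok H -> ok (fun p => F p + H p).
Proof.
move=> oF oH; have := integrableD measurableT (okr_mod oF) (okr_mod oH) => h.
apply: (ok_le (h := fun p => modulus (F p) + modulus (H p))) => //; first by apply: mCD; exact: mC_ok.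
by move=> p; exact: modD.
Qed.

Lemma okr_Z c h : okr h -> okr (fun p => c * h p).
Proof.
move=> oh; have := integrableZl measurableT c oh; apply: eq_integrable => //.
Qed.

Lemma okrD h k : okr h -> okr k -> okr (fun p => h p + k p).
Proof. by move=> oh ok'; exact: (integrableD measurableT oh ok'). Qed.

Lemma okZ c F : ok F -> ok (fun p => c * F p).
Proof.
move=> oF; apply: (ok_le (h := fun p => modulus c * modulus (F p))).
- by apply: mCM; [exact: mC_cst | exact: mC_ok].
- by apply: okr_Z; exact: okr_mod.
- by move=> p; rewrite modM.
Qed.

Lemma ok_bddM F H (B : R) : mC H -> (forall p, modulus (H p) <= B) -> ok F -> ok (fun p => H p * F p).
Proof.
move=> mH HB oF; apply: (ok_le (h := fun p => B * modulus (F p))).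
- by apply: mCM => //; exact: mC_ok.
- by apply: okr_Z; exact: okr_mod.
- by move=> p; rewrite modM ler_wpM2r ?mod_ge0.
Qed.

Lemma ok_conj F : ok F -> ok (fun p => conjc (F p)).
Proof.
move=> oF; apply: ok_le (okr_mod oF) _; first by apply: mC_conj; exact: mC_ok.
by move=> p; rewrite mod_conj.
Qed.

Lemma plintD F H : ok F -> ok H -> plint (fun p => F p + H p) = plint F + plint H.
Proof.
move=> [f1 f2] [h1 h2]; rewrite /plint.
have -> : (fun p : T => Re (F p + H p)) = (fun p : T => Re (F p) + Re (H p)).
  by apply/funext => p; case: (F p) => a b; case: (H p).
have -> : (fun p : T => Im (F p + H p)) = (fun p : T => Im (F p) + Im (H p)).
  by apply/funext => p; case: (F p) => a b; case: (H p).
by rewrite !RintegralD.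
Qed.

Lemma plintZ c F : ok F -> plint (fun p => c * F p) = c * plint F.
Proof.
move=> [f1 f2]; rewrite /plint; case: c => a b.
have -> : (fun p : T => Re ((a +i* b)%C * F p)) = (fun p : T => a * Re (F p) - b * Im (F p)).
  by apply/funext => p; case: (F p).
have -> : (fun p : T => Im ((a +i* b)%C * F p)) = (fun p : T => a * Im (F p) + b * Re (F p)).
  by apply/funext => p; case: (F p).
have Z c h : mu.-integrable [set: T] (fun p : T => (h p)%:E) -> mu.-integrable [set: T] (fun p : T => (c * h p)%:E).
  exact: okr_Z.
rewrite RintegralB ?RintegralD ?RintegralZl //; try exact: Z.
Qed.

Lemma plintN F : ok F -> plint (fun p => - F p) = - plint F.
Proof.
by move=> oF; rewrite -mulN1r -plintZ //; congr plint; apply/funext => p; rewrite mulN1r.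
Qed.

Lemma okN F : ok F -> ok (fun p => - F p).
Proof. by move=> /(okZ (-1)); congr ok; apply/funext => p; rewrite mulN1r. Qed.

Lemma plint_conj F : ok F -> plint (fun p => conjc (F p)) = conjc (plint F).
Proof.
move=> [f1 f2]; rewrite /plint /=; congr (_ +i* _)%C.
  by apply: eq_Rintegral => p _; case: (F p).
rewrite -mulN1r -RintegralZl //; apply: eq_Rintegral => p _; rewrite mulN1r.
by case: (F p).
Qed.

Lemma plint0 : plint (fun=> 0) = 0.
Proof. by rewrite /plint /= /Rintegral integral0_eq. Qed.

Lemma plint_sum (J : Type) (r : seq J) (F : J -> R * R -> C) : (forall j, ok (F j)) ->
  ok (fun p => \sum_(j <- r) F j p) /\ plint (fun p => \sum_(j <- r) F j p) = \sum_(j <- r) plint (F j).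
Proof.
move=> h; elim: r => [|j r [IH1 IH2]].
  rewrite (_ : (fun p => _) = fun=> 0); last by apply/funext => p; rewrite big_nil.
  rewrite big_nil plint0; split=> //; split; exact: integrable0.
rewrite (_ : (fun p => _) = fun p => F j p + \sum_(j <- r) F j p); last by apply/funext => p; rewrite big_cons.
by split; [exact: okD | rewrite plintD // IH2 big_cons].
Qed.

(** The factor 2 arises from bounding the real and the imaginary part separately. *)
Lemma plint_le F h : mC F -> okr h -> (forall p, modulus (F p) <= h p) ->
  modulus (plint F) <= 2 * \int[mu]_p (h p).
Proof.
move=> mF ih Fh; have [f1 f2] := ok_le mF ih Fh.
have b (k : T -> R) : mu.-integrable [set: T] (fun p : T => (k p)%:E) -> (forall p, `|k p| <= modulus (F p)) ->
    `|\int[mu]_p (k p)| <= \int[mu]_p (h p).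
  move=> ik kF; apply: le_trans (le_normr_Rintegral measurableT ik) _.
  apply: le_Rintegral => //; first exact: integrable_norm.
  by move=> p _; rewrite (le_trans (kF p)).
apply: le_trans (mod_le _) _; rewrite /plint /= mulrDl mul1r; apply: lerD; apply: b => // p.
  exact: ReE_le.
exact: ImE_le.
Qed.

Lemma plint_real (h : R * R -> R) : okr h -> plint (fun p => rc (h p)) = rc (\int[mu]_p (h p)).
Proof. by move=> oh; congr (_ +i* _)%C; rewrite /Rintegral integral0_eq. Qed.

Lemma plint_ae F H : mC F -> mC H -> {ae mu, forall p, F p = H p} -> plint F = plint H.
Proof.
move=> [f1 f2] [h1 h2] ae; rewrite /plint /Rintegral; congr (fine _ +i* fine _)%C.
  apply: (@ae_eq_integral _ _ _ mu setT) => //; [exact/measurable_EFinP|exact/measurable_EFinP|].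
  by apply: (ae_imp _ ae) => p -> _.
apply: (@ae_eq_integral _ _ _ mu setT) => //; [exact/measurable_EFinP|exact/measurable_EFinP|].
by apply: (ae_imp _ ae) => p -> _.
Qed.

Lemma ok_ae F H : mC H -> ok F -> {ae mu, forall p, F p = H p} -> ok H.
Proof.
move=> mH oF ae; have mF := mC_ok oF; have := okr_mod oF => oM.
have mMH := mC_mod mH; have mMF := mC_mod mF.
have key : okr (fun p => modulus (H p)).
  apply/integrableP; split; first exact/measurable_EFinP.
  move/integrableP: oM => [_]; apply: le_lt_trans; rewrite le_eqVlt; apply/orP; left; apply/eqP.
  apply: (@ae_eq_integral _ _ _ mu setT) => //.
  - by apply: measurableT_comp => //; exact/measurable_EFinP.
  - by apply: measurableT_comp => //; exact/measurable_EFinP.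
  - by apply: (ae_imp _ ae) => p -> _.
exact: ok_le mH key _.
Qed.

Lemma plint_dct (Fn : nat -> R * R -> C) F h : (forall n, mC (Fn n)) -> okr h ->
  (forall n p, modulus (Fn n p) <= h p) ->
  (forall p e, 0 < e -> exists N, forall n, (N <= n)%N -> modulus (Fn n p - F p) <= e) ->
  ok F /\ forall e, 0 < e -> exists N, forall n, (N <= n)%N -> modulus (plint (Fn n) - plint F) <= e.
Proof.
move=> mFn ih Fh lim; have mF := mC_lim mFn lim.
have Fb p : modulus (F p) <= h p.
  apply: eps_le => e e0; have [N hN] := lim p e e0.
  have -> : F p = Fn N p - (Fn N p - F p) by ring.
  by rewrite (le_trans (modB _ _)) // lerD // hN.
have oF := ok_le mF ih Fb; split=> // e e0.
have part (k : C -> R) : (forall z w, `|k z - k w| <= modulus (z - w)) -> (forall z, `|k z| <= modulus z) ->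
   (forall H, mC H -> measurable_fun [set: T] (fun p : T => k (H p))) ->
   forall e, 0 < e -> exists N, forall n, (N <= n)%N -> `|\int[mu]_p (k (Fn n p)) - \int[mu]_p (k (F p))| <= e.
  move=> k1 k2 k3 d d0.
  have ik H : mC H -> (forall p, modulus (H p) <= h p) -> mu.-integrable [set: T] (fun p : T => (k (H p))%:E).
    move=> mH Hh; have mk := k3 _ mH; apply: (le_integrable measurableT _ _ ih); first exact/measurable_EFinP.
    by move=> p _; rewrite lee_fin /=; apply: le_trans (k2 _) _; apply: le_trans (Hh p) _; exact: ler_norm.
  have mkn n : measurable_fun [set: T] (fun p : T => (k (Fn n p))%:E).
    by have mk := k3 _ (mFn n); exact/measurable_EFinP.
  have mkF : measurable_fun [set: T] (fun p : T => (k (F p))%:E).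
    by have mk := k3 _ mF; exact/measurable_EFinP.
  have [||_ _ D] := @dominated_convergence _ _ _ mu setT measurableT (fun n p => (k (Fn n p))%:E) (fun p => (k (F p))%:E)
    (fun p => (h p)%:E) mkn mkF _ ih _.
  - apply: aeW => p _; apply: cvg_EFin; first exact: nearW.
    apply/cvgrPdist_le => c c0; have [N hN] := lim p c c0; exists N => // n /= Nn.
    by rewrite distrC; apply: le_trans (k1 _ _) (hN n Nn).
  - by apply: aeW => p n _; rewrite lee_fin; apply: le_trans (k2 _) (Fh n p).
  have e1 n : (\int[mu]_p (k (Fn n p))%:E)%E = (\int[mu]_p (k (Fn n p)))%:E.
    by rewrite /Rintegral fineK //; apply: integrable_fin_num => //; exact: ik.
  have e2 : (\int[mu]_p (k (F p))%:E)%E = (\int[mu]_p (k (F p)))%:E.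
    by rewrite /Rintegral fineK //; apply: integrable_fin_num => //; exact: ik.
  rewrite e2 in D; have D' : (fun n => \int[mu]_p (k (Fn n p))) @ \oo --> \int[mu]_p (k (F p)).
    exact: (fine_cvg D).
  move/cvgrPdist_le: D' => /(_ d d0)[N _ hN]; exists N => n Nn; rewrite distrC; exact: hN.
have e2 : 0 < e / 2 by rewrite divr_gt0.
have [N1 h1] : exists N, forall n, (N <= n)%N -> `|\int[mu]_p (Re (Fn n p)) - \int[mu]_p (Re (F p))| <= e / 2.
  apply: part => //.
  - by move=> z w; have := ReE_le (z - w); case: z => a b; case: w.
  - exact: ReE_le.
  - by move=> H [].
have [N2 h2] : exists N, forall n, (N <= n)%N -> `|\int[mu]_p (Im (Fn n p)) - \int[mu]_p (Im (F p))| <= e / 2.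
  apply: part => //.
  - by move=> z w; have := ImE_le (z - w); case: z => a b; case: w.
  - exact: ImE_le.
  - by move=> H [].
exists (maxn N1 N2) => n; rewrite geq_max => /andP[n1 n2].
by rewrite (le_trans (mod_le _)) // [e]splitr lerD // ?h1 ?h2.
Qed.

Lemma plint_shift t F : ok F -> ok (fun p => F (shift t p)) /\ plint (fun p => F (shift t p)) = plint F.
Proof.
move=> oF; pose m := mfun_Sub (mem_set (measurable_shift t) : (shift t : T -> T) \in mfun).
have mE (A : set T) : measurable A -> A `<=` setT -> pushforward mu m A = mu A.
  by move=> mA _; exact: plane_shift.
have mF := mC_ok oF.
have key (k : T -> R) : mu.-integrable [set: T] (fun p : T => (k p)%:E) ->
    mu.-integrable [set: T] (fun p : T => (k (shift t p))%:E) /\ \int[mu]_p (k (shift t p)) = \int[mu]_p (k p).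
  move=> ik; have mk := measurable_int _ ik.
  have mks : measurable_fun [set: T] ((fun p : T => (k p)%:E) \o (shift t : T -> T)).
    by apply: measurableT_comp => //; exact: measurable_shift.
  have iks : mu.-integrable [set: T] (fun p : T => (k (shift t p))%:E).
    apply/integrableP; split=> //.
    have mak : measurable_fun [set: T] (fun p : T => `|(k p)%:E|%E) by apply: measurableT_comp.
    have ge0 : {in [set: T], forall p : T, (0 <= `|(k p)%:E|)%E} by move=> p _; exact: abse_ge0.
    have E0 := ge0_integral_pushforward (measurable_shift t) mu measurableT mak ge0.
    have E1 : (\int[mu]_p `|(k p)%:E| = \int[mu]_p `|(k (shift t p))%:E|)%E.
      rewrite preimage_setT in E0; apply: etrans E0.
      apply: eq_measure_integral; first exact: measurable_shift.
      by move=> mphi A mA _; apply/esym/plane_shift.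
    by move/integrableP: ik => [_]; rewrite E1.
  split=> //; rewrite /Rintegral; congr fine.
  have := integral_pushforward (measurable_shift t) (mu := mu) (D := setT) mk.
  rewrite preimage_setT => /(_ iks measurableT) <-.
  apply: eq_measure_integral; first exact: measurable_shift.
  by move=> mphi A mA _; exact: plane_shift.
case: oF => o1 o2; have [k1 k2] := key _ o1; have [k3 k4] := key _ o2.
by split; [split | rewrite /plint k2 k4].
Qed.
End PlaneIntegral.

Section PlaneCell.
Variable R : realType.
Local Notation C := R[i].
Local Notation T := (measurableTypeR R * measurableTypeR R)%type.
Local Notation mu := (@plane R).

(** Measurability is for the product sigma-algebra, so an open set is exhibited as a countable union
    of squares with rational centre and half-side. A centre within e / 4 and a half-side between e /
    4 and e / 2 give a square that contains p and lies in the ball. *)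
Lemma open_plane (A : set (R * R)) : open A -> measurable (A : set T).
Proof.
move=> oA.
pose bx (q : rat * rat * rat) : set T :=
  `]ratr q.1.1 - ratr q.2 : R, ratr q.1.1 + ratr q.2[%classic `*`
  `]ratr q.1.2 - ratr q.2 : R, ratr q.1.2 + ratr q.2[%classic.
rewrite (_ : A = \bigcup_q (if `[< bx q `<=` A >] then bx q else set0)).
  apply: countable_bigcupT_measurable => [|q]; first exact: countableP.
  by case: ifP => _ //; apply: measurableX; exact: measurable_itv.
apply/seteqP; split => [p Ap|p [q _]]; last by case: ifP => // /asboolP h /h.
have [e /= e0 eA] : exists2 e : R, 0 < e & ball p e `<=` A.
  by move: oA; rewrite openE => /(_ p Ap) /nbhs_ballP.
have i0 : e / 4 < e / 2 by lra.
have i1 : p.1 - e / 4 < p.1 + e / 4 by lra.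
have i2 : p.2 - e / 4 < p.2 + e / 4 by lra.
have [r] := rat_in_itvoo i0; rewrite in_itv /= => /andP[r1 r2].
have [q1] := rat_in_itvoo i1; rewrite in_itv /= => /andP[a1 a2].
have [q2] := rat_in_itvoo i2; rewrite in_itv /= => /andP[b1 b2].
exists (q1, q2, r) => //; case: ifPn => [_|/asboolP[]].
  by split; rewrite /= in_itv /=; apply/andP; split; lra.
move=> [x y] [/= ]; rewrite !in_itv /= => /andP[x1 x2] /andP[y1 y2]; apply: eA; split.
  by rewrite /ball /= ltr_norml; apply/andP; split; lra.
by rewrite /ball /= ltr_norml; apply/andP; split; lra.
Qed.

Lemma closed_plane (A : set (R * R)) : closed A -> measurable (A : set T).
Proof. by move=> cA; rewrite -(setCK A); apply: measurableC; apply: open_plane; exact: closed_openC. Qed.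

Lemma compact_plane (A : set (R * R)) : compact A -> measurable (A : set T).
Proof. by move=> cA; apply: closed_plane; apply: compact_closed => //; exact: norm_hausdorff. Qed.

Lemma continuous_plane (f : R * R -> R) : continuous f -> measurable_fun [set: T] (f : T -> R).
Proof.
move=> cf; apply: (measurability _ (RGenOInfty.measurableE R)) => //.
move=> _ [_ [x ->] <-]; rewrite setTI; apply: open_plane.
by move/continuousP: cf; apply; exact: interval_open.
Qed.

Definition box (r : R) : set (R * R) := `[- r, r]%classic `*` `[- r, r]%classic.
Lemma box_compact r : compact (box r).
Proof. by apply: compact_setX; exact: segment_compact. Qed.

Lemma box_measurable r : measurable (box r : set T).
Proof. by apply: (@compact_plane (box r)); exact: box_compact. Qed.

Lemma boxP r p : box r p <-> `|p.1| <= r /\ `|p.2| <= r.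
Proof.
split; last by rewrite !ler_norml => -[h1 h2]; split; rewrite /= in_itv.
by case=> /=; rewrite !in_itv /= !ler_norml => -> ->.
Qed.

Lemma compact_box (B : set (R * R)) : compact B -> exists r : R, B `<=` box r.
Proof.
move=> /compact_bounded [r [_ hr]]; exists (r + 1) => p Bp; apply/boxP.
have r1 : r < r + 1 by lra.
have h : Num.max `|p.1| `|p.2| <= r + 1 := hr _ r1 p Bp.
by move: h; rewrite ge_max => /andP[-> ->].
Qed.

Lemma okr_box r : okr (fun p => if p \in box r then 1 else 0 : R).
Proof.
have mb : (mu (box r) < +oo)%E.
  rewrite planeX; try exact: measurable_itv.
  by rewrite !lebesgue_measure_itv /=; case: ifP; rewrite ?mule0 // -EFinM ltry.
have -> : (fun p : R * R => if p \in box r then 1 else 0 : R) = \1_(box r).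
  by apply/funext => p; rewrite indicE; case: (p \in box r).
apply/integrableP; split; first by apply/measurable_EFinP; exact: measurable_indic (box_measurable r).
rewrite (eq_integral (fun p : T => (\1_(box r) p)%:E)).
  by rewrite integral_indic // ?setIT //; exact: box_measurable.
by move=> p _; rewrite /= ger0_norm // indicE.
Qed.

Lemma ok_supp r F (M : R) : mC F -> (forall p, modulus (F p) <= M) -> (forall p, ~ box r p -> F p = 0) -> ok F.
Proof.
move=> mF FM F0; apply: ok_le mF (okr_Z M (okr_box r)) _ => p.
case: ifPn => [_|/negP h]; first by rewrite mulr1.
by rewrite mulr0 F0 ?mod0 // => b; apply: h; rewrite inE.
Qed.

Lemma continuous_bdd (f : R * R -> R) r : continuous f -> exists M : R, forall p, box r p -> `|f p| <= M.
Proof.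
move=> cf; have cc : compact (f @` box r).
  by apply: (@continuous_compact _ _ f (box r)); [exact: continuous_subspaceT | exact: box_compact].
have [M [_ hM]] := compact_bounded cc; exists (M + 1) => p bp.
have M1 : M < M + 1 by lra.
by apply: (hM _ M1); exists p.
Qed.

Definition sqrt3 : R := Num.sqrt 3.
Lemma s3_sq : sqrt3 ^+ 2 = 3. Proof. by rewrite /sqrt3 sqr_sqrtr. Qed.

Lemma s3_gt0 : 0 < sqrt3. Proof. by rewrite /sqrt3 sqrtr_gt0. Qed.

Lemma s3_bd : 1 < sqrt3 /\ sqrt3 < 2.
Proof. by have := s3_sq; have := s3_gt0; split; nra. Qed.

Lemma omegaE : omega R = (- (1 / 2) +i* (sqrt3 / 2))%C.
Proof.
rewrite /omega /expi.
have pi3 : 0 < (pi : R) / 3 < pi / 2 by have := pi_gt0 R; lra.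
have c3 : cos (pi / 3 : R) = 1 / 2.
  set t : R := pi / 3.
  have h1 : cos (t + t + t) = -1 by rewrite (_ : t + t + t = pi) ?cospi // /t; field.
  have c0 : 0 < cos t by apply: cos_gt0_pihalf; rewrite /t; have := pi_gt0 R; lra.
  have := cos2Dsin2 t; move: h1; rewrite !cosD !sinD => h1 h2.
  (* The triple angle formula for cos (3 t) = - 1, that is 4 c^3 - 3 c + 1 = 0, factored. *)
  have : (2 * cos t - 1) ^+ 2 * (cos t + 1) = 0.
    have -> : (2 * cos t - 1) ^+ 2 * (cos t + 1) = 
      (cos t * cos t - sin t * sin t) * cos t - (sin t * cos t + cos t * sin t) * sin t + 1 - 3 * cos t * (1 - (cos t ^+2 + sin t ^+ 2)) by ring.
    by rewrite h1 h2; ring.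
  by move/eqP; rewrite mulf_eq0 sqrf_eq0 => /orP[] /eqP ?; lra.
have sp : 0 < sin (pi / 3 : R) by apply: sin_gt0_pi; have := pi_gt0 R; lra.
have s3E : sin (pi / 3 : R) = sqrt3 / 2.
  have := cos2Dsin2 (pi / 3 : R); rewrite c3 => h.
  have h2 := s3_sq; have h3 := s3_gt0.
  have : (sin (pi / 3) - sqrt3 / 2) * (sin (pi / 3) + sqrt3 / 2) = 0.
    by rewrite -subr_sqr exprMn h2; lra.
  by move/eqP; rewrite mulf_eq0 => /orP[] /eqP ?; lra.
have -> : 2 * (pi : R) / 3 = pi / 3 + pi / 3 by field.
rewrite cosD sinD c3 s3E; congr (_ +i* _)%C; last by field.
by have := s3_sq; lra.
Qed.

(* Coordinates of p in the basis (1, omega); [pt] is the inverse. *)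
Definition ca (p : R * R) : R := p.1 + p.2 / sqrt3.
Definition cb (p : R * R) : R := 2 * p.2 / sqrt3.
Definition pt (a b : R) : R * R := (a - b / 2, b * sqrt3 / 2).
Lemma ca_pt a b : ca (pt a b) = a.
Proof. by rewrite /ca /pt /=; have := s3_gt0 => h; field; rewrite gt_eqF. Qed.

Lemma cb_pt a b : cb (pt a b) = b.
Proof. by rewrite /cb /pt /=; have := s3_gt0 => h; field; rewrite gt_eqF. Qed.

Lemma pt_ab p : pt (ca p) (cb p) = p.
Proof. by case: p => x y; have h := s3_gt0; rewrite /pt /ca /cb /=; congr (_, _); field; rewrite gt_eqF. Qed.

Lemma to_C_pt a b : to_C (pt a b) = rc a + rc b * omega R.
Proof. by rewrite omegaE /to_C /pt; apply/eqP; rewrite eq_complex /=; apply/andP; split; apply/eqP; field. Qed.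

Lemma to_C_inj : injective (@to_C R).
Proof. by move=> [a b] [c d] [-> ->]. Qed.

Lemma cellE p : cell p <-> (0 <= ca p < 1) /\ (0 <= cb p < 1).
Proof.
split=> [[a [b [ha hb]]]|[ha hb]].
  by rewrite -to_C_pt => /to_C_inj ->; rewrite ca_pt cb_pt.
by exists (ca p), (cb p); split=> //; rewrite -to_C_pt pt_ab.
Qed.

Lemma shift_add (t p : R * R) : shift t p = p + t. Proof. by []. Qed.

Lemma caD p q : ca (p + q) = ca p + ca q. Proof. by rewrite /ca /=; ring. Qed.

Lemma cbD p q : cb (p + q) = cb p + cb q. Proof. by rewrite /cb /=; ring. Qed.

Lemma lin_measurable (a b : R) : measurable_fun [set: T] (fun p : T => a * p.1 + b * p.2).
Proof.
apply: continuous_plane => p; apply: cvgD; apply: cvgM; try exact: cvg_cst.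
  exact: cvg_fst. 
exact: cvg_snd.
Qed.

Lemma ca_measurable : measurable_fun [set: T] (ca : T -> R).
Proof. by have := lin_measurable 1 sqrt3^-1; congr measurable_fun; apply/funext => p; rewrite /ca; ring. Qed.

Lemma cb_measurable : measurable_fun [set: T] (cb : T -> R).
Proof. by have := lin_measurable 0 (2 / sqrt3); congr measurable_fun; apply/funext => p; rewrite /cb; ring. Qed.

Lemma cell_measurable : measurable (@cell R : set T).
Proof.
have -> : (@cell R : set T) = (ca @^-1` `[0, 1[%classic) `&` (cb @^-1` `[0, 1[%classic).
  apply/seteqP; split => p; first by move=> /cellE [h1 h2]; split; rewrite /= in_itv.
  by case; rewrite /= !in_itv /= => h1 h2; apply/cellE.
apply: measurableI.
  by have := ca_measurable measurableT (measurable_itv `[0, 1[); rewrite setTI.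
by have := cb_measurable measurableT (measurable_itv `[0, 1[); rewrite setTI.
Qed.

Lemma near_box (r : R) p : `|ca p| <= r -> `|cb p| <= r -> box (2 * r) p.
Proof.
move=> ha hb; have [h1 h2] := s3_bd; have h3 := s3_sq; rewrite -(pt_ab p); apply/boxP => /=.
move: ha hb; rewrite !ler_norml => /andP[a1 a2] /andP[b1 b2].
by split; apply/andP; split; nra.
Qed.

Lemma cell_box : @cell R `<=` box 2.
Proof.
move=> p /cellE [/andP[h1 h2] /andP[h3 h4]].
by have := @near_box 1 p; rewrite mulr1; apply; rewrite ler_norml; apply/andP; split; lra.
Qed.

Lemma ind1 (D : set (R * R)) p : D p -> ind D p = 1.
Proof. by move=> h; rewrite /ind mem_set. Qed.

Lemma ind0 (D : set (R * R)) p : ~ D p -> ind D p = 0.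
Proof. by move=> h; rewrite /ind memNset. Qed.

Lemma mod_ind (D : set (R * R)) p : modulus (ind D p) <= 1.
Proof. by rewrite /ind; case: ifP => _; rewrite ?mod0 ?(mod_rc 1) ?normr1. Qed.

Lemma conj_ind (D : set (R * R)) p : conjc (ind D p) = ind D p.
Proof. by rewrite /ind; case: ifP => _; rewrite ?rmorph1 ?rmorph0. Qed.

Lemma mC_to_C (f : C -> C) : L2loc f -> mC (fun p => f (to_C p)).
Proof. by case. Qed.

Lemma L2loc_sq (f : C -> C) r : L2loc f ->
  okr (fun p => if p \in box r then modulus (f (to_C p)) ^+ 2 else 0).
Proof.
move=> h; have mf := mC_mod (mC_to_C h); case: h => _ _ h.
have := h _ (@box_compact r) => hi.
have mm : measurable_fun [set: T] (fun p : T => modulus (f (to_C p)) ^+ 2).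
  exact: measurable_funX.
have : mu.-integrable (box r) (fun p : T => (modulus (f (to_C p)) ^+ 2)%:E).
  apply/integrableP; split.
    by apply/measurable_EFinP; apply: measurable_funS mm.
  rewrite (eq_integral (fun p : T => (modulus (f (to_C p)) ^+ 2)%:E)) //.
  by move=> p _; rewrite /= ger0_norm // sqr_ge0.
rewrite integrable_mkcond; last exact: box_measurable.
by congr integrable; apply/funext => p; rewrite patchE; case: ifP.
Qed.

(** On a bounded set |f| <= 1 + |f|^2 turns local square integrability into integrability. *)
Lemma L2loc_ok (f : C -> C) (H : R * R -> C) r (M : R) : L2loc f -> mC H ->
  (forall p, modulus (H p) <= M) -> (forall p, ~ box r p -> H p = 0) -> ok (fun p => H p * f (to_C p)).
Proof.
move=> h mH HM H0; have M0 : 0 <= M by exact: le_trans (mod_ge0 _) (HM 0).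
apply: (ok_le (h := fun p => M * ((if p \in box r then 1 else 0) + (if p \in box r then modulus (f (to_C p)) ^+ 2 else 0)))).
- by apply: mCM => //; exact: mC_to_C.
- by apply: okr_Z; apply: okrD; [exact: okr_box | exact: L2loc_sq].
move=> p; rewrite modM; case: ifPn => [_|/negP nb].
  apply: ler_pM => //; rewrite ?mod_ge0 //.
  have := sqr_ge0 (modulus (f (to_C p)) - 1/2); nra.
by rewrite H0 ?mod0 ?mul0r ?addr0 ?mulr0 // => b; apply: nb; rewrite inE.
Qed.

Lemma L2loc_cell (f : C -> C) (H : R * R -> C) (M : R) : L2loc f -> mC H ->
  (forall p, cell p -> modulus (H p) <= M) -> ok (fun p => ind (@cell R) p * (f (to_C p) * H p)).
Proof.
move=> h mH HM.
have -> : (fun p => ind (@cell R) p * (f (to_C p) * H p)) = fun p => (ind (@cell R) p * H p) * f (to_C p).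
  by apply/funext => p; ring.
apply: (@L2loc_ok f (fun p => ind (@cell R) p * H p) 2 `|M|) => //.
- by apply: mCM => //; apply: mC_ind; exact: cell_measurable.
- move=> p; have [cp|cp] := pselect (cell p); last by rewrite ind0 // mul0r mod0.
  by rewrite ind1 // mul1r (le_trans (HM p cp)) // ler_norm.
- by move=> p np; rewrite ind0 ?mul0r // => /cell_box.
Qed.
End PlaneCell.

Section Characters.
Variable R : realType.
Local Notation C := R[i].
Local Notation mR := (measurableTypeR R).
Local Notation T := (measurableTypeR R * measurableTypeR R)%type.
Local Notation G := (int * int)%type.
Implicit Types (g h : G) (p : R * R).

Lemma expiD (x y : R) : expi (x + y) = expi x * expi y.
Proof. by rewrite /expi cosD sinD; apply/eqP; rewrite eq_complex /=; apply/andP; split; apply/eqP; ring. Qed.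

Lemma expi0 : expi (0 : R) = 1. Proof. by rewrite /expi cos0 sin0. Qed.

Lemma conj_expi (x : R) : conjc (expi x) = expi (- x).
Proof. by rewrite /expi cosN sinN. Qed.

Lemma mod_expi (x : R) : modulus (expi x) = 1.
Proof.
have : modulus (expi x) ^+ 2 = 1 by rewrite mod_sq /= cos2Dsin2.
by move/eqP; rewrite sqrf_eq1 => /orP[] /eqP // h; have := mod_ge0 (expi x); rewrite h; lra.
Qed.

Lemma expi_neq0 (x : R) : expi x != 0.
Proof. by apply/eqP => h; have := mod_expi x; rewrite h mod0; lra. Qed.

Lemma expi_2pin (n : nat) : expi (2 * pi * n%:R : R) = 1.
Proof.
elim: n => [|n IH]; first by rewrite mulr0 expi0.
have -> : 2 * pi * n.+1%:R = 2 * pi * n%:R + 2 * pi :> R by rewrite -[n.+1%:R]natr1; ring.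
rewrite expiD IH mul1r /expi.
by rewrite mulrC mulr_natr cos2pi sin2pi.
Qed.

Lemma expi_2pi (n : int) : expi (2 * pi * n%:~R : R) = 1.
Proof.
case: n => n; first exact: expi_2pin.
by rewrite NegzE mulrNz mulrN -conj_expi expi_2pin rmorph1.
Qed.

Lemma measurable_expi (f : T -> R) : measurable_fun [set: T] f -> mC (fun p => expi (f p)).
Proof.
move=> mf; split.
  apply: (measurableT_comp (f := @cos R : mR -> mR) _ mf); apply: continuous_measurable_fun.
  exact: continuous_cos.
apply: (measurableT_comp (f := @sin R : mR -> mR) _ mf); apply: continuous_measurable_fun.
exact: continuous_sin.
Qed.

(* The pair (m, y) encodes the frequency with coordinates (m + y / 3, y / 3) in the basis of R^2 dual to (1, omega); the
   character has the twist of the first spinor component when y = 1 mod 3, of the second when y = 2 mod 3. *)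
Definition fa g : R := g.1%:~R + g.2%:~R / 3.
Definition fb g : R := g.2%:~R / 3.
Definition ch g p : C := expi (2 * pi * (fa g * ca p + fb g * cb p)).
Lemma faD g h : fa (g + h) = fa g + fa h. Proof. by rewrite /fa /= !intrD; ring. Qed.

Lemma fbD g h : fb (g + h) = fb g + fb h. Proof. by rewrite /fb /= !intrD; ring. Qed.

Lemma faN g : fa (- g) = - fa g. Proof. by rewrite /fa /= !mulrNz; ring. Qed.

Lemma fbN g : fb (- g) = - fb g. Proof. by rewrite /fb /= !mulrNz; ring. Qed.

Lemma chD g h p : ch (g + h) p = ch g p * ch h p.
Proof. by rewrite /ch -expiD faD fbD; congr expi; ring. Qed.

Lemma ch0 p : ch 0 p = 1.
Proof.
have e1 : (0 : G).1 = 0 by []. have e2 : (0 : G).2 = 0 by [].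
by rewrite /ch /fa /fb e1 e2 mulr0z !mul0r !addr0 !mul0r mulr0 expi0.
Qed.

Lemma ch_conj g p : conjc (ch g p) = ch (- g) p.
Proof. by rewrite /ch conj_expi faN fbN; congr expi; ring. Qed.

Lemma ch_mod g p : modulus (ch g p) = 1. Proof. exact: mod_expi. Qed.

Lemma ch_mC g : mC (ch g).
Proof.
apply: measurable_expi; have ma := @ca_measurable R; have mb := @cb_measurable R.
have -> : (fun p : T => 2 * pi * (fa g * ca p + fb g * cb p)) =
  (fun p : T => (2 * pi * fa g) * ca p + (2 * pi * fb g) * cb p) by apply/funext => p; ring.
by apply: measurable_funD; apply: measurable_funM => //; exact: measurable_cst.
Qed.

Definition lat (m n : int) : R * R := pt m%:~R n%:~R.
Definition phase (y : int) (n : int) : C := expi (2 * pi * (y%:~R * n%:~R / 3)).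
(** The twist of a character depends only on its second index, because [g.1 * m] is an integer;
    [phase] then sees this index only mod 3. *)
Lemma ch_lat g (m n : int) p : ch g (p + lat m n) = phase g.2 (m + n) * ch g p.
Proof.
rewrite /ch caD cbD ca_pt cb_pt /phase -expiD.
rewrite (_ : 2 * pi * (fa g * (ca p + m%:~R) + fb g * (cb p + n%:~R)) =
  2 * pi * (g.2%:~R * (m + n)%:~R / 3) + 2 * pi * (fa g * ca p + fb g * cb p) + 2 * pi * (g.1 * m)%:~R); last first.
  by rewrite /fa /fb intrD intrM; field.
by rewrite [LHS]expiD expi_2pi mulr1.
Qed.
End Characters.

(** * Completeness of the characters on a cell *)

Section Kuhn.
Variable R : realType.
(* Tends to 1 for 0 <= s < 1/2 and to 0 for 1/2 < s <= 1. *)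
Definition kuhn (s : R) (n : nat) : R := (1 - s ^+ n) ^+ (n * 2 ^ n).
Lemma bernoulli_ge (x : R) n : 0 <= x -> 1 + n%:R * x <= (1 + x) ^+ n.
Proof.
move=> x0; elim: n => [|n IH]; first by rewrite mul0r addr0 expr0.
rewrite exprS -natr1; have n0 : 0 <= n%:R :> R by []. 
have : (1 + x) * (1 + n%:R * x) <= (1 + x) * (1 + x) ^+ n by rewrite ler_wpM2l // addr_ge0.
have : 0 <= n%:R * x * x by rewrite !mulr_ge0.
lra.
Qed.

Lemma bernoulli_le (x : R) n : 0 <= x <= 1 -> 1 - n%:R * x <= (1 - x) ^+ n.
Proof.
move=> /andP[x0 x1]; elim: n => [|n IH]; first by rewrite mul0r subr0 expr0.
rewrite exprS -natr1; have n0 : 0 <= n%:R :> R by [].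
have : (1 - x) * (1 - n%:R * x) <= (1 - x) * (1 - x) ^+ n by rewrite ler_wpM2l // subr_ge0.
have : 0 <= n%:R * x * x by rewrite !mulr_ge0.
lra.
Qed.

Lemma kuhn01 (s : R) n : 0 <= s <= 1 -> 0 <= kuhn s n <= 1.
Proof.
move=> /andP[s0 s1]; have h1 : s ^+ n <= 1 by rewrite exprn_ile1.
have h0 : 0 <= s ^+ n by rewrite exprn_ge0.
by rewrite /kuhn exprn_ge0 ?subr_ge0 // exprn_ile1 ?subr_ge0 // lerBlDr lerDl.
Qed.

(** (1 - x)^m <= (1 + x)^-m, and by Bernoulli (1 + x)^m >= m x, which for x = s^n and m = n 2^n is n
    (2 s)^n >= n. *)
Lemma kuhn_high (s : R) : 1 / 2 <= s <= 1 -> forall e : R, 0 < e -> exists N, forall n, (N <= n)%N -> kuhn s n <= e.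
Proof.
move=> /andP[s0 s1] e e0; exists (Num.truncn e^-1).+1 => n nN.
have h1 : s ^+ n <= 1 by rewrite exprn_ile1 //; lra.
have h0 : 0 <= s ^+ n by rewrite exprn_ge0 //; lra.
have s01 : 0 <= s <= 1 by lra.
have /andP[k0 _] := kuhn01 n s01.
have ne : e^-1 <= n%:R.
  by apply/ltW/(lt_le_trans (truncnS_gt _)); rewrite ler_nat.
have b1 : n%:R <= (1 + s ^+ n) ^+ (n * 2 ^ n).
  apply: le_trans (bernoulli_ge _ h0).
  have : n%:R * 1 <= (n * 2 ^ n)%:R * s ^+ n.
    rewrite natrM -mulrA ler_wpM2l // natrX -exprMn exprn_ege1 //; lra.
  by lra.
have b2 : kuhn s n * (1 + s ^+ n) ^+ (n * 2 ^ n) <= 1.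
  rewrite /kuhn -exprMn exprn_ile1 //; nra.
have b3 : kuhn s n * e^-1 <= 1.
  by apply: le_trans b2; rewrite ler_wpM2l // (le_trans ne).
by move: b3; rewrite ler_pdivrMr // mul1r.
Qed.

(** Bernoulli leaves the error n (2 s)^n. With y = sqrt (2 s) < 1 this is (n y^n) y^n, a bounded
    factor times one that tends to 0. *)
Lemma kuhn_low (s : R) : 0 <= s < 1 / 2 -> forall e : R, 0 < e -> exists N, forall n, (N <= n)%N -> 1 - e <= kuhn s n.
Proof.
move=> /andP[s0 s1] e e0.
pose x := 2 * s; pose y := Num.sqrt x.
have x0 : 0 <= x by rewrite /x; lra.
have yx : y ^+ 2 = x by rewrite sqr_sqrtr.
have y0 : 0 <= y by exact: sqrtr_ge0.
have y1 : y < 1 by rewrite -(@ltr_sqr _ y 1) ?nnegrE // yx /x expr1n; lra.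
pose d := 1 - y; have d0 : 0 < d by rewrite /d; lra.
have ny (n : nat) : n%:R * y ^+ n <= d^-1.
  have b1 : 1 + n%:R * d <= (1 + d) ^+ n by apply: bernoulli_ge; lra.
  have b2 : y ^+ n * (1 + d) ^+ n <= 1.
    by rewrite -exprMn exprn_ile1 //; rewrite /d; [apply: mulr_ge0 => //; lra | nra].
  have yn : 0 <= y ^+ n by rewrite exprn_ge0.
  rewrite -[d^-1]mul1r ler_pdivlMr //; apply: le_trans b2.
  by rewrite mulrAC mulrC ler_wpM2l //; lra.
have : (fun n : nat => y ^+ n) @ \oo --> (0 : R) by apply: cvg_expr; rewrite ger0_norm.
move/cvgrPdist_le => /(_ (e * d) (mulr_gt0 e0 d0)) [N _ hN]; exists N => n Nn.
have yn : 0 <= y ^+ n by rewrite exprn_ge0.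
have h1 : s ^+ n <= 1 by rewrite exprn_ile1 //; lra.
have h0 : 0 <= s ^+ n by rewrite exprn_ge0.
have hyn : y ^+ n <= e * d by have := hN n Nn; rewrite /= sub0r normrN ger0_norm.
have sn : 0 <= s ^+ n <= 1 by apply/andP.
apply: le_trans (bernoulli_le _ sn); rewrite lerD2l lerN2.
have -> : (n * 2 ^ n)%:R * s ^+ n = (n%:R * y ^+ n) * y ^+ n.
  by rewrite natrM natrX -mulrA -exprMn -/x -yx -[in RHS]mulrA -exprD addnn -muln2 mulnC exprM.
apply: le_trans (_ : d^-1 * (e * d) <= e); first by apply: ler_pM => //; rewrite mulr_ge0.
by rewrite mulrCA mulVf ?mulr1 // gt_eqF.
Qed.
End Kuhn.

Section Completeness.
Variable R : realType.
Local Notation C := R[i].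
Local Notation mR := (measurableTypeR R).
Local Notation T := (measurableTypeR R * measurableTypeR R)%type.
Local Notation mu := (@plane R).
Local Notation G := (int * int)%type.
Local Notation cel := (@cell R).
Variable F : R * R -> C.
Hypothesis okF : ok (fun p => ind cel p * F p).

Let bdd (f : R * R -> C) := exists M : R, forall p, modulus (f p) <= M.
(** [N] is a linear space on which nothing multiplicative is known, so the argument works with its
    multipliers [Mu]: an algebra, closed under bounded pointwise limits, that contains the periodic
    characters. *)
Let N (f : R * R -> C) := [/\ mC f, bdd f &
  forall m n : int, plint (fun p => f p * ch (m, n * 3) p * (ind cel p * F p)) = 0].
Let Mu (f : R * R -> C) := [/\ mC f, bdd f & forall h, N h -> N (fun p => f p * h p)].

Let bddM f h : bdd f -> bdd h -> bdd (fun p => f p * h p).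
Proof.
by move=> [M hM] [M' hM']; exists (M * M') => p; rewrite modM ler_pM ?mod_ge0.
Qed.

Let bddD f h : bdd f -> bdd h -> bdd (fun p => f p + h p).
Proof.
by move=> [M hM] [M' hM']; exists (M + M') => p; rewrite (le_trans (modD _ _)) // lerD.
Qed.

Let bdd_ch g : bdd (ch g). Proof. by exists 1 => p; rewrite ch_mod. Qed.

Let oks f g : mC f -> bdd f -> ok (fun p => f p * ch g p * (ind cel p * F p)).
Proof.
move=> mf bf; have [M hM] := bddM bf (@bdd_ch g).
by apply: (ok_bddM (B := M)) => //; apply: mCM => //; exact: ch_mC.
Qed.

Let Mu_ch (m n : int) : Mu (ch (m, n * 3)).
Proof.
split; [exact: ch_mC | exact: bdd_ch|] => h [mh bh zh]; split.
- by apply: mCM => //; exact: ch_mC.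
- exact: bddM.
move=> m' n'; rewrite -[RHS](zh (m + m') (n + n')); congr plint; apply/funext => p.
have -> : ((m + m', (n + n') * 3) : G) = (m, n * 3) + (m', n' * 3) by congr (_, _); rewrite mulrDl.
by rewrite chD; ring.
Qed.

Let Mu_cst c : Mu (fun=> c).
Proof.
split; [exact: mC_cst | by exists (modulus c)|] => h [mh bh zh]; split.
- by apply: mCM => //; exact: mC_cst.
- by apply: bddM => //; exists (modulus c).
move=> m' n'; rewrite -[RHS](mulr0 c) -(zh m' n') -plintZ; last exact: oks.
by congr plint; apply/funext => p; ring.
Qed.

Let MuM f h : Mu f -> Mu h -> Mu (fun p => f p * h p).
Proof.
move=> [mf bf nf] [mh bh nh]; split; [exact: mCM | exact: bddM |] => k /nh /nf.
by congr N; apply/funext => p; ring.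
Qed.

Let MuD f h : Mu f -> Mu h -> Mu (fun p => f p + h p).
Proof.
move=> [mf bf nf] [mh bh nh]; split; [exact: mCD | exact: bddD |] => k nk.
have [m1 b1 z1] := nf _ nk; have [m2 b2 z2] := nh _ nk; case: nk => mk bk zk; split.
- by apply: mCM => //; exact: mCD.
- by apply: bddM => //; exact: bddD.
move=> m n; transitivity (plint (fun p => f p * k p * ch (m, n * 3) p * (ind cel p * F p)) +
    plint (fun p => h p * k p * ch (m, n * 3) p * (ind cel p * F p))); last by rewrite z1 z2 addr0.
rewrite -plintD; [by congr plint; apply/funext => p; ring | exact: oks | exact: oks].
Qed.

Let MuX f n : Mu f -> Mu (fun p => f p ^+ n).
Proof.
move=> mf; elim: n => [|n IH].
  by have := Mu_cst 1; congr Mu; apply/funext => p; rewrite expr0.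
by have := MuM mf IH; congr Mu; apply/funext => p; rewrite exprS.
Qed.

Let Mu_lim (fn : nat -> R * R -> C) f (B : R) : (forall n, Mu (fn n)) -> (forall n p, cel p -> modulus (fn n p) <= B) ->
  mC f -> bdd f ->
  (forall p, cel p -> forall e : R, 0 < e -> exists N, forall n, (N <= n)%N -> modulus (fn n p - f p) <= e) -> Mu f.
Proof.
move=> mn bn mf bf lim; split=> // h nh; have [mh bh zh] := nh; split; [exact: mCM | exact: bddM |] => m n.
have [M hM] := bddM bh (@bdd_ch (m, n * 3)).
have B0 : 0 <= B by case: (pselect (exists p, cel p)) => [[p cp]|ne];
  [exact: le_trans (mod_ge0 _) (bn 0%N p cp) | exfalso; apply: ne; exists 0; apply/cellE; rewrite /ca /cb /= mulr0 mul0r addr0 ; lra].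
have M0 : 0 <= M by exact: le_trans (mod_ge0 _) (hM 0).
have [|||_ D] := @plint_dct R (fun k p => fn k p * h p * ch (m, n * 3) p * (ind cel p * F p))
   (fun p => f p * h p * ch (m, n * 3) p * (ind cel p * F p))
   (fun p => B * M * modulus (ind cel p * F p)) _ (okr_Z _ (okr_mod okF)).
- move=> k; apply: mC_ok; apply: oks; first by apply: mCM => //; case: (mn k).
  by apply: bddM => //; case: (mn k).
- move=> k p; have [cp|cp] := pselect (cel p); last by rewrite ind0 // mul0r mulr0 !mod0 mulr0.
  rewrite [modulus (_ * (_ * _))]modM -[_ * h p * _]mulrA [modulus (fn k p * _)]modM.
  by rewrite ler_wpM2r ?mod_ge0 // ler_pM ?mod_ge0 // bn.
- move=> p e e0; have [cp|cp] := pselect (cel p); last first.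
    by exists 0%N => k _; rewrite ind0 // !(mul0r, mulr0) subrr mod0 ltW.
  pose K := M * modulus (ind cel p * F p) + 1.
  have K1 : M * modulus (ind cel p * F p) <= K by rewrite /K; lra.
  have K0 : 0 < K by rewrite /K ltr_wpDl // mulr_ge0 // mod_ge0.
  have [N0 hN] := lim p cp (e / K) (divr_gt0 e0 K0); exists N0 => k /hN hk.
  have -> : fn k p * h p * ch (m, n * 3) p * (ind cel p * F p) - f p * h p * ch (m, n * 3) p * (ind cel p * F p)
    = (fn k p - f p) * (h p * ch (m, n * 3) p * (ind cel p * F p)) by ring.
  rewrite modM; apply: (@le_trans _ _ (e / K * K)); last by rewrite divfK // gt_eqF.
  apply: ler_pM; rewrite ?mod_ge0 //.
  by rewrite modM (le_trans _ K1) // ler_wpM2r ?mod_ge0.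
apply: eps_eq0 => e e0; have [N0 hN] := D e e0.
have := hN N0 (leqnn _); have [_ _ nN] := mn N0; have [_ _ ->] := nN _ nh.
by rewrite sub0r modN.
Qed.

(** [kuhn] turns a trigonometric polynomial in X, whose values lie on either side of 1 / 2 according
    to whether c < X, into the indicator in the limit; every approximant is a polynomial in
    multipliers. *)
Let Mu_ind_cos (X : R * R -> R) (c : R) : measurable_fun [set: T] (X : T -> R) ->
  (forall p, cel p -> 0 <= X p < 1) -> Mu (fun p => expi (2 * pi * X p)) -> Mu (fun p => expi (- (2 * pi * X p))) ->
  Mu (ind [set p | c < X p]).
Proof.
move=> mX X01 m1 m2.
have mA : mC (ind [set p : T | c < X p]).
  apply: mC_ind; have := mX measurableT _ (measurable_itv `]c, +oo[); rewrite setTI.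
  by congr measurable; apply/seteqP; split => p /=; rewrite in_itv /= andbT.
have bA : bdd (ind [set p : T | c < X p]) by exists 1 => p; exact: mod_ind.
have [c0|c0] := ltP c 0.
  apply: (@Mu_lim (fun _ => fun=> 1) _ 1) => //; first by move=> _ p _; rewrite (mod_rc 1) normr1.
  move=> p cp e e0; exists 0%N => _ _; rewrite ind1 ?subrr ?mod0 ?(ltW e0) //=.
  by have := X01 p cp; lra.
have [c1|c1] := leP 1 c.
  apply: (@Mu_lim (fun _ => fun=> 0) _ 0) => //; first by move=> _ p _; rewrite mod0.
  move=> p cp e e0; exists 0%N => _ _; rewrite ind0 ?subrr ?mod0 ?(ltW e0) //=.
  by have := X01 p cp; lra.
(* Equal to 2 sin (pi (X - c)) sin (pi (1 - X)), so positive exactly when X > c; s rescales it to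
   [0, 1] with threshold 1 / 2. *)
pose t p := cos (2 * pi * X p - pi * (1 + c)) - cos (pi * (1 - c)).
pose s p := 1 / 2 - t p / 4.
have s01 p : 0 <= s p <= 1.
  rewrite /s /t; have := cos_le1 (2 * pi * X p - pi * (1 + c)); have := cos_geN1 (2 * pi * X p - pi * (1 + c)).
  by have := cos_le1 (pi * (1 - c)); have := cos_geN1 (pi * (1 - c)); lra.
have tE p : t p = 2 * (sin (pi * (X p - c)) * sin (pi * (1 - X p))).
  rewrite /t.
  have -> : 2 * pi * X p - pi * (1 + c) = pi * (X p - c) - pi * (1 - X p) by ring.
  have -> : pi * (1 - c) = pi * (X p - c) + pi * (1 - X p) by ring.
  by rewrite cosB cosD; ring.
have pi0 := pi_gt0 R.
have s_pos p : cel p -> (s p < 1 / 2) = (c < X p).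
  move=> cp; have /andP[x0 x1] := X01 p cp.
  have [cx|cx] := ltP c (X p).
    have h1 : 0 < sin (pi * (X p - c)) by apply: sin_gt0_pi; nra.
    have h2 : 0 < sin (pi * (1 - X p)) by apply: sin_gt0_pi; nra.
    by have := mulr_gt0 h1 h2; rewrite /s tE => h; apply/idP; lra.
  have h1 : 0 <= sin (pi * (c - X p)) by apply: sin_ge0_pi; nra.
  have h2 : 0 <= sin (pi * (1 - X p)) by apply: sin_ge0_pi; nra.
  have e1 : sin (pi * (X p - c)) = - sin (pi * (c - X p)) by rewrite -sinN; congr sin; ring.
  have := mulr_ge0 h1 h2; rewrite /s tE e1 => h; apply/idP; lra.
have Mut : Mu (fun p => rc (s p)).
  have := MuD (Mu_cst (rc (1 / 2 + cos (pi * (1 - c)) / 4)))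
     (MuD (MuM (Mu_cst (- (expi (- (pi * (1 + c))) / 8%:R))) m1) (MuM (Mu_cst (- (expi (pi * (1 + c)) / 8%:R))) m2)).
  congr Mu; apply/funext => p.
  have -> : - (expi (- (pi * (1 + c))) / 8%:R) * expi (2 * pi * X p) = - (expi (2 * pi * X p - pi * (1 + c)) / 8%:R).
    by rewrite expiD; ring.
  have -> : - (expi (pi * (1 + c)) / 8%:R) * expi (- (2 * pi * X p)) = - (conjc (expi (2 * pi * X p - pi * (1 + c))) / 8%:R).
    by rewrite conj_expi opprB [_ - 2 * pi * _]addrC expiD; ring.
  rewrite -opprD -mulrDl.
  have -> (z : C) : z + conjc z = rc (2 * complex.Re z).
    by case: z => a b; apply/eqP; rewrite eq_complex /= subrr eqxx andbT; apply/eqP; ring.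
  have -> : 8%:R = rc (8 : R) :> C by rewrite rmorph_nat.
  by rewrite -fmorphV -rcM -rmorphN -rcD /s /t /=; congr (rc _); field.
apply: (@Mu_lim (fun n p => rc (kuhn (s p) n)) _ 1) => //.
- move=> n; have := MuX (n * 2 ^ n) (MuD (Mu_cst 1) (MuM (Mu_cst (-1)) (MuX n Mut))).
  congr Mu; apply/funext => p; rewrite mulN1r /kuhn.
  have e1 : rc (s p ^+ n) = rc (s p) ^+ n :> C by exact: rmorphXn.
  by rewrite [RHS]rmorphXn /= -e1 -rcB.
- by move=> n p cp; have /andP[k0 k1] := kuhn01 n (s01 p); rewrite mod_rc ger0_norm.
move=> p cp e e0; have /andP[k0 k1] := s01 p; have [h|h] := ltP (s p) (1 / 2).
  have hs : 0 <= s p < 1/2 by rewrite k0.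
  have [N0 hN] := kuhn_low hs e0; exists N0 => n /hN hn.
  have hp : [set p | c < X p] p by rewrite /= -s_pos.
  rewrite (ind1 hp); have -> : rc (kuhn (s p) n) - 1 = rc (kuhn (s p) n - 1) :> C by rewrite rcB.
  rewrite mod_rc.
  by have := kuhn01 n (s01 p); rewrite ler_norml; lra.
have hs : 1/2 <= s p <= 1 by rewrite h.
have [N0 hN] := kuhn_high hs e0; exists N0 => n /hN hn.
have hp : ~ [set p | c < X p] p by rewrite /= -s_pos //; apply/negP; rewrite -leNgt.
rewrite (ind0 hp).
by have := kuhn01 n (s01 p) => /andP[q0 q1]; rewrite subr0 mod_rc ger0_norm.
Qed.

Let Ms : set (set T) := [set A | measurable A /\ Mu (ind A)].
Let Ms_sigma : sigma_algebra setT Ms.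
Proof.
have C1 A : Ms A -> Ms (setT `\` A).
  move=> [mA uA]; split; first exact: measurableD.
  have := MuD (Mu_cst 1) (MuM (Mu_cst (-1)) uA); congr Mu; apply/funext => p.
  rewrite mulN1r; have [a|a] := pselect (A p); last by rewrite (ind0 a) subr0 ind1.
  by rewrite (ind1 a) subrr ind0 // => -[].
have E0 : Ms set0.
  split=> //; have := Mu_cst 0; congr Mu; apply/funext => p; by rewrite ind0.
have I2 A B : Ms A -> Ms B -> Ms (A `|` B).
  move=> [mA uA] [mB uB]; split; first exact: measurableU.
  have := MuD uA (MuM (MuD (Mu_cst 1) (MuM (Mu_cst (-1)) uA)) uB); congr Mu; apply/funext => p.
  have [a|a] := pselect (A p); first by rewrite (ind1 a) [RHS]ind1; [ring | left].
  have [b|b] := pselect (B p); first by rewrite (ind0 a) (ind1 b) [RHS]ind1; [ring | right].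
  by rewrite (ind0 a) (ind0 b) [RHS]ind0; [ring | case].
split=> // A hA.
have mA : measurable (\bigcup_k A k) by apply: bigcup_measurable => k _; case: (hA k).
split=> //.
have fin n : Ms (\big[setU/set0]_(k < n) A k).
  by elim: n => [|n IH]; rewrite ?big_ord0 // big_ord_recr /=; exact: I2.
apply: (@Mu_lim (fun n => ind (\big[setU/set0]_(k < n) A k)) _ 1).
- by move=> n; case: (fin n).
- by move=> n p _; exact: mod_ind.
- exact: mC_ind.
- by exists 1 => p; exact: mod_ind.
move=> p _ e e0; have [[k _ Akp]|np] := pselect ((\bigcup_k A k) p).
  exists k.+1 => n kn; have h1 : (\bigcup_k A k) p by exists k.
  have h2 : (\big[setU/set0]_(k < n) A k) p by rewrite -bigcup_mkord; exists k.
  by rewrite (ind1 h1) (ind1 h2) subrr mod0 ltW.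
exists 0%N => n _; have h2 : ~ (\big[setU/set0]_(k < n) A k) p.
  by rewrite -bigcup_mkord => -[k _ h]; apply: np; exists k.
by rewrite (ind0 np) (ind0 h2) subrr mod0 ltW.
Qed.

(** The coordinates [ca] and [cb] are measurable for the sigma-algebra [Ms], hence so is the
    identity, rebuilt from them; its preimages are all measurable sets. *)
Let all_Ms (A : set T) : measurable A -> Ms A.
Proof.
pose S' := g_sigma_algebraType Ms.
have mS (B : set S') : measurable B <-> Ms B.
  by change (<<s Ms >> B <-> Ms B); rewrite sigma_algebra_id.
have mX (X : T -> R) : (forall c, Ms [set p | c < X p]) -> measurable_fun [set: S'] (X : S' -> mR).
  move=> hX; apply: (measurability _ (RGenOInfty.measurableE R)) => //.
  move=> _ [_ [x ->] <-]; rewrite setTI; apply/mS; have := hX x; congr Ms.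
  by apply/seteqP; split => p /=; rewrite in_itv /= andbT.
have mI X c : measurable_fun [set: T] (X : T -> R) -> measurable [set p : T | c < X p].
  move=> h; have := h measurableT _ (measurable_itv `]c, +oo[); rewrite setTI.
  by congr measurable; apply/seteqP; split => p /=; rewrite in_itv /= andbT.
have ma : measurable_fun [set: S'] (@ca R : S' -> mR).
  apply: mX => c; split; first exact: mI (@ca_measurable R).
  apply: Mu_ind_cos; first exact: ca_measurable.
  - by move=> p /cellE [].
  - have := Mu_ch 1 0; congr Mu; apply/funext => p; rewrite /ch /fa /fb /= mul0r; congr expi.
    by rewrite mulr1z !mul0r !addr0 mul1r.
  have := Mu_ch (-1) 0; congr Mu; apply/funext => p; rewrite /ch /fa /fb /= mul0r; congr expi.
  by rewrite mulrN1z !mul0r !addr0 mulN1r mulrN.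
have mb : measurable_fun [set: S'] (@cb R : S' -> mR).
  apply: mX => c; split; first exact: mI (@cb_measurable R).
  apply: Mu_ind_cos; first exact: cb_measurable.
  - by move=> p /cellE [].
  - have := Mu_ch (-1) 1; congr Mu; apply/funext => p; rewrite /ch /fa /fb /= mul1r; congr expi.
    by rewrite -pmulrn; field.
  have := Mu_ch 1 (-1); congr Mu; apply/funext => p; rewrite /ch /fa /fb /= mulN1r mulrNz; congr expi.
  by rewrite mulr1z -pmulrn; field.
have mid : measurable_fun [set: S'] (fun p : S' => (ca p - cb p / 2, cb p * sqrt3 R / 2) : T).
  apply/measurable_fun_pairP; split => /=.
    have : measurable_fun [set: S'] (fun p : S' => ca p - 2^-1 * cb p : mR).
      by apply: measurable_funB => //; apply: measurable_funM => //; exact: measurable_cst.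
    by congr measurable_fun; apply/funext => p /=; field.
  have : measurable_fun [set: S'] (fun p : S' => (sqrt3 R / 2) * cb p : mR).
    by apply: measurable_funM => //; exact: measurable_cst.
  by congr measurable_fun; apply/funext => p /=; field.
move=> mA; apply/mS; have := mid measurableT _ mA; rewrite setTI; congr measurable.
by apply/seteqP; split => p /=; have := pt_ab p; rewrite /pt => ->.
Qed.

(** The assumption says that 1 lies in [N]; multiplying by the indicator of A shows that the
    integral of F over each measurable part of the cell is 0. *)
Lemma completeness0 : (forall m n : int, plint (fun p => ch (m, n * 3) p * (ind cel p * F p)) = 0) ->
  {ae mu, forall p, cel p -> F p = 0}.
Proof.
move=> h.
have N1 : N (fun=> 1).
  split; [exact: mC_cst | by exists (modulus 1) | move=> m n].
  by rewrite -[RHS](h m n); congr plint; apply/funext => p; rewrite mul1r.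
have z (A : set T) : measurable A -> plint (fun p => ind A p * (ind cel p * F p)) = 0.
  move=> /all_Ms [_ [_ _ /(_ _ N1) [_ _ /(_ 0 0)]]]; rewrite mul0r => <-.
  by congr plint; apply/funext => p; rewrite (_ : (0, 0) = 0) // ch0 !mulr1.
have part (k : C -> R) : (forall A p, k (ind A p * (ind cel p * F p)) = if p \in A then k (ind cel p * F p) else 0) ->
   mu.-integrable setT (fun p : T => (k (ind cel p * F p))%:E) ->
   (forall A, measurable A -> \int[mu]_p (k (ind A p * (ind cel p * F p))) = 0) ->
   ae_eq mu setT (fun p : T => (k (ind cel p * F p))%:E) (cst 0%E).
  move=> hk ik h0; apply: integral_ae_eq => // A _ mA.
  have e := h0 A mA; rewrite /Rintegral in e; rewrite [RHS]integral0_eq // integral_mkcond.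
  have hE : (fun p : T => (k (ind A p * (ind cel p * F p)))%:E) = (fun p : T => (k (ind cel p * F p))%:E) \_ A.
    by apply/funext => p; rewrite hk patchE; case: ifP.
  rewrite hE in e; rewrite -[LHS]fineK ?e //; apply: (@integrable_fin_num _ _ _ mu setT) => //.
  by rewrite -integrable_mkcond //; apply: integrableS ik.
have iE A p (w : C) : ind A p * w = if p \in A then w else 0 by rewrite /ind; case: ifP; rewrite ?mul1r ?mul0r.
have a1 := part (@complex.Re R) _ okF.1; have a2 := part (@complex.Im R) _ okF.2.
have {}a1 := a1 _ _; have {}a2 := a2 _ _.
apply: ae_imp2 (a1 _ _) (a2 _ _) => [p /= e1 e2 cp|||| ].
- have := e1 I; have := e2 I; rewrite ind1 // mul1r => -[i0] [r0].
  by move: i0 r0; case: (F p) => a b /= -> ->.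
- by move=> A p; rewrite iE; case: ifP.
- by move=> A mA; have [] := z A mA.
- by move=> A p; rewrite iE; case: ifP.
- by move=> A mA; have [] := z A mA.
Qed.
End Completeness.

(** * Smooth functions, cutoffs and Fourier coefficients of weak derivatives *)

Section Smooth.
Variable R : realType.
Local Notation C := R[i].
Implicit Types (f g : R * R -> R) (p : R * R) (j : bool).
Local Notation e_ := (@basis_vec R).

Lemma is_derive_cast (V : normedModType R) (f g : V -> R) (x v : V) (df dg : R) :
  is_derive x v f df -> f =1 g -> df = dg -> is_derive x v g dg.
Proof. by move=> h /funext <- <-. Qed.

Lemma is_derive_quot (V W : normedModType R) (f : V -> R) (g : W -> R) (x v : V) (y w : W) (d : R) :
  (forall h : R, f (h *: v + x) = g (h *: w + y)) -> f x = g y -> is_derive x v f d -> is_derive y w g d.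
Proof.
move=> E E0 [df vf].
have F : (fun h : R => h^-1 *: (f (h *: v + x) - f x)) = (fun h : R => h^-1 *: (g (h *: w + y) - g y)).
  by apply/funext => h; rewrite E E0.
have df' : cvg ((fun h : R => h^-1 *: (f (h *: v + x) - f x)) @ 0^') := df.
have vf' : lim ((fun h : R => h^-1 *: (f (h *: v + x) - f x)) @ 0^') = d := vf.
by rewrite F in df' vf'; split.
Qed.

(* The functions x^-k exp(-1/x) on x > 0, extended by 0: their span is closed under derivation. *)
Definition flat (k : nat) (x : R) : R := if 0 < x then x^-1 ^+ k * expR (- x^-1) else 0.
Lemma flat_ge0 k x : 0 <= flat k x.
Proof. by rewrite /flat; case: ifP => // x0; rewrite mulr_ge0 ?expR_ge0 // exprn_ge0 // invr_ge0 ltW. Qed.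

(** The exponential beats every power; the quadratic bound gives derivative 0 at the origin for
    every k. *)
Lemma flat_le k x : flat k x <= (k.+2)`!%:R * x ^+ 2.
Proof.
rewrite /flat; case: ifP => x0; last by rewrite mulr_ge0 // sqr_ge0.
have y0 : 0 <= x^-1 by rewrite invr_ge0 ltW.
have f0 : 0 < (k.+2)`!%:R :> R by rewrite ltr0n fact_gt0.
have h := expR_ge1Dxn k.+1 y0.
have h1 : x^-1 ^+ k.+2 <= (k.+2)`!%:R * expR x^-1.
  by rewrite mulrC -ler_pdivrMr //; apply: le_trans h; rewrite lerDr.
rewrite expRN ler_pdivrMr ?expR_gt0 //.
have -> : x^-1 ^+ k = x ^+ 2 * x^-1 ^+ k.+2.
  by rewrite -[k.+2]addn2 exprD mulrCA -exprMn mulfV ?gt_eqF // expr1n mulr1.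
by apply: le_trans (ler_wpM2l (sqr_ge0 x) h1) _; rewrite mulrCA mulrA.
Qed.

Lemma is_derive_flat k (x : R) : is_derive x 1 (flat k) (flat k.+2 x - k%:R * flat k.+1 x).
Proof.
have [x0|x0|x0] := ltgtP x 0.
- have -> : flat k.+2 x - k%:R * flat k.+1 x = 0 by rewrite /flat ltNge (ltW x0) /= mulr0 subr0.
  apply: (near_eq_is_derive _ (is_derive_cst (0 : R) x 1)).
  near=> y; rewrite /flat ltNge (_ : y <= 0) //=.
  by apply/ltW; near: y; exact: lt_nbhsl.
- have hx : x != 0 by rewrite gt_eqF.
  have D1 : is_derive x 1 (fun y : R => y^-1) (- x ^- 2 *: 1) by exact: is_deriveV.
  have D2 : is_derive x 1 (fun y : R => - y^-1) (x ^- 2).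
    by apply: is_derive_cast (is_deriveN D1) _ _ => //; rewrite scaleNr opprK /GRing.scale /= mulr1.
  have D3 : is_derive x 1 (expR \o (fun y : R => - y^-1)) (expR (- x^-1) * x ^- 2).
    exact: is_derive1_comp.
  have D4 := is_deriveM (is_deriveX k D1) D3.
  apply: (@near_eq_is_derive _ _ _ ((fun y : R => y^-1) ^+ k * (expR \o (fun y : R => - y^-1)))); last first.
  { apply: is_derive_cast D4 _ _ => //; rewrite /flat x0 exprfctE /GRing.scale /= mulr1.
  case: k => [|k] /=; first by field.
  by rewrite !exprS; move: (x^-1 ^+ k) => w; field. }
  near=> y; rewrite /flat (_ : 0 < y); last by near: y; exact: lt_nbhsr.
    by change (((fun z : R => z^-1) ^+ k) y * expR (- y^-1) = y^-1 ^+ k * expR (- y^-1)); rewrite exprfctE.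
rewrite x0; have -> : flat k.+2 0 - k%:R * flat k.+1 0 = 0 by rewrite /flat ltxx mulr0 subr0.
have f0 : 0 < (k.+2)`!%:R :> R by rewrite ltr0n fact_gt0.
have key : (fun h : R => h^-1 *: (flat k (h *: 1 + 0) - flat k 0)) @ 0^' --> (0 : R).
  apply/cvgrPdist_le => e e0; near=> h.
  rewrite sub0r normrN /= {2}/flat ltxx subr0 addr0 /GRing.scale /= mulr1 normrM normfV.
  have h0 : h != 0 by near: h; exact: nbhs_dnbhs_neq.
  rewrite mulrC ler_pdivrMr ?normr_gt0 // ger0_norm ?flat_ge0 //.
  apply: le_trans (flat_le _ _) _; rewrite -real_normK ?num_real // expr2 mulrA ler_wpM2r //.
  rewrite mulrC -ler_pdivlMr //; near: h; apply: dnbhs0_le; exact: divr_gt0.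
split; first by apply/cvg_ex; exists 0.
exact/cvg_lim.
Unshelve. all: by end_near. Qed.

Lemma derive_lin (g : R -> R) (l1 l2 c d : R) j p :
  is_derive (l1 * p.1 + l2 * p.2 + c) 1 g d ->
  is_derive p (e_ j) (fun q => g (l1 * q.1 + l2 * q.2 + c)) ((if j then l2 else l1) * d).
Proof.
move=> dg; set lv := if j then l2 else l1; set L0 := l1 * p.1 + l2 * p.2 + c.
have D1 : is_derive (0 : R) 1 (fun t : R => lv * t + L0) lv.
  have h1 := is_deriveM (is_derive_cst lv (0 : R) 1) (is_derive_id (0 : R) 1).
  have h2 := is_deriveD h1 (is_derive_cst L0 (0 : R) 1).
  by apply: is_derive_cast h2 _ _ => //; rewrite /GRing.scale /= mulr1 mulr0 !addr0.
have D2 : is_derive (0 : R) 1 (g \o (fun t : R => lv * t + L0)) (d * lv).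
  by apply: is_derive1_comp => //; rewrite mulr0 add0r.
rewrite mulrC; apply: is_derive_quot D2; last by rewrite /= mulr0 add0r.
by move=> h /=; congr g; rewrite /L0 /lv; case: (j) => /=; rewrite /GRing.scale /=; ring.
Qed.

(** [smooth2] quantifies over all iterated partial derivatives. A syntactic class that contains its
    own partial derivatives gives them by one induction; cosines are covered by the phase c in
    [SM_sin]. *)
Inductive SM : (R * R -> R) -> Prop :=
| SM_base f : smooth2 f -> SM f
| SM_cst c : SM (fun=> c)
| SM_flat k l1 l2 c : SM (fun p => flat k (l1 * p.1 + l2 * p.2 + c))
| SM_sin l1 l2 c : SM (fun p => sin (l1 * p.1 + l2 * p.2 + c))
| SM_add f g : SM f -> SM g -> SM (fun p => f p + g p)
| SM_mul f g : SM f -> SM g -> SM (fun p => f p * g p)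
| SM_inv f : SM f -> (forall p, f p != 0) -> SM (fun p => (f p)^-1).

Lemma partialE j f p (d : R) : is_derive p (e_ j) f d -> partial j f p = d.
Proof. by move=> h; rewrite /partial (derive_val). Qed.

Lemma smooth2_partial j f : smooth2 f -> smooth2 (partial j f).
Proof. by move=> h s; have := h (rcons s j); rewrite foldr_rcons. Qed.

Lemma smooth2_cont f : smooth2 f -> continuous f.
Proof. by move=> /(_ [::]) []. Qed.

Lemma smooth2_der f j p : smooth2 f -> derivable f p (e_ j).
Proof. by move=> /(_ [::]) [_]; apply. Qed.

Arguments smooth2_der {f} j p _.
Lemma lin_cont (l1 l2 c : R) : continuous (fun p : R * R => l1 * p.1 + l2 * p.2 + c).
Proof.
move=> p; apply: cvgD; last exact: cvg_cst.
by apply: cvgD; apply: cvgM; try exact: cvg_cst; [exact: cvg_fst | exact: cvg_snd].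
Qed.

Lemma derivable_cont (g dg : R -> R) : (forall x : R, is_derive x 1 g (dg x)) -> continuous g.
Proof. by move=> h x; apply/differentiable_continuous/derivable1_diffP; exact: ex_derive. Qed.

Lemma SM_step f : SM f -> [/\ continuous f, forall j p, derivable f p (e_ j) & forall j, SM (partial j f)].
Proof.
elim=> {f} [f sf|c|k l1 l2 c|l1 l2 c|f g sf [cf df pf] sg [cg dg pg]|f g sf [cf df pf] sg [cg dg pg]|f sf [cf df pf] f0].
- split; [exact: smooth2_cont | by move=> j p; exact: smooth2_der | by move=> j; apply: SM_base; exact: smooth2_partial].
- split; [exact: cst_continuous | by move=> j p; exact: derivable_cst |] => j.
  rewrite (_ : partial j _ = fun=> 0); first exact: SM_cst.
  by apply/funext => p; apply: partialE; exact: is_derive_cst.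
- have D j p := @derive_lin (flat k) l1 l2 c _ j p (is_derive_flat k _).
  split; first by move=> p; apply: (@continuous_comp _ _ _ (fun p : R * R => l1 * p.1 + l2 * p.2 + c) (flat k)); [exact: lin_cont | apply: derivable_cont => x; exact: is_derive_flat].
    by move=> j p; have := D j p => h; exact: ex_derive.
  move=> j; rewrite (_ : partial j _ = fun p => (if j then l2 else l1) *
    (flat k.+2 (l1 * p.1 + l2 * p.2 + c) + (- k%:R) * flat k.+1 (l1 * p.1 + l2 * p.2 + c))).
    apply: SM_mul; [exact: SM_cst | apply: SM_add; [exact: SM_flat | apply: SM_mul; [exact: SM_cst | exact: SM_flat]]].
  by apply/funext => p; rewrite (partialE (D j p)) mulNr.
- have D j p := @derive_lin sin l1 l2 c _ j p (is_derive_sin _).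
  split; first by move=> p; apply: (@continuous_comp _ _ _ (fun p : R * R => l1 * p.1 + l2 * p.2 + c) sin); [exact: lin_cont | exact: continuous_sin].
    by move=> j p; have := D j p => h; exact: ex_derive.
  move=> j; rewrite (_ : partial j _ = fun p => (if j then l2 else l1) * sin (l1 * p.1 + l2 * p.2 + (c + pi / 2))).
    by apply: SM_mul; [exact: SM_cst | exact: SM_sin].
  by apply/funext => p; rewrite (partialE (D j p)) addrA sinDpihalf.
- have D j p := is_deriveD (derivableP (df j p)) (derivableP (dg j p)).
  split; first by move=> p; exact: continuousD (cf p) (cg p).
    by move=> j p; have := D j p => h; exact: ex_derive.
  move=> j; rewrite (_ : partial j _ = fun p => partial j f p + partial j g p); first exact: SM_add.
  by apply/funext => p; exact: partialE (D j p).
- have D j p := is_deriveM (derivableP (df j p)) (derivableP (dg j p)).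
  split; first by move=> p; exact: continuousM (cf p) (cg p).
    by move=> j p; have := D j p => h; exact: ex_derive.
  move=> j; rewrite (_ : partial j _ = fun p => f p * partial j g p + g p * partial j f p).
    by apply: SM_add; exact: SM_mul.
  by apply/funext => p; exact: partialE (D j p).
split; first by move=> p; exact: continuousV (f0 p) (cf p).
  by move=> j p; exact: derivableV.
move=> j; rewrite (_ : partial j _ = fun p => -1 * (((f p)^-1 * (f p)^-1) * partial j f p)).
  apply: SM_mul; first exact: SM_cst.
  by apply: SM_mul => //; apply: SM_mul; exact: SM_inv.
apply/funext => p; rewrite /partial deriveV // /GRing.scale /= mulN1r mulNr; congr (- (_ * _)).
by rewrite expr2 invfM.
Qed.

Lemma SM_smooth f : SM f -> smooth2 f.
Proof.
move=> sf s; have h : SM (foldr (@partial R) f s) by elim: s => //= j s /SM_step [].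
by have [c d _] := SM_step h.
Qed.

Lemma smooth2M f g : smooth2 f -> smooth2 g -> smooth2 (fun p => f p * g p).
Proof. by move=> hf hg; apply/SM_smooth/SM_mul; exact: SM_base. Qed.

Lemma partialM j f g p : smooth2 f -> smooth2 g ->
  partial j (fun p => f p * g p) p = partial j f p * g p + f p * partial j g p.
Proof.
move=> hf hg; rewrite (partialE (is_deriveM (derivableP (smooth2_der j p hf)) (derivableP (smooth2_der j p hg)))).
by rewrite /GRing.scale /= addrC [g p * _]mulrC.
Qed.

Lemma quot_lim f j p : derivable f p (e_ j) -> forall e : R, 0 < e -> exists N, forall n, (N <= n)%N ->
  `|n.+1%:R * (f (p + n.+1%:R^-1 *: e_ j) - f p) - partial j f p| <= e.
Proof.
move=> df e e0.
have D : (fun h : R => h^-1 *: (f (h *: e_ j + p) - f p)) @ 0^' --> partial j f p by exact: df.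
move/cvgrPdist_le: D => /(_ e e0) [d /= d0 hd].
exists (Num.truncn d^-1) => n nN.
have i0 : 0 < n.+1%:R^-1 :> R by rewrite invr_gt0.
have id : n.+1%:R^-1 < d.
  rewrite invf_plt ?posrE //; apply: lt_le_trans (truncnS_gt _) _; by rewrite ler_nat ltnS.
have := hd n.+1%:R^-1; rewrite /= sub0r normrN gtr0_norm // => /(_ id (lt0r_neq0 i0)).
by rewrite invrK distrC [p + _]addrC.
Qed.

Lemma mvt_partial f j p (t : R) : smooth2 f -> 0 < t ->
  exists2 s : R, 0 <= s <= t & f (p + t *: e_ j) - f p = partial j f (p + s *: e_ j) * t.
Proof.
move=> sf t0; pose k s := f (p + s *: e_ j).
have dk (s : R) : is_derive s 1 k (partial j f (p + s *: e_ j)).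
  apply: is_derive_quot (derivableP (smooth2_der j (p + s *: e_ j) sf)) => // h.
  have -> : h *: (1 : R) = h by rewrite /GRing.scale /= mulr1.
  by rewrite /k; congr f; rewrite scalerDl addrCA.
have ck : {within `[0, t], continuous k} by apply: continuous_subspaceT; exact: derivable_cont dk.
have [s] := MVT_segment (ltW t0) (fun s _ => dk s) ck.
by rewrite in_itv /= subr0 /k scale0r addr0 => hs e; exists s.
Qed.

Lemma box_step r p (t : R) j : 0 <= t <= 1 -> ~ box (r + 1) p -> ~ box r (p + t *: e_ j).
Proof.
move=> /andP[t0 t1] nb /boxP [/=]; rewrite !ler_norml => /andP[a1 a2] /andP[b1 b2]; apply: nb; apply/boxP.
move: a1 a2 b1 b2; rewrite !ler_norml; case: j => /=; rewrite /GRing.scale /= ?mulr0 ?mulr1 ?addr0 => *;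
  by split; apply/andP; split; lra.
Qed.

Lemma box_step2 r p (t : R) j : 0 <= t <= 1 -> box r p -> box (r + 1) (p + t *: e_ j).
Proof.
move=> /andP[t0 t1] /boxP []; rewrite !ler_norml => /andP[a1 a2] /andP[b1 b2]; apply/boxP => /=.
rewrite !ler_norml; case: j => /=; rewrite /GRing.scale /= ?mulr0 ?mulr1 ?addr0;
  by split; apply/andP; split; lra.
Qed.

Lemma inv01 n : 0 <= (n.+1%:R^-1 : R) <= 1.
Proof. by rewrite invr_ge0 ler0n /= invf_le1 // ler1n. Qed.

Lemma partial_supp f j r : smooth2 f -> (forall p, ~ box r p -> f p = 0) -> forall p, ~ box (r + 1) p -> partial j f p = 0.
Proof.
move=> sf f0 p np; apply/eqP; rewrite -normr_eq0; apply/eqP/le_anti; rewrite normr_ge0 andbT.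
apply: eps_le => e e0; have [N hN] := quot_lim (smooth2_der j p sf) e0; have := hN N (leqnn _).
have i01 := inv01 N.
rewrite (f0 p) ?(f0 (p + _)) ?subr0 ?mulr0 ?sub0r ?normrN ?add0r //; first exact: box_step.
by move=> b; apply: np; have := @box_step2 r p 0 j; rewrite scale0r addr0; apply=> //; rewrite lexx ler01.
Qed.

(** Translation invariance kills the integral of each difference quotient, and these converge
    boundedly by the mean value theorem; no iterated integration is needed. The bound is taken on
    the box r + 2 because mean value points move by up to 1 from the box r + 1. *)
Lemma int_partial f j : test_function f -> plint (fun p => rc (partial j f p)) = 0.
Proof.
move=> [sf [B cB f0']]; have [r hr] := compact_box cB.
have f0 p : ~ box r p -> f p = 0 by move=> nb; apply: f0' => /hr.
have [M hM] := @continuous_bdd R (partial j f) (r + 2) (smooth2_cont (smooth2_partial j sf)).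
have [M2 hM2] := @continuous_bdd R f r (smooth2_cont sf).
have mf : mC (fun p => rc (f p)) by apply: mC_rc; apply: continuous_plane; exact: smooth2_cont.
have okf : ok (fun p => rc (f p)).
  apply: (@ok_supp R r _ `|M2|) => // p; last by move=> /f0 ->.
  have [b|/f0 ->] := pselect (box r p); last by rewrite mod0.
  by rewrite mod_rc (le_trans (hM2 p b)) // ler_norm.
pose t (n : nat) := n.+1%:R^-1 : R.
have t01 n : 0 <= t n <= 1 by exact: inv01.
pose Q n p := rc (n.+1%:R * (f (p + t n *: e_ j) - f p)).
have QE n : Q n = fun p => rc n.+1%:R * (rc (f (shift (t n *: e_ j) p)) + - rc (f p)).
  by apply/funext => p; rewrite /Q rcM rcB.
have okQ n : ok (Q n) /\ plint (Q n) = 0.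
  have [k1 e1] := plint_shift (t n *: e_ j) okf.
  have k2 := okD k1 (okN okf); rewrite QE; split; first exact: okZ.
  by rewrite plintZ // plintD // ?plintN // ?e1 ?subrr ?mulr0 //; exact: okN.
have [|||oP lim] := @plint_dct R Q (fun p => rc (partial j f p)) (fun p => `|M| * (if p \in box (r + 1) then 1 else 0)) _ (okr_Z _ (okr_box (r + 1))).
- by move=> n; apply: mC_ok; case: (okQ n).
- move=> n p; have [b|nb] := pselect (box (r + 1) p); last first.
    rewrite memNset // mulr0 /Q (f0 p) ?(f0 (p + _)) ?subrr ?mulr0 ?mod0 //; first exact: box_step.
    by move=> b; apply: nb; have := @box_step2 r p 0 j; rewrite scale0r addr0; apply=> //; rewrite lexx ler01.
  rewrite mem_set // mulr1 /Q mod_rc; have tn0 : 0 < t n by rewrite /t invr_gt0.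
  have [s /andP[s0 s1] ->] := mvt_partial j p sf tn0.
  rewrite [X in `|X|]mulrCA /t mulfV ?pnatr_eq0 // mulr1.
  apply: le_trans (hM _ _) (ler_norm _); have -> : r + 2 = r + 1 + 1 by ring.
  apply: box_step2 b; rewrite s0 (le_trans s1) //; by case/andP: (t01 n).
- move=> p e e0; have [N hN] := quot_lim (smooth2_der j p sf) e0; exists N => n /hN.
  by rewrite /Q -rcB mod_rc.
apply: eps_eq0 => e e0; have [N hN] := lim e e0; have := hN N (leqnn _).
by rewrite (okQ N).2 sub0r modN.
Qed.

Lemma test_supp f : test_function f -> exists2 r : R, (forall p, ~ box r p -> f p = 0) & forall j p, ~ box r p -> partial j f p = 0.
Proof.
move=> [sf [B cB f0']]; have [r hr] := compact_box cB.
have f0 p : ~ box r p -> f p = 0 by move=> nb; apply: f0' => /hr.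
exists (r + 1) => [p nb|j p]; last exact: partial_supp.
by apply: f0 => b; apply: nb; have := @box_step2 r p 0 false; rewrite scale0r addr0; apply=> //; rewrite lexx ler01.
Qed.

Lemma test_bdd f : test_function f -> exists M : R, (forall p, `|f p| <= M) /\ forall j p, `|partial j f p| <= M.
Proof.
move=> tf; have [r f0 pf0] := test_supp tf; have [sf _] := tf.
have [M1 h1] := @continuous_bdd R f r (smooth2_cont sf).
have [M2 h2] := @continuous_bdd R (partial false f) r (smooth2_cont (smooth2_partial _ sf)).
have [M3 h3] := @continuous_bdd R (partial true f) r (smooth2_cont (smooth2_partial _ sf)).
have a1 := ler_norm M1; have a2 := ler_norm M2; have a3 := ler_norm M3.
have b1 := normr_ge0 M1; have b2 := normr_ge0 M2; have b3 := normr_ge0 M3.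
exists (`|M1| + `|M2| + `|M3|); split=> [p|j p].
  have [b|nb] := pselect (box r p); last by rewrite f0 // normr0; lra.
  by have := h1 p b; lra.
have [b|nb] := pselect (box r p); last by rewrite pf0 // normr0; lra.
by case: j; [have := h3 p b | have := h2 p b]; lra.
Qed.

Lemma mC_cont (f : R * R -> R) : continuous f -> mC (fun p => rc (f p)).
Proof. by move=> cf; apply: mC_rc; exact: continuous_plane. Qed.

Lemma ok_cont_test (f g : R * R -> R) r : continuous f -> continuous g -> (forall p, ~ box r p -> g p = 0) ->
  ok (fun p => rc (f p * g p)).
Proof.
move=> cf cg g0; have [M1 h1] := continuous_bdd r cf; have [M2 h2] := continuous_bdd r cg.
apply: (@ok_supp R r _ (`|M1| * `|M2|)).
- have := mCM (mC_cont cf) (mC_cont cg); congr mC; apply/funext => p; by rewrite rcM.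
- move=> p; have [b|nb] := pselect (box r p); last by rewrite g0 // mulr0 mod0 mulr_ge0.
  rewrite mod_rc normrM ler_pM //; [exact: le_trans (h1 p b) (ler_norm _) | exact: le_trans (h2 p b) (ler_norm _)].
by move=> p nb; rewrite g0 // mulr0.
Qed.

Lemma ibp (f phi : R * R -> R) j : smooth2 f -> test_function phi ->
  plint (fun p => rc (f p * partial j phi p)) = - plint (fun p => rc (partial j f p * phi p)).
Proof.
move=> sf tp; have [r p0 pp0] := test_supp tp; have [sp [B cB hB]] := tp.
have tt : test_function (fun p => f p * phi p).
  by split; [exact: smooth2M | exists B => // p /hB ->; rewrite mulr0].
have := int_partial j tt.
have -> : (fun p => rc (partial j (fun q => f q * phi q) p)) = fun p => rc (partial j f p * phi p) + rc (f p * partial j phi p) :> C.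
  by apply/funext => p; rewrite partialM // rcD.
rewrite plintD; first by rewrite addrC => /eqP; rewrite addr_eq0 => /eqP.
  by apply: (@ok_cont_test _ _ r) => //; apply: smooth2_cont => //; exact: smooth2_partial.
by apply: (@ok_cont_test _ _ r) => //; [exact: smooth2_cont | apply: smooth2_cont; exact: smooth2_partial | exact: pp0].
Qed.
End Smooth.

Section Cutoff.
Variable R : realType.
Local Notation C := R[i].
Local Notation mu := (@plane R).
Local Notation cel := (@cell R).
Local Notation G := (int * int)%type.
Local Notation e_ := (@basis_vec R).
Implicit Types (p : R * R) (j : bool) (x : R) (g : G).

Lemma flat0_gt0 x : 0 < x -> 0 < flat 0 x.
Proof. by move=> x0; rewrite /flat x0 expr0 mul1r expR_gt0. Qed.

Lemma flat0_le0 x : x <= 0 -> flat 0 x = 0.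
Proof. by move=> x0; rewrite /flat ltNge x0. Qed.

Definition sg_den x := flat 0 x + flat 0 (1 - x).
Lemma sg_den_gt0 x : 0 < sg_den x.
Proof.
rewrite /sg_den; have h1 := flat_ge0 0 x; have h2 := flat_ge0 0 (1 - x).
have [x0|x0] := ltP 0 x; first by have := flat0_gt0 x0; lra.
have x1 : 0 < 1 - x by lra.
by have := flat0_gt0 x1; lra.
Qed.

Definition sg x := flat 0 x * (sg_den x)^-1.
Lemma sg_le0 x : x <= 0 -> sg x = 0.
Proof. by move=> x0; rewrite /sg flat0_le0 // mul0r. Qed.

Lemma sg_ge1 x : 1 <= x -> sg x = 1.
Proof.
move=> x1; have x0 : 0 < x by lra. have h : 1 - x <= 0 by lra.
by rewrite /sg /sg_den (flat0_le0 h) addr0 mulfV // gt_eqF // flat0_gt0.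
Qed.

Lemma sg01 x : 0 <= sg x <= 1.
Proof.
have d := sg_den_gt0 x; rewrite /sg mulr_ge0 ?flat_ge0 ?invr_ge0 ?(ltW d) //=.
by rewrite ler_pdivrMr // mul1r /sg_den lerDl flat_ge0.
Qed.

Lemma SM_sg (l1 l2 c : R) : SM (fun p => sg (l1 * p.1 + l2 * p.2 + c)).
Proof.
apply: SM_mul; first exact: SM_flat.
apply: (@SM_inv _ (fun p => sg_den (l1 * p.1 + l2 * p.2 + c))) => [|p]; last by rewrite gt_eqF // sg_den_gt0.
apply: SM_add; first exact: SM_flat.
have := SM_flat 0 (- l1) (- l2) (1 - c); congr SM; apply/funext => p; congr flat; ring.
Qed.

(** A smooth step up on [- 1 / (n + 1), 0] minus its translate by 1. Sums of integer translates
    telescope to 1, and at each point the value is eventually that of the indicator of [0, 1),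
    endpoints included. *)
Definition eta (n : nat) x := sg (n.+1%:R * x + 1) - sg (n.+1%:R * (x - 1) + 1).
Lemma n1_ge1 n : 1 <= n.+1%:R :> R. Proof. by rewrite ler1n. Qed.

Lemma eta_supp n x : ~~ (-1 <= x <= 1) -> eta n x = 0.
Proof.
have h := n1_ge1 n; rewrite negb_and -!ltNge /eta => /orP[] hx.
  by rewrite !sg_le0 ?subrr //; nra.
by rewrite !sg_ge1 ?subrr //; nra.
Qed.

Lemma eta_sum n x : -1 <= x <= 1 -> eta n (x - 1) + eta n x + eta n (x + 1) = 1.
Proof.
have h := n1_ge1 n; move=> /andP[x0 x1]; rewrite /eta.
have -> : x + 1 - 1 = x by ring.
rewrite (sg_le0 (x := n.+1%:R * (x - 1 - 1) + 1)); last by nra.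
rewrite (sg_ge1 (x := n.+1%:R * (x + 1) + 1)); last by nra.
ring.
Qed.

Lemma eta_bd n x : `|eta n x| <= 1.
Proof.
rewrite /eta; have := sg01 (n.+1%:R * x + 1); have := sg01 (n.+1%:R * (x - 1) + 1).
by rewrite ler_norml; lra.
Qed.

Lemma big_mul (a b : R) : 0 < a -> exists N, forall n, (N <= n)%N -> b <= n.+1%:R * a.
Proof.
move=> a0; exists (Num.truncn (b / a)) => n nN; rewrite -ler_pdivrMr //.
apply/ltW/(lt_le_trans (truncnS_gt _)); by rewrite ler_nat ltnS.
Qed.

Lemma eta_lim x : exists N, forall n, (N <= n)%N -> eta n x = if 0 <= x < 1 then 1 else 0.
Proof.
have [x0|x0] := ltP x 0.
  have y0 : 0 < - x by lra.
  have [N hN] := big_mul 1 y0.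
  by exists N => n /hN h; have h1 := n1_ge1 n; rewrite /= /eta !sg_le0 ?subrr //; nra.
have [x1|x1] := ltP x 1.
  have y0 : 0 < 1 - x by lra.
  have [N hN] := big_mul 1 y0.
  exists N => n /hN h; have h1 := n1_ge1 n; rewrite /= /eta sg_ge1 ?sg_le0 ?subr0 //; nra.
exists 0%N => n _; have h1 := n1_ge1 n; rewrite /= /eta !sg_ge1 ?subrr //; nra.
Qed.

Lemma caE p : ca p = 1 * p.1 + (sqrt3 R)^-1 * p.2 + 0. Proof. by rewrite /ca; ring. Qed.

Lemma cbE p : cb p = 0 * p.1 + (2 / sqrt3 R) * p.2 + 0. Proof. by rewrite /cb; ring. Qed.

Lemma SM_eta n (l1 l2 c : R) : SM (fun p => eta n (l1 * p.1 + l2 * p.2 + c)).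
Proof.
have := SM_add (SM_sg (n.+1%:R * l1) (n.+1%:R * l2) (n.+1%:R * c + 1))
  (SM_mul (SM_cst (-1)) (SM_sg (n.+1%:R * l1) (n.+1%:R * l2) (n.+1%:R * (c - 1) + 1))).
congr SM; apply/funext => p; rewrite mulN1r /eta; congr (sg _ - sg _); ring.
Qed.

(* Smooth approximation of the indicator of the cell whose lattice translates form a partition of unity. *)
Definition chi n p := eta n (ca p) * eta n (cb p).
Lemma chi_smooth n : smooth2 (chi n).
Proof.
apply: SM_smooth; have := SM_mul (SM_eta n 1 (sqrt3 R)^-1 0) (SM_eta n 0 (2 / sqrt3 R) 0).
by congr SM; apply/funext => p; rewrite -caE -cbE.
Qed.

Definition near0 p := (-1 <= ca p <= 1) && (-1 <= cb p <= 1).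
Lemma chi_supp n p : ~~ near0 p -> chi n p = 0.
Proof. by rewrite /near0 negb_and /chi => /orP[] /eta_supp ->; rewrite ?mul0r ?mulr0. Qed.

Lemma near0_box p : near0 p -> box 2 p.
Proof.
move=> /andP[h1 h2]; have := @near_box R 1 p; rewrite mulr1; apply; rewrite ler_norml; lra.
Qed.

Lemma chi_box n p : ~ box 2 p -> chi n p = 0.
Proof. by move=> nb; apply: chi_supp; apply/negP => /near0_box. Qed.

Lemma chi_test n : test_function (chi n).
Proof. by split; [exact: chi_smooth | exists (box 2); [exact: box_compact | exact: chi_box]]. Qed.

Lemma chi_bd n p : `|chi n p| <= 1.
Proof. by rewrite normrM mulr_ile1 ?eta_bd. Qed.

Lemma chi_lim p : exists N, forall n, (N <= n)%N -> rc (chi n p) = ind cel p.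
Proof.
have [N1 h1] := eta_lim (ca p); have [N2 h2] := eta_lim (cb p); exists (maxn N1 N2) => n.
rewrite geq_max /chi => /andP[/h1 -> /h2 ->]; have [c|c] := pselect (cel p).
  by rewrite ind1 //; move/cellE: (c) => [-> ->]; rewrite mulr1.
rewrite ind0 //; case: ifP => c1; case: ifP => c2; rewrite ?mulr0 ?mul0r //.
by exfalso; apply: c; apply/cellE.
Qed.

Lemma ca_cont : continuous (@ca R).
Proof. by move=> p; have := @lin_cont R 1 (sqrt3 R)^-1 0 p; rewrite (_ : (fun q => _) = @ca R) //; apply/funext => q; rewrite caE. Qed.

Lemma cb_cont : continuous (@cb R).
Proof. by move=> p; have := @lin_cont R 0 (2 / sqrt3 R) 0 p; rewrite (_ : (fun q => _) = @cb R) //; apply/funext => q; rewrite cbE. Qed.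

Lemma open_pre (X : R * R -> R) (A : set R) p : continuous X -> open A -> A (X p) -> \forall q \near p, A (X q).
Proof.
move=> cX oA Ap; apply: (cX p); exact: open_nbhs_nbhs.
Qed.

Lemma partial_near (f h : R * R -> R) j p : (\forall q \near p, f q = h q) -> partial j f p = partial j h p.
Proof. exact: near_eq_derive. Qed.

Lemma partial_cst c j p : partial j (fun=> c) p = 0.
Proof. by apply: partialE; exact: is_derive_cst. Qed.

Lemma dchi_supp n j p : ~~ near0 p -> partial j (chi n) p = 0.
Proof.
have key (X : R * R -> R) : continuous X -> ~~ (-1 <= X p <= 1) -> \forall q \near p, ~~ (-1 <= X q <= 1).
  move=> cX; rewrite negb_and -!ltNge => /orP[] h.
    have := open_pre cX (@open_lt R (-1)) h; apply: filterS => q /= hq.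
    by rewrite negb_and -!ltNge hq.
  have := open_pre cX (@open_gt R 1) h; apply: filterS => q /= hq.
  by rewrite negb_and -!ltNge hq orbT.
move=> np; rewrite -(partial_cst 0 j p); apply: partial_near.
move: np; rewrite /near0 negb_and => /orP[/(key _ ca_cont)|/(key _ cb_cont)]; apply: filterS => q hq;
  by rewrite chi_supp // /near0 negb_and hq ?orbT.
Qed.

Definition sh : seq int := [:: -1; 0; 1].
Lemma ca_lat p (a b : int) : ca (p + lat R a b) = ca p + a%:~R.
Proof. by rewrite caD ca_pt. Qed.

Lemma cb_lat p (a b : int) : cb (p + lat R a b) = cb p + b%:~R.
Proof. by rewrite cbD cb_pt. Qed.

Lemma big_sh (V : nmodType) (F : int -> V) : \sum_(a <- sh) F a = F (-1) + F 0 + F 1.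
Proof. by rewrite /sh !big_cons big_nil addr0 addrA. Qed.

Lemma chi_sum n p : near0 p -> \sum_(a <- sh) \sum_(b <- sh) chi n (p + lat R a b) = 1.
Proof.
move=> /andP[ha hb].
have -> : \sum_(a <- sh) \sum_(b <- sh) chi n (p + lat R a b) =
  (\sum_(a <- sh) eta n (ca p + a%:~R)) * (\sum_(b <- sh) eta n (cb p + b%:~R)).
  rewrite mulr_suml; apply: eq_bigr => a _; rewrite mulr_sumr; apply: eq_bigr => b _.
  by rewrite /chi ca_lat cb_lat.
by rewrite !big_sh !addr0 !mulrN1z !mulr1z !eta_sum // mulr1.
Qed.

Lemma partial_shift (f : R * R -> R) j p (t : R * R) : derivable f (p + t) (e_ j) ->
  is_derive p (e_ j) (fun q => f (q + t)) (partial j f (p + t)).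
Proof. by move=> /derivableP; apply: is_derive_quot => // h; rewrite addrA. Qed.

Lemma is_derive_bigsum (I : Type) (r : seq I) (F : I -> R * R -> R) (D : I -> R) p (v : R * R) :
  (forall i, is_derive p v (F i) (D i)) -> is_derive p v (fun q => \sum_(i <- r) F i q) (\sum_(i <- r) D i).
Proof.
move=> h; elim: r => [|i r IH].
  by apply: is_derive_cast (is_derive_cst (0 : R) p v) _ _ => [q|]; rewrite big_nil.
by apply: is_derive_cast (is_deriveD (h i) IH) _ _ => [q|]; rewrite big_cons.
Qed.

(** The nine translates already sum to 1 on a neighbourhood of each point of the cell, so the sum of
    the derivatives vanishes there. *)
Lemma dchi_sum n j p : cel p -> \sum_(a <- sh) \sum_(b <- sh) partial j (chi n) (p + lat R a b) = 0.
Proof.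
move=> /cellE [ha hb].
have D : is_derive p (e_ j) (fun q => \sum_(a <- sh) \sum_(b <- sh) chi n (q + lat R a b))
    (\sum_(a <- sh) \sum_(b <- sh) partial j (chi n) (p + lat R a b)).
  do 2 (apply: is_derive_bigsum => ?); apply: partial_shift; exact: smooth2_der (chi_smooth n).
rewrite -(partialE D); transitivity (partial j (fun=> 1 : R) p); last exact: partial_cst.
apply: partial_near.
have n1 : \forall q \near p, (ca q < 1) && (-1 < ca q).
  have h1 := open_pre ca_cont (@open_lt R 1) (_ : ca p < 1); have h2 := open_pre ca_cont (@open_gt R (-1)) (_ : -1 < ca p).
  by apply: filterS2 (h1 _) (h2 _) => [q /= -> -> //||]; lra.
have n2 : \forall q \near p, (cb q < 1) && (-1 < cb q).
  have h1 := open_pre cb_cont (@open_lt R 1) (_ : cb p < 1); have h2 := open_pre cb_cont (@open_gt R (-1)) (_ : -1 < cb p).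
  by apply: filterS2 (h1 _) (h2 _) => [q /= -> -> //||]; lra.
apply: filterS2 n1 n2 => q /andP[h1 h2] /andP[h3 h4].
have n0 : near0 q by rewrite /near0 !ltW.
exact: (chi_sum n n0).
Qed.

Lemma latN (a b : int) : lat R (- a) (- b) = - lat R a b.
Proof. by rewrite /lat /pt !mulrNz; congr (_, _); rewrite /=; ring. Qed.

Lemma cell_tile p : near0 p -> \sum_(a <- sh) \sum_(b <- sh) ind cel (p + lat R (- a) (- b)) = 1.
Proof.
move=> /andP[/andP[a0 a1] /andP[b0 b1]].
pose I1 (x : R) : C := if 0 <= x < 1 then 1 else 0.
have E a b : ind cel (p + lat R (- a) (- b)) = I1 (ca p - a%:~R) * I1 (cb p - b%:~R).
  rewrite /I1; have [c|c] := pselect (cel (p + lat R (- a) (- b))).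
    rewrite ind1 //; move/cellE: c; rewrite ca_lat cb_lat !mulrNz => -[-> ->]; by rewrite mulr1.
  rewrite ind0 //; case: ifP => c1; case: ifP => c2; rewrite ?mulr0 ?mul0r //.
  by exfalso; apply: c; apply/cellE; rewrite ca_lat cb_lat !mulrNz.
have S1 x : -1 <= x -> x <= 1 -> \sum_(a <- sh) I1 (x - a%:~R) = 1.
  move=> x0 x1; rewrite big_sh mulrN1z mulr1z mulr0z subr0 opprK /I1.
  have [h|h] : x < 0 \/ 0 <= x by case: (ltP x 0); [left | right].
    have -> : 0 <= x + 1 < 1 by lra.
    have -> : (0 <= x < 1) = false by apply/negbTE; rewrite negb_and -ltNge h.
    have -> : (0 <= x - 1 < 1) = false by apply/negbTE; rewrite negb_and -ltNge (_ : x - 1 < 0) //; lra.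
    by rewrite !addr0.
  have -> : (0 <= x + 1 < 1) = false by apply/negbTE; rewrite negb_and -!leNgt (_ : 1 <= x + 1) ?orbT //; lra.
  have [h1|h1] : x < 1 \/ 1 <= x by case: (ltP x 1); [left | right].
    rewrite h h1 /= (_ : (0 <= x - 1 < 1) = false) ?addr0 ?add0r //.
    by apply/negbTE; rewrite negb_and -ltNge (_ : x - 1 < 0) //; lra.
  have -> : (0 <= x < 1) = false by apply/negbTE; rewrite negb_and -!leNgt h1 orbT.
  by rewrite (_ : 0 <= x - 1 < 1) ?addr0 ?add0r //; lra.
transitivity ((\sum_(a <- sh) I1 (ca p - a%:~R)) * (\sum_(b <- sh) I1 (cb p - b%:~R))).
  rewrite mulr_suml; apply: eq_bigr => a _; rewrite mulr_sumr; apply: eq_bigr => b _.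
  exact: E.
by rewrite !S1 // mulr1.
Qed.

(** Unfolding: the plane integral of a periodic H against X equals the cell integral of H against
    the sum of the translates of X. H is periodic only almost everywhere, so each translate is
    compared under the integral sign. *)
Lemma fold (H X : R * R -> C) : mC H -> mC X -> (forall p, ~~ near0 p -> X p = 0) ->
  (forall m n : int, {ae mu, forall p, H (p + lat R m n) = H p}) -> ok (fun p => H p * X p) ->
  plint (fun p => H p * X p) = plint (fun p => ind cel p * (H p * \sum_(a <- sh) \sum_(b <- sh) X (p + lat R a b))).
Proof.
move=> mH mX X0 pH okHX.
have mcel : mC (ind cel) := mC_ind (@cell_measurable R).
pose K (a b : int) p := ind cel (p + lat R (- a) (- b)) * (H p * X p).
have okK a b : ok (K a b).
  apply: (ok_bddM (B := 1)) => //; last by move=> p; exact: mod_ind.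
  exact: (mC_shift (lat R (- a) (- b)) mcel).
pose K' (a b : int) p := ind cel p * (H p * X (p + lat R a b)).
have mK' a b : mC (K' a b).
  apply: mCM => //; apply: mCM => //; exact: (mC_shift (lat R a b) mX).
have aeK a b : {ae mu, forall p, K a b (p + lat R a b) = K' a b p}.
  by apply: ae_imp (pH a b) => p hp; rewrite /K /K' hp latN addrK.
have okK' a b : ok (K' a b).
  by have [k1 _] := plint_shift (lat R a b) (okK a b); apply: ok_ae (mK' a b) k1 (aeK a b).
have eK a b : plint (K a b) = plint (K' a b).
  have [k1 <-] := plint_shift (lat R a b) (okK a b).
  by apply: plint_ae (aeK a b) => //; exact: mC_ok.
have i1 a := plint_sum sh (okK a); have i2 a := plint_sum sh (okK' a).
have [_ e1] := plint_sum sh (fun a => (i1 a).1); have [_ e2] := plint_sum sh (fun a => (i2 a).1).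
transitivity (plint (fun p => \sum_(a <- sh) \sum_(b <- sh) K a b p)).
  congr plint; apply/funext => p; have [n0|n0] := boolP (near0 p).
    rewrite -[LHS]mul1r -(cell_tile n0) mulr_suml; apply: eq_bigr => a _.
    by rewrite mulr_suml.
  by rewrite /K X0 // mulr0 big1 // => a _; rewrite big1 // => b _; rewrite mulr0.
rewrite e1; transitivity (plint (fun p => \sum_(a <- sh) \sum_(b <- sh) K' a b p)).
  rewrite e2; apply: eq_bigr => a _; rewrite (i1 a).2 (i2 a).2; apply: eq_bigr => b _; exact: eK.
congr plint; apply/funext => p; rewrite !mulr_sumr; apply: eq_bigr => a _.
by rewrite !mulr_sumr.
Qed.

Definition qf (j : bool) g : R := if j then 2 * pi * (2 * fb R g + fa R g) / sqrt3 R else 2 * pi * fa R g.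
Lemma qfN j g : qf j (- g) = - qf j g.
Proof. by rewrite /qf faN fbN; case: j; ring. Qed.

Lemma chE g p : ch g p = expi (qf false g * p.1 + qf true g * p.2).
Proof. by rewrite /ch /qf /ca /cb; congr expi; have := s3_gt0 R => h; field; rewrite gt_eqF. Qed.

Definition chr g p : R := complex.Re (ch g p).
Definition chm g p : R := complex.Im (ch g p).
Lemma ch_ri g p : ch g p = rc (chr g p) + iunit R * rc (chm g p).
Proof. by rewrite /chr /chm; case: (ch g p) => a b; apply/eqP; rewrite eq_complex /=; apply/andP; split; apply/eqP; ring. Qed.

Lemma chmE g : chm g = fun p => sin (qf false g * p.1 + qf true g * p.2 + 0).
Proof. by apply/funext => p; rewrite /chm chE addr0. Qed.

Lemma chrE g : chr g = fun p => sin (qf false g * p.1 + qf true g * p.2 + pi / 2).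
Proof. by apply/funext => p; rewrite /chr chE sinDpihalf. Qed.

Lemma chr_smooth g : smooth2 (chr g).
Proof. by rewrite chrE; apply: SM_smooth; exact: SM_sin. Qed.

Lemma chm_smooth g : smooth2 (chm g).
Proof. by rewrite chmE; apply: SM_smooth; exact: SM_sin. Qed.

Lemma d_chr j g p : partial j (chr g) p = - (qf j g * chm g p).
Proof.
rewrite chrE (partialE (@derive_lin R sin _ _ _ _ j p (is_derive_sin _))) chmE addr0 cosDpihalf.
by rewrite mulrN; case: j.
Qed.

Lemma d_chm j g p : partial j (chm g) p = qf j g * chr g p.
Proof.
rewrite chmE (partialE (@derive_lin R sin _ _ _ _ j p (is_derive_sin _))) chrE addr0 sinDpihalf.
by case: j.
Qed.

Lemma weak_plint j (f h : C -> C) : is_weak_partial j f h <-> forall phi, test_function phi ->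
  plint (fun p => f (to_C p) * rc (partial j phi p)) = - plint (fun p => h (to_C p) * rc (phi p)).
Proof.
have E (k : R * R -> R) (F : C -> C) : cintegral setT (fun z => F z * rc (k (complex.Re z, complex.Im z))) =
    plint (fun p => F (to_C p) * rc (k p)).
  by rewrite cintegralE; congr plint; apply/funext => p; rewrite ind1 // mul1r; case: p.
split=> hw phi tp; first by rewrite -!E; exact: hw.
by rewrite !E; exact: hw.
Qed.

Lemma ok_test (f : C -> C) phi : L2loc f -> test_function phi ->
  ok (fun p => f (to_C p) * rc (phi p)) /\ forall j, ok (fun p => f (to_C p) * rc (partial j phi p)).
Proof.
move=> lf tp; have [r p0 pp0] := test_supp tp; have [M [hM hM2]] := test_bdd tp; have [sp _] := tp.
split=> [|j].
  have := @L2loc_ok R f (fun p => rc (phi p)) r M lf (mC_cont (smooth2_cont sp)).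
  rewrite (_ : (fun p => rc (phi p) * f (to_C p)) = fun p => f (to_C p) * rc (phi p)); last by apply/funext => p; rewrite mulrC.
  by apply=> p; [rewrite mod_rc | move=> /p0 ->].
have := @L2loc_ok R f (fun p => rc (partial j phi p)) r M lf (mC_cont (smooth2_cont (smooth2_partial j sp))).
rewrite (_ : (fun p => rc _ * f (to_C p)) = fun p => f (to_C p) * rc (partial j phi p)); last by apply/funext => p; rewrite mulrC.
by apply=> p; [rewrite mod_rc | move=> /pp0 ->].
Qed.

Lemma chi_ch_test n g : test_function (fun p => chi n p * chr g p) /\ test_function (fun p => chi n p * chm g p).
Proof.
by split; split; [apply: smooth2M; [exact: chi_smooth | exact: chr_smooth] | exists (box 2) => [|p /chi_box ->]; rewrite ?mul0r //; exact: box_compact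
 | apply: smooth2M; [exact: chi_smooth | exact: chm_smooth] | exists (box 2) => [|p /chi_box ->]; rewrite ?mul0r //; exact: box_compact].
Qed.

Definition qper (y : int) (F : R * R -> C) := forall m n : int, {ae mu, forall p, F (p + lat R m n) = phase R y (m + n) * F p}.
Lemma phaseN (y n : int) : phase R (- y) n = conjc (phase R y n).
Proof. by rewrite /phase conj_expi mulrNz; congr expi; ring. Qed.

Lemma phaseK (y n : int) : phase R y n * phase R (- y) n = 1.
Proof. by rewrite phaseN mul_conj mod_expi expr1n. Qed.

Lemma phase_eq (y y' n : int) (k : int) : y = y' + 3 * k -> phase R y n = phase R y' n.
Proof.
move=> ->; rewrite /phase (_ : 2 * pi * ((y' + 3 * k)%:~R * n%:~R / 3) = 2 * pi * (y'%:~R * n%:~R / 3) + 2 * pi * (k * n)%:~R).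
  by rewrite expiD expi_2pi mulr1.
by rewrite intrD !intrM -[3%:~R]/(3%:R); field.
Qed.

(** Integration by parts on the cell, for a derivative that is only weak. The test function is
    [chi n] times the character; the translates of its cutoff derivative sum to 0, so no boundary
    term appears. *)
Lemma weak_coef j (f h : C -> C) g : L2loc f -> L2loc h -> is_weak_partial j f h -> qper g.2 (fun p => f (to_C p)) ->
  plint (fun p => ind cel p * (h (to_C p) * ch (- g) p)) =
  iunit R * rc (qf j g) * plint (fun p => ind cel p * (f (to_C p) * ch (- g) p)).
Proof.
move=> lf lh /weak_plint hw qf'.
set c := RHS.
have ii : iunit R * iunit R = -1 by apply/eqP; rewrite eq_complex /=; apply/andP; split; apply/eqP; ring.
have mF : mC (fun p => f (to_C p) * ch (- g) p) by apply: mCM; [exact: mC_to_C | exact: ch_mC].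
have per m n : {ae mu, forall p, f (to_C (p + lat R m n)) * ch (- g) (p + lat R m n) = f (to_C p) * ch (- g) p}.
  apply: ae_imp (qf' m n) => p ->; rewrite ch_lat.
  by rewrite mulrACA phaseK mul1r.
have mch n : mC (fun p => rc (chi n p)) := mC_cont (smooth2_cont (chi_smooth n)).
have mdch n : mC (fun p => rc (partial j (chi n) p)) := mC_cont (smooth2_cont (smooth2_partial j (chi_smooth n))).
have okch F : ok F -> ok (fun p => ch (- g) p * F p).
  by apply: (ok_bddM (B := 1)) => [|p]; [exact: ch_mC | rewrite ch_mod].
have okchi n : ok (fun p => f (to_C p) * ch (- g) p * rc (chi n p)).
  by have := okch _ (ok_test lf (chi_test n)).1; congr ok; apply/funext => p; ring.
have okdchi n : ok (fun p => f (to_C p) * ch (- g) p * rc (partial j (chi n) p)).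
  by have := okch _ ((ok_test lf (chi_test n)).2 j); congr ok; apply/funext => p; ring.
have okh n : ok (fun p => h (to_C p) * ch (- g) p * rc (chi n p)).
  by have := okch _ (ok_test lh (chi_test n)).1; congr ok; apply/funext => p; ring.
(* An identity for every n, since only h is not known to be periodic. The limit below replaces
   [chi n] by the indicator of the cell. *)
have step n : plint (fun p => h (to_C p) * ch (- g) p * rc (chi n p)) = c.
  have [t1 t2] := chi_ch_test n (- g).
  have [a1 a2] := ok_test lf t1; have [b1 b2] := ok_test lf t2.
  have [c1 _] := ok_test lh t1; have [d1 _] := ok_test lh t2.
  have w1 := hw _ t1; have w2 := hw _ t2.
  have L : plint (fun p => f (to_C p) * ch (- g) p * rc (partial j (chi n) p) +
       (- (iunit R * rc (qf j g))) * (f (to_C p) * ch (- g) p * rc (chi n p))) =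
     - plint (fun p => h (to_C p) * ch (- g) p * rc (chi n p)).
    transitivity (plint (fun p => f (to_C p) * rc (partial j (fun p => chi n p * chr (- g) p) p) +
        iunit R * (f (to_C p) * rc (partial j (fun p => chi n p * chm (- g) p) p)))).
      congr plint; apply/funext => p.
      have E1 : rc (partial j (fun p => chi n p * chr (- g) p) p) = rc (partial j (chi n) p) * rc (chr (- g) p) + rc (chi n p) * (rc (qf j g) * rc (chm (- g) p)) :> C.
        by rewrite (partialM j p (chi_smooth n) (chr_smooth (- g))) d_chr qfN mulNr opprK rcD !rcM.
      have E2 : rc (partial j (fun p => chi n p * chm (- g) p) p) = rc (partial j (chi n) p) * rc (chm (- g) p) - rc (chi n p) * (rc (qf j g) * rc (chr (- g) p)) :> C.
        by rewrite (partialM j p (chi_smooth n) (chm_smooth (- g))) d_chm qfN mulNr mulrN rcB !rcM.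
      rewrite E1 E2 ch_ri.
      set A := f _; set B := rc (partial _ _ _); set y1 := rc (chr _ _); set y2 := rc (chm _ _); set q := rc (qf _ _); set X := rc (chi _ _).
      transitivity (A * (B * (y1 + iunit R * y2) - iunit R * q * y1 * X - (iunit R * iunit R) * q * y2 * X)); first by ring.
      by rewrite ii; ring.
    have b2' := okZ (iunit R) (b2 j); have d1' := okZ (iunit R) d1.
    rewrite (plintD (a2 j) b2') (plintZ _ (b2 j)) w1 w2.
    rewrite mulrN -opprD -(plintZ _ d1) -(plintD c1 d1'); congr (- plint _); apply/funext => p.
    by rewrite [ch _ _]ch_ri !rcM; ring.
  have k1 := okZ (- (iunit R * rc (qf j g))) (okchi n).
  move: L; rewrite (plintD (okdchi n) k1) (plintZ _ (okchi n)).
  rewrite (fold mF (mdch n) _ per (okdchi n)); last by move=> p np; rewrite dchi_supp.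
  rewrite (fold mF (mch n) _ per (okchi n)); last by move=> p np; rewrite chi_supp.
  rewrite (_ : (fun p => ind cel p * (f (to_C p) * ch (- g) p * \sum_(a <- sh) \sum_(b <- sh) rc (partial j (chi n) (p + lat R a b)))) = fun=> 0); last first.
    apply/funext => p; have [cp|cp] := pselect (cel p); last by rewrite ind0 // mul0r.
    under eq_bigr do rewrite -rc_sum; rewrite -rc_sum dchi_sum //= mulr0 mulr0 //.
  rewrite (_ : (fun p => ind cel p * (f (to_C p) * ch (- g) p * \sum_(a <- sh) \sum_(b <- sh) rc (chi n (p + lat R a b)))) = fun p => ind cel p * (f (to_C p) * ch (- g) p)); last first.
    apply/funext => p; have [cp|cp] := pselect (cel p); last by rewrite ind0 // !mul0r.
    under eq_bigr do rewrite -rc_sum; rewrite -rc_sum chi_sum //= ?mulr1 //.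
    by move/cellE: cp; rewrite /near0 => -[]; lra.
  by rewrite plint0 add0r mulNr => /oppr_inj <-.
have okb : ok (fun p => ind (box 2) p * h (to_C p)).
  apply: (@L2loc_ok R h (ind (box 2)) 2 1 lh); first by apply: mC_ind; exact: box_measurable.
    by move=> p; exact: mod_ind.
  by move=> p nb; rewrite ind0.
have [|||_ lim] := @plint_dct R (fun n p => h (to_C p) * ch (- g) p * rc (chi n p)) (fun p => ind cel p * (h (to_C p) * ch (- g) p))
  (fun p => modulus (ind (box 2) p * h (to_C p))) _ (okr_mod okb).
- by move=> n; exact: mC_ok.
- move=> n p; have [b|nb] := pselect (box 2 p); last by rewrite chi_box // mulr0 mod0 mod_ge0.
  rewrite ind1 // mul1r !modM ch_mod mulr1 mod_rc ler_piMr ?mod_ge0 //; exact: chi_bd.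
- move=> p e e0; have [N hN] := chi_lim p; exists N => n /hN ->.
  by rewrite [_ * ind cel p]mulrC subrr mod0 ltW.
apply/eqP; rewrite -subr_eq0; apply/eqP; apply: eps_eq0 => e e0; have [N hN] := lim e e0.
by have := hN N (leqnn _); rewrite step modC.
Qed.
End Cutoff.

Section Fourier.
Variable R : realType.
Local Notation C := R[i].
Local Notation T := (measurableTypeR R * measurableTypeR R)%type.
Local Notation mu := (@plane R).
Local Notation cel := (@cell R).
Local Notation G := (int * int)%type.
Implicit Types (p : R * R) (g h : G) (f : C -> C) (F H : R * R -> C).

Lemma mC_cel : mC (ind cel). Proof. by apply: mC_ind; exact: cell_measurable. Qed.

Lemma ok_cel : ok (ind cel).
Proof. by apply: (@ok_supp R 2 _ 1 mC_cel (mod_ind _)) => p np; rewrite ind0 // => /cell_box. Qed.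

Lemma ok_celM F (M : R) : mC F -> (forall p, cel p -> modulus (F p) <= M) -> ok (fun p => ind cel p * F p).
Proof.
move=> mF hM; apply: (@ok_supp R 2 _ `|M|); first by apply: mCM => //; exact: mC_cel.
  move=> p; have [cp|cp] := pselect (cel p); last by rewrite ind0 // mul0r mod0.
  by rewrite ind1 // mul1r (le_trans (hM p cp)) // ler_norm.
by move=> p np; rewrite ind0 ?mul0r // => /cell_box.
Qed.

Definition area : R := \int[mu]_p complex.Re (ind cel p).
Lemma areaE : plint (ind cel) = rc area.
Proof.
rewrite -plint_real; last by case: ok_cel.
by congr plint; apply/funext => p; rewrite /ind; case: ifP.
Qed.

Lemma area_gt0 : 0 < area.
Proof.
pose Q : set T := `[0, 1/4 : R]%classic `*` `[0, 1/4 : R]%classic.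
have mQ : measurable Q by apply: measurableX; exact: measurable_itv.
have QC : Q `<=` cel.
  move=> p [/=]; rewrite !in_itv /= => /andP[a0 a1] /andP[b0 b1]; apply/cellE; rewrite /ca /cb.
  have [h1 h2] := s3_bd R; have i0 : 0 < (sqrt3 R)^-1 by rewrite invr_gt0; lra.
  have i1 : (sqrt3 R)^-1 <= 1 by rewrite invf_le1; lra.
  by split; apply/andP; split; nra.
have e1 : area = fine (mu cel).
  rewrite /area /Rintegral; congr fine.
  have <- : (\int[mu]_(p in cel) (cst 1%:E) p)%E = mu cel.
    by rewrite integral_cst ?mul1e //; exact: cell_measurable.
  rewrite [RHS]integral_mkcond; apply: eq_integral => p _; rewrite patchE /ind; by case: ifP.
have fin : (mu cel < +oo)%E.
  apply: (@le_lt_trans _ _ (mu (box 2 : set T))).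
    by apply: le_measure; rewrite ?inE; [exact: cell_measurable | exact: box_measurable | exact: cell_box].
  rewrite planeX; try exact: measurable_itv.
  by rewrite !lebesgue_measure_itv /=; case: ifP => _; rewrite ?mule0 // -EFinM ltry.
rewrite e1 fine_gt0 // fin andbT; apply: (@lt_le_trans _ _ (mu Q)); last first.
  by apply: le_measure; rewrite ?inE //; exact: cell_measurable.
rewrite planeX; try exact: measurable_itv.
rewrite !lebesgue_measure_itv /= lte_fin (_ : 0 < 1/4 :> R); last by lra.
by rewrite -EFinB -EFinM lte_fin; lra.
Qed.

Definition fC F : C -> C := fun z => F (complex.Re z, complex.Im z).
Lemma fCE F : (fun p => fC F (to_C p)) = F. Proof. by apply/funext => -[a b]. Qed.

Lemma L2loc_bdd f : mC (fun p => f (to_C p)) -> (forall r : R, exists M : R, forall p, box r p -> modulus (f (to_C p)) <= M) -> L2loc f.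
Proof.
move=> mf hb; have mm := mC_mod mf; case: (mf) => m1 m2; split=> // B cB; have [r hr] := compact_box cB.
have [M hM] := hb r; have mB := compact_plane cB.
have m2' : measurable_fun [set: T] (fun p : T => (modulus (f (to_C p)) ^+ 2)%:E).
  by apply/measurable_EFinP; exact: measurable_funX.
apply: (@le_lt_trans _ _ (\int[mu]_(p in B) (M ^+ 2)%:E)%E).
  apply: ge0_le_integral => //.
  - by move=> p _; rewrite lee_fin sqr_ge0.
  - exact: measurable_funS m2'.
  move=> p Bp; rewrite lee_fin lerXn2r ?nnegrE ?mod_ge0 ?hM //; first by apply: le_trans (mod_ge0 _) (hM p _); exact: hr.
  exact: hr.
rewrite integral_cst // lte_mul_pinfty ?lee_fin ?sqr_ge0 //.
apply: (@le_lt_trans _ _ (mu (box r : set T))).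
  by apply: le_measure; rewrite ?inE //; exact: box_measurable.
rewrite planeX; try exact: measurable_itv.
by rewrite !lebesgue_measure_itv /=; case: ifP => _; rewrite ?mule0 // -EFinM ltry.
Qed.

Lemma L2loc_cst c : L2loc (fun=> c : C).
Proof. by apply: L2loc_bdd => [|r]; [exact: mC_cst | exists (modulus c)]. Qed.

Lemma phase0 n : phase R 0 n = 1.
Proof. by rewrite /phase mulr0z !mul0r mulr0 expi0. Qed.

Lemma qf_eq0 g : (forall j, qf R j g = 0) -> g = 0.
Proof.
move=> h; have h0 := h false; have h1 := h true; have p0 := pi_gt0 R; have s0 := s3_gt0 R.
have a0 : fa R g = 0 by move: h0; rewrite /qf => /eqP; rewrite mulf_eq0 gt_eqF ?mulr_gt0 //= => /eqP.
have b0 : fb R g = 0.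
  move: h1; rewrite /qf a0 addr0 => e.
  have p2 : 0 < 2 * pi :> R by rewrite mulr_gt0.
  by move/eqP: e; rewrite mulf_eq0 invr_eq0 (gt_eqF s0) orbF mulf_eq0 (gt_eqF p2) /= mulf_eq0 pnatr_eq0 /= => /eqP.
have y0 : g.2 = 0.
  move/eqP: b0; rewrite /fb mulf_eq0 invr_eq0 pnatr_eq0 orbF intr_eq0 => /eqP //.
move: a0; rewrite /fa y0 mulr0z mul0r addr0 => /eqP; rewrite intr_eq0 => /eqP x0.
by case: g x0 y0 {h h0 h1 b0} => a b /= -> ->.
Qed.

Lemma weak0 j : is_weak_partial j (fun=> 1 : C) (fun=> 0).
Proof.
apply/weak_plint => phi tp; rewrite [X in - X](_ : _ = 0); last first.
  by rewrite -[RHS]plint0; congr plint; apply/funext => p; rewrite mul0r.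
by rewrite oppr0 -[RHS](int_partial j tp); congr plint; apply/funext => p; rewrite mul1r.
Qed.

(** [weak_coef] applied to the constant 1, whose weak derivative is 0, gives qf * integral = 0 for
    both components of the frequency. *)
Lemma ch_orth g (k : int) : g.2 = 3 * k -> g != 0 -> plint (fun p => ind cel p * ch g p) = 0.
Proof.
move=> gk g0; have per : qper (- g).2 (fun _ : R * R => 1 : C).
  move=> m n; apply: aeW => p; rewrite mulr1 (@phase_eq R _ 0 (m + n) (- k)) ?phase0 //.
  by rewrite /= gk add0r mulrN.
have key j : iunit R * rc (qf R j (- g)) * plint (fun p => ind cel p * ch g p) = 0.
  have := weak_coef (L2loc_cst 1) (L2loc_cst 0) (weak0 j) per; rewrite opprK.
  rewrite (_ : (fun p => ind cel p * (1 * ch g p)) = fun p => ind cel p * ch g p); last by apply/funext => p; rewrite mul1r.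
  move=> <-; rewrite -[RHS]plint0; congr plint; apply/funext => p; by rewrite mul0r mulr0.
apply/eqP; apply: contraT => nz; case/eqP: g0; apply: oppr_inj; rewrite oppr0; apply: qf_eq0 => j.
have := key j => /eqP; rewrite mulf_eq0 (negbTE nz) orbF mulf_eq0 => /orP[|/eqP].
  by rewrite eq_complex /= oner_eq0 andbF.
by move=> [].
Qed.

Definition coef F g : C := (rc area)^-1 * plint (fun p => ind cel p * (F p * ch (- g) p)).
Lemma rc_area : rc area != 0 :> C.
Proof. by rewrite eq_complex /= gt_eqF // area_gt0. Qed.

Lemma coefE F g : plint (fun p => ind cel p * (F p * ch (- g) p)) = rc area * coef F g.
Proof. by rewrite /coef mulVKf // rc_area. Qed.

Definition okc F := mC F /\ ok (fun p => ind cel p * F p).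
Lemma okc_ch F g : okc F -> ok (fun p => ind cel p * (F p * ch g p)).
Proof.
move=> [mF oF]; have := ok_bddM (B := 1) (ch_mC R g) _ oF.
rewrite (_ : (fun p => ch g p * _) = fun p => ind cel p * (F p * ch g p)); last by apply/funext => p; ring.
by apply=> p; rewrite ch_mod.
Qed.

Lemma okcM F g : okc F -> okc (fun p => F p * ch g p).
Proof. by move=> oF; split; [apply: mCM; [case: oF | exact: ch_mC] | exact: okc_ch]. Qed.

Lemma okcD F H : okc F -> okc H -> okc (fun p => F p + H p).
Proof.
move=> [m1 k1] [m2 k2]; split; first exact: mCD.
by have := okD k1 k2; congr ok; apply/funext => p; rewrite mulrDr.
Qed.

Lemma okcZ c F : okc F -> okc (fun p => c * F p).
Proof.
move=> [m1 k1]; split; first by apply: mCM => //; exact: mC_cst.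
by have := okZ c k1; congr ok; apply/funext => p; ring.
Qed.

Lemma L2loc_okc f : L2loc f -> okc (fun p => f (to_C p)).
Proof.
move=> lf; split; first exact: mC_to_C.
have := @L2loc_cell R f (fun=> 1) 1 lf (mC_cst 1); rewrite (_ : (fun p => _ * (_ * 1)) = fun p => ind cel p * f (to_C p)).
  by apply=> p _; rewrite (mod_rc 1) normr1.
by apply/funext => p; rewrite mulr1.
Qed.

Lemma coefD F H g : okc F -> okc H -> coef (fun p => F p + H p) g = coef F g + coef H g.
Proof.
move=> hF hH; rewrite /coef -mulrDr -plintD; try exact: okc_ch.
by congr (_ * plint _); apply/funext => p; ring.
Qed.

Lemma coefZ c F g : okc F -> coef (fun p => c * F p) g = c * coef F g.
Proof.
move=> hF; rewrite /coef [RHS]mulrCA -[c * plint _]plintZ; last exact: okc_ch.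
by congr (_ * plint _); apply/funext => p; ring.
Qed.

Lemma coef_ae F H g : mC F -> mC H -> {ae mu, forall p, cel p -> F p = H p} -> coef F g = coef H g.
Proof.
move=> mF mH ae; congr (_ * _); apply: plint_ae.
- by apply: mCM; [exact: mC_cel | apply: mCM => //; exact: ch_mC].
- by apply: mCM; [exact: mC_cel | apply: mCM => //; exact: ch_mC].
apply: ae_imp ae => p e; have [c|c] := pselect (cel p); last by rewrite ind0 // !mul0r.
by rewrite e.
Qed.

Lemma coef_ch h g (k : int) : (g - h).2 = 3 * k -> coef (ch h) g = if g == h then 1 else 0.
Proof.
move=> gk; have -> : coef (ch h) g = (rc area)^-1 * plint (fun p => ind cel p * ch (h - g) p).
  by congr (_ * plint _); apply/funext => p; rewrite chD.
case: eqP => [->|ne].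
  rewrite subrr (_ : (fun p => ind cel p * ch 0 p) = ind cel); first by rewrite areaE mulVf // rc_area.
  by apply/funext => p; rewrite ch0 mulr1.
rewrite (@ch_orth _ (- k)) ?mulr0 //.
  by rewrite -opprB mulrN -gk.
by rewrite subr_eq0; apply/eqP => e; apply: ne.
Qed.

(** Multiplying by one character of the opposite class reduces to the untwisted case. *)
Lemma completeness F (y : int) : okc F -> (forall g (k : int), g.2 - y = 3 * k -> coef F g = 0) ->
  {ae mu, forall p, cel p -> F p = 0}.
Proof.
move=> okF h; have [mF oF] := okcM (0, - y) okF.
apply: ae_imp (completeness0 oF _) => [p e cp|m n].
  by have /eqP := e cp; rewrite mulf_eq0 (negbTE (expi_neq0 _)) orbF => /eqP.
have := h (- ((m, n * 3) + (0, - y))) (- n) _; rewrite /= opprD opprK addrK => /(_ _) e.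
have {e} : coef F (- ((m, n * 3) + (0, - y))) = 0 by apply: e; ring.
rewrite /coef opprK => /eqP; rewrite mulf_eq0 invr_eq0 (negbTE rc_area) /= => /eqP e; rewrite -[RHS]e.
by congr plint; apply/funext => p; rewrite chD; ring.
Qed.

Lemma L2loc_sqc f : L2loc f -> okr (fun p => if p \in cel then modulus (f (to_C p)) ^+ 2 else 0).
Proof.
move=> lf; have h := L2loc_sq 2 lf; have mf := mC_mod (mC_to_C lf).
have E : (fun p => rc (if p \in cel then modulus (f (to_C p)) ^+ 2 else 0)) = fun p => ind cel p * rc (modulus (f (to_C p)) ^+ 2) :> C.
  by apply/funext => p; rewrite /ind; case: ifP => _; rewrite ?mul1r ?mul0r.
have : ok (fun p => rc (if p \in cel then modulus (f (to_C p)) ^+ 2 else 0)).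
  apply: (ok_le _ h) => [|p]; first by rewrite E; apply: mCM; [exact: mC_cel | apply: mC_rc; exact: measurable_funX].
  rewrite mod_rc ger0_norm; last by case: ifP => // _; exact: sqr_ge0.
  case: ifPn => [|_]; last by case: ifP => // _; exact: sqr_ge0.
  by rewrite inE => /cell_box b; rewrite mem_set.
by case.
Qed.

(** Expand the integral of |F - P|^2 over the cell, P being the Fourier polynomial over S. The cross
    terms and |P|^2 all give area * W, because characters of one class mod 3 are orthogonal on the
    cell. *)
Lemma bessel f (y : int) (S : {fset G}) : L2loc f -> (forall g, g \in S -> exists k : int, g.2 - y = 3 * k) ->
  area * rpsum (sq (coef (fun p => f (to_C p)))) S <= \int[mu]_p (if p \in cel then modulus (f (to_C p)) ^+ 2 else 0).
Proof.
move=> lf hS; set F := fun p => f (to_C p); set h := fun p => if _ then _ else _.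
have okh : okr h := L2loc_sqc lf; have cF := L2loc_okc lf.
have [c cE] : exists c : G -> C, c = coef F by exists (coef F).
rewrite -cE; pose P p := \sum_(g <- S) c g * ch g p.
have mP : mC P by apply: mC_sum => g; apply: mCM; [exact: mC_cst | exact: ch_mC].
pose W : R := rpsum (sq c) S.
have bP p : modulus (P p) <= \sum_(g <- S) modulus (c g).
  by apply: le_trans (mod_sum _ _) _; apply: ler_sum => g _; rewrite modM ch_mod mulr1.
have k1 g : ok (fun p => conjc (c g) * (ind cel p * (F p * ch (- g) p))) by apply: okZ; exact: okc_ch.
have e1 : plint (fun p => ind cel p * (F p * conjc (P p))) = rc (area * W).
  transitivity (plint (fun p => \sum_(g <- S) conjc (c g) * (ind cel p * (F p * ch (- g) p)))).
    congr plint; apply/funext => p; rewrite /P conjc_sum !mulr_sumr; apply: eq_bigr => g _.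
    by rewrite conjcM ch_conj; ring.
  rewrite (plint_sum S k1).2 rcM /W /rpsum rc_sum mulr_sumr; apply: eq_bigr => g _.
  by rewrite plintZ ?coefE -?cE; [rewrite /sq -mul_conj; ring | exact: okc_ch].
have o1 : ok (fun p => ind cel p * (F p * conjc (P p))).
  have [+ _] := plint_sum S k1; congr ok; apply/funext => p; rewrite /P conjc_sum !mulr_sumr; apply: eq_bigr => g _.
  by rewrite conjcM ch_conj; ring.
have o2 := ok_conj o1; have e2 := plint_conj o1; rewrite e1 conjc_real in e2.
have o3 : ok (fun p => ind cel p * (P p * conjc (P p))).
  apply: (@ok_celM _ ((\sum_(g <- S) modulus (c g)) * (\sum_(g <- S) modulus (c g)))).
    by apply: mCM => //; exact: mC_conj.
  by move=> p _; rewrite modM mod_conj ler_pM ?mod_ge0.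
have e3 : plint (fun p => ind cel p * (P p * conjc (P p))) = rc (area * W).
  have k3 g : ok (fun p => conjc (c g) * (ind cel p * (P p * ch (- g) p))).
    by apply: okZ; apply: okc_ch; split=> //; apply: ok_celM => // p _; exact: bP.
  transitivity (plint (fun p => \sum_(g <- S) conjc (c g) * (ind cel p * (P p * ch (- g) p)))).
    congr plint; apply/funext => p; rewrite {2}/P conjc_sum !mulr_sumr; apply: eq_bigr => g _.
    by rewrite conjcM ch_conj; ring.
  rewrite (plint_sum S k3).2 rcM /W /rpsum rc_sum mulr_sumr; apply: eq_big_seq => g gS.
  have oP : okc P by split=> //; apply: ok_celM => // p _; exact: bP.
  rewrite plintZ ?coefE; last exact: okc_ch.
  have cP : coef P g = c g.
    have k4 h' : ok (fun p => c h' * (ind cel p * (ch h' p * ch (- g) p))).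
      by apply: okZ; apply: okc_ch; split; [exact: ch_mC | apply: (@ok_celM _ 1) => [|p _]; [exact: ch_mC | rewrite ch_mod]].
    have -> : coef P g = \sum_(h' <- S) c h' * coef (ch h') g.
      rewrite /coef (_ : (fun p => ind cel p * (P p * ch (- g) p)) = fun p => \sum_(h' <- S) c h' * (ind cel p * (ch h' p * ch (- g) p))).
        rewrite (plint_sum S k4).2 mulr_sumr; apply: eq_bigr => h' _; rewrite plintZ; first by ring.
        by apply: okc_ch; split; [exact: ch_mC | apply: (@ok_celM _ 1) => [|p _]; [exact: ch_mC | rewrite ch_mod]].
      by apply/funext => p; rewrite /P mulr_suml mulr_sumr; apply: eq_bigr => h' _; ring.
    rewrite (bigD1_seq g) //= (@coef_ch g g 0) ?subrr ?mulr0 // eqxx mulr1 big_seq_cond big1 ?addr0 //.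
    move=> h' /andP[hS' ne]; have [kg eg] := hS g gS; have [kh eh] := hS h' hS'.
    have dk : (g - h').2 = 3 * (kg - kh).
      have -> : (g - h').2 = (g.2 - y) - (h'.2 - y) by rewrite /=; ring.
      by rewrite eg eh mulrBr.
    by rewrite (coef_ch dk) eq_sym (negbTE ne) mulr0.
  by rewrite cP /sq -mul_conj; ring.
have o4 : ok (fun p => rc (h p)) by split; [exact: okh | exact: integrable0].
have e4 : plint (fun p => ind cel p * ((F p - P p) * conjc (F p - P p))) = rc (\int[mu]_p h p - area * W).
  have -> : (fun p => ind cel p * ((F p - P p) * conjc (F p - P p))) =
     fun p => (rc (h p) + - (ind cel p * (F p * conjc (P p)))) +
      (- conjc (ind cel p * (F p * conjc (P p))) + ind cel p * (P p * conjc (P p))).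
    apply/funext => p; have -> : rc (h p) = ind cel p * (F p * conjc (F p)).
      by rewrite /h /ind mul_conj /F; case: ifP; rewrite ?mul1r ?mul0r.
    by rewrite !conjcM conjcB conjcK conj_ind; ring.
  have q1 := okN o1; have q2 := okN o2; have q3 := okD o4 q1; have q4 := okD q2 o3.
  rewrite (plintD q3 q4) (plintD o4 q1) (plintD q2 o3) !plintN // e1 e2 e3 plint_real // rcB; ring.
have : 0 <= \int[mu]_p h p - area * W; last by rewrite subr_ge0.
have o5 : ok (fun p => ind cel p * ((F p - P p) * conjc (F p - P p))).
  have -> : (fun p => ind cel p * ((F p - P p) * conjc (F p - P p))) =
     fun p => (rc (h p) + - (ind cel p * (F p * conjc (P p)))) +
      (- conjc (ind cel p * (F p * conjc (P p))) + ind cel p * (P p * conjc (P p))).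
    apply/funext => p; have -> : rc (h p) = ind cel p * (F p * conjc (F p)).
      by rewrite /h /ind mul_conj /F; case: ifP; rewrite ?mul1r ?mul0r.
    by rewrite !conjcM conjcB conjcK conj_ind; ring.
  by apply: okD; apply: okD => //; exact: okN.
have [-> _] : \int[mu]_p h p - area * W = \int[mu]_p complex.Re (ind cel p * ((F p - P p) * conjc (F p - P p))) /\ True.
  by split=> //; move: e4; rewrite /plint => -[-> _].
apply: Rintegral_ge0 => p _; rewrite mul_conj /ind; case: ifP => _; rewrite ?mul1r ?mul0r //=.
exact: sqr_ge0.
Qed.

Lemma coef_l2 f (y : int) (J : G -> bool) : L2loc f -> (forall g, J g -> exists k : int, g.2 - y = 3 * k) ->
  l2 (fun g => if J g then coef (fun p => f (to_C p)) g else 0).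
Proof.
move=> lf hJ; set I := \int[mu]_p (if p \in cel then modulus (f (to_C p)) ^+ 2 else 0).
exists (area^-1 * I) => S.
rewrite -(ler_pM2l area_gt0) mulrA mulfV ?gt_eqF ?area_gt0 // mul1r.
have hS g : g \in [fset g in S | J g]%fset -> exists k : int, g.2 - y = 3 * k.
  by rewrite !inE => /andP[_ /hJ].
apply: le_trans (bessel lf hS); rewrite ler_wpM2l ?(ltW area_gt0) // /rpsum.
have -> : \sum_(i <- S) sq (fun g => if J g then coef (fun p => f (to_C p)) g else 0) i = \sum_(i <- S | J i) sq (coef (fun p => f (to_C p))) i.
  by rewrite [RHS]big_mkcond; apply: eq_bigr => i _; rewrite /sq; case: ifP => // _; rewrite mod0 expr0n.
by rewrite big_fset_condE /= lexx.
Qed.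
End Fourier.

(** * Fourier series with twisted frequencies *)

Section Series.
Variable R : realType.
Local Notation C := R[i].
Local Notation mu := (@plane R).
Local Notation cel := (@cell R).
Local Notation G := (int * int)%type.
Implicit Types (p : R * R) (g h : G) (f : C -> C) (F H : R * R -> C) (s : G -> C).

Definition ser s p : C := csum (fun g => s g * ch g p).
Lemma asum_ch s p : asum s -> asum (fun g => s g * ch g p).
Proof.
move=> hs; have := asum_bdd (g := fun g => ch g p) (B := 1) _ hs.
rewrite (_ : (fun t => ch t p * s t) = fun g => s g * ch g p); last by apply/funext => g; rewrite mulrC.
by apply=> g; rewrite ch_mod.
Qed.

(** One sequence of finite sets serves for all multipliers bounded by B. Hence the partial sums
    converge uniformly in p, which yields measurability, continuity and the exchange with
    integrals. *)
Lemma approx s : asum s -> exists Sn : nat -> {fset G}, forall n (c : G -> C) (B : R), (forall g, modulus (c g) <= B) ->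
  modulus (csum (fun g => s g * c g) - psum (fun g => s g * c g) (Sn n)) <= B / n.+1%:R.
Proof.
move=> hs; have tl n : exists S, forall S', [disjoint S & S']%fset -> rpsum (fun g => modulus (s g)) S' <= n.+1%:R^-1.
  by apply: (bsum_tail (fun g => mod_ge0 (s g)) hs); rewrite invr_gt0.
have [Sn hSn] := choice tl; exists Sn => n c B hB.
have B0 : 0 <= B by exact: le_trans (mod_ge0 _) (hB 0).
have hsc : asum (fun g => s g * c g).
  have := asum_bdd hB hs; congr asum; apply/funext => g; exact: mulrC.
pose f1 g := if g \in Sn n then s g * c g else 0; pose f2 g := if g \in Sn n then 0 else s g * c g.
have E : (fun g => s g * c g) = fun g => f1 g + f2 g.
  by apply/funext => g; rewrite /f1 /f2; case: ifP; rewrite ?addr0 ?add0r.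
have a1 : asum f1 by apply: asum_le hsc => g; rewrite /f1; case: ifP; rewrite ?mod0 ?mod_ge0.
have a2 : asum f2 by apply: asum_le hsc => g; rewrite /f2; case: ifP; rewrite ?mod0 ?mod_ge0.
have e1 : csum f1 = psum (fun g => s g * c g) (Sn n).
  rewrite (@csum_fin _ _ _ (Sn n)); last by move=> g /negbTE h; rewrite /f1 h.
  by rewrite /psum; apply: eq_big_seq => g h; rewrite /f1 h.
rewrite {1}E csumD // e1 addrC addKr; apply: csum_ler => S.
apply: le_trans (_ : B * rpsum (fun g => modulus (s g)) (S `\` Sn n)%fset <= _); last first.
  by rewrite ler_wpM2l // hSn //; apply/fdisjointP => g gS; rewrite !inE gS.
have -> : rpsum (fun g => modulus (f2 g)) S = rpsum (fun g => modulus (f2 g)) (S `\` Sn n)%fset.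
  rewrite /rpsum (big_fsetID _ (mem (Sn n))) /= big1_fset ?add0r; last first.
    by move=> g; rewrite !inE /f2 => /andP[_ ->]; rewrite mod0.
  by apply: eq_fbigl => g; rewrite !inE andbC.
rewrite /rpsum mulr_sumr; apply: ler_sum => g _; rewrite /f2; case: ifP => _.
  by rewrite mod0 mulr_ge0 ?mod_ge0.
by rewrite modM mulrC ler_wpM2r ?mod_ge0.
Qed.

Lemma inv_small (e : R) : 0 < e -> exists N, forall n, (N <= n)%N -> n.+1%:R^-1 <= e.
Proof.
move=> e0; exists (Num.truncn e^-1) => n nN; rewrite invf_ple ?posrE //.
by apply/ltW/(lt_le_trans (truncnS_gt _)); rewrite ler_nat ltnS.
Qed.

Lemma ser_mC s : asum s -> mC (ser s).
Proof.
move=> hs; have [Sn hSn] := approx hs.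
apply: (@mC_lim R (fun n p => psum (fun g => s g * ch g p) (Sn n))) => [n|p e e0].
  by apply: mC_sum => g; apply: mCM; [exact: mC_cst | exact: ch_mC].
have [N hN] := inv_small e0; exists N => n /hN h; rewrite modC.
have := hSn n (fun g => ch g p) 1; rewrite mul1r => /(_ _) h2; apply: le_trans (h2 _) h => g; by rewrite ch_mod.
Qed.

Lemma ser_bd s p : asum s -> modulus (ser s p) <= rsum (fun g => modulus (s g)).
Proof.
move=> hs; apply: csum_ler => S; have := rpsum_rsum S (fun g => mod_ge0 (s g)) hs; apply: le_trans.
by apply: ler_sum => g _; rewrite modM ch_mod mulr1.
Qed.

Lemma ser_swap s H : asum s -> ok H ->
  plint (fun p => ser s p * H p) = csum (fun g => s g * plint (fun p => ch g p * H p)).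
Proof.
move=> hs oH; have [Sn hSn] := approx hs.
pose B : R := 2 * \int[mu]_p modulus (H p); have okm := okr_mod oH.
have okch g : ok (fun p => ch g p * H p).
  by apply: (ok_bddM (B := 1)) => // [|p]; [exact: ch_mC | rewrite ch_mod].
have hB g : modulus (plint (fun p => ch g p * H p)) <= B.
  by apply: plint_le => //; [exact: mC_ok | move=> p; rewrite modM ch_mod mul1r].
have B0 : 0 <= B by exact: le_trans (mod_ge0 _) (hB 0).
have okser : ok (fun p => ser s p * H p).
  by apply: (ok_bddM (B := rsum (fun g => modulus (s g)))) => // [|p]; [exact: ser_mC | exact: ser_bd].
apply/eqP; rewrite -subr_eq0; apply/eqP; apply: eps_eq0 => e e0.
have K0 : 0 < 2 * B + 1 by lra.
have [N /(_ N (leqnn _)) hN] := inv_small (divr_gt0 e0 K0).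
have h1 := hSn N (fun g => plint (fun p => ch g p * H p)) B hB.
set X := csum _ in h1 *; set Y := psum _ _ in h1.
have okP : ok (fun p => psum (fun g => s g * ch g p) (Sn N) * H p) /\
   plint (fun p => psum (fun g => s g * ch g p) (Sn N) * H p) = Y.
  have okg g : ok (fun p => s g * (ch g p * H p)) by exact: okZ.
  have [k1 k2] := plint_sum (Sn N) okg.
  have E : (fun p => psum (fun g => s g * ch g p) (Sn N) * H p) = fun p => \sum_(g <- Sn N) s g * (ch g p * H p).
    by apply/funext => p; rewrite /psum mulr_suml; apply: eq_bigr => g _; rewrite mulrA.
  by rewrite E; split=> //; rewrite k2 /Y /psum; apply: eq_bigr => g _; rewrite plintZ.
have h2 : modulus (plint (fun p => ser s p * H p) - Y) <= B / N.+1%:R.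
  have oN := okN okP.1; rewrite -okP.2 -(plintN okP.1) -(plintD okser oN).
  have i0 : 0 <= N.+1%:R^-1 :> R by rewrite invr_ge0.
  have -> : B / N.+1%:R = 2 * \int[mu]_p (N.+1%:R^-1 * modulus (H p)).
    by rewrite RintegralZl // /B; ring.
  apply: plint_le; first by apply: mCD; apply: mC_ok => //; apply: okN; case: okP.
    exact: okr_Z.
  move=> p; rewrite -mulNr -mulrDl modM ler_wpM2r ?mod_ge0 //.
  have := hSn N (fun g => ch g p) 1; rewrite mul1r; apply=> g; by rewrite ch_mod.
have -> : plint (fun p => ser s p * H p) - X = (plint (fun p => ser s p * H p) - Y) - (X - Y) by ring.
apply: le_trans (modB _ _) _; apply: le_trans (lerD h2 h1) _.
apply: le_trans (_ : (2 * B + 1) * (e / (2 * B + 1)) <= _); last by rewrite mulrCA mulfV ?mulr1 // gt_eqF.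
apply: le_trans (_ : (2 * B + 1) * N.+1%:R^-1 <= _); last by rewrite ler_wpM2l // ltW.
rewrite -mulrDl ler_wpM2r ?invr_ge0 //; lra.
Qed.

Lemma coef_mul_ser s F g : asum s -> okc F -> coef (fun p => F p * ser s p) g = csum (fun h => s h * coef F (g - h)).
Proof.
move=> hs oF; have := ser_swap hs (okc_ch (- g) oF).
rewrite /coef (_ : (fun p => ser s p * _) = fun p => ind cel p * (F p * ser s p * ch (- g) p)); last by apply/funext => p; ring.
move=> ->; rewrite -csumZ.
  congr csum; apply/funext => h; rewrite mulrCA; congr (_ * (_ * plint _)); apply/funext => p.
  by rewrite opprB addrC chD; ring.
have [M hM] : exists M : R, forall h, modulus (plint (fun p => ch h p * (ind cel p * (F p * ch (- g) p)))) <= M.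
  exists (2 * \int[mu]_p modulus (ind cel p * (F p * ch (- g) p))) => h; have o1 := okc_ch (- g) oF.
  apply: plint_le; [|exact: okr_mod|by move=> p; rewrite modM ch_mod mul1r].
  by apply: mCM; [exact: ch_mC | exact: mC_ok].
by have := asum_bdd hM hs; congr asum; apply/funext => h; rewrite mulrC.
Qed.

Lemma okc_cst c : okc (fun _ : R * R => c : C).
Proof. by split; [exact: mC_cst | apply: (@ok_celM R _ (modulus c)) => //; exact: mC_cst]. Qed.

Definition insupp (y : int) s := forall g, s g != 0 -> exists k : int, g.2 - y = 3 * k.
Lemma coef_ser y s g : asum s -> insupp y s -> (exists k : int, g.2 - y = 3 * k) -> coef (ser s) g = s g.
Proof.
move=> hs ys [k gk].
have Es : ser s = fun p => 1 * ser s p by apply/funext => p; rewrite mul1r.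
rewrite [in LHS]Es (coef_mul_ser _ hs (okc_cst 1)).
have E h : (exists k : int, h.2 = 3 * k) -> coef (fun _ : R * R => 1 : C) h = if h == 0 then 1 else 0.
  have -> : (fun _ : R * R => 1 : C) = ch 0 by apply/funext => p; rewrite ch0.
  by move=> [k' hk]; rewrite (@coef_ch R 0 h k') // subr0.
rewrite (@csum1 _ _ _ g).
  by rewrite subrr E ?eqxx ?mulr1 //; exists 0; rewrite mulr0.
move=> h hg; have [->|/ys [k' hk]] := eqVneq (s h) 0; first by rewrite mul0r.
rewrite E; first by rewrite subr_eq0 eq_sym (negbTE hg) mulr0.
exists (k - k'); rewrite mulrBr -gk -hk /=; ring.
Qed.

Lemma ser_per y s : asum s -> insupp y s -> forall (m n : int) p, ser s (p + lat R m n) = phase R y (m + n) * ser s p.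
Proof.
move=> hs ys m n p; rewrite /ser -csumZ; last exact: asum_ch.
congr csum; apply/funext => g.
have [->|/ys [k gk]] := eqVneq (s g) 0; first by rewrite !mul0r mulr0.
have e : phase R g.2 (m + n) = phase R y (m + n) by apply: (@phase_eq R _ _ _ k); rewrite -gk addrC subrK.
rewrite ch_lat e; exact: mulrCA.
Qed.

Lemma plint_ch_ibp g j phi : test_function phi ->
  plint (fun p => ch g p * rc (partial j phi p)) = - (iunit R * rc (qf R j g)) * plint (fun p => ch g p * rc (phi p)).
Proof.
move=> tp; have w : is_weak_partial j (fC (ch g)) (fC (fun p => iunit R * rc (qf R j g) * ch g p)).
  apply/weak_plint => {tp}phi tp.
  have [r p0 pp0] := test_supp tp; have [sp _] := tp.
  have c1 := smooth2_cont sp; have c2 := smooth2_cont (smooth2_partial j sp).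
  have k1 := ok_cont_test (smooth2_cont (chr_smooth R g)) c2 (pp0 j).
  have k2 := ok_cont_test (smooth2_cont (chm_smooth R g)) c2 (pp0 j).
  have k3 := ok_cont_test (smooth2_cont (smooth2_partial j (chr_smooth R g))) c1 p0.
  have k4 := ok_cont_test (smooth2_cont (smooth2_partial j (chm_smooth R g))) c1 p0.
  have i1 := ibp j (chr_smooth R g) tp; have i2 := ibp j (chm_smooth R g) tp.
  have k2' := okZ (iunit R) k2; have k4' := okZ (iunit R) k4.
  transitivity (plint (fun p => rc (chr g p * partial j phi p) + iunit R * rc (chm g p * partial j phi p))).
    by congr plint; apply/funext => p; rewrite /fC -surjective_pairing ch_ri !rcM; ring.
  rewrite plintD // plintZ // i1 i2 mulrN -opprD -plintZ // -plintD //; congr (- plint _); apply/funext => p.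
  rewrite /fC -surjective_pairing ch_ri d_chr d_chm rcM rcM rmorphN /= rcM rcM.
  have ii : iunit R * iunit R = -1 by apply/eqP; rewrite eq_complex /=; apply/andP; split; apply/eqP; ring.
  set A := rc (qf _ _ _); set B := rc (chr _ _); set D := rc (chm _ _); set E := rc (phi _).
  by transitivity (- A * D * E + iunit R * A * B * E); [ring | rewrite -[- A]mulN1r -ii; ring].
have := (weak_plint _ _ _).1 w phi tp.
rewrite (_ : (fun p => fC (ch g) (to_C p) * _) = fun p => ch g p * rc (partial j phi p)); last by apply/funext => -[a b].
move=> ->; rewrite mulNr -plintZ; first by congr (- plint _); apply/funext => -[a b]; rewrite /fC /=; ring.
have [r p0 _] := test_supp tp; have [M [hM _]] := test_bdd tp; have [sp _] := tp.
apply: (@ok_supp R r _ M); first by apply: mCM; [exact: ch_mC | exact: mC_cont (smooth2_cont sp)].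
  by move=> p; rewrite modM ch_mod mul1r mod_rc.
by move=> p /p0 ->; rewrite mulr0.
Qed.

Lemma ok_test_rc phi : test_function phi -> ok (fun p => rc (phi p)) /\ forall j, ok (fun p => rc (partial j phi p)).
Proof.
move=> tp; have := ok_test (L2loc_cst (1 : C)) tp => -[k1 k2]; split.
  by move: k1; congr ok; apply/funext => p; rewrite mul1r.
by move=> j; have := k2 j; congr ok; apply/funext => p; rewrite mul1r.
Qed.

Lemma ser_weak j s : asum s -> asum (fun g => rc (qf R j g) * s g) ->
  is_weak_partial j (fC (ser s)) (fC (ser (fun g => iunit R * rc (qf R j g) * s g))).
Proof.
move=> hs hqs; apply/weak_plint => phi tp; have [k1 k2] := ok_test_rc tp.
have E F : (fun p => fC F (to_C p)) = F := fCE F.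
have E2 F (H : R * R -> C) : (fun p => fC F (to_C p) * H p) = fun p => F p * H p by apply/funext => -[a b].
have hqs' : asum (fun g => iunit R * rc (qf R j g) * s g).
  by have := asumZ (iunit R) hqs; congr asum; apply/funext => g; rewrite mulrA.
rewrite !E2 (ser_swap hs (k2 j)) (ser_swap hqs' k1).
transitivity (csum (fun g => -1 * (iunit R * rc (qf R j g) * s g * plint (fun p => ch g p * rc (phi p))))).
  by congr csum; apply/funext => g; rewrite plint_ch_ibp //; ring.
rewrite csumZ ?mulN1r //.
have [M hM] : exists M : R, forall g, modulus (plint (fun p => ch g p * rc (phi p))) <= M.
  exists (2 * \int[mu]_p modulus (rc (phi p))) => g.
  apply: plint_le; [|exact: okr_mod|by move=> p; rewrite modM ch_mod mul1r].
  by apply: mCM; [exact: ch_mC | exact: mC_ok].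
by have := asum_bdd hM hqs'; congr asum; apply/funext => h; rewrite mulrC.
Qed.

Lemma ser_L2loc s : asum s -> L2loc (fC (ser s)).
Proof.
move=> hs; apply: L2loc_bdd; first by rewrite fCE; exact: ser_mC.
move=> r; exists (rsum (fun g => modulus (s g))) => -[a b] _; exact: ser_bd.
Qed.

(** The symbol of 2 D_zbar: i (q_1 + i q_2) from d_1 + i d_2, divided by i. *)
Definition frq g : C := rc (qf R false g) + iunit R * rc (qf R true g).
Lemma qfD j g h : qf R j (g + h) = qf R j g + qf R j h.
Proof. by rewrite /qf faD fbD; case: j; ring. Qed.

Lemma frqD g h : frq (g + h) = frq g + frq h.
Proof. by rewrite /frq !qfD !rcD; ring. Qed.

Lemma frqE g : frq g = (qf R false g +i* qf R true g)%C.
Proof. by apply/eqP; rewrite eq_complex /=; apply/andP; split; apply/eqP; ring. Qed.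

Lemma qf_le j g : `|qf R j g| <= modulus (frq g).
Proof. by rewrite frqE; have h1 := ImE_le (qf R false g +i* qf R true g)%C; have h2 := ReE_le (qf R false g +i* qf R true g)%C; case: j. Qed.

Lemma frq_le g : modulus (frq g) <= `|qf R false g| + `|qf R true g|.
Proof. by rewrite frqE; exact: mod_le. Qed.

Lemma frq_lower g : `|g.1%:~R : R| <= 2 * modulus (frq g) /\ `|g.2%:~R : R| <= 2 * modulus (frq g).
Proof.
have h0 := qf_le false g; have h1 := qf_le true g; set M := modulus _ in h0 h1 *.
have p2 := pi_ge2 R; have [s1 s2] := s3_bd R.
set m : R := g.1%:~R; set y : R := g.2%:~R.
have a0 : `|m + y / 3| <= M / 4.
  have -> : m + y / 3 = qf R false g / (2 * pi) by rewrite /qf /fa -/m -/y; field; rewrite gt_eqF //; lra.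
  rewrite normrM normfV (gtr0_norm (_ : 0 < 2 * pi)); last by lra.
  rewrite ler_pdivrMr; last by lra.
  have M0 : 0 <= M by exact: mod_ge0.
  have : 0 <= M * (pi - 2) by rewrite mulr_ge0 // subr_ge0.
  by move=> h; apply: le_trans h0 _; lra.
have a1 : `|m + y| <= M / 2.
  have -> : m + y = qf R true g * sqrt3 R / (2 * pi).
    rewrite /qf /fa /fb -/m -/y -[_ / sqrt3 R * sqrt3 R]mulrA mulVf ?mulr1; last by rewrite gt_eqF //; lra.
    by field; rewrite gt_eqF //; lra.
  rewrite normrM normfV (gtr0_norm (_ : 0 < 2 * pi)); last by lra.
  rewrite ler_pdivrMr; last by lra.
  rewrite normrM (gtr0_norm (_ : 0 < sqrt3 R)); last by lra.
  have M0 : 0 <= M by exact: mod_ge0.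
  have q0 := normr_ge0 (qf R true g).
  have q1 : 0 <= `|qf R true g| * (2 - sqrt3 R) by rewrite mulr_ge0 // subr_ge0 ltW.
  have q2 : 0 <= M * (pi - 2) by rewrite mulr_ge0 // subr_ge0.
  lra.
by split; move: a0 a1; rewrite !ler_norml => /andP[x1 x2] /andP[x3 x4]; apply/andP; split; lra.
Qed.

Lemma bsum_int (h : int -> R) (B : R) : (forall m, 0 <= h m) -> (forall N, \sum_(n < N) (h (Posz n) + h (Negz n)) <= B) -> bsum h.
Proof.
move=> h0 hB; exists B => S; pose N := (\max_(m <- S) (absz m)).+1.
have hN m : m \in S -> (absz m < N)%N by move=> mS; rewrite ltnS (big_rem m) //= leq_maxl.
apply: le_trans (hB N); rewrite /rpsum.
have cnt (x : int) : \sum_(m <- S) (if m == x then 1 else 0) <= 1 :> R.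
  rewrite -big_mkcond /= big_const_seq iter_addr_0 (_ : count _ _ = count_mem x S) // count_uniq_mem ?fset_uniq //.
  by case: (x \in S).
apply: le_trans (_ : \sum_(m <- S) \sum_(n < N) (h (Posz n) * (if m == Posz n then 1 else 0) + h (Negz n) * (if m == Negz n then 1 else 0)) <= _).
  rewrite big_seq [leRHS]big_seq; apply: ler_sum => m mS; have mN := hN m mS.
  have nn (n : 'I_N) : 0 <= h (Posz n) * (if m == Posz n then 1 else 0) + h (Negz n) * (if m == Negz n then 1 else 0).
    by apply: addr_ge0; apply: mulr_ge0 => //; case: ifP.
  case: m mS mN nn => n mS mN nn.
    rewrite (bigD1 (Ordinal mN)) //= eqxx mulr1 -addrA lerDl; apply: addr_ge0.
      by apply: mulr_ge0 => //; case: ifP.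
    by apply: sumr_ge0 => i _; exact: nn.
  have mN' : (n < N)%N by move: mN; rewrite /= ; apply: leq_trans; rewrite ltnS.
  rewrite (bigD1 (Ordinal mN')) //= eqxx mulr1 [X in _ <= X + _]addrC -addrA lerDl; apply: addr_ge0.
    by apply: mulr_ge0 => //; case: ifP.
  by apply: sumr_ge0 => i _; exact: nn.
rewrite exchange_big /=; apply: ler_sum => n _; rewrite big_split /= -!mulr_sumr.
by apply: lerD; rewrite ler_piMr.
Qed.

Lemma bsum_invsq : bsum (fun m : int => ((1 + `|m%:~R|) ^+ 2)^-1 : R).
Proof.
have sq (N : nat) : \sum_(n < N.+1) ((n.+1%:R ^+ 2)^-1 : R) <= 2 - N.+1%:R^-1.
  elim: N => [|N IH]; first by rewrite big_ord_recr big_ord0 /= expr1n invr1; lra.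
  rewrite big_ord_recr /=; apply: le_trans (lerD IH (lexx _)) _.
  have -> : N.+2%:R = N.+1%:R + 1 :> R by rewrite natr1.
  have : 0 < N.+1%:R :> R by rewrite ltr0n.
  move: (N.+1%:R) => x x0; have x1 : 0 < x + 1 by lra.
  have E : x^-1 - (x + 1)^-1 - ((x + 1) ^+ 2)^-1 = (x * (x + 1) ^+ 2)^-1.
    by field; rewrite !gt_eqF.
  have : 0 <= (x * (x + 1) ^+ 2)^-1 by rewrite invr_ge0 mulr_ge0 ?exprn_ge0 // ltW.
  by rewrite -E; lra.
apply: (@bsum_int _ 4); first by move=> m; rewrite invr_ge0 sqr_ge0.
move=> N; apply: le_trans (_ : \sum_(n < N) (2 * (n.+1%:R ^+ 2)^-1) <= _).
  apply: ler_sum => n _.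
  have e1 : 1 + `|(Posz n)%:~R| = n.+1%:R :> R by rewrite -pmulrn ger0_norm // addrC [LHS]natr1.
  have e2 : n.+1%:R <= 1 + `|(Negz n)%:~R| :> R by rewrite NegzE mulrNz normrN -pmulrn ger0_norm // lerDr.
  have n0 : 0 < n.+1%:R :> R by rewrite ltr0n.
  have n1 := lt_le_trans n0 e2.
  rewrite e1 (_ : 2 = 1 + 1) // mulrDl !mul1r lerD2l lef_pV2 ?posrE ?exprn_gt0 //.
  by rewrite lerXn2r ?nnegrE ?(ltW n0) ?(ltW n1).
have s2 : \sum_(n < N) ((n.+1%:R ^+ 2)^-1 : R) <= 2.
  apply: (@le_trans _ _ (\sum_(n < N.+1) ((n.+1%:R ^+ 2)^-1 : R))).
    by rewrite big_ord_recr /= lerDl invr_ge0 sqr_ge0.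
  by apply: le_trans (sq N) _; rewrite gerBl invr_ge0.
rewrite -mulr_sumr; apply: le_trans (ler_wpM2l (ler0n _ 2) s2) _; lra.
Qed.

(** By [frq_lower] the weight is at least (1 + |g.1|) / 2 and (1 + |g.2|) / 2; squaring both gives a
    product of one-dimensional sums and the factor 16. *)
Lemma bsum_wt : bsum (fun g => (wt frq g ^+ 4)^-1).
Proof.
pose u (m : int) : R := ((1 + `|m%:~R|) ^+ 2)^-1.
have u0 m : 0 <= u m by rewrite invr_ge0 sqr_ge0.
have b1 := bsum_invsq.
apply: (bsum_le (k := fun g => 16 * (u g.1 * u g.2))).
  move=> g; have [h1 h2] := frq_lower g; rewrite /u -invfM -[16]invrK -invfM.
  have M0 := mod_ge0 (frq g); set A : R := `|g.1%:~R| in h1 *; set B : R := `|g.2%:~R| in h2 *.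
  have A0 : 0 <= A by exact: normr_ge0. have B0 : 0 <= B by exact: normr_ge0.
  have P0 : 0 < 16^-1 * ((1 + A) ^+ 2 * (1 + B) ^+ 2) by rewrite !mulr_gt0 ?invr_gt0 ?exprn_gt0 //; lra.
  rewrite lef_pV2 ?posrE ?exprn_gt0 ?wt_gt0 //.
  have -> : 16^-1 * ((1 + A) ^+ 2 * (1 + B) ^+ 2) = ((1 + A) / 2) ^+ 2 * ((1 + B) / 2) ^+ 2 by field.
  rewrite (exprD _ 2 2); apply: ler_pM; rewrite ?sqr_ge0 //; rewrite lerXn2r ?nnegrE /wt //; lra.
apply: bsumZ => //; apply: tonelli => [t|i|] /=; first by rewrite mulr_ge0.
  exact: bsumZ.
have -> : (fun i : int => rsum (fun j : int => u i * u j)) = fun i => rsum u * u i.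
  apply/funext => i; rewrite /rsum.
  have -> : (fun t => rc (u i * u t)) = fun t => rc (u i) * rc (u t) :> C by apply/funext => t; rewrite rcM.
  rewrite csumZ; last exact: bsum_asum.
  by rewrite rsumE //= !mul0r subr0 mulrC.
by apply: bsumZ => //; apply: rsum_ge0.
Qed.

(** Coercivity is read off from summability: outside a finite set each single term wt^-4 is below (2
    + |M|)^-4. *)
Lemma frq_coer (M : R) : exists S : {fset G}, forall g, g \notin S -> M <= modulus (frq g).
Proof.
pose e : R := ((2 + `|M|) ^+ 4)^-1; have K0 : 0 < 2 + `|M| by have := normr_ge0 M; lra.
have e0 : 0 < e by rewrite invr_gt0 exprn_gt0.
have h0 g : 0 <= (wt frq g ^+ 4)^-1 by rewrite invr_ge0 exprn_ge0 // ltW // wt_gt0.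
have [S hS] := bsum_tail h0 bsum_wt e0; exists S => g gS.
have := hS [fset g]%fset; rewrite /rpsum big_seq_fset1 => /(_ _) h.
have {}h : (wt frq g ^+ 4)^-1 <= e.
  by apply: h; rewrite fdisjoint_sym; apply/fdisjointP => x; rewrite !inE => /eqP ->.
rewrite /e lef_pV2 ?posrE ?exprn_gt0 ?wt_gt0 // in h.
have h2 : 2 + `|M| <= wt frq g.
  by move: h; rewrite ler_pXn2r ?nnegrE ?(ltW K0) ?(ltW (wt_gt0 _ _)).
by move: h2; rewrite /wt; have := ler_norm M; lra.
Qed.
End Series.

(** * Fourier coefficients of the potential *)

Section Potential.
Variable R : realType.
Local Notation C := R[i].
Local Notation mR := (measurableTypeR R).
Local Notation T := (measurableTypeR R * measurableTypeR R)%type.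
Local Notation mu := (@plane R).
Local Notation cel := (@cell R).
Local Notation G := (int * int)%type.
Implicit Types (p q : R * R) (g h : G) (F : R * R -> C) (s : G -> C).

Definition ccont F := forall p (e : R), 0 < e -> \forall q \near p, modulus (F q - F p) <= e.
Lemma ccont_ri (f1 f2 : R * R -> R) : continuous f1 -> continuous f2 -> ccont (fun p => (f1 p +i* f2 p)%C).
Proof.
move=> h1 h2 p e e0; have e2 : 0 < e / 2 by lra.
have /cvgrPdist_le/(_ _ e2) n1 := h1 p; have /cvgrPdist_le/(_ _ e2) n2 := h2 p.
apply: filterS2 n1 n2 => q q1 q2; apply: le_trans (mod_le _) _ => /=.
by rewrite distrC (distrC (f2 q)); apply: le_trans (lerD q1 q2) _; lra.
Qed.

Lemma ccont_ch g : ccont (ch g).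
Proof.
have := ccont_ri (smooth2_cont (chr_smooth R g)) (smooth2_cont (chm_smooth R g)).
by congr ccont; apply/funext => p; rewrite /chr /chm; case: (ch g p).
Qed.

Lemma ccontD F H : ccont F -> ccont H -> ccont (fun p => F p + H p).
Proof.
move=> h1 h2 p e e0; have e2 : 0 < e / 2 by lra.
apply: filterS2 (h1 p _ e2) (h2 p _ e2) => q q1 q2.
have -> : F q + H q - (F p + H p) = (F q - F p) + (H q - H p) by ring.
by apply: le_trans (modD _ _) _; apply: le_trans (lerD q1 q2) _; lra.
Qed.

Lemma ccontZ c F : ccont F -> ccont (fun p => c * F p).
Proof.
move=> h p e e0; have K0 : 0 < modulus c + 1 by have := mod_ge0 c; lra.
apply: filterS (h p _ (divr_gt0 e0 K0)) => q hq; rewrite -mulrBr modM.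
apply: le_trans (ler_wpM2l (mod_ge0 c) hq) _; rewrite mulrCA ler_piMr ?(ltW e0) // ler_pdivrMr //; lra.
Qed.

Lemma ccont_psum s (S : {fset G}) : ccont (fun p => psum (fun g => s g * ch g p) S).
Proof.
rewrite /psum; elim: (S : seq G) => [|g r IH].
  by move=> p e e0; near=> q; rewrite !big_nil subrr mod0 ltW.
have := ccontD (ccontZ (s g) (ccont_ch g)) IH; congr ccont; apply/funext => p; by rewrite big_cons.
Unshelve. all: by end_near. Qed.

Lemma ccont_ser s : asum s -> ccont (ser s).
Proof.
move=> hs p e e0; have [Sn hSn] := approx hs; have e3 : 0 < e / 3 by lra.
have [N /(_ N (leqnn _)) hN] := inv_small e3.
have b q : modulus (ser s q - psum (fun g => s g * ch g q) (Sn N)) <= e / 3.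
  apply: le_trans hN; have := hSn N (fun g => ch g q) 1; rewrite mul1r; apply=> g; by rewrite ch_mod.
apply: filterS (ccont_psum s (Sn N) p e3) => q hq.
set P := fun q => psum (fun g => s g * ch g q) (Sn N); rewrite -/(P _) -/(P _) in hq.
have -> : ser s q - ser s p = (ser s q - P q) + (P q - P p) - (ser s p - P p) by ring.
apply: le_trans (modB _ _) _; apply: le_trans (lerD (modD _ _) (lexx _)) _.
by have := b q; have := b p; rewrite -/(P _) -/(P _); lra.
Qed.

(** Continuity gives a whole rectangle of nonzero values, of positive measure, inside the cell. *)
Lemma ae_cont F : ccont F -> {ae mu, forall p, cel p -> F p = 0} -> forall p, cel p -> F p = 0.
Proof.
move=> cF ae p0 cp0; apply/eqP; apply: contraT => nz.
have m0 := mod_gt0 nz; have m2 : 0 < modulus (F p0) / 2 by lra.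
have /nbhs_ballP [d /= d0 hd] := cF p0 _ m2.
have {}hd q : ball p0 d q -> F q != 0.
  move=> /hd /= h; apply/eqP => z; move: h; rewrite z sub0r modN; lra.
move/cellE: cp0 => [/andP[a0 a1] /andP[b0 b1]].
(* The rectangle is placed to the upper right of p0, where both cell coordinates increase; it stays
   in the half-open cell even if p0 lies on its closed sides. *)
pose t : R := Num.min (d / 4) (Num.min ((1 - ca p0) / 4) ((1 - cb p0) / 4)).
have t0 : 0 < t by rewrite /t !lt_min; apply/and3P; split; lra.
have [t1 t2 t3] : [/\ t <= d / 4, t <= (1 - ca p0) / 4 & t <= (1 - cb p0) / 4].
  by rewrite /t; split; rewrite !ge_min lexx ?orbT.
pose Q : set T := `[p0.1 + t / 4, p0.1 + t / 2]%classic `*` `[p0.2 + t / 4, p0.2 + t / 2]%classic.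
have QN : Q `<=` ~` [set p | cel p -> F p = 0].
  move=> [x y] [/=]; rewrite !in_itv /= => /andP[x0 x1] /andP[y0 y1] h.
  have xy : ball p0 d (x, y).
    by split; rewrite /ball /= ltr_norml; apply/andP; split; lra.
  have /eqP := hd _ xy; apply; apply: h; apply/cellE.
  have [s1 s2] := s3_bd R; have i0 : 0 < (sqrt3 R)^-1 by rewrite invr_gt0; lra.
  have i1 : (sqrt3 R)^-1 <= 1 by rewrite invf_le1; lra.
  have ea : ca (x, y) = ca p0 + (x - p0.1) + (y - p0.2) * (sqrt3 R)^-1 by rewrite /ca /=; ring.
  have eb : cb (x, y) = cb p0 + 2 * ((y - p0.2) * (sqrt3 R)^-1) by rewrite /cb /=; ring.
  have z0 : 0 <= (y - p0.2) * (sqrt3 R)^-1 by rewrite mulr_ge0 ?(ltW i0) //; lra.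
  have z1 : (y - p0.2) * (sqrt3 R)^-1 <= t / 2.
    by apply: le_trans (_ : (y - p0.2) * 1 <= _); [rewrite ler_wpM2l //; lra | lra].
  by rewrite ea eb; split; apply/andP; split; lra.
have mQ : measurable Q by apply: measurableX; exact: measurable_itv.
have nQ : mu.-negligible Q by apply: negligibleS QN _; exact: ae.
have mi (a b : R) : measurable (`[a, b]%classic : set mR) by exact: measurable_itv.
have := @planeX R _ _ (mi (p0.1 + t / 4) (p0.1 + t / 2)) (mi (p0.2 + t / 4) (p0.2 + t / 2)).
have -> : mu (`[p0.1 + t / 4, p0.1 + t / 2]%classic `*` `[p0.2 + t / 4, p0.2 + t / 2]%classic) = 0%E by exact/(negligibleP _ mQ).
have p1 : p0.1 + t / 4 < p0.1 + t / 2 by lra.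
have p2 : p0.2 + t / 4 < p0.2 + t / 2 by lra.
move=> /esym; rewrite !lebesgue_measure_itv /= !lte_fin p1 p2.
rewrite -!EFinB -EFinM => -[] /eqP; rewrite mulf_eq0 => /orP[] /eqP; lra.
Qed.

Lemma ae_all_cells (P : R * R -> Prop) : (forall m n : int, {ae mu, forall p, cel p -> P (p + lat R m n)}) -> {ae mu, forall p, P p}.
Proof.
move=> h; have h' (m n : int) : {ae mu, forall p, cel (p + lat R (- m) (- n)) -> P p}.
  have [N [mN N0 hN]] := h m n; exists (shift (lat R (- m) (- n)) @^-1` N); split.
  - by have := measurable_shift (lat R (- m) (- n)) measurableT mN; rewrite setTI.
  - by rewrite plane_shift.
  move=> p /= np; apply: hN => /= np'; apply: np => cp; have := np' cp.
  by rewrite shift_add -addrA latN addNr addr0.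
pose A (i : nat) : set T := if (choice.unpickle i : option (int * int)) is Some mn
  then ~` [set q : R * R | cel (q + lat R (- mn.1) (- mn.2)) -> P q] else set0.
have hh : mu.-negligible (\bigcup_i A i).
  apply: negligible_bigcup => i; rewrite /A; case: (choice.unpickle i) => [[m n]|]; first exact: h'.
  exact: negligible_set0.
apply: negligibleS hh => p /= nP.
have /andP[f1 f2] := floor_itv (ca p); have /andP[f3 f4] := floor_itv (cb p).
refine (ex_intro2 _ _ (choice.pickle (Num.floor (ca p), Num.floor (cb p))) I _).
rewrite /A choice.pickleK => h1; apply: nP; apply: h1.
apply/cellE; rewrite ca_lat cb_lat !mulrNz /=; move: f2 f4; rewrite !intrD => f2 f4.
by split; apply/andP; split; lra.
Qed.

Lemma bdd_per F : (forall r : R, exists M : R, forall p, box r p -> modulus (F p) <= M) ->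
  (forall (m n : int) p, modulus (F (p + lat R m n)) = modulus (F p)) -> exists M : R, forall p, modulus (F p) <= M.
Proof.
move=> hb hp; have [M hM] := hb 2; exists M => p.
have /andP[f1 f2] := floor_itv (ca p); have /andP[f3 f4] := floor_itv (cb p).
rewrite -(hp (- Num.floor (ca p)) (- Num.floor (cb p))); apply: hM; apply: cell_box.
apply/cellE; rewrite ca_lat cb_lat !mulrNz /=; move: f2 f4; rewrite !intrD => f2 f4.
by split; apply/andP; split; lra.
Qed.

Variable U : C -> C.
Hypothesis smoothU : smoothC U.
Hypothesis periodicU : forall g : C, Lambda g -> forall z : C, U (z + g) = expi (cdot g (Kpt R)) * U z.
Hypothesis rotationU : forall z : C, U (omega R * z) = omega R * U z.

(** With K = 4 pi / 3 the pairing is 4 pi m / 3 - 2 pi n / 3, which is - 2 pi (m + n) / 3 mod 2 pi.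
    So U has the twist of class - 1. *)
Lemma expi_lat (m n : int) : expi (cdot (to_C (lat R m n)) (Kpt R)) = phase R (-1) (m + n).
Proof.
rewrite /cdot /phase (_ : complex.Re _ = 2 * pi * ((-1)%:~R * (m + n)%:~R / 3) + 2 * pi * m%:~R).
  by rewrite expiD expi_2pi mulr1.
by rewrite /lat /pt /to_C /Kpt /= intrD; field.
Qed.

Lemma Lambda_lat (m n : int) : Lambda (to_C (lat R m n)).
Proof. by exists m, n; rewrite to_C_pt; congr (_ + _ * _); exact: rmorph_int. Qed.

Lemma to_CD p q : to_C (p + q) = to_C p + to_C q :> C. Proof. by []. Qed.

(** All iterated partial derivatives of U at once; each is again bounded with the same twist, so its
    coefficients are bounded. *)
Definition Us (l : seq bool) p : C :=
  (foldr (@partial R) (fun p => complex.Re (U (to_C p))) l p +i* foldr (@partial R) (fun p => complex.Im (U (to_C p))) l p)%C.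
Lemma Us_nil : Us [::] = fun p => U (to_C p).
Proof. by apply/funext => p; rewrite /Us /=; case: (U _). Qed.

Lemma Us_smooth l : smooth2 (fun p => complex.Re (Us l p)) /\ smooth2 (fun p => complex.Im (Us l p)).
Proof.
case: smoothU => h1 h2; elim: l => [|j l [IH1 IH2]]; first by split.
by split; [exact: (smooth2_partial j IH1) | exact: (smooth2_partial j IH2)].
Qed.

Lemma Us_per l (m n : int) p : Us l (p + lat R m n) = phase R (-1) (m + n) * Us l p.
Proof.
elim: l p => [|j l IH] p.
  by rewrite Us_nil to_CD periodicU ?expi_lat //; exact: Lambda_lat.
have [s1 s2] := Us_smooth l; set t := lat R m n in IH *.
case: (phase R (-1) (m + n)) IH => a b IH.
have D1 := partial_shift (@smooth2_der R _ j (p + t) s1); have D2 := partial_shift (@smooth2_der R _ j (p + t) s2).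
have E1 : (fun q => complex.Re (Us l (q + t))) = fun q => a * complex.Re (Us l q) + (- b) * complex.Im (Us l q).
  by apply/funext => q; rewrite IH; case: (Us l q) => x y /=; ring.
have E2 : (fun q => complex.Im (Us l (q + t))) = fun q => a * complex.Im (Us l q) + b * complex.Re (Us l q).
  by apply/funext => q; rewrite IH; case: (Us l q) => x y /=; ring.
have Z c (f : R * R -> R) : smooth2 f -> smooth2 (fun q => c * f q) /\ partial j (fun q => c * f q) p = c * partial j f p.
  move=> sf; have sc : smooth2 (fun _ : R * R => c) by apply: SM_smooth; exact: SM_cst.
  by split; [exact: smooth2M | rewrite (partialM j p sc sf) partial_cst mul0r add0r].
have Dl (f k : R * R -> R) : smooth2 f -> smooth2 k -> partial j (fun q => f q + k q) p = partial j f p + partial j k p.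
  by move=> sf sk; exact: (partialE (is_deriveD (derivableP (@smooth2_der R _ j p sf)) (derivableP (@smooth2_der R _ j p sk)))).
rewrite E1 in D1; rewrite E2 in D2.
have F1 := partialE D1; have F2 := partialE D2.
rewrite (Dl _ _ (Z a _ s1).1 (Z (- b) _ s2).1) (Z a _ s1).2 (Z (- b) _ s2).2 in F1.
rewrite (Dl _ _ (Z a _ s2).1 (Z b _ s1).1) (Z a _ s2).2 (Z b _ s1).2 in F2.
apply/eqP; rewrite eq_complex; apply/andP; split; apply/eqP.
  by rewrite -[LHS]/(partial j (fun p => complex.Re (Us l p)) (p + t)) -F1 /= mulNr.
by rewrite -[LHS]/(partial j (fun p => complex.Im (Us l p)) (p + t)) -F2.
Qed.

Lemma Us_box l (r : R) : exists M : R, forall p, box r p -> modulus (Us l p) <= M.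
Proof.
have [s1 s2] := Us_smooth l.
have [M1 h1] := continuous_bdd r (smooth2_cont s1); have [M2 h2] := continuous_bdd r (smooth2_cont s2).
by exists (M1 + M2) => p b; apply: le_trans (mod_le _) _; apply: lerD; [exact: h1 | exact: h2].
Qed.

Lemma Us_mC l : mC (Us l).
Proof. by have [s1 s2] := Us_smooth l; split; apply: continuous_plane; exact: smooth2_cont. Qed.

Lemma Us_bdd l : exists M : R, forall p, modulus (Us l p) <= M.
Proof.
apply: bdd_per (Us_box l) _ => m n p; by rewrite Us_per modM mod_expi mul1r.
Qed.

Lemma Us_L2loc l : L2loc (fC (Us l)).
Proof.
apply: L2loc_bdd; first by rewrite fCE; exact: Us_mC.
by move=> r; have [M hM] := Us_box l r; exists M => -[a b] hb; exact: hM.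
Qed.

Lemma Us_weak j l : is_weak_partial j (fC (Us l)) (fC (Us (j :: l))).
Proof.
apply/weak_plint => phi tp; have [s1 s2] := Us_smooth l; have [d1 d2] := Us_smooth (j :: l).
have [r p0 pp0] := test_supp tp; have [sp _] := tp.
have c1 := smooth2_cont sp; have c2 := smooth2_cont (smooth2_partial j sp).
have k1 := ok_cont_test (smooth2_cont s1) c2 (pp0 j).
have k2 := ok_cont_test (smooth2_cont s2) c2 (pp0 j).
have k3 := ok_cont_test (smooth2_cont d1) c1 p0.
have k4 := ok_cont_test (smooth2_cont d2) c1 p0.
have i1 := ibp j s1 tp; have i2 := ibp j s2 tp.
have k2' := okZ (iunit R) k2; have k4' := okZ (iunit R) k4.
have E (z : C) (x : R) : z * rc x = rc (complex.Re z * x) + iunit R * rc (complex.Im z * x).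
  by case: z => a b; apply/eqP; rewrite eq_complex /=; apply/andP; split; apply/eqP; ring.
transitivity (plint (fun p => rc (complex.Re (Us l p) * partial j phi p) + iunit R * rc (complex.Im (Us l p) * partial j phi p))).
  by congr plint; apply/funext => -[a b]; rewrite E.
rewrite plintD // plintZ // i1 i2 mulrN -opprD.
transitivity (- plint (fun p => rc (complex.Re (Us (j :: l) p) * phi p) + iunit R * rc (complex.Im (Us (j :: l) p) * phi p))).
  by rewrite plintD // plintZ.
by congr (- plint _); apply/funext => -[a b]; rewrite [RHS]E.
Qed.

Lemma okc_bdd F (M : R) : mC F -> (forall p, modulus (F p) <= M) -> okc F.
Proof. by move=> mF hM; split=> //; apply: (@ok_celM R _ M). Qed.

Lemma coef_bdd F (M : R) g : mC F -> (forall p, modulus (F p) <= M) -> modulus (coef F g) <= 2 * M.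
Proof.
move=> mF hM; have M0 : 0 <= M by exact: le_trans (mod_ge0 _) (hM 0).
rewrite /coef modM modV mod_rc (gtr0_norm (area_gt0 R)) mulrC ler_pdivrMr ?area_gt0 //.
have okh : okr (fun p => M * complex.Re (ind cel p)) by apply: okr_Z; case: (ok_cel R).
have := @plint_le R (fun p => ind cel p * (F p * ch (- g) p)) _ (mC_ok (okc_ch (- g) (okc_bdd mF hM))) okh _.
rewrite RintegralZl //; last by case: (ok_cel R).
rewrite mulrA; apply=> p; rewrite !modM ch_mod mulr1 /ind; case: ifP => _.
  by rewrite (mod_rc 1) normr1 mul1r /= mulr1.
by rewrite mod0 mul0r /= mulr0.
Qed.

Lemma coef_Us j l g (k : int) : g.2 - (-1) = 3 * k -> coef (Us (j :: l)) g = iunit R * rc (qf R j g) * coef (Us l) g.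
Proof.
move=> gk; have per : qper g.2 (fun p => fC (Us l) (to_C p)).
  move=> m n; apply: aeW => p; rewrite -[fC _ _]/(fC (Us l) (to_C (p + lat R m n))).
  have E q : fC (Us l) (to_C q) = Us l q by case: q.
  rewrite !E Us_per (@phase_eq R g.2 (-1) (m + n) k) //.
  by rewrite -gk addrC subrK.
have := weak_coef (Us_L2loc l) (Us_L2loc (j :: l)) (Us_weak j l) per.
have E2 F (H : R * R -> C) : (fun p => ind cel p * (fC F (to_C p) * H p)) = fun p => ind cel p * (F p * H p) by apply/funext => -[a b].
by rewrite !E2 /coef => ->; rewrite mulrCA.
Qed.

Lemma coef_pow j n : exists M : R, forall g, (exists k : int, g.2 - (-1) = 3 * k) -> `|qf R j g| ^+ n * modulus (coef (Us [::]) g) <= M.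
Proof.
have [M hM] := Us_bdd (nseq n j); exists (2 * M) => g [k gk].
have <- : modulus (coef (Us (nseq n j)) g) = `|qf R j g| ^+ n * modulus (coef (Us [::]) g); last exact: coef_bdd (Us_mC _) hM.
have mi : modulus (iunit R) = 1.
  by apply/eqP; rewrite -sqrp_eq1 ?mod_ge0 // mod_sq /= expr0n expr1n add0r.
elim: n {M hM} => [|n IH]; first by rewrite expr0 mul1r.
by rewrite [nseq _ _]/= (coef_Us j _ gk) modM modM mi mod_rc IH mul1r exprS mulrA.
Qed.

Definition cls (g : G) : 'Z_3 := g.2%:~R.
Lemma clsD g h : cls (g + h) = cls g + cls h. Proof. exact: intrD. Qed.

Lemma Z3_3 : (3 : int)%:~R = 0 :> 'Z_3. Proof. exact/val_inj. Qed.

Lemma cls0P (z : int) : z%:~R = 0 :> 'Z_3 <-> exists k : int, z = 3 * k.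
Proof.
split=> [|[k ->]]; last by rewrite intrM Z3_3 mul0r.
rewrite {1}(divz_eq z 3) intrD intrM Z3_3 mulr0 add0r => h.
exists (z %/ 3)%Z; rewrite {1}(divz_eq z 3) mulrC.
have : (0 <= z %% 3)%Z by exact: modz_ge0.
have : (z %% 3 < 3)%Z by exact: ltz_pmod.
case: (z %% 3)%Z h => [[|[|[|]]]|] //=; rewrite ?addr0 //.
Qed.

Lemma clsP g (y : int) : cls g = y%:~R <-> exists k : int, g.2 - y = 3 * k.
Proof.
rewrite -cls0P intrB -/(cls g); split=> [->|/eqP]; first by rewrite subrr.
by rewrite subr_eq0 => /eqP.
Qed.

Definition U_hat g : C := if cls g == -1 then coef (Us [::]) g else 0.
Lemma uh_supp : insupp (-1) U_hat.
Proof.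
move=> g; rewrite /U_hat; have [e _|ne] := eqVneq (cls g) (-1); last by rewrite eqxx.
by apply/clsP; rewrite e mulrN1z.
Qed.

Lemma wt_pow n : exists M : R, forall g, wt (@frq R) g ^+ n * modulus (U_hat g) <= M.
Proof.
have [M0 h0] := coef_pow false 0; have [M1 h1] := coef_pow false n; have [M2 h2] := coef_pow true n.
exists (3 ^+ n * (`|M0| + `|M1| + `|M2|)) => g; rewrite /U_hat; have [e|ne] := eqVneq (cls g) (-1); last by rewrite mod0 mulr0 mulr_ge0 ?exprn_ge0 ?addr_ge0.
have cg : exists k : int, g.2 - (-1) = 3 * k by apply/clsP; rewrite e mulrN1z.
have := h0 g cg; have := h1 g cg; have := h2 g cg; rewrite expr0 mul1r.
set c := modulus _; set x := `|qf R false g|; set y := `|qf R true g| => k2 k1 k0.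
have c0 : 0 <= c by exact: mod_ge0.
have x0 : 0 <= x by exact: normr_ge0. have y0 : 0 <= y by exact: normr_ge0.
have w : wt (@frq R) g <= 1 + x + y by rewrite /wt -addrA lerD2l frq_le.
have w0 : 0 <= wt (@frq R) g by exact/ltW/wt_gt0.
have key : wt (@frq R) g ^+ n <= 3 ^+ n * (1 + x ^+ n + y ^+ n).
  have xn : 0 <= x ^+ n by exact: exprn_ge0. have yn : 0 <= y ^+ n by exact: exprn_ge0.
  (* z is the largest of 1, x and y. *)
  have [z [z0 hz zn]] : exists z : R, [/\ 0 <= z, wt (@frq R) g <= 3 * z & z ^+ n <= 1 + x ^+ n + y ^+ n].
    have [h|h] := leP x y.
      have [h'|h'] := leP y 1; first by exists 1; rewrite expr1n; split; lra.
      by exists y; split; lra.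
    have [h'|h'] := leP x 1; first by exists 1; rewrite expr1n; split; lra.
    by exists x; split; lra.
  apply: le_trans (_ : (3 * z) ^+ n <= _); first by rewrite lerXn2r ?nnegrE // mulr_ge0.
  by rewrite exprMn ler_wpM2l // exprn_ge0.
apply: le_trans (ler_wpM2r c0 key) _; rewrite -mulrA ler_wpM2l ?exprn_ge0 // !mulrDl mul1r.
by apply: lerD; [apply: lerD|]; apply: le_trans (ler_norm _).
Qed.

Lemma uh_w n : asum (fun g => rc (wt (@frq R) g ^+ n) * U_hat g).
Proof.
have [M hM] := wt_pow (n + 4).
apply: (asum_le (k := fun g => `|M| * (wt (@frq R) g ^+ 4)^-1)); last by apply: bsumZ => //; exact: bsum_wt.
move=> g; have w0 := wt_gt0 (@frq R) g; rewrite modM mod_rc ger0_norm; last by rewrite exprn_ge0 // ltW.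
rewrite ler_pdivlMr ?exprn_gt0 // mulrAC -exprD; exact: le_trans (hM g) (ler_norm M).
Qed.

Lemma uh_sum : asum U_hat.
Proof. by have := uh_w 0; congr asum; apply/funext => g; rewrite expr0 mul1r. Qed.

(** Equality almost everywhere on the cell by completeness, at every point of the cell by
    continuity, and on the plane because both sides have the same twist. *)
Lemma U_ser p : U (to_C p) = ser U_hat p.
Proof.
have [M hM] := Us_bdd [::]; have oU : okc (Us [::]) := okc_bdd (Us_mC _) hM.
have mS := ser_mC uh_sum; have oS : okc (ser U_hat) := okc_bdd mS (fun p => ser_bd p uh_sum).
pose F p := Us [::] p + (-1) * ser U_hat p.
have oF : okc F := okcD oU (okcZ (-1) oS).
have cF : ccont F.
  apply: ccontD; last by apply: ccontZ; exact: ccont_ser uh_sum.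
  have [s1 s2] := Us_smooth [::].
  have := ccont_ri (smooth2_cont s1) (smooth2_cont s2); congr ccont; apply/funext => q; by rewrite /=.
have ae : {ae mu, forall p, cel p -> F p = 0}.
  apply: (completeness (y := -1) oF) => g k gk.
  have sS := coef_ser uh_sum uh_supp (ex_intro _ k gk).
  rewrite /F coefD //; last exact: okcZ.
  rewrite coefZ // sS /U_hat; have -> : cls g == -1 by apply/eqP; rewrite -[-1]mulrN1z; apply/clsP; exists k.
  by rewrite mulN1r subrr.
have z := ae_cont cF ae.
have per m n q : F (q + lat R m n) = phase R (-1) (m + n) * F q.
  by rewrite /F Us_per (ser_per uh_sum uh_supp); ring.
have /andP[f1 f2] := floor_itv (ca p); have /andP[f3 f4] := floor_itv (cb p).
have : F (p + lat R (- Num.floor (ca p)) (- Num.floor (cb p))) = 0.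
  apply: z; apply/cellE; rewrite ca_lat cb_lat !mulrNz /=; move: f2 f4; rewrite !intrD => f2 f4.
  by split; apply/andP; split; lra.
rewrite per => /eqP; rewrite mulf_eq0 (negbTE (expi_neq0 _)) /= /F Us_nil mulN1r subr_eq0 => /eqP //.
Qed.

(* Multiplication of the frequency by the conjugate of omega. *)
Definition freq_rot g : G := (g.1 + g.2, - (3 * g.1) - 2 * g.2).
Definition freq_unrot g : G := (- (2 * g.1) - g.2, 3 * g.1 + g.2).
Lemma R0K : cancel freq_rot freq_unrot. Proof. by move=> [m y]; rewrite /freq_rot /freq_unrot /=; congr (_, _); ring. Qed.

Lemma R1K : cancel freq_unrot freq_rot. Proof. by move=> [m y]; rewrite /freq_rot /freq_unrot /=; congr (_, _); ring. Qed.

Lemma R0N g : freq_rot (- g) = - freq_rot g.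
Proof. by rewrite /freq_rot /=; congr (_, _); rewrite /=; ring. Qed.

Lemma cls_R0 g : cls (freq_rot g) = cls g.
Proof.
apply/eqP; rewrite -subr_eq0 /cls -intrB; apply/eqP/cls0P; exists (- g.1 - g.2).
by rewrite /freq_rot /=; ring.
Qed.

Definition rot p : R * R := pt (- cb p) (ca p - cb p).
Lemma omega2 : omega R * omega R = - 1 - omega R.
Proof. by rewrite omegaE; apply/eqP; rewrite eq_complex /=; apply/andP; split; apply/eqP; have := s3_sq R => h; lra. Qed.

Lemma to_C_rot p : to_C (rot p) = omega R * to_C p.
Proof.
have -> : to_C p = rc (ca p) + rc (cb p) * omega R by rewrite -to_C_pt pt_ab.
by rewrite /rot to_C_pt mulrDr [omega R * (_ * _)]mulrCA omega2 rcB rmorphN /=; ring.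
Qed.

Lemma fa_R0 g : fa R (freq_rot g) = fb R g.
Proof. by rewrite /fa /fb /freq_rot /= intrB mulrNz !intrM intrD -[3%:~R]/(3%:R) -[2%:~R]/(2%:R); field. Qed.

Lemma fb_R0 g : fb R (freq_rot g) = - fa R g - fb R g.
Proof. by rewrite /fa /fb /freq_rot /= intrB mulrNz !intrM -[3%:~R]/(3%:R) -[2%:~R]/(2%:R); field. Qed.

Lemma ch_rot g p : ch g (rot p) = ch (freq_rot g) p.
Proof.
by rewrite /ch /rot ca_pt cb_pt fa_R0 fb_R0; congr expi; ring.
Qed.

Lemma frq_R0 g : frq R (freq_rot g) = conjc (omega R) * frq R g.
Proof.
rewrite !frqE; have -> : conjc (omega R) = (- (1 / 2) +i* - (sqrt3 R / 2))%C by rewrite omegaE.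
have s2 := s3_sq R; have s0 := s3_gt0 R; have hs : sqrt3 R != 0 by rewrite gt_eqF.
have h3 : (sqrt3 R)^-1 = sqrt3 R / 3 by rewrite -s2; field.
have e0 : qf R false (freq_rot g) = - (1 / 2) * qf R false g - - (sqrt3 R / 2) * qf R true g.
  by rewrite /qf fa_R0; field.
have e1 : qf R true (freq_rot g) = - (1 / 2) * qf R true g + - (sqrt3 R / 2) * qf R false g.
  by rewrite /qf fa_R0 fb_R0 h3; field.
by apply/eqP; rewrite eq_complex; apply/andP; split; apply/eqP; [exact: e0 | exact: e1].
Qed.

(** Rotating the argument permutes the frequencies by [freq_rot], so the rotation law of U becomes
    an identity between two absolutely convergent series with equal coefficients. *)
Lemma uh_rot g : U_hat (freq_rot g) = conjc (omega R) * U_hat g.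
Proof.
have mo : omega R * conjc (omega R) = 1 by rewrite mul_conj mod_expi expr1n.
have s1 : asum (fun g => omega R * U_hat g) := asumZ _ uh_sum.
have s2 : asum (fun g => U_hat (freq_unrot g)) by apply: asum_inj uh_sum; exact: can_inj R1K.
have E : ser (fun g => U_hat (freq_unrot g)) = ser (fun g => omega R * U_hat g).
  apply/funext => p; transitivity (ser U_hat (rot p)).
    rewrite /ser -(csum_bij R0K R1K); last exact: asum_ch.
    by congr csum; apply/funext => h; rewrite R0K ch_rot.
  rewrite -U_ser to_C_rot rotationU U_ser /ser -csumZ; last exact: asum_ch uh_sum.
  by congr csum; apply/funext => h; rewrite mulrA.
have [cg|cg] := eqVneq (cls g) (-1); last by rewrite /U_hat cls_R0 (negbTE cg) mulr0.
have sp1 : insupp (-1) (fun g => U_hat (freq_unrot g)).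
  move=> h /uh_supp /clsP; rewrite -cls_R0 R1K => e; exact/clsP.
have sp2 : insupp (-1) (fun g => omega R * U_hat g).
  by move=> h nz; apply: uh_supp; apply: contraNneq nz => ->; rewrite mulr0.
have ck : exists k : int, (freq_rot g).2 - (-1) = 3 * k by apply/clsP; rewrite cls_R0 cg mulrN1z.
have := coef_ser s1 sp2 ck; rewrite -E (coef_ser s2 sp1 ck) R0K => ->.
by rewrite mulrA [conjc _ * _]mulrC mo mul1r.
Qed.

(** U(z) has frequencies of class - 1 and U(-z) of class 1, so both off-diagonal entries fit into
    one sequence. The class of g - g' selects the entry that maps the component of g' to that of
    g. *)
Definition a_hat g : C := if cls g == -1 then U_hat g else if cls g == 1 then U_hat (- g) else 0.
Lemma clsN g : cls (- g) = - cls g. Proof. exact: mulrNz. Qed.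

Lemma aa_even g : a_hat (- g) = a_hat g.
Proof.
rewrite /a_hat clsN opprK; case: (Z3P (cls g)) => ->; rewrite ?oppr0 ?opprK //.
Qed.

Lemma aa_cls g : cls g = 0 -> a_hat g = 0.
Proof. by rewrite /a_hat => ->. Qed.

Lemma aa_w n : asum (fun g => rc (wt (@frq R) g ^+ n) * a_hat g).
Proof.
have h1 := uh_w n; have h2 : asum (fun g => rc (wt (@frq R) (- g) ^+ n) * U_hat (- g)).
  by apply: (@asum_inj _ _ _ (fun g => - g) (fun g => rc (wt (@frq R) g ^+ n) * U_hat g)) h1; exact: oppr_inj.
apply: asum_le (bsumD h1 h2) => g; rewrite !modM /a_hat.
have -> : wt (@frq R) (- g) = wt (@frq R) g.
  rewrite /wt (_ : frq R (- g) = - frq R g) ?modN //.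
  by rewrite !frqE !qfN.
rewrite -mulrDr ler_wpM2l ?mod_ge0 //; case: ifP => _; first by rewrite lerDl mod_ge0.
by case: ifP => _; rewrite ?lerDr ?mod0 ?addr_ge0 ?mod_ge0.
Qed.

Lemma aa_sum : asum a_hat.
Proof. by have := aa_w 0; congr asum; apply/funext => g; rewrite expr0 mul1r. Qed.

Lemma aa_rot g : a_hat (freq_rot g) = conjc (omega R) * a_hat g.
Proof. by rewrite /a_hat cls_R0 -R0N !uh_rot; case: ifP => // _; case: ifP => // _; rewrite mulr0. Qed.
End Potential.

(** * Spinors and their Fourier coefficients *)

Section Spinor.
Variable R : realType.
Local Notation C := R[i].
Local Notation T := (measurableTypeR R * measurableTypeR R)%type.
Local Notation mu := (@plane R).
Local Notation cel := (@cell R).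
Local Notation G := (int * int)%type.
Local Notation spinor := (C -> 'cV[C]_2).
Implicit Types (p q : R * R) (g h : G) (F H : R * R -> C) (s x y : G -> C) (u v w : spinor) (i : 'I_2).

Definition J g := cls g != 0.
Definition yc i : int := if i == 0 then 1 else -1.
Definition ci g : 'I_2 := if cls g == 1 then 0 else 1.
Definition oth i : 'I_2 := if i == 0 then 1 else 0.
Lemma ciP g i : (cls g == (yc i)%:~R) = J g && (ci g == i).
Proof.
rewrite /J /ci /yc; case: (Z3P (cls g)) => ->; case: i => [[|[|]]] // hi; rewrite -?val_eqE //=.
Qed.

Lemma J_ci g : J g -> cls g = (yc (ci g))%:~R.
Proof. by move=> Jg; apply/eqP; rewrite ciP Jg eqxx. Qed.

Lemma cls_k g i : cls g = (yc i)%:~R -> exists k : int, g.2 - yc i = 3 * k.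
Proof. by move/clsP. Qed.

Definition uf u i p : C := u (to_C p) i 0.
Definition part i x g : C := if cls g == (yc i)%:~R then x g else 0.
Definition sp x : spinor := fun z => \col_i fC (ser (part i x)) z.
Definition hat u g : C := if J g then coef (uf u (ci g)) g else 0.
Lemma hat_supp u : supp J (hat u).
Proof. by move=> g /negbTE h; rewrite /hat h. Qed.

Lemma hat_i u g i : cls g = (yc i)%:~R -> hat u g = coef (uf u i) g.
Proof. by move=> /eqP; rewrite ciP => /andP[Jg /eqP <-]; rewrite /hat Jg. Qed.

Lemma asum_part i x : asum x -> asum (part i x).
Proof. by apply: asum_le => g; rewrite /part; case: ifP; rewrite ?mod0 ?mod_ge0. Qed.

Lemma part_supp i x : insupp (yc i) (part i x).
Proof.
move=> g; rewrite /part; have [e _|_] := eqVneq (cls g) _; last by rewrite eqxx.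
exact: cls_k.
Qed.

Lemma uf_sp x i p : uf (sp x) i p = ser (part i x) p.
Proof. by rewrite /uf /sp mxE; case: p. Qed.

Lemma uf_spE x i : uf (sp x) i = ser (part i x).
Proof. by apply/funext => p; exact: uf_sp. Qed.

Lemma sp_entry x i : (fun z => sp x z i 0) = fC (ser (part i x)).
Proof. by apply/funext => z; rewrite /sp mxE. Qed.

Lemma okc_ser s : asum s -> okc (ser s).
Proof. by move=> hs; exact: okc_bdd (ser_mC hs) (fun p => ser_bd p hs). Qed.

Lemma hat_sp x : asum x -> supp J x -> hat (sp x) = x.
Proof.
move=> hx sx; apply/funext => g; rewrite /hat; case: ifPn => [Jg|/sx -> //].
rewrite uf_spE (coef_ser (asum_part _ hx) (@part_supp _ _)); last by apply: cls_k; exact: J_ci.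
by rewrite /part -J_ci // eqxx.
Qed.

Lemma okcB_bd H F (M : R) : mC H -> (forall p, modulus (H p) <= M) -> okc F -> okc (fun p => H p * F p).
Proof.
move=> mH hM [mF oF]; split; first exact: mCM.
by have := ok_bddM mH hM oF; congr ok; apply/funext => p; ring.
Qed.

Lemma coef_bd F : okc F -> exists M : R, forall g, modulus (coef F g) <= M.
Proof.
move=> [mF oF]; exists (modulus (rc (area R))^-1 * (2 * \int[mu]_p modulus (ind cel p * F p))) => g.
rewrite modM ler_wpM2l ?mod_ge0 //; apply: plint_le; [|exact: okr_mod|].
  exact: mC_ok (okc_ch _ (conj mF oF)).
by move=> p; rewrite mulrA modM ch_mod mulr1.
Qed.

Lemma ae_same (y : int) F H : okc F -> okc H -> qper y F -> qper y H ->
  (forall g (k : int), g.2 - y = 3 * k -> coef F g = coef H g) -> {ae mu, forall p, F p = H p}.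
Proof.
move=> oF oH pF pH h.
have oD := okcD oF (okcZ (-1) oH).
have ae : {ae mu, forall p, cel p -> F p + (-1) * H p = 0}.
  apply: (completeness (y := y) oD) => g k gk.
  by rewrite coefD ?coefZ ?(h g k gk) ?mulN1r ?subrr //; exact: okcZ.
apply: ae_all_cells => m n.
apply: ae_imp2 (pF m n) (ae_imp2 (S := fun p => cel p -> F p = H p /\ H (p + lat R m n) = phase R y (m + n) * H p) _ (pH m n) ae) => [p e1 e2 cp|p e1 e2 cp].
  by have [e3 e4] := e2 cp; rewrite e1 e4 e3.
by split=> //; have /eqP := e2 cp; rewrite mulN1r subr_eq0 => /eqP.
Qed.

Lemma phaseD (y y' n : int) : phase R (y + y') n = phase R y n * phase R y' n.
Proof. by rewrite /phase -expiD intrD; congr expi; ring. Qed.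

Lemma qperZ (c : C) (y : int) F : qper y F -> qper y (fun p => c * F p).
Proof. by move=> h m n; apply: ae_imp (h m n) => p ->; rewrite mulrCA. Qed.

Lemma qperD (y : int) F H : qper y F -> qper y H -> qper y (fun p => F p + H p).
Proof. by move=> h1 h2 m n; apply: ae_imp2 (h1 m n) (h2 m n) => p -> ->; rewrite mulrDr. Qed.

Lemma qperM (y y' : int) F H : qper y F -> qper y' H -> qper (y + y') (fun p => F p * H p).
Proof. by move=> h1 h2 m n; apply: ae_imp2 (h1 m n) (h2 m n) => p -> ->; rewrite phaseD; ring. Qed.

Lemma qper_eq (y y' : int) F (k : int) : y = y' + 3 * k -> qper y F -> qper y' F.
Proof. by move=> e h m n; apply: ae_imp (h m n) => p ->; rewrite (phase_eq R _ e). Qed.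

Lemma qper_ser (y : int) s : asum s -> insupp y s -> qper y (ser s).
Proof. by move=> hs ys m n; apply: aeW => p; exact: ser_per. Qed.

(** A weak derivative is not known to be periodic. On each translated cell it is compared through
    its translate f', divided by the phase, which is again a weak derivative of the series; its
    coefficients then follow from [weak_coef]. *)
Lemma weak_ser j (y : int) s (f : C -> C) : asum s -> insupp y s -> asum (fun g => rc (qf R j g) * s g) -> L2loc f ->
  is_weak_partial j (fC (ser s)) f -> {ae mu, forall p, f (to_C p) = ser (fun g => iunit R * rc (qf R j g) * s g) p}.
Proof.
move=> hs ys hq lf wf; set s' := fun g => _.
have hs' : asum s' by have := asumZ (iunit R) hq; congr asum; apply/funext => g; rewrite /s' mulrA.
have ys' : insupp y s' by move=> g nz; apply: ys; apply: contraNneq nz => e; rewrite /s' e mulr0.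
apply: ae_all_cells => m n; set t := lat R m n; set c := phase R y (m + n).
have c0 : c != 0 by exact: expi_neq0.
pose f' z := c^-1 * f (z + to_C t).
have lf' : L2loc f'.
  have mf : mC (fun p => f' (to_C p)).
    by apply: mCM; [exact: mC_cst | exact: (mC_shift t (mC_to_C lf))].
  have mm := mC_mod mf; case: (mf) => m1 m2; split=> // B cB; have [r hr] := compact_box cB.
  have [r' hr'] : exists r' : R, forall p, box r p -> box r' (p + t).
    exists (r + `|t.1| + `|t.2|) => p /boxP [/= b1 b2]; apply/boxP; split => /=.
      by apply: le_trans (ler_normD _ _) _; have := normr_ge0 t.2; lra.
    by apply: le_trans (ler_normD _ _) _; have := normr_ge0 t.1; lra.
  have okh : okr (fun p => modulus c^-1 ^+ 2 * (if p + t \in box r' then modulus (f (to_C (p + t))) ^+ 2 else 0)).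
    apply: okr_Z; have o1 : ok (fun p => rc (if p \in box r' then modulus (f (to_C p)) ^+ 2 else 0)).
      by split; [exact: L2loc_sq | exact: integrable0].
    by have [[k1 _] _] := plint_shift t o1.
  have mB := compact_plane cB.
  have m3 : measurable_fun [set: T] (fun p : T => (modulus (f' (to_C p)) ^+ 2)%:E).
    by apply/measurable_EFinP; exact: measurable_funX.
  move/integrableP: okh => [mk hk].
  apply: le_lt_trans hk; apply: (@le_trans _ _ (\int[mu]_(p in B) `|(modulus c^-1 ^+ 2 * (if (p + t)%R \in box r' then modulus (f (to_C (p + t)%R)) ^+ 2 else 0))%:E|)%E).
    apply: ge0_le_integral => //.
    - by move=> p _; rewrite lee_fin sqr_ge0.
    - exact: measurable_funS m3.
    - by apply: measurableT_comp => //; apply: measurable_funS mk.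
    move=> p Bp; rewrite lee_fin /f' modM exprMn ger0_norm.
      by rewrite mem_set; [rewrite to_CD | apply/hr'/hr].
    by apply: mulr_ge0; [exact: sqr_ge0 | case: ifP => // _; exact: sqr_ge0].
  by apply: ge0_subset_integral => //; apply: measurableT_comp.
have wf' : is_weak_partial j (fC (ser s)) f'.
  apply/weak_plint => phi tp.
  pose psi p := phi (p - t).
  have tpsi : test_function psi.
    case: tp => sp [B cB hB]; split.
      have E (l : seq bool) : foldr (@partial R) psi l = fun p => foldr (@partial R) phi l (p - t).
        elim: l => //= j' l IH; apply/funext => p; rewrite IH.
        by have [_ d] := sp l; exact: (partialE (partial_shift (d j' (p - t)))).
      move=> l; have [cl dl] := sp l; rewrite E; split.
        move=> p; apply: (@continuous_comp _ _ _ (fun q => q - t) (foldr (@partial R) phi l)); last exact: cl.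
        by apply: cvgB; [exact: cvg_id | exact: cvg_cst].
      by move=> j' p; have := partial_shift (dl j' (p - t)) => h; exact: ex_derive.
    have [r hr] := compact_box cB; exists (box (r + `|t.1| + `|t.2|)); first exact: box_compact.
    move=> p np; apply: hB => /hr /boxP [/= b1 b2]; apply: np; apply/boxP; split.
      have -> : p.1 = (p.1 - t.1) + t.1 by ring.
      by apply: le_trans (ler_normD _ _) _; have := normr_ge0 t.2; lra.
    have -> : p.2 = (p.2 - t.2) + t.2 by ring.
    by apply: le_trans (ler_normD _ _) _; have := normr_ge0 t.1; lra.
  have dpsi p : partial j psi (p + t) = partial j phi p.
    have [sp _] := tp; have := @partial_shift R phi j (p + t) (- t) (@smooth2_der R _ j _ sp) => D.
    by rewrite -[LHS]/(partial j (fun q => phi (q + - t)) (p + t)) (partialE D) addrK.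
  have w := (weak_plint _ _ _).1 wf psi tpsi.
  have [k1 k2] := ok_test lf tpsi; have [k3 k4] := ok_test (ser_L2loc hs) tpsi.
  have [_ e1] := plint_shift t k1; have [_ e2] := plint_shift t (k4 j).
  rewrite -e1 -e2 in w.
  have E1 : (fun p => fC (ser s) (to_C (shift t p)) * rc (partial j psi (shift t p))) = fun p => c * (fC (ser s) (to_C p) * rc (partial j phi p)).
    apply/funext => p; rewrite shift_add dpsi.
    have E q : fC (ser s) (to_C q) = ser s q by case: q.
    by rewrite !E (ser_per hs ys) mulrA.
  have E2 : (fun p => f (to_C (shift t p)) * rc (psi (shift t p))) = fun p => c * (f' (to_C p) * rc (phi p)).
    by apply/funext => p; rewrite shift_add /psi addrK /f' to_CD -mulrA mulVKf.
  rewrite E1 E2 in w.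
  have [_ k5] := ok_test (ser_L2loc hs) tp; have [k6 _] := ok_test lf' tp.
  move: w; rewrite (plintZ _ (k5 j)) (plintZ _ k6) -mulrN; exact: (mulfI c0).
have per : qper y (fun p => fC (ser s) (to_C p)).
  by rewrite fCE; exact: qper_ser.
have of' := L2loc_okc lf'; have os' := okc_ser hs'.
have ae : {ae mu, forall p, cel p -> f' (to_C p) + (-1) * ser s' p = 0}.
  apply: (completeness (y := y) (okcD of' (okcZ (-1) os'))) => g k gk.
  have os2 := okcZ (-1) os'; rewrite (coefD _ of' os2) coefZ // (coef_ser hs' ys' (ex_intro _ k gk)).
  have per' : qper g.2 (fun p => fC (ser s) (to_C p)) by apply: (@qper_eq y g.2 _ (- k)) per; rewrite mulrN -gk; ring.
  have := weak_coef (ser_L2loc hs) lf' wf' per'.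
  have -> : (fun p => ind cel p * (fC (ser s) (to_C p) * ch (- g) p)) = fun p => ind cel p * (ser s p * ch (- g) p) by apply/funext => -[a b].
  rewrite !coefE (coef_ser hs ys (ex_intro _ k gk)) => e.
  have -> : coef (fun p => f' (to_C p)) g = s' g.
    by apply: (mulfI (rc_area R)); rewrite e /s'; ring.
  by rewrite mulN1r subrr.
apply: ae_imp ae => p e cp; have /eqP := e cp; rewrite mulN1r subr_eq0 /f' => /eqP e'.
by rewrite to_CD (ser_per hs' ys') -/c -e' mulVKf.
Qed.
End Spinor.

Section SpinorOperator.
Variable R : realType.
Local Notation C := R[i].
Local Notation mu := (@plane R).
Local Notation cel := (@cell R).
Local Notation G := (int * int)%type.
Local Notation fr := (@frq R).
Local Notation spinor := (C -> 'cV[C]_2).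
Implicit Types (p q : R * R) (g h : G) (F H : R * R -> C) (s x y : G -> C) (u v w : spinor) (i : 'I_2).

Lemma phase_cdot i (m n : int) : expi (if i == 0 then cdot (to_C (lat R m n)) (Kpt R) else - cdot (to_C (lat R m n)) (Kpt R))
   = phase R (- yc i) (m + n).
Proof.
rewrite /yc; case: ifP => _; first by rewrite expi_lat.
by rewrite -conj_expi expi_lat -phaseN opprK.
Qed.

Lemma Ltrans_entry (m n : int) u p i : Ltrans (to_C (lat R m n)) u (to_C p) i 0 = phase R (- yc i) (m + n) * uf u i (p + lat R m n).
Proof.
rewrite -phase_cdot /Ltrans mxE big_ord_recl big_ord1 !mxE /uf to_CD.
by case: i => [[|[|]]] // hi; rewrite -?val_eqE /= ?mul0r ?addr0 ?add0r; congr (_ * u _ _ _); apply: val_inj.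
Qed.

Lemma L20_qper u : L20 u -> forall i, L2loc (fun z => u z i 0) /\ qper (yc i) (uf u i).
Proof.
move=> [l2u per] i; split=> // m n.
apply: ae_imp (per _ (Lambda_lat R m n)) => p /(congr1 (fun M : 'cV[C]_2 => M i 0)).
by rewrite Ltrans_entry => e; rewrite /uf -e mulrA phaseK mul1r.
Qed.

Lemma L20_of u : (forall i, L2loc (fun z => u z i 0)) -> (forall i, qper (yc i) (uf u i)) -> L20 u.
Proof.
move=> l2u per; split=> // g [m [n ->]].
have -> : m%:~R + n%:~R * omega R = to_C (lat R m n).
  by rewrite to_C_pt; congr (_ + _ * _); apply/esym; exact: rmorph_int.
apply: ae_imp2 (per 0 m n) (per 1 m n) => p e0 e1; apply/matrixP => i j; rewrite (ord1 j) Ltrans_entry.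
have -> : uf u i (p + lat R m n) = phase R (yc i) (m + n) * uf u i p.
  have [->|i1] := eqVneq i 0; first exact: e0.
  have -> : i = 1 by apply: val_inj; case: i i1 => [[|[|]]].
  exact: e1.
by rewrite mulrA [phase _ _ _ * _]mulrC phaseK mul1r.
Qed.

Lemma weak_partialP (j : bool) (f : C -> C) : H1loc f -> L2loc (weak_partial j f) /\ is_weak_partial j f (weak_partial j f).
Proof. by move=> [_ /(_ j) [k hk]]; rewrite /weak_partial; case: xgetP => [k' _ //|/(_ k)]. Qed.

Lemma ii1 : (2 * iunit R)^-1 * 2 = - iunit R.
Proof.
have i2 : iunit R * iunit R = -1 by apply/eqP; rewrite eq_complex /=; apply/andP; split; apply/eqP; ring.
have i0 : iunit R != 0 by apply: contra_eqN i2 => /eqP ->; rewrite mul0r eq_sym oppr_eq0 oner_eq0.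
have t0 : (2 : C) != 0 by rewrite pnatr_eq0.
rewrite invfM mulrAC mulVf // mul1r; apply: (mulfI i0); rewrite mulfV // mulrN i2 opprK //.
Qed.

Lemma Dz2 (f : C -> C) z : 2 * Dzbar f z = - iunit R * (weak_partial false f z + iunit R * weak_partial true f z).
Proof. by rewrite /Dzbar mulrA [2 * _]mulrC ii1. Qed.

Lemma coef_wp j (f : C -> C) g (y : int) (k : int) : H1loc f -> qper y (fun p => f (to_C p)) -> g.2 - y = 3 * k ->
  coef (fun p => weak_partial j f (to_C p)) g = iunit R * rc (qf R j g) * coef (fun p => f (to_C p)) g.
Proof.
move=> hf per gk; have [lw ww] := weak_partialP j hf.
have per' : qper g.2 (fun p => f (to_C p)) by apply: (qper_eq (k := - k)) per; rewrite mulrN -gk; ring.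
by rewrite /coef (weak_coef hf.1 lw ww per') mulrCA.
Qed.

Lemma coef_lin (a b : C) (W0 W1 : R * R -> C) g : okc W0 -> okc W1 ->
  coef (fun p => a * (W0 p + b * W1 p)) g = a * (coef W0 g + b * coef W1 g).
Proof.
move=> o0 o1; have o2 := okcZ b o1; have e1 := coefZ b g o1; have e2 := coefD g o0 o2.
by have e3 := coefZ a g (okcD o0 o2); rewrite e3 e2 e1.
Qed.

Lemma coef_Dz (f : C -> C) g (y : int) (k : int) : H1loc f -> qper y (fun p => f (to_C p)) -> g.2 - y = 3 * k ->
  okc (fun p => 2 * Dzbar f (to_C p)) /\ coef (fun p => 2 * Dzbar f (to_C p)) g = fr g * coef (fun p => f (to_C p)) g.
Proof.
move=> hf per gk; pose W j p := weak_partial j f (to_C p).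
have e j : coef (W j) g = iunit R * rc (qf R j g) * coef (fun p => f (to_C p)) g := coef_wp j hf per gk.
have hO j : okc (W j) := L2loc_okc (weak_partialP j hf).1.
have E : (fun p => 2 * Dzbar f (to_C p)) = fun p => - iunit R * (W false p + iunit R * W true p).
  by apply/funext => p; rewrite Dz2.
clearbody W; rewrite E; split; first by apply: okcZ; apply: okcD => //; exact: okcZ.
have i2 : iunit R * iunit R = -1 by apply/eqP; rewrite eq_complex /=; apply/andP; split; apply/eqP; ring.
rewrite coef_lin // !e /frq.
move: (coef _ _) (rc _) (rc _) => c q1 q0.
transitivity (- (iunit R * iunit R) * (q0 + iunit R * q1) * c); first by ring.
by rewrite i2; ring.
Qed.

Variable U : C -> C.
Hypothesis smoothU : smoothC U.
Hypothesis periodicU : forall g : C, Lambda g -> forall z : C, U (z + g) = expi (cdot g (Kpt R)) * U z.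
Variable al : C.
Local Notation a_hat := (a_hat U).
Local Notation U_hat := (U_hat U).
Local Notation opA0 := (opA J fr a_hat al 0).
Let uhs : asum U_hat := uh_sum smoothU periodicU.
Let aas : asum a_hat := aa_sum smoothU periodicU.

(** Fourier coefficients of the off-diagonal entry in row i of the potential. *)
Definition Vh i : G -> C := if i == 0 then U_hat else fun g => U_hat (- g).
Definition vc i : int := if i == 0 then -1 else 1.
Lemma Vh_sum i : asum (Vh i).
Proof.
rewrite /Vh; case: ifP => _; first exact: uhs.
exact: (asum_inj (h := fun g : G => - g) (@oppr_inj _) uhs).
Qed.

Lemma ch_opp g p : ch g (- p) = ch (- g) p.
Proof.
have ea : ca (- p) = - ca p by rewrite /ca [(- p).1]/(- p.1) [(- p).2]/(- p.2) mulNr opprD.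
have eb : cb (- p) = - cb p by rewrite /cb [(- p).2]/(- p.2) mulrN mulNr.
by rewrite /ch faN fbN ea eb !mulrN !mulNr.
Qed.

Lemma V_ser i p : (if i == 0 then U (to_C p) else U (- to_C p)) = ser (Vh i) p.
Proof.
rewrite /Vh; case: ifP => _; first exact: U_ser.
have -> : - to_C p = to_C (- p) :> C by [].
rewrite (U_ser smoothU periodicU) /ser -(csum_bij (h := fun g => - g) (hinv := fun g => - g)); try exact: opprK.
  by congr csum; apply/funext => g; rewrite ch_opp opprK.
exact: asum_ch.
Qed.

Lemma Vh_supp i : insupp (vc i) (Vh i).
Proof.
rewrite /Vh /vc; case: ifP => _; first exact: uh_supp.
move=> g /uh_supp [k hk]; exists (- k); rewrite mulrN -hk /=; ring.
Qed.

Lemma Vh0 i g : cls g != (vc i)%:~R -> Vh i g = 0.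
Proof.
move=> h; apply/eqP; apply: contraNT h => /Vh_supp /clsP ->; by [].
Qed.

Lemma Dop_entry u i p : uf (Dop U al u) i p = 2 * Dzbar (fun z => u z i 0) (to_C p) + al * (ser (Vh i) p * uf u (oth i) p).
Proof.
rewrite /uf /Dop mxE [in LHS]mxE; congr (_ + _); rewrite -V_ser mxE big_ord_recl big_ord1 !mxE /oth.
case: i => [[|[|]]] // hi; rewrite -?val_eqE /= ?mulr0 ?mul0r ?add0r ?addr0 -mulrA; congr (_ * (_ * u _ _ _)); exact: val_inj.
Qed.

Lemma oth_cls i : (yc (oth i))%:~R = - (yc i)%:~R :> 'Z_3.
Proof. by case: i => [[|[|]]] // hi; apply: val_inj. Qed.

(** Row i of the potential only meets the other component; for the remaining frequencies of x the
    combined sequence vanishes by its class. *)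
Lemma conv_V i (c x : G -> C) g : cls g = (yc i)%:~R -> (exists M : R, forall h, modulus (c h) <= M) -> supp J x ->
  (forall h, cls h = (yc (oth i))%:~R -> c h = x h) -> csum (fun h => Vh i h * c (g - h)) = conv a_hat x g.
Proof.
move=> cg [M hM] sx hc.
have K g' : g - (g - g') = g' by rewrite opprB addrC subrK.
have as1 : asum (fun h => Vh i h * c (g - h)).
  have := asum_bdd (f := Vh i) (g := fun h => c (g - h)) (fun h => hM _) (Vh_sum i).
  by congr asum; apply/funext => h; exact: mulrC.
rewrite -(csum_bij (h := fun g' => g - g') (hinv := fun g' => g - g') K K as1).
rewrite /conv; congr csum; apply/funext => g'; rewrite K.
have cB : cls (g - g') = (yc i)%:~R - cls g' by rewrite clsD clsN cg.
have [e|ne] := eqVneq (cls g') (yc (oth i))%:~R.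
  rewrite (hc _ e); congr (_ * _); rewrite /Vh /a_hat cB e oth_cls opprK.
  by case: (i) => [[|[|]]] // hi.
rewrite Vh0 ?mul0r; last first.
  rewrite cB; apply: contraNneq ne => e; apply/eqP; rewrite oth_cls.
  have -> : cls g' = (yc i)%:~R - (vc i)%:~R by rewrite -e opprB addrC subrK.
  by rewrite /vc /yc; case: (i) => [[|[|]]] // hi; apply: val_inj.
have [J0|J1] := boolP (J g'); last by rewrite sx // mulr0.
rewrite aa_cls ?mul0r // cB; move: ne J0; rewrite oth_cls /J /yc.
by case: (i) => [[|[|]]] // hi; case: (Z3P (cls g')) => -> // _ _; apply: val_inj.
Qed.

Lemma H10_okc u : H10 u -> forall i, okc (uf u i).
Proof. by move=> [[l2u _] _] i; exact: L2loc_okc (l2u i). Qed.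

Lemma hat_Dop u : H10 u -> (forall i, okc (uf (Dop U al u) i)) /\ forall g, hat (Dop U al u) g = opA0 (hat u) g.
Proof.
move=> hu; have [l20 h1u] := hu; have lq := L20_qper l20.
have E i : uf (Dop U al u) i = fun p => 2 * Dzbar (fun z => u z i 0) (to_C p) + al * (ser (Vh i) p * uf u (oth i) p).
  by apply/funext => p; exact: Dop_entry.
have oD i : okc (fun p => 2 * Dzbar (fun z => u z i 0) (to_C p)).
  have e : (0, yc i).2 - yc i = 3 * 0 :> int by rewrite /= subrr mulr0.
  by have [] := coef_Dz (h1u i) (lq i).2 e.
have oV i : okc (fun p => al * (ser (Vh i) p * uf u (oth i) p)).
  apply: okcZ; apply: (okcB_bd (M := rsum (fun g => modulus (Vh i g)))); first exact: ser_mC (Vh_sum i).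
    by move=> p; exact: ser_bd (Vh_sum i).
  exact: H10_okc.
split=> [i|g]; first by rewrite E; exact: okcD.
rewrite /opA; case: ifPn => [Jg|nJ]; last by rewrite hat_supp.
have cg := J_ci Jg; set i := ci g in cg *; have [k gk] := cls_k cg.
rewrite (hat_i _ cg) E (coefD _ (oD i) (oV i)) addr0.
have [_ ->] := coef_Dz (h1u i) (lq i).2 gk; rewrite (hat_i _ cg); congr (_ + _).
have oo := H10_okc hu (oth i).
rewrite coefZ; last first.
  apply: (okcB_bd (M := rsum (fun g => modulus (Vh i g)))) => //; first exact: ser_mC (Vh_sum i).
  by move=> p; exact: ser_bd (Vh_sum i).
congr (_ * _); rewrite -(conv_V cg (coef_bd oo) (@hat_supp R u) (fun h ch => esym (hat_i u ch))).
have -> : (fun p => ser (Vh i) p * uf u (oth i) p) = fun p => uf u (oth i) p * ser (Vh i) p by apply/funext => p; rewrite mulrC.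
exact: coef_mul_ser (Vh_sum i) oo.
Qed.

Lemma hat_l2 u : (forall i, L2loc (fun z => u z i 0)) -> l2 (hat u).
Proof.
move=> lu; have h i := @coef_l2 R (fun z => u z i 0) (yc i) (fun g => cls g == (yc i)%:~R) (lu i) (fun g e => cls_k (eqP e)).
apply: bsum_le (bsumD (h 0) (h 1)) => g; rewrite /sq /hat; case: ifPn => [Jg|_]; last first.
  by rewrite mod0 expr0n addr_ge0 // sqr_ge0.
have cg := J_ci Jg; have [e|e] := eqVneq (ci g) 0.
  by rewrite -e -cg eqxx lerDl sqr_ge0.
have e1 : ci g = 1 by apply: val_inj; case: (ci g) e => [[|[|]]].
by rewrite -e1 -cg eqxx lerDr sqr_ge0.
Qed.

Lemma h1_hat u : H10 u -> h1 J fr (hat u).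
Proof.
move=> [l20 h1u]; have lq := L20_qper l20.
have key j : l2 (fun g => rc (qf R j g) * hat u g).
  (* Bessel's inequality is applied to the spinor of weak derivatives, whose coefficients are i
     times the frequency component times those of u. *)
  have := @hat_l2 (fun z => \col_i weak_partial j (fun z' => u z' i 0) z) _.
  rewrite (_ : hat _ = fun g => iunit R * (rc (qf R j g) * hat u g)).
    move=> h; have {}h : l2 (fun g => iunit R * (rc (qf R j g) * hat u g)).
      apply: h => i; have := (weak_partialP j (h1u i)).1; congr L2loc; apply/funext => z; by rewrite mxE.
    have i2 : - iunit R * iunit R = 1 by apply/eqP; rewrite eq_complex /=; apply/andP; split; apply/eqP; ring.
    have := l2Z (- iunit R) h; congr l2; apply/funext => g; by rewrite mulrA i2 mul1r.
  apply/funext => g; have [Jg|nJ] := boolP (J g); last by rewrite !hat_supp // !mulr0.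
  have cg := J_ci Jg; have [k gk] := cls_k cg; rewrite !(hat_i _ cg).
  rewrite (_ : uf _ (ci g) = fun p => weak_partial j (fun z' => u z' (ci g) 0) (to_C p)).
    by rewrite (coef_wp j (h1u _) (lq _).2 gk) mulrA.
  by apply/funext => p; rewrite /uf mxE.
split; [exact: hat_supp | by apply: hat_l2 => i; case: (lq i) |].
have := l2D (key false) (l2Z (iunit R) (key true)); congr l2; apply/funext => g; rewrite /frq; ring.
Qed.

(** Rapidly decreasing coefficients. For such sequences the series and their derivatives converge
    absolutely, and the class is stable under the operator. *)
Definition reg x := supp J x /\ forall n, wl2 fr n x.
Lemma reg_l2 x : reg x -> l2 x.
Proof. by move=> [_ /(_ 0)]; congr l2; apply/funext => g; rewrite expr0 mul1r. Qed.

Lemma reg_wasum n x : reg x -> asum (fun g => rc (wt fr g ^+ n) * x g).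
Proof. by move=> [_ h]; exact: (wl2_asum (bsum_wt R)). Qed.

Lemma reg_asum x : reg x -> asum x.
Proof. by move=> /(reg_wasum 0); congr asum; apply/funext => g; rewrite expr0 mul1r. Qed.

Lemma reg_q j x : reg x -> asum (fun g => rc (qf R j g) * x g).
Proof.
move=> /(reg_wasum 1); apply: asum_le => g; rewrite !modM !mod_rc expr1.
apply: ler_wpM2r; first exact: mod_ge0.
by have h1 := qf_le R j g; have := ler_norm (wt fr g); rewrite {1}/wt; lra.
Qed.

Lemma reg_h1 x : reg x -> h1 J fr x.
Proof.
move=> hx; have [sx wx'] := hx; split=> //; first exact: reg_l2.
apply: bsum_le (wx' 1%N) => g; rewrite /sq !modM mod_rc expr1 lerXn2r ?nnegrE ?mulr_ge0 ?mod_ge0 //.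
rewrite ler_wpM2r ?mod_ge0 //; apply: le_trans (ler_norm _); by rewrite /wt lerDr.
Qed.

Lemma reg_fr x : reg x -> reg (fun g => fr g * x g).
Proof.
move=> [sx hx]; split=> [g /sx ->|n]; first by rewrite mulr0.
apply: (wl2_le (v := fun g => rc (wt fr g) * x g)) => [g|].
  rewrite !modM ler_wpM2r ?mod_ge0 // mod_rc; apply: le_trans (ler_norm _); by rewrite /wt lerDr.
by have := hx n.+1; congr l2; apply/funext => g; rewrite exprSr rcM mulrA.
Qed.

Lemma reg_conj x : reg x -> reg (fun g => conjc (x g)).
Proof.
move=> [sx hx]; split=> [g /sx ->|n]; first by rewrite conjc0.
by apply: wl2_le (hx n) => g; rewrite mod_conj.
Qed.

Lemma reg_opA x : reg x -> reg (opA0 x).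
Proof.
move=> hx; split=> [g nJ|n]; first by rewrite /opA (negbTE nJ).
have [_ h1] := reg_fr hx; have [_ h2] := hx.
have h3 := wl2_conv (@frqD R) (aa_w smoothU periodicU) (h2 n).
apply: (wl2_le (v := fun g => fr g * x g + al * conv a_hat x g)); last by apply: wl2D => //; exact: wl2Z.
by move=> g; rewrite /opA addr0; case: ifP => // _; rewrite mod0 mod_ge0.
Qed.

Lemma reg_fin x (S : {fset G}) : supp J x -> (forall g, g \notin S -> x g = 0) -> reg x.
Proof.
move=> sx hS; split=> // n; apply: (@bsum_fin _ _ _ S) => [g|g /hS]; first exact: sqr_ge0.
by rewrite /sq => ->; rewrite mulr0 mod0 expr0n.
Qed.

Lemma serD s1 s2 p : asum s1 -> asum s2 -> ser (fun g => s1 g + s2 g) p = ser s1 p + ser s2 p.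
Proof.
move=> h1 h2; rewrite /ser -csumD; try exact: asum_ch.
by congr csum; apply/funext => g; rewrite mulrDl.
Qed.

Lemma serZ c s p : asum s -> ser (fun g => c * s g) p = c * ser s p.
Proof.
move=> h1; rewrite /ser -csumZ; last exact: asum_ch.
by congr csum; apply/funext => g; rewrite mulrA.
Qed.

Lemma part_q j i x : asum (fun g => rc (qf R j g) * x g) -> asum (fun g => rc (qf R j g) * part i x g).
Proof. by apply: asum_le => g; rewrite /part; case: ifP => _ //; rewrite mulr0 mod0 mod_ge0. Qed.

Lemma H10_sp x : reg x -> H10 (sp x).
Proof.
move=> rx; have ax := reg_asum rx; split; first apply: L20_of => i.
- by rewrite sp_entry; apply: ser_L2loc; exact: asum_part.
- by rewrite uf_spE; apply: qper_ser; [exact: asum_part | exact: part_supp].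
move=> i; rewrite sp_entry; split=> [|j]; first by apply: ser_L2loc; exact: asum_part.
have q1 := part_q i (reg_q j rx); exists (fC (ser (fun g => iunit R * rc (qf R j g) * part i x g))); split.
  apply: ser_L2loc; have := asumZ (iunit R) q1; congr asum; apply/funext => g; by rewrite mulrA.
by apply: ser_weak => //; exact: asum_part.
Qed.

(** The chosen weak derivatives agree almost everywhere with the termwise ones by [weak_ser]; the
    product with the potential is identified by comparing coefficients. *)
Lemma Dop_sp x i : reg x -> {ae mu, forall p, uf (Dop U al (sp x)) i p = uf (sp (opA0 x)) i p}.
Proof.
move=> rx; have hH := H10_sp rx; have [sx _] := rx; have ax := reg_asum rx.
set s := part i x; have as_ : asum s := asum_part i ax.
have q j : asum (fun g => rc (qf R j g) * s g) := part_q i (reg_q j rx).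
have q' j : asum (fun g => iunit R * rc (qf R j g) * s g).
  by have := asumZ (iunit R) (q j); congr asum; apply/funext => g; rewrite mulrA.
have [_ h1] := hH; have w j := weak_partialP j (h1 i).
have ae j : {ae mu, forall p, weak_partial j (fun z => sp x z i 0) (to_C p) = ser (fun g => iunit R * rc (qf R j g) * s g) p}.
  have [w1 w2] := w j; apply: weak_ser as_ (@part_supp _ _ _) (q j) w1 _.
  by have := w2; rewrite {1}sp_entry.
have i2 : iunit R * iunit R = -1 by apply/eqP; rewrite eq_complex /=; apply/andP; split; apply/eqP; ring.
have afr : asum (fun g => fr g * s g).
  have := asumD (q false) (asumZ (iunit R) (q true)); congr asum; apply/funext => g; rewrite /frq; ring.
pose F p := ser (fun g => fr g * s g) p + al * (ser (Vh i) p * ser (part (oth i) x) p).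
have aeF : {ae mu, forall p, uf (Dop U al (sp x)) i p = F p}.
  apply: ae_imp2 (ae false) (ae true) => p e0 e1.
  rewrite Dop_entry Dz2 e0 e1 uf_sp /F; congr (_ + _).
  have -> : ser (fun g => fr g * s g) p = - iunit R * (ser (fun g => iunit R * rc (qf R false g) * s g) p + iunit R * ser (fun g => iunit R * rc (qf R true g) * s g) p); last by [].
  rewrite -(serZ (iunit R)) // -serD ?q' //; last exact: asumZ.
  rewrite -serZ; last by apply: asumD => //; exact: asumZ.
  rewrite /ser; congr csum; apply/funext => g; congr (_ * _); rewrite /frq.
  transitivity (- (iunit R * iunit R) * (rc (qf R false g) + iunit R * rc (qf R true g)) * s g); last by ring.
  by rewrite i2 opprK mul1r.
have asp := asum_part (oth i) ax; have ro := reg_opA rx; have ao := reg_asum ro.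
have okV : okc (fun p => ser (Vh i) p * ser (part (oth i) x) p).
  apply: (okcB_bd (M := rsum (fun g => modulus (Vh i g)))); first exact: ser_mC (Vh_sum i).
    by move=> p; exact: ser_bd (Vh_sum i).
  exact: okc_ser.
have okF : okc F := okcD (okc_ser afr) (okcZ al okV).
have pF : qper (yc i) F.
  apply: qperD.
    by apply: qper_ser => // g nz; apply: (@part_supp _ i x); apply: contraNneq nz => e; rewrite /s e mulr0.
  apply: qperZ; apply: (qper_eq (y := vc i + yc (oth i)) (k := if i == 0 then -1 else 1)).
    by case: (i) => [[|[|]]] // hi.
  by apply: qperM; apply: qper_ser; [exact: Vh_sum | exact: Vh_supp | | exact: part_supp].
have aeS : {ae mu, forall p, F p = ser (part i (opA0 x)) p}.
  apply: (ae_same (y := yc i)) => //; [exact: okc_ser (asum_part i ao) | exact: qper_ser (asum_part i ao) (@part_supp _ _ _) |].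
  move=> g k gk; have cg : cls g = (yc i)%:~R by apply/clsP; exists k.
  rewrite (coef_ser (asum_part i ao) (@part_supp _ _ _) (ex_intro _ k gk)).
  have Jg : J g by move/eqP: cg; rewrite ciP => /andP[].
  rewrite /F (coefD _ (okc_ser afr) (okcZ al okV)) (coefZ _ _ okV) /part cg eqxx /opA Jg addr0.
  congr (_ + _ * _).
    rewrite (coef_ser (y := yc i) afr); [by rewrite /s /part cg eqxx | | by exists k].
    by move=> g' nz; apply: (@part_supp _ i x); apply: contraNneq nz => e; rewrite /s e mulr0.
  have -> : (fun p => ser (Vh i) p * ser (part (oth i) x) p) = fun p => ser (part (oth i) x) p * ser (Vh i) p by apply/funext => p; rewrite mulrC.
  have oo := okc_ser asp; rewrite (coef_mul_ser _ (Vh_sum i) oo).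
  apply: conv_V => //; first exact: coef_bd.
  move=> h ch'; rewrite (coef_ser asp (@part_supp _ _ _)); last exact: cls_k.
  by rewrite /part ch' eqxx.
by apply: ae_imp2 aeF aeS => p -> ->; rewrite uf_sp.
Qed.

Lemma inner_plint u v : inner u v = plint (fun p => ind cel p * \sum_i uf u i p * conjc (uf v i p)).
Proof. by rewrite /inner cintegralE. Qed.

Lemma inner_ae u u' v v' : (forall i, mC (uf u i)) -> (forall i, mC (uf u' i)) -> (forall i, mC (uf v i)) -> (forall i, mC (uf v' i)) ->
  {ae mu, forall p, cel p -> forall i, uf u i p = uf u' i p} -> {ae mu, forall p, cel p -> forall i, uf v i p = uf v' i p} ->
  inner u v = inner u' v'.
Proof.
move=> m1 m2 m3 m4 e1 e2; have mm (a b : spinor) : (forall i, mC (uf a i)) -> (forall i, mC (uf b i)) ->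
   mC (fun p => ind cel p * \sum_i uf a i p * conjc (uf b i p)).
  by move=> ma mb; apply: mCM; [exact: mC_cel | apply: mC_sum => i; apply: mCM => //; exact: mC_conj].
rewrite !inner_plint; apply: plint_ae; [exact: mm | exact: mm |].
apply: ae_imp2 e1 e2 => p h1 h2; have [c|c] := pselect (cel p); last by rewrite ind0 // !mul0r.
by congr (_ * _); apply: eq_bigr => i _; rewrite h1 // h2.
Qed.

Lemma conj_ser s p : asum s -> conjc (ser s p) = ser (fun g => conjc (s (- g))) p.
Proof.
move=> hs; rewrite /ser -csum_conj; last exact: asum_ch.
rewrite -(csum_bij (h := fun g => - g) (hinv := fun g => - g)); try exact: opprK.
  by congr csum; apply/funext => g; rewrite conjcM ch_conj opprK.
by have := asum_conj (asum_ch p hs); congr asum; apply/funext.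
Qed.

(** Parseval with one absolutely summable side: the inner product is the coefficient at frequency 0
    of a product with a series, hence a convolution. *)
Lemma inner_ser u s : (forall i, okc (uf u i)) -> asum s -> supp J s ->
  inner u (sp s) = rc (area R) * csum (fun g => hat u g * conjc (s g)) /\
  ok (fun p => ind cel p * \sum_i uf u i p * conjc (uf (sp s) i p)).
Proof.
move=> ou hs ss.
pose s' i g := conjc (part i s (- g)).
have hs' i : asum (s' i).
  by have := asum_conj (asum_part i hs); move=> /(asum_inj (h := fun g : G => - g) (@oppr_inj _)).
have oi i : okc (fun p => uf u i p * ser (s' i) p).
  have := okcB_bd (ser_mC (hs' i)) (fun p => ser_bd p (hs' i)) (ou i).
  by congr okc; apply/funext => p; rewrite mulrC.
have E : (fun p => ind cel p * \sum_i uf u i p * conjc (uf (sp s) i p)) = fun p => \sum_i ind cel p * (uf u i p * ser (s' i) p).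
  by apply/funext => p; rewrite mulr_sumr; apply: eq_bigr => i _; rewrite uf_sp conj_ser //; exact: asum_part.
have [k1 k2] := plint_sum (index_enum 'I_2) (fun i => (oi i).2).
rewrite inner_plint E; split=> //; rewrite k2.
have ai i : asum (fun g => coef (uf u i) g * conjc (part i s g)).
  have [M hM] := coef_bd (ou i); exact: asum_bdd hM (asum_conj (asum_part i hs)).
have [c1 _] := csum_sum (index_enum 'I_2) ai.
have -> : (fun g => hat u g * conjc (s g)) = fun g => \sum_i coef (uf u i) g * conjc (part i s g).
  apply/funext => g; have [Jg|nJ] := boolP (J g); last first.
    rewrite hat_supp // mul0r big1 // => i _; rewrite /part; case: ifP => _; by rewrite ?ss // conjc0 mulr0.
  have cg := J_ci Jg; rewrite (bigD1 (ci g)) //= big1 ?addr0.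
    by rewrite (hat_i _ cg) /part cg eqxx.
  move=> i ne; rewrite /part ciP Jg /= eq_sym (negbTE ne) conjc0 mulr0 //.
rewrite c1 mulr_sumr; apply: eq_bigr => i _.
have e := coef_mul_ser 0 (hs' i) (ou i).
transitivity (rc (area R) * coef (fun p => uf u i p * ser (s' i) p) 0).
  by rewrite -coefE; congr plint; apply/funext => p; rewrite oppr0 ch0 mulr1.
rewrite e; congr (_ * _); rewrite -(csum_bij (h := fun g => - g) (hinv := fun g => - g)); try exact: opprK.
  by congr csum; apply/funext => g; rewrite /s' sub0r opprK mulrC.
have [M hM] := coef_bd (ou i); have := asum_bdd (fun g => hM (0 - g)) (hs' i).
by congr asum; apply/funext => g; exact: mulrC.
Qed.

Lemma inner_conj u s : (forall i, okc (uf u i)) -> asum s -> supp J s -> inner (sp s) u = conjc (inner u (sp s)).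
Proof.
move=> ou hs ss; have [_ o] := inner_ser ou hs ss; rewrite inner_plint inner_plint -plint_conj //; congr plint.
apply/funext => p; rewrite conjcM conj_ind conjc_sum; congr (_ * _); apply: eq_bigr => i _.
by rewrite conjcM conjcK mulrC.
Qed.
End SpinorOperator.

Section Eigenspaces.
Variable R : realType.
Local Notation C := R[i].
Local Notation mu := (@plane R).
Local Notation G := (int * int)%type.
Local Notation fr := (@frq R).
Local Notation spinor := (C -> 'cV[C]_2).
Implicit Types (p q : R * R) (g h : G) (s x y : G -> C) (u v w : spinor) (i : 'I_2).
Variable U : C -> C.
Hypothesis smoothU : smoothC U.
Hypothesis periodicU : forall g : C, Lambda g -> forall z : C, U (z + g) = expi (cdot g (Kpt R)) * U z.
Variable al : C.
Local Notation a_hat := (a_hat U).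
Local Notation A := (opA J fr a_hat al).
Let aas : asum a_hat := aa_sum smoothU periodicU.
Local Notation Dp := (Dop U al).

Definition delta g0 g : C := if g == g0 then 1 else 0.
Lemma reg_delta g0 : J g0 -> reg (delta g0).
Proof.
move=> J0; apply: (@reg_fin R (delta g0) [fset g0]%fset) => g; last by rewrite inE /delta => /negbTE ->.
by rewrite /delta; have [->|//] := eqVneq g g0; rewrite J0.
Qed.

Lemma csum_delta g0 s : csum (fun g => s g * delta g0 g) = s g0.
Proof.
rewrite (@csum1 _ _ _ g0); first by rewrite /delta eqxx mulr1.
by move=> g /negbTE h; rewrite /delta h mulr0.
Qed.

(** The set from which [adjoint] chooses. *)
Definition adj_set v : set spinor := [set w | L20 w /\ forall u, H10 u -> inner (Dp u) v = inner u w].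
Lemma L20_okc w : L20 w -> forall i, okc (uf w i).
Proof. by move=> [l2w _] i; exact: L2loc_okc (l2w i). Qed.

Lemma Dp_sp_all x : reg x -> {ae mu, forall p, forall i, uf (Dp (sp x)) i p = uf (sp (A 0 x)) i p}.
Proof.
move=> rx; apply: ae_imp2 (Dop_sp smoothU periodicU al 0 rx) (Dop_sp smoothU periodicU al 1 rx) => p e0 e1 i.
have [->|i1] := eqVneq i 0; first exact: e0.
by have -> : i = 1 by apply: val_inj; case: i i1 => [[|[|]]].
Qed.

Lemma mC_sp x i : asum x -> mC (uf (sp x) i).
Proof. by move=> ax; rewrite uf_spE; apply: ser_mC; exact: asum_part. Qed.

(** Testing the defining identity with the spinor of a single frequency g isolates the coefficient
    of w at g. *)
Lemma adj_hat v w g : H10 v -> adj_set v w -> J g -> hat w g = conjc (A 0 (fun t => conjc (hat v t)) g).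
Proof.
move=> hv [lw hw] Jg; have rd := reg_delta Jg; have [sd _] := rd; have ad := reg_asum rd.
have ro := reg_opA smoothU periodicU al rd; have [so _] := ro; have ao := reg_asum ro.
have hsp := H10_sp rd.
have e1 : inner (Dp (sp (delta g))) v = inner (sp (A 0 (delta g))) v.
  have okD := (hat_Dop smoothU periodicU al hsp).1.
  apply: inner_ae => [i|i|i|i||].
  - by case: (okD i).
  - exact: mC_sp.
  - by case: (H10_okc hv i).
  - by case: (H10_okc hv i).
  - by apply: ae_imp (Dp_sp_all rd) => p e _ i.
  - exact: aeW.
have e2 := hw _ hsp; rewrite e1 (inner_conj (H10_okc hv) ao so) (inner_conj (L20_okc lw) ad sd) in e2.
have {}e2 := can_inj (@conjcK _) e2; rewrite (inner_ser (H10_okc hv) ao so).1 (inner_ser (L20_okc lw) ad sd).1 in e2.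
have {}e2 := mulfI (rc_area R) e2.
have E : (fun t => hat w t * conjc (delta g t)) = fun t => hat w t * delta g t.
  by apply/funext => t; rewrite /delta; case: ifP => _; rewrite ?conjc0 // conjc1.
rewrite E csum_delta in e2; rewrite -e2.
have -> : (fun t => hat v t * conjc (A 0 (delta g) t)) = fun t => conjc (conjc (hat v t) * A 0 (delta g) t).
  by apply/funext => t; rewrite conjcM conjcK.
have hh := h1_conj (h1_hat hv); have hd := reg_h1 rd.
have as1 : asum (fun t => conjc (hat v t) * A 0 (delta g) t).
  by apply: l2_mul; [case: hh | exact: reg_l2 ro].
by rewrite csum_conj // -(opA_sym al (@aa_even R U) aas 0 hh hd) csum_delta.
Qed.

Lemma ae_sp v x : L20 v -> reg x -> (forall g, J g -> hat v g = x g) -> {ae mu, forall p, forall i, uf v i p = uf (sp x) i p}.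
Proof.
move=> lv rx e; have ax := reg_asum rx; have lq := L20_qper lv.
have key i : {ae mu, forall p, uf v i p = uf (sp x) i p}.
  rewrite uf_spE; apply: (ae_same (y := yc i)); [exact: L20_okc | exact: okc_ser (asum_part i ax) | by case: (lq i) | exact: qper_ser (asum_part i ax) (@part_supp _ i x) |].
  move=> g k gk; have cg : cls g = (yc i)%:~R by apply/clsP; exists k.
  rewrite (coef_ser (asum_part i ax) (@part_supp _ i x) (ex_intro _ k gk)) /part cg eqxx.
  by rewrite -(hat_i v cg); apply: e; move/eqP: cg; rewrite ciP => /andP[].
apply: ae_imp2 (key 0) (key 1) => p e0 e1 i.
have [->|i1] := eqVneq i 0; first exact: e0.
by have -> : i = 1 by apply: val_inj; case: i i1 => [[|[|]]].
Qed.

Lemma H10_L20 u : H10 u -> L20 u. Proof. by case. Qed.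

Lemma adj_exists v x : L20 v -> reg x -> (forall g, J g -> hat v g = x g) ->
  adj_set v (sp (fun g => conjc (A 0 (fun t => conjc (x t)) g))).
Proof.
move=> lv rx e; have rc_ := reg_conj rx; have ro := reg_opA smoothU periodicU al rc_; have rw := reg_conj ro.
have [sx _] := rx; have [sw _] := rw; have ax := reg_asum rx; have aw := reg_asum rw.
split=> [|u hu]; first exact: H10_L20 (H10_sp rw).
have [okD hD] := hat_Dop smoothU periodicU al hu.
have -> : inner (Dp u) v = inner (Dp u) (sp x).
  apply: inner_ae => [i|i|i|i||]; [by case: (okD i) | by case: (okD i) | by case: (L20_okc lv i) | exact: mC_sp | exact: aeW |].
  by apply: ae_imp (ae_sp lv rx e) => p h _ i.
rewrite (inner_ser okD ax sx).1 (inner_ser (H10_okc hu) aw sw).1; congr (_ * _).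
transitivity (csum (fun g => A 0 (hat u) g * conjc (x g))); first by congr csum; apply/funext => g; rewrite hD.
rewrite (opA_sym al (@aa_even R U) aas 0 (h1_hat hu) (reg_h1 rc_)); congr csum; apply/funext => g; by rewrite conjcK.
Qed.

Lemma adjoint_mem v : adj_set v !=set0 -> adj_set v (adjoint Dp v).
Proof. by move=> [w hw]; rewrite /adjoint; case: xgetP => [w' _ //|/(_ w)]. Qed.

Lemma adjoint_none v : ~ (adj_set v !=set0) -> adjoint Dp v = fun=> 0.
Proof. by move=> h; rewrite /adjoint; case: xgetP => [w' _ hw|//]; exfalso; apply: h; exists w'. Qed.

Definition up (w : C -> 'cV[C]_(2 + 2)) : spinor := fun z => usubmx (w z).
Definition dn (w : C -> 'cV[C]_(2 + 2)) : spinor := fun z => dsubmx (w z).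
Lemma col_rows (a b : 'cV[C]_2) (W : 'cV[C]_(2 + 2)) (c d e : C) :
  col_mx (a + c *: dsubmx W) (b + d *: usubmx W) = e *: W <->
  (forall i, a i 0 + c * dsubmx W i 0 = e * usubmx W i 0) /\ (forall i, b i 0 + d * usubmx W i 0 = e * dsubmx W i 0).
Proof.
split=> [h|[e1 e2]].
  have eu := congr1 usubmx h; have ed := congr1 dsubmx h; rewrite col_mxKu in eu; rewrite col_mxKd in ed.
  split=> i; first by move/matrixP: eu => /(_ i 0); rewrite !mxE.
  by move/matrixP: ed => /(_ i 0); rewrite !mxE.
rewrite -[RHS]vsubmxK; congr col_mx; apply/matrixP => i j; rewrite (ord1 j).
  by have := e1 i; rewrite !mxE.
by have := e2 i; rewrite !mxE.
Qed.

Lemma hop_rows k l (w : C -> 'cV[C]_(2 + 2)) z : Hop U al k w z = rc l *: w z <->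
  (forall i, adjoint Dp (dn w) z i 0 + conjc k * dn w z i 0 = rc l * up w z i 0) /\
  (forall i, Dp (up w) z i 0 + k * up w z i 0 = rc l * dn w z i 0).
Proof. exact: col_rows. Qed.

Lemma A_shift k x g : supp J x -> A k x g = A 0 x g + k * x g.
Proof. by move=> sx; rewrite -(opA_shift fr a_hat al 0 k g sx) add0r. Qed.

Lemma coef_comb (F H K : R * R -> C) (a b : C) g : okc F -> okc H -> okc K ->
  {ae mu, forall p, F p + a * H p = b * K p} -> coef F g + a * coef H g = b * coef K g.
Proof.
move=> oF oH oK ae; have oH' := okcZ a oH; have oK' := okcZ b oK.
have e1 := coefD g oF oH'; have e2 := coefZ a g oH; have e3 := coefZ b g oK.
rewrite -e2 -e1 -e3; apply: coef_ae; [by case: (okcD oF oH') | by case: oK' |].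
by apply: ae_imp ae => p e _.
Qed.

(** The lower row is compared coefficient by coefficient. The upper row needs a genuine adjoint, and
    k <> 0 excludes its default value. *)
Lemma eig_eigp k (l : R) (w : C -> 'cV[C]_(2 + 2)) : k != 0 -> eigenspaceH U al k l w ->
  eigenpair J fr a_hat al k l (hat (up w)) (hat (dn w)).
Proof.
move=> k0 [[hu hv] ae]; set x := hat (up w); set y := hat (dn w).
have hu' : H10 (up w) := hu; have hv' : H10 (dn w) := hv.
have hx := h1_hat hu'; have hy := h1_hat hv'; have sx : supp J x := @hat_supp R _; have sy : supp J y := @hat_supp R _.
have ae' : {ae mu, forall p, (forall i, uf (adjoint Dp (dn w)) i p + conjc k * uf (dn w) i p = rc l * uf (up w) i p) /\
    (forall i, uf (Dp (up w)) i p + k * uf (up w) i p = rc l * uf (dn w) i p)}.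
  by apply: ae_imp ae => p /hop_rows.
have [okD hD] := hat_Dop smoothU periodicU al hu'.
have bot g : A k x g = rc l * y g.
  have [Jg|nJ] := boolP (J g); last by rewrite (opA_supp fr a_hat al k _ nJ) sy // mulr0.
  have cg := J_ci Jg; rewrite A_shift // -hD !(hat_i _ cg) /x /y !(hat_i _ cg).
  by apply: coef_comb (okD _) (H10_okc hu' _) (H10_okc hv' _) _; apply: ae_imp ae' => p [_].
split=> //.
have [ne|em] := pselect (adj_set (dn w) !=set0).
  have mw := adjoint_mem ne; move=> g.
  have [Jg|nJ] := boolP (J g); last by rewrite (opA_supp fr a_hat al k _ nJ) sx // conjc0 mulr0.
  have sy' : supp J (fun t => conjc (y t)) by move=> t /sy ->; rewrite conjc0.
  have cg := J_ci Jg; have hw := adj_hat hv' mw Jg.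
  have e : hat (adjoint Dp (dn w)) g + conjc k * y g = rc l * x g.
    rewrite /x /y !(hat_i _ cg); have [lw _] := mw.
    by apply: coef_comb (L20_okc lw _) (H10_okc hv' _) (H10_okc hu' _) _; apply: ae_imp ae' => p [+ _].
  rewrite A_shift //; apply: (can_inj (@conjcK _)); rewrite conjcD -hw conjcM conjcK e.
  by rewrite conjcM conjcK conjc_real.
(* If the default 0 were taken, the upper row would be conj k y = l x. Then y is shown to decay
   rapidly, so [adj_exists] provides an adjoint after all. *)
exfalso; have a0 := adjoint_none em.
have ey g : conjc k * y g = rc l * x g.
  have [Jg|nJ] := boolP (J g); last by rewrite sx // sy // !mulr0.
  have cg := J_ci Jg; rewrite /x /y !(hat_i _ cg).
  have h := @coef_comb (fun=> 0) (uf (dn w) (ci g)) (uf (up w) (ci g)) (conjc k) (rc l) g (okc_cst 0) (H10_okc hv' _) (H10_okc hu' _) _.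
  have c0 : coef (fun _ : R * R => 0 : C) g = 0.
    have -> : (fun _ : R * R => 0 : C) = fun p => 0 * (fun _ : R * R => 0 : C) p by apply/funext => p; rewrite mul0r.
    by rewrite coefZ ?mul0r //; exact: okc_cst.
  rewrite c0 add0r in h; apply: h; apply: ae_imp ae' => p [/(_ (ci g)) + _].
  by rewrite /uf a0 mxE.
have kb : conjc k != 0 by apply: contraNneq k0 => e; apply/eqP; rewrite -[k]conjcK e conjc0.
have ry : reg y.
  have [l0|l0] := eqVneq l 0.
    have y0 g : y g = 0 by apply: (mulfI kb); rewrite ey l0 mul0r mulr0.
    by apply: (@reg_fin R y fset0) => // g _; exact: y0.
  have l0' : rc l != 0 by rewrite eq_complex /= negb_and l0.
  have xE : x = fun g => (conjc k / rc l) * y g.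
    by apply/funext => g; apply: (mulfI l0'); rewrite -ey mulrA [rc l * _]mulrC divfK.
  (* For l <> 0, x is a multiple of y, and the lower row becomes an eigenvalue equation for y alone,
     to which the bootstrap applies. *)
  pose c0 := rc l / (conjc k / rc l).
  have Ay g : A k y g = c0 * y g.
    have h := bot g; rewrite xE (opAZ J fr al aas) in h; last by case: hy.
    have c1 : conjc k / rc l != 0 by rewrite mulf_neq0 // invr_eq0.
    by apply: (mulfI c1); rewrite h /c0 mulrA [_ / _ * (_ / _)]mulrC divfK.
  have ly : l2 y by case: hy.
  have hb g : modulus (A k y g) <= modulus c0 * modulus (y g) by rewrite Ay modM.
  have := regular (@frqD R) (aa_w smoothU periodicU) sy sy ly ly hb hb => hr.
  by split=> // n; case: (hr n).
apply: em; exists (sp (fun g => conjc (A 0 (fun t => conjc (y t)) g))).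
by apply: adj_exists => //; exact: H10_L20.
Qed.

Lemma sp_comb (X Y Z : G -> C) (a b : C) i p : asum X -> asum Y -> asum Z -> (forall g, X g + a * Y g = b * Z g) ->
  uf (sp X) i p + a * uf (sp Y) i p = b * uf (sp Z) i p.
Proof.
move=> hX hY hZ e; rewrite !uf_sp.
have pX := asum_part i hX; have pY := asum_part i hY; have pZ := asum_part i hZ.
rewrite -(serZ a p pY) -(serZ b p pZ) -serD //; last exact: asumZ.
rewrite /ser; congr csum; apply/funext => g; congr (_ * _); rewrite /part; case: ifP => _; first exact: e.
by rewrite !mulr0 addr0.
Qed.

Lemma sp_sum (I : Type) (r : seq I) (c : I -> C) (X : I -> G -> C) i p : (forall j, asum (X j)) ->
  uf (sp (fun g => \sum_(j <- r) c j * X j g)) i p = \sum_(j <- r) c j * uf (sp (X j)) i p.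
Proof.
move=> hX; rewrite uf_sp.
have hc j : asum (fun g => c j * part i (X j) g * ch g p).
  by apply: asum_ch; apply: asumZ; exact: asum_part.
have [e _] := csum_sum r hc.
transitivity (csum (fun g => \sum_(j <- r) c j * part i (X j) g * ch g p)).
  rewrite /ser; congr csum; apply/funext => g; rewrite -mulr_suml; congr (_ * _); rewrite /part.
  by case: ifP => // _; rewrite big1 // => j _; rewrite mulr0.
rewrite e; apply: eq_bigr => j _; rewrite uf_sp -(serZ (c j) p) //; exact: asum_part.
Qed.

Lemma eigp_reg k l x y : eigenpair J fr a_hat al k l x y -> reg x /\ reg y.
Proof.
move=> he; have h := regular_eigp (@frqD R) (aa_w smoothU periodicU) he.
by case: he => -[sx _ _] [sy _ _] _ _; split; split=> // n; case: (h n).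
Qed.

Lemma eigp_eig k l x y : eigenpair J fr a_hat al k l x y -> eigenspaceH U al k l (fun z => col_mx (sp x z) (sp y z)).
Proof.
move=> he; have [rx ry] := eigp_reg he; have [_ _ e1 e2] := he; have [sx _] := rx; have [sy _] := ry.
have hx := H10_sp rx; have hy := H10_sp ry; have ax := reg_asum rx; have ay := reg_asum ry.
set W := fun z => _; have uW : up W = sp x by apply/funext => z; rewrite /up /W col_mxKu.
have dW : dn W = sp y by apply/funext => z; rewrite /dn /W col_mxKd.
split; first by split; [rewrite -[X in H10 X]/(up W) uW | rewrite -[X in H10 X]/(dn W) dW].
have hsy := hat_sp ay sy.
have ne : adj_set (sp y) !=set0.
  exists (sp (fun g => conjc (A 0 (fun t => conjc (y t)) g))); apply: adj_exists (H10_L20 hy) ry _ => g _; by rewrite hsy.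
have mw := adjoint_mem ne; have [lw _] := mw; set w0 := adjoint Dp (sp y) in mw lw *.
have rc_ := reg_conj ry; have ro := reg_opA smoothU periodicU al rc_; have rX := reg_conj ro.
set X := fun g => conjc _ in rX; have aX := reg_asum rX.
have hX g : J g -> hat w0 g = X g by move=> Jg; rewrite (adj_hat hy mw Jg) /X hsy.
have aeX := ae_sp lw rX hX; have rA := reg_opA smoothU periodicU al rx; have aA := reg_asum rA.
have c1 g : X g + conjc k * y g = rc l * x g.
  have scy : supp J (fun t => conjc (y t)) by case: rc_.
  have := e2 g; rewrite A_shift // => /(congr1 (@conjc R)).
  by rewrite conjcD !conjcM !conjcK conjc_real.
have c2 g : A 0 x g + k * x g = rc l * y g by rewrite -A_shift.
apply: ae_imp2 aeX (Dp_sp_all rx) => p h1 h2; apply/hop_rows; rewrite uW dW; split=> i.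
  rewrite -[adjoint Dp (sp y) (to_C p) i 0]/(uf w0 i p) h1; exact: sp_comb aX ay ax c1.
rewrite -[Dp (sp x) (to_C p) i 0]/(uf (Dp (sp x)) i p) h2; exact: sp_comb aA ax ay c2.
Qed.

Lemma hat_ae0 u g : (forall i, mC (uf u i)) -> {ae mu, forall p, forall i, uf u i p = 0} -> hat u g = 0.
Proof.
move=> mu_ ae; have [Jg|nJ] := boolP (J g); last exact: hat_supp.
have -> : hat u g = coef (uf u (ci g)) g by rewrite /hat Jg.
have -> : coef (uf u (ci g)) g = coef (fun=> 0) g.
  by apply: coef_ae; [exact: mu_ | exact: mC_cst | apply: ae_imp ae => p h _; exact: h].
have -> : (fun _ : R * R => 0 : C) = fun p => 0 * (fun _ : R * R => 0 : C) p by apply/funext => p; rewrite mul0r.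
by rewrite coefZ ?mul0r //; exact: okc_cst.
Qed.
End Eigenspaces.

(** * Band labellings and the first band *)

Section Bands.
Variable R : realType.
Local Notation C := R[i].
Local Notation mu := (@plane R).
Local Notation G := (int * int)%type.
Local Notation fr := (@frq R).
Local Notation spinor4 := (C -> 'cV[C]_(2 + 2)).
Implicit Types (p q : R * R) (g h : G) (x y : G -> C).
Variable U : C -> C.
Hypothesis smoothU : smoothC U.
Hypothesis periodicU : forall g : C, Lambda g -> forall z : C, U (z + g) = expi (cdot g (Kpt R)) * U z.
Variable al : C.
Local Notation a_hat := (a_hat U).
Local Notation A := (opA J fr a_hat al).
Let aas : asum a_hat := aa_sum smoothU periodicU.
Let aae : forall g, a_hat (- g) = a_hat g := @aa_even R U.

Lemma mem_fin (r : seq int) (P : set int) : (forall j, P j -> j \in r) -> exists js : seq int,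
  [/\ uniq js, forall j, j \in js <-> P j & (P #= `I_(size js))%card].
Proof.
move=> h; have fP : finite_set P.
  by apply: (@sub_finite_set _ _ [set` r]) => [j /h //|]; apply/finite_seqP; exists r.
have [X e] := finite_fsetP.1 fP; exists (enum_fset X); split; first exact: fset_uniq.
  by move=> j; rewrite e.
by rewrite e; apply/card_eq_fsetP.
Qed.

Lemma spinor4E (w : spinor4) (n : nat) (e : 'I_n -> spinor4) (c : 'I_n -> C) z :
  w z = \sum_i c i *: e i z <-> (forall r, up w z r 0 = \sum_i c i * up (e i) z r 0) /\ (forall r, dn w z r 0 = \sum_i c i * dn (e i) z r 0).
Proof.
split=> [h|[h1 h2]].
  split=> r; rewrite /up /dn h mxE summxE; apply: eq_bigr => j _; by rewrite !mxE.
apply/matrixP => r j; rewrite (ord1 j) summxE -(fintype.splitK r); case: (fintype.split r) => r' /=.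
  have := h1 r'; rewrite /up mxE => ->; apply: eq_bigr => t _; by rewrite !mxE.
have := h2 r'; rewrite /dn mxE => ->; apply: eq_bigr => t _; by rewrite !mxE.
Qed.

Section Labelling.
Variables (k : C) (Us : nat -> G -> C) (ss : nat -> R).
Hypothesis k0 : k != 0.
Hypothesis tb : takagi_basis J fr a_hat al k Us ss.
Local Notation wX := (wx Us).
Local Notation wY := (wy Us).
Lemma eigp_wj (j : int) : j != 0 -> eigenpair J fr a_hat al k (band_label ss j) (wX j) (wY j).
Proof. by move=> h; exact: (eigp_w aas tb h). Qed.

Lemma reg_w (j : int) : reg (wX j) /\ reg (wY j).
Proof.
have [->|j0] := eqVneq j 0; last exact: (eigp_reg smoothU periodicU (eigp_wj j0)).
have h1 : (1 : int) != 0 by [].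
have [r1 _] := eigp_reg smoothU periodicU (eigp_wj h1); split; first exact: r1.
have rC := reg_conj r1; have [sC wC] := rC; split=> [g nJ|n].
  by rewrite /wy (sC g nJ) mulr0.
by apply: (wl2_le (v := fun g => conjc (wX 1 g))) (wC n) => g; rewrite /wy /bsgn ltxx mulN1r modN.
Qed.

Definition eb (js : seq int) (i : 'I_(size js)) : spinor4 := fun z => col_mx (sp (wX (nth 0 js i)) z) (sp (wY (nth 0 js i)) z).
Lemma up_eb js i : up (@eb js i) = sp (wX (nth 0 js i)).
Proof. by apply/funext => z; rewrite /up /eb col_mxKu. Qed.

Lemma dn_eb js i : dn (@eb js i) = sp (wY (nth 0 js i)).
Proof. by apply/funext => z; rewrite /dn /eb col_mxKd. Qed.

(** Independence comes from the orthogonality relations of [wpair_w], and spanning from [eigp_span]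
    on the coefficients. *)
Lemma blab_basis (l : R) (js : seq int) : uniq js -> (forall j, j \in js <-> j != 0 /\ band_label ss j = l) ->
  eigenbasis U al k l (@eb js).
Proof.
move=> ujs hjs; set n := size js.
have jn0 (i : 'I_n) : nth 0 js i != 0 /\ band_label ss (nth 0 js i) = l by apply/hjs; rewrite mem_nth.
have aX (i : 'I_n) : asum (wX (nth 0 js i)) by apply: reg_asum; case: (reg_w (nth 0 js i)).
have aY (i : 'I_n) : asum (wY (nth 0 js i)) by apply: reg_asum; case: (reg_w (nth 0 js i)).
split=> [i|c ae i0|w hw].
- have [j0 <-] := jn0 i; exact: (eigp_eig smoothU periodicU (eigp_wj j0)).
- pose X g := \sum_(i < n) c i * wX (nth 0 js i) g; pose Y g := \sum_(i < n) c i * wY (nth 0 js i) g.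
  have sumr (Z : int -> G -> C) : (forall j, reg (Z j)) -> asum (fun g => \sum_(i < n) c i * Z (nth 0 js i) g) /\ supp J (fun g => \sum_(i < n) c i * Z (nth 0 js i) g).
    move=> hZ; split.
      have := csum_sum (index_enum 'I_n) (F := fun i g => c i * Z (nth 0 js i) g) _ => -[i|_ //].
      by apply: asumZ; exact: reg_asum.
    by move=> g nJ; rewrite big1 // => i _; have [sZ _] := hZ (nth 0 js i); rewrite sZ // mulr0.
  have [a1 s1] : asum X /\ supp J X by apply: sumr => j; case: (reg_w j).
  have [a2 s2] : asum Y /\ supp J Y by apply: sumr => j; case: (reg_w j).
  have ae' : {ae mu, forall p, (forall r, uf (sp X) r p = 0) /\ (forall r, uf (sp Y) r p = 0)}.
    apply: ae_imp ae => p /esym e.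
    have [h1 h2] := (spinor4E (fun=> 0) (@eb js) c (to_C p)).1 e.
    split=> r.
      rewrite (sp_sum (index_enum 'I_n) c (X := fun i => wX (nth 0 js i))) //.
      transitivity (\sum_i c i * up (@eb js i) (to_C p) r 0); last by rewrite -h1 /up linear0 mxE.
      by apply: eq_bigr => i _; rewrite up_eb.
    rewrite (sp_sum (index_enum 'I_n) c (X := fun i => wY (nth 0 js i))) //.
    transitivity (\sum_i c i * dn (@eb js i) (to_C p) r 0); last by rewrite -h2 /dn linear0 mxE.
    by apply: eq_bigr => i _; rewrite dn_eb.
  have X0 g : X g = 0.
    rewrite -(hat_sp a1 s1); apply: hat_ae0 => [r|]; first exact: mC_sp.
    by apply: ae_imp ae' => p [].
  have Y0 g : Y g = 0.
    rewrite -(hat_sp a2 s2); apply: hat_ae0 => [r|]; first exact: mC_sp.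
    by apply: ae_imp ae' => p [].
  set j0 := nth 0 js i0.
  have lX (i : 'I_n) : l2 (wX (nth 0 js i)) by apply: reg_l2; case: (reg_w (nth 0 js i)).
  have lY (i : 'I_n) : l2 (wY (nth 0 js i)) by apply: reg_l2; case: (reg_w (nth 0 js i)).
  have [_ e1] := ip_suml (index_enum 'I_n) c lX (lX i0).
  have [_ e2] := ip_suml (index_enum 'I_n) c lY (lY i0).
  have z1 : ip X (wX j0) = 0 by rewrite /ip csum0 // => g; rewrite X0 mul0r.
  have z2 : ip Y (wY j0) = 0 by rewrite /ip csum0 // => g; rewrite Y0 mul0r.
  rewrite -/X -/j0 z1 in e1; rewrite -/Y -/j0 z2 in e2.
  have : \sum_(i < n) c i * wpair Us (wX (nth 0 js i)) (wY (nth 0 js i)) j0 = 0.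
    transitivity (\sum_(i < n) c i * ip (wX (nth 0 js i)) (wX j0) + \sum_(i < n) c i * ip (wY (nth 0 js i)) (wY j0)).
      by rewrite -big_split /=; apply: eq_bigr => i _; rewrite /wpair mulrDr.
    by rewrite -e1 -e2 addr0.
  rewrite (bigD1 i0) //= big1 ?addr0.
    have [h _] := jn0 i0; rewrite (wpair_w tb h h) eqxx => /eqP; rewrite mulf_eq0 pnatr_eq0 orbF => /eqP //.
  move=> i ne; have [h1 _] := jn0 i; have [h2 _] := jn0 i0; rewrite (wpair_w tb h1 h2).
  have ne' : (i == i0 :> nat) = false by apply/negbTE.
  by rewrite nth_uniq // ne' mulr0.
have he := eig_eigp smoothU periodicU k0 hw; have [rx ry] := eigp_reg smoothU periodicU he.
have [hx hy] := eigp_span (@frq_coer R) aae aas tb he ujs hjs.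
have [[hu hv] _] := hw.
have a1 := ae_sp (H10_L20 (hu : H10 (up w))) rx (fun g _ => erefl).
have a2 := ae_sp (H10_L20 (hv : H10 (dn w))) ry (fun g _ => erefl).
pose cc (i : 'I_n) := wpair Us (hat (up w)) (hat (dn w)) (nth 0 js i) / 2.
have ex : hat (up w) = fun g => \sum_(i < n) cc i * wX (nth 0 js i) g.
  by apply/funext => g; rewrite {1}hx (big_nth 0) big_mkord.
have ey : hat (dn w) = fun g => \sum_(i < n) cc i * wY (nth 0 js i) g.
  by apply/funext => g; rewrite {1}hy (big_nth 0) big_mkord.
clearbody cc.
exists cc; apply: ae_imp2 a1 a2 => p e1 e2; apply/spinor4E; split=> r.
  rewrite -[LHS]/(uf (up w) r p) e1 ex (sp_sum (index_enum 'I_n) _ (X := fun i => wX (nth 0 js i))) //.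
  by apply: eq_bigr => i _; rewrite up_eb.
rewrite -[LHS]/(uf (dn w) r p) e2 ey (sp_sum (index_enum 'I_n) _ (X := fun i => wY (nth 0 js i))) //.
by apply: eq_bigr => i _; rewrite dn_eb.
Qed.

Lemma s_ge0 n : 0 <= ss n. Proof. exact: tb_s0 tb n. Qed.

Lemma blabN (j : int) : band_label ss (- j) = - band_label ss j.
Proof.
rewrite /band_label oppr_eq0; case: eqP => [_|j0]; first by rewrite oppr0.
rewrite oppr_gt0 /bidx abszN; case: (ltgtP j 0) j0 => // _ _; by rewrite ?opprK.
Qed.

Lemma blab_mono (i j : int) : i != 0 -> j != 0 -> i <= j -> band_label ss i <= band_label ss j.
Proof.
move=> i0 j0 ij; rewrite /band_label (negbTE i0) (negbTE j0).
have [ip|ni] := ltP 0 i.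
  have jp : 0 < j := lt_le_trans ip ij; rewrite jp; apply: (tb_mono tb).
  by move: ip jp ij; rewrite /bidx; case: (i) => // a; case: (j) => // b _ _; rewrite lez_nat /= => h; rewrite -!subn1 leq_sub2r.
have [jp|nj] := ltP 0 j; first by apply: le_trans (_ : 0 <= _); rewrite ?oppr_le0 s_ge0.
rewrite lerN2; apply: (tb_mono tb); move: i0 j0 ni nj ij; rewrite /bidx.
by case: (i) => [[|a]|a] //; case: (j) => [[|b]|b] // _ _ _ _; rewrite !NegzE lerN2 lez_nat.
Qed.

Lemma blab_fin (l : R) : exists r : seq int, forall j, j != 0 /\ band_label ss j = l -> j \in r.
Proof.
have [N hN] := tb_unbounded (@frq_coer R) aas tb `|l|.
exists ([seq Posz n | n <- iota 0 N.+1] ++ [seq Negz n | n <- iota 0 N.+1]) => j [j0 e].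
have lt : (bidx j < N)%N.
  rewrite ltnNge; apply/negP => h; have h1 := tb_mono tb h.
  have e' : `|l| = ss (bidx j).
    by rewrite -e /band_label (negbTE j0); case: ifP => _; rewrite ?normrN ger0_norm // s_ge0.
  by rewrite e' in hN; lra.
rewrite mem_cat; case: j {e} j0 lt => [[|n]|n] // _ lt; apply/orP; [left | right]; apply: map_f; rewrite mem_iota /=.
  by move: lt; rewrite /bidx /= add0n !ltnS.
by move: lt; rewrite /bidx /= add0n !ltnS; exact: ltnW.
Qed.

Lemma blab_labelling : band_labelling U al k (band_label ss).
Proof.
split; [exact: blab_mono | exact: blabN |] => l.
have [r hr] := blab_fin l; have [js [ujs hjs hc]] := @mem_fin r [set j | j != 0 /\ band_label ss j = l] hr.
exists (size js); last exact: hc.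
by exists (@eb js); apply: blab_basis.
Qed.
End Labelling.

(** The values of any labelling are exactly the eigenvalues. This compares the chosen labelling with
    the constructed one without a proof of uniqueness. *)
Lemma mult_pos (k : C) (E : int -> R) (l : R) : band_labelling U al k E ->
  (exists2 j : int, j != 0 & E j = l) <-> (exists w, eigenspaceH U al k l w /\ ~ ae_eqC w (fun=> 0)).
Proof.
move=> [_ _ /(_ l) [n [e [e1 e2 e3]] hc]].
case: n e e1 e2 e3 hc => [|n] e e1 e2 e3 hc.
  split=> [[j j0 ej]|[w [hw nw]]].
    have : [set j : int | j != 0 /\ E j = l] = set0 by apply/eqP; move: hc; rewrite II0 card_eq0.
    by move/seteqP => [/(_ j)] /= h _; case: h.
  exfalso; apply: nw; have [c hcw] := e3 w hw; apply: ae_imp hcw => p ->; by rewrite big_ord0.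
split=> _.
  exists (e ord0); split=> // z0.
  have aez : ae_eqC (fun z => \sum_(i < n.+1) (if i == ord0 then 1 else 0 : C) *: e i z) (fun=> 0).
    apply: ae_imp z0 => p e0; rewrite (bigD1 ord0) //= scale1r e0 big1 ?addr0 // => i /negbTE ->.
    by rewrite scale0r.
  have h : (if (ord0 : 'I_n.+1) == ord0 then 1 else 0) = 0 :> C := e2 (fun i => if i == ord0 then 1 else 0) aez ord0.
  by move: h; rewrite eqxx => /eqP; rewrite oner_eq0.
have : [set j : int | j != 0 /\ E j = l] !=set0.
  apply/set0P/negP => /eqP z; move: hc; rewrite z card_eq_sym card_eq0 => /eqP /seteqP [h _].
  by have := h 0%N; apply.
by move=> [j [j0 ej]]; exists j.
Qed.

Lemma bandsP (k : C) : (exists E, band_labelling U al k E) -> band_labelling U al k (bands U al k).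
Proof. by move=> [E hE]; rewrite /bands; case: xgetP => [E' _ //|/(_ E)]. Qed.

(** The vector (u, 0) is an eigenvector for 0, so every labelling takes the value 0, and
    monotonicity with oddness then forces it at label 1. No condition on k is imposed, as [magic]
    requires k = 0 as well. *)
Lemma E1_zero (k : C) u : h1 J fr u -> n2 u = 1 -> (forall g, A k u g = 0) -> E1 U al k = 0.
Proof.
move=> hu u1 Au; have he : eigenpair J fr a_hat al k 0 u (fun=> 0).
  split=> // [|g|g].
  - by have := h1Z 0 hu; congr h1; apply/funext => g; rewrite mul0r.
  - by rewrite Au mul0r.
  have := opAZ J fr al aas k 0 g (h1_l2 hu).
  rewrite !mul0r => e; rewrite -[RHS]e; congr opA; apply/funext => t; by rewrite mul0r conjc0.
have hW := eigp_eig smoothU periodicU he; set W := fun z => _ in hW.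
(* Without any labelling [bands] is the zero function, so the claim still holds. *)
have [ex|nex] := pselect (exists E, band_labelling U al k E); last first.
  by rewrite /E1 /bands; case: xgetP => [E _ hE|//]; exfalso; apply: nex; exists E.
have hb := bandsP ex; have [mono odd _] := hb.
have [j j0 ej] : exists2 j : int, j != 0 & bands U al k j = 0.
  apply/(mult_pos 0 hb); exists W; split=> // ae.
  have [ru _] := eigp_reg smoothU periodicU he; have [su _] := ru; have au := reg_asum ru.
  have u0 g : u g = 0.
    rewrite -(hat_sp au su); apply: hat_ae0 => [r|]; first exact: mC_sp.
    apply: ae_imp ae => p e r; have := congr1 (fun M : 'cV[C]_(2 + 2) => usubmx M r 0) e.
    by rewrite /W col_mxKu linear0 [RHS]mxE.
  move: u1; rewrite /n2 (_ : sq u = fun=> 0); last by apply/funext => g; rewrite /sq u0 mod0 expr0n.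
  by rewrite /rsum csum0 // => /eqP; rewrite eq_sym oner_eq0.
rewrite /E1; have b1 : 0 <= bands U al k 1.
  have := mono (-1) 1 isT isT isT; rewrite odd; lra.
apply/le_anti; rewrite b1 andbT; have [jp|jn] := ltP 0 j.
  by rewrite -ej; apply: mono => //.
have jn' : j <= -1 by move: j0 jn; case: (j) => [[|a]|a].
by have := mono j (-1) j0 isT jn'; rewrite odd ej; lra.
Qed.

Lemma E1_min (k : C) (s : R) (jn : nat -> G) : injective jn -> (forall n, J (jn n)) -> k != 0 ->
  is_min J fr a_hat al k s -> E1 U al k = s.
Proof.
move=> jnI jnJ k0 [s0 [[u tu] hs]].
have [Us [ss tb]] := takagi_basis_exists al (@frq_coer R) aae aas jnI jnJ k.
(* Each of the two singular values is a lower bound for the image norm of the other one's unit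
   vector. *)
have es : s = ss 0%N.
  have t0 := tb_tk tb 0; have [hU U1 ss0 AU] := t0; have [hu u1 _ Au] := tu.
  have n2s (t : R) v : takagi_vec J fr a_hat al k t v -> n2 (A k v) = t ^+ 2.
    move=> [hv v1 t0' Av]; have -> : A k v = fun g => rc t * conjc (v g) by apply/funext => g; exact: Av.
    rewrite n2Z; last by apply: l2_conj; exact: (h1_l2 hv).
    by rewrite n2_conj v1 mulr1 mod_rc real_normK ?num_real.
  have c1 := hs _ hU; rewrite U1 mulr1 (n2s _ _ t0) in c1.
  have [_ _ hm] := tb 0; have c2 : ss 0%N ^+ 2 * n2 u <= n2 (A k u) by apply: hm.
  rewrite u1 mulr1 (n2s _ _ tu) in c2.
  apply/eqP; rewrite -(eqrXn2 (n := 2)) //; apply/eqP/le_anti; by rewrite c1 c2.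
have hl := blab_labelling k0 tb; have hb := bandsP (ex_intro _ _ hl); have [mono odd _] := hb.
rewrite /E1 es; set E := bands U al k in hb mono odd *.
have b1 : 0 <= E 1 by have := mono (-1) 1 isT isT isT; rewrite odd; lra.
have bl1 : band_label ss 1 = ss 0%N by [].
have s00 := s_ge0 tb 0.
apply/le_anti/andP; split.
  (* Upper bound: ss 0 is an eigenvalue, hence some |E j| = ss 0, and E 1 is the least of these
     moduli. The lower bound exchanges the two labellings. *)
  have [w hw] : exists w, eigenspaceH U al k (ss 0%N) w /\ ~ ae_eqC w (fun=> 0).
    by apply/(mult_pos (ss 0%N) hl); exists 1.
  have [j j0 ej] := (mult_pos (ss 0%N) hb).2 (ex_intro _ w hw).
  have [jp|jn'] := ltP 0 j; first by rewrite -ej; apply: mono.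
  have jm : j <= -1 by move: j0 jn'; case: (j) => [[|a]|a].
  by have := mono j (-1) j0 isT jm; rewrite odd ej; lra.
have [w hw] : exists w, eigenspaceH U al k (E 1) w /\ ~ ae_eqC w (fun=> 0).
  by apply/(mult_pos (E 1) hb); exists 1.
have [j j0 ej] := (mult_pos (E 1) hl).2 (ex_intro _ w hw).
have sj := tb_mono tb (leq0n (bidx j)).
move: ej b1; rewrite /band_label (negbTE j0); case: ifP => _ <- //.
by have := s_ge0 tb (bidx j); lra.
Qed.
End Bands.

Lemma sqrtC_ex (R : realType) (z : R[i]) : exists w : R[i], w * w = z.
Proof. by exists (sqrtc z); rewrite -expr2 sqr_sqrtc. Qed.

(** * Protected states at K and the two conical points *)

Section Main.
Variable R : realType.
Local Notation C := R[i].
Local Notation G := (int * int)%type.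
Local Notation fr := (@frq R).
Variable U : C -> C.
Hypothesis smoothU : smoothC U.
Hypothesis periodicU : forall g : C, Lambda g -> forall z : C, U (z + g) = expi (cdot g (Kpt R)) * U z.
Hypothesis rotationU : forall z : C, U (omega R * z) = omega R * U z.
Variable al : C.
Local Notation a_hat := (a_hat U).
Local Notation A := (opA J fr a_hat al).
Local Notation K := (Kpt R).
Let aas : asum a_hat := aa_sum smoothU periodicU.
Let aae : forall g, a_hat (- g) = a_hat g := @aa_even R U.

(** The index whose frequency is K, which lets K be treated as a lattice shift. *)
Let kap : G := (1, -1).
Lemma frq_kap : frq R kap = K.
Proof.
have s0 := s3_gt0 R.
have e1 : fa R kap = 2 / 3 by rewrite /fa /kap /= rmorphN1; field.
have e2 : fb R kap = - (1 / 3) by rewrite /fb /kap /= rmorphN1; field.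
rewrite frqE /qf e1 e2; apply/eqP; rewrite eq_complex; apply/andP; split; apply/eqP.
  by change (2 * pi * (2 / 3) = 4 / 3 * pi :> R); field.
by change (2 * pi * (2 * - (1 / 3) + 2 / 3) / sqrt3 R = 0 :> R); field; rewrite gt_eqF.
Qed.

(** The rotation centred at - kap, so that fr g + K is multiplied by the conjugate of omega. *)
Let rho (g : G) : G := freq_rot (g + kap) - kap.
Let xi : C := conjc (omega R).
Lemma rho_fr g : fr (rho g) + K = xi * (fr g + K).
Proof. by rewrite -frq_kap -frqD subrK frq_R0 frqD. Qed.

Lemma rho_a g h : a_hat (rho g - rho h) = xi * a_hat (g - h).
Proof.
rewrite -(aa_rot smoothU periodicU rotationU); congr a_hat.
by rewrite /rho; case: g h => [m y] [m' y']; rewrite /freq_rot /=; congr (_, _) => /=; ring.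
Qed.

Lemma rho_inj : injective rho.
Proof. by move=> g h /addIr /(can_inj R0K) /addIr. Qed.

Lemma rho_J g : J (rho g) = J g.
Proof. by rewrite /J /rho clsD cls_R0 clsN clsD addrK. Qed.

(** This is - kap, the frequency - K at which 2 D_zbar + K vanishes; it has class 1 and hence lies
    in [J]. *)
Let g0 : G := (-1, 1).
Lemma rho_fix g : rho g = g <-> g = g0.
Proof.
split; last by move=> ->.
case: g => [m y]; rewrite /rho /freq_rot /= => -[] /= e1 e2.
have ey : y = 1 by lia.
by rewrite ey /g0; congr (_, _); lia.
Qed.

Lemma xi_neq1 : xi != 1.
Proof. by apply/negP => /eqP /(congr1 (@complex.Im R)); rewrite /xi omegaE /=; have := s3_gt0 R => h h2; lra. Qed.

Lemma xi_mod : modulus xi = 1.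
Proof. by rewrite mod_conj mod_expi. Qed.

Let jn (n : nat) : G := (Posz n, 1).
Lemma jn_inj : injective jn.
Proof. by move=> i j [] . Qed.

Lemma jnJ n : J (jn n). Proof. by []. Qed.

Lemma frq_half (g : G) : (g.1 != 0) || (g.2 != 0) -> 1 / 2 <= modulus (fr g).
Proof.
have [h1 h2] := frq_lower R g.
have n1 (z : int) : z != 0 -> (1 : R) <= `|z%:~R| by move=> z0; rewrite -intr_norm (ler_int _ 1); lia.
by case/orP => /n1 h; lra.
Qed.

Lemma frq_gap (p : G) : cls p = 0 -> p != 0 -> 1 / 2 <= modulus (fr p).
Proof.
move=> _ p0; apply: frq_half; rewrite -negb_and; apply: contra p0 => /andP[/eqP e1 /eqP e2].
by rewrite -pair_eqE /= e1 e2.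
Qed.

(** 2 K is the frequency of 2 kap, whose class is not 0; p + 2 kap therefore never has second index
    0. *)
Lemma frq_gap2 (p : G) : cls p = 0 -> 1 / 2 <= modulus (fr p + 2 * K).
Proof.
move=> /cls0P [m e]; have -> : fr p + 2 * K = fr (p + kap + kap) by rewrite !frqD frq_kap; ring.
by apply: frq_half; apply/orP; right; rewrite /= e; lia.
Qed.

Lemma E1_isotropic v : h1 J fr v -> (exists g, v g != 0) -> asum v -> (forall g, A K v g = 0) ->
  csum (fun g => v g * v g) = 0 -> forall k, E1 U al k = 0.
Proof.
move=> hv nv av Av cv k.
have [s hs] := is_min_exists al aae aas (@frq_coer R) jn_inj jnJ k.
have s0 := isotropic_magic (@frqD R) clsD aae aas (@aa_cls R U) frq_gap frq_gap2 (divr_gt0 ltr01 (ltr0n _ 2)) (@frq_coer R) hv nv av Av cv hs.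
have [_ [[u [hu u1 _ Au]] _]] := hs.
by apply: (E1_zero smoothU periodicU hu u1) => g; rewrite Au s0 mul0r.
Qed.

(** A kernel vector with zero second half is an eigenpair for the eigenvalue 0, so the regularity of
    eigenpairs applies. *)
Lemma kernel_asum v : h1 J fr v -> (forall g, A K v g = 0) -> asum v.
Proof.
move=> hv Av; have he : eigenpair J fr a_hat al K 0 v (fun=> 0).
  split=> // [|g|g].
  - by have := h1Z 0 hv; congr h1; apply/funext => g; rewrite mul0r.
  - by rewrite Av mul0r.
  have := opAZ J fr al aas K 0 g (h1_l2 hv).
  rewrite !mul0r => e; rewrite -[RHS]e; congr opA; apply/funext => t; by rewrite mul0r conjc0.
by have [ru _] := eigp_reg smoothU periodicU he; exact: reg_asum.
Qed.

Lemma kernelD (c d : C) u v : h1 J fr u -> h1 J fr v -> (forall g, A K u g = 0) -> (forall g, A K v g = 0) ->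
  h1 J fr (fun g => c * u g + d * v g) /\ forall g, A K (fun t => c * u t + d * v t) g = 0.
Proof.
move=> hu hv Au Av; have h1u := h1Z c hu; have h1v := h1Z d hv; split; first exact: h1D.
move=> g; rewrite (opAD J fr al aas K g (h1_l2 h1u) (h1_l2 h1v)).
by rewrite (opAZ J fr al aas K c g (h1_l2 hu)) (opAZ J fr al aas K d g (h1_l2 hv)) Au Av !mulr0 addr0.
Qed.

(* In a complex plane of functions every quadratic form has an isotropic line. *)
Lemma isotropic_comb (u v : G -> C) : l2 u -> l2 v -> (forall t : C, ~ forall g, v g = t * u g) ->
  csum (fun g => u g * u g) != 0 ->
  exists t : C, csum (fun g => (t * u g + 1 * v g) * (t * u g + 1 * v g)) = 0 /\ exists g, t * u g + 1 * v g != 0.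
Proof.
move=> lu lv nuv; set q := csum _ => q0.
set b := csum (fun g => u g * v g); set c := csum (fun g => v g * v g).
have [w hw] := sqrtC_ex (b * b - q * c).
exists ((w - b) / q); set t := (w - b) / q; split.
  have e : (fun g => (t * u g + 1 * v g) * (t * u g + 1 * v g)) =
    fun g => (t * t) * (u g * u g) + ((2 * t) * (u g * v g) + v g * v g) by apply/funext => g; ring.
  have a1 := l2_mul lu lu; have a2 := l2_mul lu lv; have a3 := l2_mul lv lv.
  rewrite e csumD; [|exact: asumZ|by apply: asumD => //; exact: asumZ].
  rewrite csumD; [|exact: asumZ|by []].
  rewrite !csumZ // -/q -/b -/c /t.
  have -> : c = (b * b - w * w) / q by rewrite hw; field.
  by field.
have [//|h] := pselect (exists g, t * u g + 1 * v g != 0).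
exfalso; apply: (nuv (- t)) => g; apply/eqP; rewrite -subr_eq0; apply/negPn/negP => n.
by apply: h; exists g; move: n; congr (_ != _); ring.
Qed.

Lemma E1_min_at k s : k != 0 -> is_min J fr a_hat al k s -> E1 U al k = s.
Proof. exact: (E1_min smoothU periodicU jn_inj jnJ). Qed.

Lemma K_gt0 : 0 < modulus K.
Proof. by rewrite mod_rc ger0_norm ?mulr_gt0 ?mulr_ge0 ?pi_gt0 ?pi_ge0 //; lra. Qed.

Lemma conical_zero (f : C -> R) (k0 : C) : (forall k, f k = 0) -> conical_at f k0 0.
Proof. by move=> f0; exists 0, 1; split=> // k _; rewrite f0 mul0r mul0r subrr normr0. Qed.

(* For k = k0 + t with t > 0 small the estimate reads c t <= M t^2. *)
Lemma conical_unique0 (f : C -> R) (k0 : C) (c : R) : 0 <= c -> (forall k, f k = 0) -> conical_at f k0 c -> c = 0.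
Proof.
move=> c0 f0 [M [d [dpos h]]]; apply/eqP/negPn/negP => cn.
have cp : 0 < c by rewrite lt_neqAle eq_sym cn.
have Mp : 0 < `|M| + 1 by rewrite ltr_wpDl.
set t := Num.min (d / 2) (c / (2 * (`|M| + 1))).
have tp : 0 < t by rewrite lt_min !divr_gt0 // mulr_gt0.
have t1 : t <= d / 2 by rewrite ge_min lexx.
have t2 : t * (2 * (`|M| + 1)) <= c by rewrite -ler_pdivlMr ?mulr_gt0 // ge_min lexx orbT.
have mt : modulus (k0 + rc t - k0) = t by rewrite addrAC subrr add0r mod_rc gtr0_norm.
have := h (k0 + rc t); rewrite mt f0 sub0r normrN gtr0_norm ?mulr_gt0 // => /(_ _) h1.
have h2 : c * t <= M * t ^+ 2 by apply: h1; lra.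
have h3 : c <= M * t by rewrite -(ler_pM2r tp) -mulrA -expr2.
have h4 := ler_norm M.
have h5 : M * t <= `|M| * t by rewrite ler_pM2r.
nra.
Qed.

(** A kernel of dimension at least 2 always contains an isotropic vector, so only two cases occur:
    an isotropic kernel vector, where all first bands vanish and c = 0, or a simple kernel with
    nonzero W, where c = |W| > 0. *)
Lemma conical_bands : exists c : R,
  [/\ 0 <= c, conical_at (E1 U al) K c, conical_at (E1 U al) (- K) c & c = 0 <-> magic U al].
Proof.
have g0J : J g0 by [].
have [u [hu u1 Au]] := protected_state al (@frq_coer R) aae aas xi_mod xi_neq1 rho_inj rho_J rho_fr rho_a
  g0J ((rho_fix g0).2 erefl) (fun g _ => (rho_fix g).1).
have iso v : h1 J fr v -> (exists g, v g != 0) -> (forall g, A K v g = 0) -> csum (fun g => v g * v g) = 0 ->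
    exists c : R, [/\ 0 <= c, conical_at (E1 U al) K c, conical_at (E1 U al) (- K) c & c = 0 <-> magic U al].
  move=> hv nv Av cv; have e0 := E1_isotropic hv nv (kernel_asum hv Av) Av cv.
  by exists 0; split=> //; apply: conical_zero.
have nu : exists g, u g != 0.
  have [//|h] := pselect (exists g, u g != 0).
  have z : u = fun=> 0 by apply/funext => g; apply/eqP/negPn/negP => n; apply: h; exists g.
  move: u1; rewrite z /n2 /rsum csum0 => [/eqP|g]; first by rewrite eq_sym oner_eq0.
  by rewrite /sq mod0 expr0n.
have [q0|q0] := eqVneq (csum (fun g => u g * u g)) 0; first exact: iso hu nu Au q0.
have [ker|nker] := pselect (forall v, h1 J fr v -> (forall g, A K v g = 0) -> exists t : C, forall g, v g = t * u g); last first.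
  have /existsNP [v nv] := nker.
  have [[hv Av] nt] : (h1 J fr v /\ (forall g, A K v g = 0)) /\ forall t : C, ~ forall g, v g = t * u g.
    move/not_implyP: nv => [hv /not_implyP [Av nt]]; split=> // t ht; apply: nt; by exists t.
  have [t [ct nt']] := isotropic_comb (h1_l2 hu) (h1_l2 hv) nt q0.
  have [h1' A'] := kernelD t 1 hu hv Au Av.
  exact: iso h1' nt' A' ct.
have [M [d [d0 hc]]] := conical_seq (@frq_coer R) aae aas jn_inj jnJ hu u1 Au ker.
set c := modulus _ in hc; have c0 : 0 < c by exact: mod_gt0.
have Kp := K_gt0.
have conK : conical_at (E1 U al) K c.
  (* The radius |K| keeps k away from 0, where [E1_min_at] does not apply. *)
  exists M, (Num.min d (modulus K)); split; first by rewrite lt_min d0 Kp.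
  move=> k; rewrite lt_min => /andP[kd kK].
  have k0 : k != 0 by apply/eqP => z; move: kK; rewrite z sub0r modN ltxx.
  have [s hs] := is_min_exists al aae aas (@frq_coer R) jn_inj jnJ k.
  rewrite (E1_min_at k0 hs); apply: hc => //.
  by rewrite (_ : K + (k - K) = k) // addrC subrK.
have conN : conical_at (E1 U al) (- K) c.
  exists M, (Num.min d (modulus K)); split; first by rewrite lt_min d0 Kp.
  move=> k; rewrite lt_min => /andP[kd kK].
  have k0 : k != 0 by apply/eqP => z; move: kK; rewrite z sub0r opprK ltxx.
  have [s hs] := is_min_exists al aae aas (@frq_coer R) jn_inj jnJ k.
  rewrite (E1_min_at k0 hs) -(modN (k - - K)); apply: hc; first by rewrite modN.
  (* Near - K the reflection moves the problem to - k, which is near K, with increment - (k + K). *)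
  rewrite (_ : K - (k - - K) = - k); last by rewrite opprB addrA subrr add0r.
  have hr := refl_min (@frqD R) clsD aae aas (@aa_cls R U) hs.
  exact: hr.
exists c; split=> //; first exact: ltW.
split=> [z|mg]; first by move: c0; rewrite z ltxx.
exact: conical_unique0 (ltW c0) mg conK.
Qed.
End Main.

Theorem theorem19 (R : realType) (U : R[i] -> R[i])
    (smoothU : smoothC U)
    (periodicU : forall g : R[i], Lambda g ->
       forall z : R[i], U (z + g) = expi (cdot g (Kpt R)) * U z)
    (rotationU : forall z : R[i], U (omega R * z) = omega R * U z)
    (reflectionU : forall z : R[i], conjc (U (conjc z)) = - U (- z))
    (alpha : R[i]) :
  exists c : R,
    [/\ 0 <= c,
        conical_at (E1 U alpha) (Kpt R) c,
        conical_at (E1 U alpha) (- Kpt R) c &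
        c = 0 <-> magic U alpha].
Proof. exact: conical_bands smoothU periodicU rotationU alpha. Qed.
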